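(* Let $G$ be a mixed unit interval graph with $n$ vertices and $m$ edges, and let $\mathcal{B}$ be a $\mathcal{U}$-bubble model for $G$. Then $$\mathrm{cwd}(G)\le\min\{2\alpha(G)+3,\ \varphi_{\mathcal{B}}(G)+2\}\le\omega(G)+1,$$ where $\alpha(G)$ and $\omega(G)$ are the maximum sizes of an independent set and of a clique of $G$. Moreover, a corresponding expression can be constructed in $O(n+m)$ time provided $\mathcal{B}$ is given, and otherwise (given only $G$) in $O(n^2)$ time.
   Context: Clique-width: $\mathrm{cwd}(G)$ is the smallest $k$ such that $G$ can be constructed using at most $k$ labels by the operations: creating a single vertex with label $i$; disjoint union; relabeling all labels $i$ to $j$; and, for $i\ne j$, adding all edges between vertices labelled $i$ and vertices labelled $j$. Such a term using at most $k$ labels is a $k$-expression. A mixed unit interval graph is an intersection graph of unit intervals, each closed, open or half-open. A 2-dimensional $\mathcal{U}$-bubble structure for a finite nonempty set $A$ is a family $\mathcal{B}=\langle B_{i,j}\rangle_{1\le j\le k,\,1\le i\le r_j}$ of pairwise disjoint (possibly empty) sets (''bubbles'') with union $A$, each partitioned into quadrants $B_{i,j}=B^{++}_{i,j}\cup B^{+-}_{i,j}\cup B^{-+}_{i,j}\cup B^{--}_{i,j}$; $B^{*+}_{i,j}=B^{++}_{i,j}\cup B^{-+}_{i,j}$, $B^{+*}_{i,j}=B^{++}_{i,j}\cup B^{+-}_{i,j}$. Column $j$ consists of the bubbles with second index $j$; row $i$ of those with first index $i$. The graph $G(\mathcal{B})$ has vertex set $A$, and distinct $u,v$ are adjacent iff,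 for some ordering, $u\in B_{i,j}$, $v\in B_{i',j'}$ and: (a) $j=j'$; or (b) $j=j'-1$ and $i>i'$; or (c) $j=j'-1$, $i=i'$, $u\in B^{*+}_{i,j}$, $v\in B^{+*}_{i',j'}$. A $\mathcal{U}$-bubble model of $G$ is such a structure for $V(G)$ with $G\cong G(\mathcal{B})$, every row and column containing a nonempty bubble, $B_{r_j,j}\ne\emptyset$ for all $j$, and with $\mathrm{top}(j)=\min\{i:B_{i,j}\ne\emptyset\}$, $\mathrm{top}(1)=1$, $\mathrm{top}(j)\le \mathrm{top}(j+1)$. Groups: vertices of the same column $j$ belong to the same group if they have the same neighbours in column $j+1$. For $v\in B_{i,j}$, the group number $g_{\mathcal{B}}(v)$ is the maximum, over the two choices $A=B^{*+}_{i,j-1}\cup B^{+*}_{i,j}$ and $A=B_{i,j}$, of the number of groups in $N(v)\cap\bigl(\bigcup_{i'=i+1}^{r_{j-1}}B_{i',j-1}\cup\bigcup_{i'=1}^{i-1}B_{i',j}\cup A\bigr)$ (bubbles of a nonexistent column $0$ are empty). The group number of $G$ in $\mathcal{B}$ is $\varphi_{\mathcal{B}}(G)=\max_{v\in V(G)}g_{\mathcal{B}}(v)$. *)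

(* Defs.v *)
From HB Require Import structures.
From mathcomp Require Import all_boot all_order all_algebra.
From mathcomp Require Import boolp reals.

Set Implicit Arguments.
Unset Strict Implicit.
Unset Printing Implicit Defensive.

Record sgraph (T : finType) := SGraph {
  adj :> rel T;
  adj_sym : symmetric adj;
  adj_irr : irreflexive adj }.

Section GraphParameters.
Variables (T : finType) (G : sgraph T).

Definition nbh (v : T) : {set T} := [set u | G v u].

Definition edges : {set {set T}} :=
  [set [set p.1; p.2] | p in [pred p : T * T | G p.1 p.2]].

Definition independent (S : {set T}) : bool :=
  [forall u in S, forall v in S, ~~ G u v].

Definition clique (S : {set T}) : bool :=
  [forall u in S, forall v in S, (u != v) ==> G u v].

Definition alpha : nat := \max_(S : {set T} | independent S) #|S|.
Definition omega : nat := \max_(S : {set T} | clique S) #|S|.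

End GraphParameters.

(** [cl] and [cr] tell whether the left and right endpoints belong to the
    interval: [BSide true x] is a closed bound on the left, an open one on the
    right. *)
Definition unit_itv (R : realType) (x : R) (cl cr : bool) : interval R :=
  Interval (BSide cl x) (BSide (~~ cr) (x + 1)%R).

Definition mixed_unit_interval (R : realType) (T : finType) (G : sgraph T) :
    Prop :=
  exists (x : T -> R) (cl cr : T -> bool), forall u v : T, u != v ->
    G u v <-> exists y : R, (y \in unit_itv (x u) (cl u) (cr u)) /\
                            (y \in unit_itv (x v) (cl v) (cr v)).

Inductive cwterm (T : Type) : Type :=
| Vert of T & nat
| Union of cwterm T & cwterm T
| Relabel of nat & nat & cwterm T
| Join of nat & nat & cwterm T.

Section CliqueWidth.
Variable T : finType.
Implicit Types (t : cwterm T) (G : sgraph T).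

Fixpoint leaves t : seq T :=
  match t with
  | Vert v _ => [:: v]
  | Union t1 t2 => leaves t1 ++ leaves t2
  | Relabel _ _ t1 | Join _ _ t1 => leaves t1
  end.

Fixpoint labels t : seq nat :=
  match t with
  | Vert _ i => [:: i]
  | Union t1 t2 => labels t1 ++ labels t2
  | Relabel i j t1 | Join i j t1 => i :: j :: labels t1
  end.

Definition nlabels t : nat := size (undup (labels t)).

(** The label of [x] in the labelled graph denoted by [t]; [None] when [x] is
    not a vertex of that graph. *)
Fixpoint lab t (x : T) : option nat :=
  match t with
  | Vert v i => if x == v then Some i else None
  | Union t1 t2 => if lab t1 x is Some i then Some i else lab t2 x
  | Relabel i j t1 => omap (fun l => if l == i then j else l) (lab t1 x)
  | Join _ _ t1 => lab t1 x
  end.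

Fixpoint cwedge t (x y : T) : bool :=
  match t with
  | Vert _ _ => false
  | Union t1 t2 => cwedge t1 x y || cwedge t2 x y
  | Relabel _ _ t1 => cwedge t1 x y
  | Join i j t1 =>
      [|| cwedge t1 x y,
          (lab t1 x == Some i) && (lab t1 y == Some j) |
          (lab t1 x == Some j) && (lab t1 y == Some i)]
  end.

Fixpoint cwwf t : bool :=
  match t with
  | Vert _ _ => true
  | Union t1 t2 => [&& cwwf t1, cwwf t2 & ~~ has (mem (leaves t1)) (leaves t2)]
  | Relabel _ _ t1 => cwwf t1
  | Join i j t1 => (i != j) && cwwf t1
  end.

Definition constructs t G : Prop :=
  [/\ cwwf t, (forall x, x \in leaves t) & forall x y, cwedge t x y = G x y].

Definition is_kexpression (k : nat) t G : Prop :=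
  constructs t G /\ nlabels t <= k.

Definition has_kexpression G (k : nat) : bool :=
  `[< exists t, is_kexpression k t G >].

(** The graph without vertices is denoted by no term; it gets the value 0. For
    every other graph the first branch applies, by [cwd_exists] below;
    see [cwdP]. *)
Definition cwd G : nat :=
  if pselect (exists k, has_kexpression G k) is left h then ex_minn h else 0.

Let rk (x : T) : nat := enum_rank x.

Let discrete v s : cwterm T :=
  foldr (fun x t => Union (Vert x (rk x)) t) (Vert v (rk v)) s.

Let add_edges (s : seq (T * T)) t : cwterm T :=
  foldr (fun p t1 => Join (rk p.1) (rk p.2) t1) t s.

Lemma cwd_exists G : 0 < #|T| -> exists k, has_kexpression G k.
Proof.
move=> T_gt0.
have [v [s es]] : exists v s, enum T = v :: s.
  by case E: (enum T) => [|v s]; [rewrite cardE E in T_gt0 | exists v, s].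
have us : uniq (v :: s) by rewrite -es enum_uniq.
have ins x : x \in v :: s by rewrite -es mem_enum.
have leavesE r : leaves (discrete v r) =i v :: r.
  elim: r => [|a r IH] x //=; rewrite !inE IH !inE.
  by rewrite orbCA.
have labE r x : x \in v :: r -> lab (discrete v r) x = Some (rk x).
  elim: r => [|a r IH] /=; first by rewrite inE => /eqP ->; rewrite eqxx.
  case: (x =P a) => [-> //|/eqP xa].
  by rewrite !inE (negPf xa) /= => h; apply: IH; rewrite inE.
have edgeE r x y : cwedge (discrete v r) x y = false by elim: r.
have wfE r : uniq (v :: r) -> cwwf (discrete v r).
  elim: r => [|a r IH] //= /andP[]; rewrite inE negb_or => /andP[va vr].
  move=> /andP[ar ur]; rewrite IH /=; last by rewrite vr.
  apply/hasPn => z; rewrite leavesE !inE => /orP[/eqP-> //|zr].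
  by apply: contraNneq ar => <-.
set t0 := discrete v s.
set es' := [seq p <- enum {: T * T} | G p.1 p.2].
have leavesA r : leaves (add_edges r t0) = leaves t0 by elim: r.
have labA r x : lab (add_edges r t0) x = Some (rk x).
  by elim: r => [|p r IH] //=; rewrite labE.
have rk_inj : injective rk by move=> x y /ord_inj /enum_rank_inj.
have labeq x y : (Some (rk x) == Some (rk y)) = (x == y).
  by apply/eqP/eqP => [[/rk_inj]|->].
exists (nlabels (add_edges es' t0)); apply/asboolP.
exists (add_edges es' t0); split=> //; split.
- have: all (fun p => G p.1 p.2) es' by apply: filter_all.
  elim: es' => [|p r IH] /=; first by rewrite wfE.
  move=> /andP[Gp /IH ->]; rewrite andbT.
  apply/eqP => /rk_inj e; move: Gp; rewrite e adj_irr //.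
- by move=> x; rewrite leavesA leavesE.
- have H r x y : cwedge (add_edges r t0) x y =
      ((x, y) \in r) || ((y, x) \in r).
    elim: r => [|[a b] r IH] /=; first by rewrite edgeE.
    rewrite IH !labA !labeq !inE !xpair_eqE.
    by do ![case: (_ == _)|case: (_ \in _)].
  have inE' p : (p \in es') = G p.1 p.2.
    by rewrite mem_filter mem_enum inE andbT.
  by move=> x y; rewrite H !inE' /= (adj_sym G y x) orbb.
Qed.

Lemma cwdP G : 0 < #|T| ->
  (exists t, is_kexpression (cwd G) t G) /\
  (forall k t, is_kexpression k t G -> cwd G <= k).
Proof.
move=> T_gt0; rewrite /cwd; case: pselect => [h|]; last first.
  by have := cwd_exists G T_gt0.
case: ex_minnP => k /asboolP kP kmin; split=> // k' t tP.
by apply: kmin; apply/asboolP; exists t.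
Qed.

End CliqueWidth.

(** The family of pairwise disjoint, possibly empty quadrants with union [T] is
    given by the map sending a vertex to the index of its quadrant: row, column
    (both counted from 1), and the first and second sign, [true] standing for
    [+]. *)
Record ububble (T : finType) := UBubble {
  ncol : nat;
  nrow : nat -> nat;
  row : T -> nat;
  col : T -> nat;
  sgn1 : T -> bool;
  sgn2 : T -> bool;
  ub_nonempty : 0 < #|T|;
  col_range : forall v, 1 <= col v <= ncol;
  row_range : forall v, 1 <= row v <= nrow (col v) }.

Section UBubble.
Variables (T : finType) (B : ububble T).

Definition bubble (i j : nat) : {set T} :=
  [set v | (row B v == i) && (col B v == j)].

(** $B^{+*}_{i,j}$ and $B^{*+}_{i,j}$ *)
Definition bubbleP_ (i j : nat) : {set T} := [set v in bubble i j | sgn1 B v].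
Definition bubble_P (i j : nat) : {set T} := [set v in bubble i j | sgn2 B v].

Definition ub_arc (u v : T) : bool :=
  [|| col B u == col B v,
      ((col B u).+1 == col B v) && (row B v < row B u) |
      [&& (col B u).+1 == col B v, row B u == row B v,
          u \in bubble_P (row B u) (col B u) &
          v \in bubbleP_ (row B v) (col B v)]].

Definition ub_rel : rel T := [rel u v | (u != v) && (ub_arc u v || ub_arc v u)].

Lemma ub_rel_sym : symmetric ub_rel.
Proof. by move=> u v; rewrite /ub_rel /= eq_sym orbC. Qed.

Lemma ub_rel_irr : irreflexive ub_rel.
Proof. by move=> u; rewrite /ub_rel /= eqxx. Qed.

Definition ub_graph : sgraph T := SGraph ub_rel_sym ub_rel_irr.

(** The minimum of a nonempty set of indices bounded by [nrow B j]. *)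
Definition ub_top (j : nat) : nat :=
  \big[minn/nrow B j]_(1 <= i < (nrow B j).+1 | bubble i j != set0) i.

Record ub_model (G : sgraph T) : Prop := UBModel {
  ubm_graph : forall u v, G u v = ub_graph u v;
  ubm_row : forall i j, 1 <= j <= ncol B -> 1 <= i <= nrow B j ->
    exists j', (1 <= j' <= ncol B) && (bubble i j' != set0);
  ubm_col : forall j, 1 <= j <= ncol B ->
    exists i, (1 <= i <= nrow B j) && (bubble i j != set0);
  ubm_last : forall j, 1 <= j <= ncol B -> bubble (nrow B j) j != set0;
  ubm_top1 : ub_top 1 = 1;
  ubm_top : forall j, 1 <= j < ncol B -> ub_top j <= ub_top j.+1 }.

Variable G : sgraph T.

Definition next_nbh (v : T) : {set T} :=
  [set w in nbh G v | col B w == (col B v).+1].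

Definition group (v : T) : {set T} :=
  [set u | (col B u == col B v) && (next_nbh u == next_nbh v)].

Definition ngroups (X : {set T}) : nat := #|[set group v | v in X]|.

Definition region (i j : nat) (A : {set T}) : {set T} :=
  (\bigcup_(i.+1 <= i' < (nrow B j.-1).+1) bubble i' j.-1)
    :|: (\bigcup_(1 <= i' < i) bubble i' j) :|: A.

Definition group_number_of (v : T) : nat :=
  let i := row B v in
  let j := col B v in
  maxn (ngroups (nbh G v :&: region i j (bubble_P i j.-1 :|: bubbleP_ i j)))
       (ngroups (nbh G v :&: region i j (bubble i j))).

Definition group_number : nat := \max_(v : T) group_number_of v.

End UBubble.

(** Word RAM.

    Programs work on finitely many registers, an unbounded zero-initialised
    memory, a read-only input array and a write-only output sequence. Every
    node of an expression and every elementary command costs one unit. All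
    values, hence all addresses, must stay below the word bound [W]; a program
    that exceeds it has no execution. *)

Inductive binop := OpAdd | OpSub | OpMul | OpDiv | OpMod | OpEq | OpLt.

Inductive expr :=
| Cst of nat
| Reg of nat
| Inp of expr
| Mem of expr
| Bin of binop & expr & expr.

Inductive cmd :=
| Skip
| Set_ of nat & expr
| Store of expr & expr
| Out of expr
| Seq of cmd & cmd
| If of expr & cmd & cmd
| While of expr & cmd.

Record state := State {
  regs : nat -> nat;
  memo : nat -> nat;
  outp : seq nat }.

Definition init_state : state := State (fun=> 0) (fun=> 0) [::].

Definition upd (f : nat -> nat) (a x : nat) : nat -> nat :=
  fun b => if b == a then x else f b.

Definition binop_val (o : binop) (x y : nat) : nat :=
  match o with
  | OpAdd => x + y
  | OpSub => x - y
  | OpMul => x * y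
  | OpDiv => x %/ y
  | OpMod => x %% y
  | OpEq => x == y
  | OpLt => x < y
  end.

Fixpoint expr_size (e : expr) : nat :=
  match e with
  | Cst _ | Reg _ => 1
  | Inp e1 | Mem e1 => (expr_size e1).+1
  | Bin _ e1 e2 => (expr_size e1 + expr_size e2).+1
  end.

Section Semantics.
Variables (W : nat) (inp : seq nat).

Definition word (x : nat) : option nat := if x < W then Some x else None.

Fixpoint eval (s : state) (e : expr) : option nat :=
  match e with
  | Cst x => word x
  | Reg r => word (regs s r)
  | Inp e1 => obind (fun a => word (nth 0 inp a)) (eval s e1)
  | Mem e1 => obind (fun a => word (memo s a)) (eval s e1)
  | Bin o e1 e2 =>
      obind (fun x => obind (fun y => word (binop_val o x y)) (eval s e2))
            (eval s e1)
  end.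

(** [exec c s t s']: run from [s], the command [c] halts in [s'] after time
    [t]. *)
Inductive exec : cmd -> state -> nat -> state -> Prop :=
| exec_skip s : exec Skip s 1 s
| exec_set r e x s : eval s e = Some x ->
    exec (Set_ r e) s (expr_size e).+1
      (State (upd (regs s) r x) (memo s) (outp s))
| exec_store ea e a x s : eval s ea = Some a -> eval s e = Some x ->
    exec (Store ea e) s (expr_size ea + expr_size e).+1
      (State (regs s) (upd (memo s) a x) (outp s))
| exec_out e x s : eval s e = Some x ->
    exec (Out e) s (expr_size e).+1
      (State (regs s) (memo s) (rcons (outp s) x))
| exec_seq c1 c2 s s1 s2 t1 t2 : exec c1 s t1 s1 -> exec c2 s1 t2 s2 ->
    exec (Seq c1 c2) s (t1 + t2) s2
| exec_if e c1 c2 x s s1 t : eval s e = Some x ->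
    exec (if x != 0 then c1 else c2) s t s1 ->
    exec (If e c1 c2) s (expr_size e + t).+1 s1
| exec_while_stop e c s : eval s e = Some 0 ->
    exec (While e c) s (expr_size e).+1 s
| exec_while_loop e c x s s1 s2 t1 t2 : eval s e = Some x -> x != 0 ->
    exec c s t1 s1 -> exec (While e c) s1 t2 s2 ->
    exec (While e c) s (expr_size e + t1 + t2).+1 s2.

End Semantics.

Definition outputs_within (W : nat) (P : cmd) (inp out : seq nat) (t : nat) :
    Prop :=
  exists t' s, [/\ exec W inp P init_state t' s, t' <= t & outp s = out].

(** Words of $O(\log n)$ bits. *)
Definition word_bound (c n : nat) : nat := n.+1 ^ c.

(** The neighbours of a vertex may be listed in any order. *)
Definition adjacency_lists (n : nat) (G : sgraph 'I_n)
    (a : 'I_n -> seq 'I_n) : Prop :=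
  forall v, uniq (a v) /\ a v =i nbh G v.

Definition encode_graph (n : nat) (a : 'I_n -> seq 'I_n) : seq nat :=
  n :: flatten [seq size (a v) :: map val (a v) | v <- enum 'I_n].

Definition encode_ububble (n : nat) (B : ububble 'I_n) : seq nat :=
  ncol B :: [seq nrow B j | j <- iota 1 (ncol B)]
    ++ flatten [seq [:: row B v; col B v; nat_of_bool (sgn1 B v);
                        nat_of_bool (sgn2 B v)] | v <- enum 'I_n].

(** Reverse Polish notation. *)
Fixpoint encode_term (n : nat) (t : cwterm 'I_n) : seq nat :=
  match t with
  | Vert v i => [:: 0; nat_of_ord v; i]
  | Union t1 t2 => encode_term t1 ++ encode_term t2 ++ [:: 1]
  | Relabel i j t1 => encode_term t1 ++ [:: 2; i; j]
  | Join i j t1 => encode_term t1 ++ [:: 3; i; j]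
  end.

(* Main.v *)
Require Import Defs.
From HB Require Import structures.
From mathcomp Require Import all_boot all_order all_algebra.
From mathcomp Require Import boolp reals.
From mathcomp Require Import zify lra.
Import Defs.

(** A bubble structure carries two linear orders of the vertices along which an
    expression can be built by inserting one vertex at a time. In the order of
    left endpoints, a vertex whose neighbourhood is not yet exhausted shares its
    label with exactly those having the same last neighbour; the live labels are
    then the groups counted by the group number, and two further labels serve
    for finished vertices and for the vertex being inserted. Row by row, one
    label per column and three auxiliary ones suffice, and taking every other
    column gives an independent set, so there are at most [2 alpha] columns.
    The vertices realising a group number form a clique with the right choice of
    representatives, hence the bound by [omega].

    For the algorithmic part, programs of a small structured language are
    compiled to the word RAM with constant overhead. Without a given structure,
    a breadth-first search from a vertex extremal in its component yields layers
    that become columns after moving some vertices one layer back; a row number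
    is the number of vertices reachable along the inequalities that the
    adjacencies impose between rows. *)

Set Implicit Arguments.
Unset Strict Implicit.
Unset Printing Implicit Defensive.

(** * Linear clique-width terms *)

(** The group number enters only through a bound on simultaneously live vertices with distinct last
    neighbours, which depends on the order of left endpoints alone. Hence the algorithm without a
    given structure may use columns and rows that are not normalised as [ub_model] demands: a
    genuine model with the same left-endpoint order is shown to exist and is never computed. The
    obstacle is that this program sees no intervals. With integer left endpoints, a unit interval
    lies strictly inside another at both ends only if both have the same endpoints, the inner one
    being open and the outer one closed. The ambiguities left by the layers are of this kind: two
    nonadjacent vertices of a layer form a claw with a parent and a grandparent, which fixes the
    relevant endpoints. The program breaks ties by counting neighbours, and the proof replaces the
    representation by one that agrees with its choices, exchanging classes with the same neighbours
    elsewhere. For a given structure the time is linear because columns are cliques: sorting inside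
    a column and finding a free label only need scans of adjacency lists. *)

Inductive op (T : Type) : Type :=
| OIns of T & nat
| ORel of nat & nat
| OJn of nat & nat.
Arguments ORel {T}.
Arguments OJn {T}.

Section LinearTerms.
Variable T : finType.
Implicit Types (t : cwterm T) (G : sgraph T).

Definition app_op t (o : op T) : cwterm T :=
  match o with
  | OIns v i => Union t (Vert v i)
  | ORel i j => Relabel i j t
  | OJn i j => Join i j t
  end.

Definition op_labels (o : op T) : seq nat :=
  match o with OIns _ i => [:: i] | ORel i j | OJn i j => [:: i; j] end.

Lemma nlabels_bound t L : {in labels t, forall i, i < L} -> nlabels t <= L.
Proof.
move=> h; rewrite /nlabels -[L in _ <= L](size_iota 0).
apply: uniq_leq_size; first exact: undup_uniq.
by move=> i; rewrite mem_undup mem_iota => /h ->.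
Qed.

Lemma nlabels_foldl t ops L : all (gtn L) (labels t) ->
  all (fun o => all (gtn L) (op_labels o)) ops ->
  nlabels (foldl app_op t ops) <= L.
Proof.
move=> ht ho; apply: nlabels_bound; apply/allP.
elim: ops t ht ho => //= o ops IH t ht /andP[ho]; apply: IH.
by case: o ho => [v i|i j|i j] /=; rewrite ?all_cat /= ht => /andP[-> //]; case/andP => ->.
Qed.

Lemma leaves_lab t x : (x \in leaves t) = (lab t x != None).
Proof.
elim: t => [v i|t1 IH1 t2 IH2|i j t IH|i j t IH] //=.
- by rewrite inE; case: (x == v).
- by rewrite mem_cat IH1 IH2; case: (lab t1 x).
- by rewrite IH; case: (lab t x).
Qed.

(** Invariant of an expression under construction. The induced subgraph on [S] is already complete,
    since every block of operations inserts one vertex together with all its edges to the earlier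
    ones. *)
Record denotes G t (S : pred T) (l : T -> nat) : Prop := Denotes {
  den_wf : cwwf t;
  den_lab : forall x, lab t x = if S x then Some (l x) else None;
  den_edge : forall x y, cwedge t x y = [&& S x, S y & G x y] }.

Lemma denotes_constructs G t S l : denotes G t S l -> (forall x, S x) ->
  constructs t G.
Proof.
case=> wf dl de hS; split=> // [x|x y]; last by rewrite de !hS.
by rewrite leaves_lab dl hS.
Qed.

Lemma denotes_ext G t S S' l l' : denotes G t S l -> S =1 S' ->
  {in S', l =1 l'} -> denotes G t S' l'.
Proof.
case=> wf dl de eS el; split=> // [x|x y]; last by rewrite de !eS.
by rewrite dl eS; case E: (S' x) => //; rewrite el.
Qed.

Lemma denotes_relabels G t S l (ls : seq nat) (j : nat) : denotes G t S l ->
  denotes G (foldl app_op t [seq ORel i j | i <- ls]) S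
    (fun x => if l x \in ls then j else l x).
Proof.
elim: ls t l => [|i ls IH] t l d /=; first exact: denotes_ext d _ _.
have d1 : denotes G (Relabel i j t) S (fun x => if l x == i then j else l x).
  case: d => wf dl de; split=> // x /=.
  by rewrite dl; case: (S x) => //=.
apply: denotes_ext (IH _ _ d1) _ _ => // x _; rewrite inE.
by case: (l x == i) => //; case: ifP.
Qed.

Lemma denotes_relabel G t S l i j : denotes G t S l ->
  denotes G (Relabel i j t) S (fun x => if l x == i then j else l x).
Proof.
move=> d; have := denotes_relabels [:: i] j d; rewrite /= => d'.
by apply: denotes_ext d' _ _ => // x _; rewrite inE.
Qed.

Lemma lab_joins t i js x :
  lab (foldl app_op t [seq OJn i j | j <- js]) x = lab t x.
Proof. by elim: js t => //= j js IH t; rewrite IH. Qed.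

Lemma cwedge_joins t i js x y :
  cwedge (foldl app_op t [seq OJn i j | j <- js]) x y =
  [|| cwedge t x y,
      (lab t x == Some i) && (lab t y \in [seq Some j | j <- js]) |
      (lab t x \in [seq Some j | j <- js]) && (lab t y == Some i)].
Proof.
elim: js t => [|j js IH] t /=; first by rewrite in_nil andbF !orbF.
rewrite IH /= !inE.
by do ![case: (_ == _)|case: (_ \in _)|case: (cwedge _ _ _)].
Qed.

Lemma cwwf_joins t i js : cwwf t -> i \notin js ->
  cwwf (foldl app_op t [seq OJn i j | j <- js]).
Proof.
elim: js t => //= j js IH t wf; rewrite inE negb_or => /andP[ij hi].
by apply: IH => //=; rewrite ij.
Qed.

(** The label [a] is free, so the joins add edges at [v] only. The last hypothesis is what a
    labelling has to guarantee: each class is completely adjacent or completely nonadjacent to the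
    new vertex. *)
Lemma denotes_insert G t S l v a js : denotes G t S l -> ~~ S v ->
  {in S, forall x, l x != a} -> a \notin js ->
  {in S, forall x, G v x = (l x \in js)} ->
  denotes G (foldl app_op t (OIns v a :: [seq OJn a j | j <- js]))
    (fun x => (x == v) || S x) (fun x => if x == v then a else l x).
Proof.
case=> wf dl de vS la ajs Gv; rewrite /=.
have lu x : lab (Union t (Vert v a)) x =
    if (x == v) || S x then Some (if x == v then a else l x) else None.
  by rewrite /= dl; case: eqP => [->|] /=; [rewrite (negPf vS)|case: (S x)].
have edge_v x : cwedge t v x = false by rewrite de (negPf vS).
have edge_v' x : cwedge t x v = false by rewrite de (negPf vS) andbF.
have memS x : ((Some x : option nat) \in [seq Some j | j <- js]) = (x \in js).
  by rewrite mem_map // => ? ? [].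
have memN : ((None : option nat) \in [seq Some j | j <- js]) = false.
  by apply/negP => /mapP[].
have someE (x y : nat) : ((Some x : option nat) == Some y) = (x == y).
  by apply/eqP/eqP => [[]|->].
split=> [|x|x y]; first 1 last.
- by rewrite lab_joins lu.
- rewrite cwedge_joins !lu.
  rewrite [cwedge _ _ _]/= orbF de.
  have [->|xv] := eqVneq x v; have [->|yv] := eqVneq y v; rewrite /=.
  + by rewrite (negPf vS) /= memS eqxx (negPf ajs) adj_irr.
  + rewrite (negPf vS) /= eqxx /= memS (negPf ajs) /= orbF.
    by case E: (S y); rewrite /= ?memN // memS Gv.
  + rewrite (negPf vS) andbF /= eqxx andbT memS (negPf ajs) /= andbF /=.
    by case E: (S x); rewrite /= ?memN // memS adj_sym Gv.
  + case Ex: (S x); case Ey: (S y); rewrite /= ?memN ?memS ?andbF //=.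
    by rewrite !someE (negPf (la _ _)) // (negPf (la y _)) // !andbF !orbF.
- apply: cwwf_joins => //=; rewrite wf /= orbF.
  by rewrite leaves_lab dl (negPf vS).
Qed.

End LinearTerms.

Lemma encode_foldl n (t : cwterm 'I_n) ops :
  encode_term (foldl (@app_op _) t ops) = encode_term t ++
  flatten [seq match o with
               | OIns v i => [:: 0; nat_of_ord v; i; 1]
               | ORel i j => [:: 2; i; j]
               | OJn i j => [:: 3; i; j]
               end | o <- ops].
Proof.
elim: ops t => [|o ops IH] t /=; first by rewrite cats0.
by rewrite IH; case: o => [v i|i j|i j] /=; rewrite -?catA.
Qed.

(** * Insertion in the order of left endpoints *)

Section ColumnTerm.
Variables (T : finType) (G : sgraph T) (s : seq T) (a : T -> seq T).
Variables (last lab : T -> nat) (bnd : nat).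
Hypothesis s_uniq : uniq s.
Hypothesis s_all : forall x, x \in s.
Hypothesis aP : forall v, a v =i nbh G v.
Local Notation pos x := (index x s).
Hypothesis umbrella : forall x y, pos x < pos y -> G x y = (pos y <= last x).
Hypothesis pos_last : forall x, pos x <= last x.

(** Vertices still awaiting a neighbour share a label exactly when they share
    their last neighbour. *)
Record lab_ok (t : nat) (l : T -> nat) : Prop := LabOk {
  lok_dead : forall x, pos x < t -> last x = pos x -> l x = 0;
  lok_bnd : forall x, pos x < t -> pos x < last x -> 1 < l x < bnd + 2;
  lok_eq : forall x y, pos x < t -> pos y < t ->
    pos x < last x -> pos y < last y -> pos x < last y -> pos y < last x ->
    (l x == l y) = (last x == last y) }.

(** Label 1 is reserved for the vertex being inserted and label 0 for vertices with no neighbour to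
    come. Earlier neighbours may share labels, so a join or relabelling can be emitted several
    times; this is harmless and avoids removing duplicates. *)
Definition col_ops (v : T) : seq (op T) :=
  OIns v 1 :: [seq OJn 1 (lab u) | u <- a v & pos u < pos v]
  ++ [seq ORel (lab u) 0 | u <- a v & (pos u < pos v) && (last u == pos v)]
  ++ [:: ORel 1 (lab v)].

(** There is no term for the empty graph: the first insertion is dropped by [behead], and the leaf
    [Vert v0 1] takes its place. *)
Definition col_term (v0 : T) : cwterm T :=
  foldl (@app_op T) (Vert v0 1) (behead (flatten [seq col_ops v | v <- s])).

Hypothesis labP : lab_ok (size s) lab.

Let pos_lt x : pos x < size s. Proof. by rewrite index_mem. Qed.

Let pos_inj x y : pos x = pos y -> x = y.
Proof. by move=> e; rewrite -(nth_index x (s_all x)) e nth_index. Qed.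

(** A vertex keeps its label exactly while its last neighbour is missing. Sharing is safe: by
    [lok_eq], vertices that are alive together with one label have the same last neighbour, so they
    are joined to the same later vertices and retire together. *)
Lemma col_term_prefix v0 t : 0 < t <= size s -> v0 = head v0 s ->
  denotes G
    (foldl (@app_op T) (Vert v0 1)
       (behead (flatten [seq col_ops v | v <- take t s])))
    (fun x => pos x < t) (fun x => if t <= last x then lab x else 0).
Proof.
elim: t => // t IH /andP[_ ts] v0E.
have [v sv] : exists v, v = nth v0 s t by exists (nth v0 s t).
have pv : pos v = t by rewrite sv index_uniq.
have take_v : take t.+1 s = rcons (take t s) v by rewrite (take_nth v0) // sv.
have joinE : [seq OJn 1 (lab u) | u <- a v & pos u < pos v] =
    [seq OJn 1 j | j <- [seq lab u | u <- a v & pos u < pos v]].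
  by move=> U; rewrite -map_comp.
have relE : [seq ORel (lab u) 0 | u <- a v & (pos u < pos v) && (last u == pos v)]
    = [seq ORel j 0 |
        j <- [seq lab u | u <- a v & (pos u < pos v) && (last u == pos v)]].
  by move=> U; rewrite -map_comp.
have final S (l : T -> nat) tm : denotes G tm S l -> S =1 (fun x => pos x < t.+1) ->
    (forall x, pos x < t.+1 -> (if l x == 1 then lab v else l x) =
        if t.+1 <= last x then lab x else 0) ->
    denotes G (Relabel 1 (lab v) tm) (fun x => pos x < t.+1)
      (fun x => if t.+1 <= last x then lab x else 0).
  by move=> d eS el; apply: denotes_ext (denotes_relabel 1 (lab v) d) _ _ => // x.
have lab_v x : x = v -> lab v = if t.+1 <= last x then lab x else 0.
  move=> ->; case: (ltnP t (last v)) => // h.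
  rewrite (lok_dead labP) //; apply/eqP; rewrite eqn_leq pos_last andbT.
  by rewrite pv.
case: t IH ts pv take_v final lab_v sv => [|t] IH ts pv take_v final lab_v sv.
  have vv0 : v = v0 by rewrite sv nth0 -v0E.
  have -> : take 1 s = [:: v0] by rewrite take_v take0 vv0.
  have none (P : pred T) : [seq u <- a v0 | (pos u < pos v0) && P u] = [::].
    rewrite -(filter_pred0 (a v0)); apply: eq_filter => u /=.
    by rewrite -vv0 pv.
  have none' : [seq u <- a v0 | pos u < pos v0] = [::].
    rewrite -(filter_pred0 (a v0)); apply: eq_filter => u /=.
    by rewrite -vv0 pv.
  rewrite /= none' none /=; have <- : lab v = lab v0 by rewrite vv0.
  have d0 : denotes G (Vert v0 1) (pred1 v0) (fun=> 1).
    split=> // x y; rewrite /=; do 2!case: eqP => //= ->.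
    by rewrite adj_irr.
  apply: (final _ _ _ d0) => [x|x] /=.
    by rewrite ltnS leqn0 -{1}vv0 -pv; apply/eqP/eqP => [->//|/pos_inj].
  by rewrite ltnS leqn0 => /eqP px; apply: lab_v; apply: pos_inj; rewrite pv.
have {}IH := IH (ltnW ts) v0E.
rewrite take_v map_rcons flatten_rcons.
have -> : behead (flatten [seq col_ops v1 | v1 <- take t.+1 s] ++ col_ops v) =
    behead (flatten [seq col_ops v1 | v1 <- take t.+1 s]) ++ col_ops v.
  by case: (s) ts => // x s' _ /=.
rewrite foldl_cat; set tm := foldl _ (Vert v0 1) _ in IH *.
have live x : pos x < t.+1 -> G v x = (t.+1 <= last x).
  by move=> px; rewrite adj_sym umbrella ?pv.
have big x : pos x < t.+1 -> t.+1 <= last x -> 1 < lab x.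
  by move=> px lx; case/andP: (lok_bnd labP (pos_lt x) (leq_trans px lx)).
have d1 := @denotes_insert _ _ _ _ _ v 1 [seq lab u | u <- a v & pos u < pos v] IH.
have {}d1 := d1 _ _ _ _.
rewrite /col_ops -cat_cons !foldl_cat joinE relE.
set tm1 := foldl _ tm _.
have {}d1 : denotes G tm1 (fun x => (x == v) || (pos x < t.+1))
    (fun x => if x == v then 1 else if t.+1 <= last x then lab x else 0).
  apply: d1; first by rewrite pv ltnn.
  - move=> x px; case: ifP => // lx.
    by have := big x px lx; case: (lab x) => [|[]].
  - apply/mapP => -[u]; rewrite mem_filter pv aP inE => /andP[pu]; rewrite live //.
    by move=> lu e; have := big u pu lu; rewrite -e.
  - move=> x; rewrite -topredE /= => px; rewrite live //; case: ifP => lx.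
      by symmetry; apply: map_f; rewrite mem_filter pv px aP inE live.
    symmetry; apply/mapP => -[u]; rewrite mem_filter pv aP inE => /andP[pu].
    by rewrite live // => lu e; have := big u pu lu; rewrite -e.
have d2 := denotes_relabels
  [seq lab u | u <- a v & (pos u < pos v) && (last u == pos v)] 0 d1.
have small z : z < 2 ->
    (z \in [seq lab u | u <- a v & (pos u < pos v) && (last u == pos v)]) = false.
  move=> z2; apply/mapP => -[u]; rewrite mem_filter pv aP inE => /andP[/andP[pu _]].
  by rewrite live // => lu e; have := big u pu lu; rewrite -e ltnNge -ltnS z2.
rewrite /=; apply: (final _ _ _ d2) => [x|x] /=.
  rewrite [RHS]ltnS [RHS]leq_eqVlt -pv; congr (_ || _).
  by apply/eqP/eqP => [->//|/pos_inj].
rewrite ltnS leq_eqVlt => /orP[/eqP px|px].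
  have xv : x = v by apply: pos_inj; rewrite pv.
  by rewrite xv eqxx small //= -lab_v.
have xv : x != v by apply: contraTneq px => ->; rewrite pv ltnn.
rewrite (negPf xv); case: (leqP t.+1 (last x)) => lx; last first.
  by rewrite small //= ifN // -ltnNge (leq_trans lx).
have xl := leq_trans px lx.
move: lx; rewrite leq_eqVlt => /orP[/eqP lx|lx].
  rewrite -lx ltnn; set c := _ \in _; have -> : c; last by [].
  by apply: map_f; rewrite mem_filter pv aP inE live // px -lx eqxx leqnn.
rewrite lx; set c := _ \in _; have -> : c = false; last first.
  by have := big x px (ltnW lx); case: (lab x) => [|[]].
(* A vertex that stays alive beyond [v] is not retired by accident: a retiring [u] with its label
   would overlap with it, and [lok_eq] would equate their last neighbours. *)
apply/mapP => -[u]; rewrite mem_filter pv aP inE => /andP[/andP[pu /eqP lu] _] e.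
have ul : pos u < last u by rewrite lu.
have := @lok_eq _ _ labP x u (pos_lt x) (pos_lt u) xl ul.
rewrite e eqxx lu => /(_ (leq_trans px (leqnn _)) (ltn_trans pu lx)) /esym/eqP h.
by rewrite h ltnn in lx.
Qed.

Lemma col_term_constructs v0 : v0 = head v0 s -> constructs (col_term v0) G.
Proof.
move=> v0E; have ne : 0 < size s by case: (s) (s_all v0).
have := @col_term_prefix v0 (size s); rewrite ne leqnn take_size => /(_ isT v0E) d.
by apply: (denotes_constructs d) => x; apply: pos_lt.
Qed.

Lemma col_term_nlabels v0 L : 1 < L -> (forall x, lab x < L) ->
  nlabels (col_term v0) <= L.
Proof.
move=> L1 labL; apply: nlabels_foldl; first by rewrite /= L1.
have L0 := ltnW L1.
have h r : all (fun o => all (gtn L) (op_labels o)) (flatten (map col_ops r)).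
  elim: r => // v r IH /=; rewrite all_cat IH andbT.
  rewrite L1 /= !all_cat !all_map /= L1 labL !andbT.
  by apply/andP; split; apply/allP => u _ /=; rewrite labL ?L1 ?L0.
by case: (flatten (map col_ops s)) (h s) => //= o ops /andP[].
Qed.

End ColumnTerm.

(** The adjacency of a bubble structure, with quadrants given by signs. *)
Definition bub_arc (T : Type) (row col : T -> nat) (s1 s2 : T -> bool) (u v : T) :=
  (col u == col v) ||
  ((col u).+1 == col v) && ((row v < row u) || [&& row u == row v, s2 u & s1 v]).

Definition bub_adj (T : finType) (G : sgraph T) (row col : T -> nat)
    (s1 s2 : T -> bool) : Prop :=
  forall u v, G u v =
    (u != v) && (bub_arc row col s1 s2 u v || bub_arc row col s1 s2 v u).

(** * Insertion row by row *)

Section RowTerm.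
Variables (T : finType) (G : sgraph T) (s : seq T) (k : nat).
Variables (row col : T -> nat) (s1 s2 : T -> bool).
Hypothesis s_uniq : uniq s.
Hypothesis s_all : forall x, x \in s.
Local Notation pos x := (index x s).
Hypothesis adjG : bub_adj G row col s1 s2.
Hypothesis col_rng : forall v, 0 < col v <= k.
Hypothesis s_sorted : forall x y, pos x < pos y ->
  (row x < row y) || (row x == row y) && (col x <= col y).

(** Label of the vertices of the current row that may still receive neighbours
    in the next column; two parities suffice. *)
Definition open_label (c : nat) : nat := k.+1 + odd c.

(** Here [p] is the predecessor of [v]. Leaving the bubble of [p] closes column [col p - 1], whose
    open label has the parity of [(col p).+1]; column [col p] stays open only if [v] lies in the
    next column of the same row. For [col p = 1] the target label is 0, but then no vertex carries
    the label that is renamed. *)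
Definition row_pre (p v : T) : seq (op T) :=
  if (row p == row v) && (col p == col v) then [::] else
    ORel (open_label (col p).+1) (col p).-1 ::
    (if (row p == row v) && ((col p).+1 == col v) then [::]
     else [:: ORel (open_label (col p)) (col p)]).

(** Of the vertices already present, those of column [col v + 1] lie in earlier rows and are all
    adjacent to [v]. In column [col v - 1] only the open vertices of the current row can be
    adjacent; their open label has the parity of [col v + 1]. *)
Definition row_joins (v : T) : seq nat :=
  col v :: open_label (col v) :: (if col v < k then [:: (col v).+1] else [::])
  ++ (if s1 v then [:: open_label (col v).+1] else [::]).

Definition row_post (v : T) : op T :=
  ORel 0 (if s2 v then open_label (col v) else col v).

Definition row_body (v : T) : seq (op T) :=
  rcons [seq OJn 0 j | j <- row_joins v] (row_post v).

Definition row_ops (p v : T) : seq (op T) := row_pre p v ++ OIns v 0 :: row_body v.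

Definition row_term (v0 : T) : cwterm T :=
  foldl (@app_op T) (Vert v0 0)
    (row_body v0 ++ flatten (pairmap row_ops v0 (behead s))).

Let cur_lab (v x : T) : nat :=
  if [&& row x == row v, s2 x & (col x == col v) || ((col x).+1 == col v)]
  then open_label (col x) else col x.

Let pos_inj x y : pos x = pos y -> x = y.
Proof. by move=> e; rewrite -(nth_index x (s_all x)) e nth_index. Qed.

Let row_joins_adj v x : x != v ->
  (row x < row v) || (row x == row v) && (col x <= col v) ->
  G v x = (cur_lab v x \in row_joins v).
Proof.
move=> xv; have := col_rng v; have := col_rng x; rewrite adjG [v == x]eq_sym xv /=.
rewrite /bub_arc /cur_lab /row_joins /open_label.
move: (row x) (row v) (col x) (col v) => i' i j' j cx cv.
case: (ltngtP i' i) => [lti _|//|_ le] /=.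
  rewrite !inE mem_cat; case: (s1 v); case: ifP => jk; rewrite ?inE ?in_nil;
    case: (odd j) => /=; rewrite ?andbF ?orbF; apply/idP/idP; lia.
rewrite !inE mem_cat.
case: (ltngtP j' j) le => [ltj _|//|-> _] /=; last first.
  by case: (s2 x); rewrite /= eqxx ?orbT.
case: (eqVneq j'.+1 j) => [ej|ne]; rewrite ?andbT ?andbF ?inE.
  subst j; have -> : (j'.+2 == j') = false by lia.
  rewrite /=; case: (s2 x) => /=; case: (s1 v); case: ifP => jk;
    rewrite ?inE ?in_nil; case: (odd j') => /=; apply/idP/idP; lia.
have -> : (j.+1 == j') = false by lia.
by case: (s1 v); case: ifP => jk; rewrite ?inE ?in_nil; case: (odd j) => /=;
  rewrite ?andbF ?orbF; apply/esym/idP; lia.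
Qed.

Let row_joins0 v : 0 \notin row_joins v.
Proof.
have := col_rng v; rewrite /row_joins /open_label !inE mem_cat.
by case: (col v) => //= c; case: ifP => _; case: (s1 v).
Qed.

Let cur_lab_pos v x : cur_lab v x != 0.
Proof.
rewrite /cur_lab /open_label; case: ifP => // _.
by have := col_rng x; case: (col x).
Qed.

Lemma row_term_prefix v0 t : 0 < t <= size s -> v0 = head v0 s ->
  denotes G
    (foldl (@app_op T) (Vert v0 0)
       (row_body v0 ++ flatten (pairmap row_ops v0 (take t.-1 (behead s)))))
    (fun x => pos x < t) (cur_lab (nth v0 s t.-1)).
Proof.
elim: t => // t IH /andP[_ ts] v0E.
have postE v : cur_lab v v = if s2 v then open_label (col v) else col v.
  by rewrite /cur_lab !eqxx /=; case: (s2 v).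
case: t IH ts => [|t] IH ts.
  rewrite take0 cats0 /row_body foldl_rcons nth0 -v0E.
  have d0 : denotes G (foldl (@app_op T) (Vert v0 0) [seq OJn 0 j | j <- row_joins v0])
      (pred1 v0) (fun=> 0).
    split=> [|x|x y].
    - exact: cwwf_joins.
    - by rewrite lab_joins.
    - rewrite cwedge_joins /=; have := row_joins0 v0.
      have memN : ((None : option nat) \in [seq Some j | j <- row_joins v0]) = false.
        by apply/negP => /mapP[].
      have memS z : ((Some z : option nat) \in [seq Some j | j <- row_joins v0])
          = (z \in row_joins v0).
        by rewrite mem_map // => ? ? [].
      have [->|_] := eqVneq x v0; have [->|_] := eqVneq y v0;
        rewrite /= ?memN ?memS ?andbF //= => /negPf->; by rewrite ?adj_irr.
  have := denotes_relabel 0 (if s2 v0 then open_label (col v0) else col v0) d0.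
  move=> d1; apply: denotes_ext d1 _ _ => x /=.
    rewrite ltnS leqn0 {1}v0E; case: (s) (s_all x) => //= y s' _.
    by rewrite eq_sym; case: (y == x).
  have -> : (x \in fun x0 => pos x0 < 1) = (pos x == 0) by rewrite -leqn0.
  have xv0 : pos x == 0 -> x = v0.
    by rewrite v0E; case: (s) (s_all x) => //= y s' _; case: (eqVneq y x).
  by move/xv0->; rewrite postE.
have {}IH := IH (ltnW ts) v0E; rewrite [t.+2.-1]/= in IH *.
set p := nth v0 s t in IH; have [v sv] : exists v, v = nth v0 s t.+1.
  by exists (nth v0 s t.+1).
rewrite -sv; have pv : pos v = t.+1 by rewrite sv index_uniq.
have pp : pos p = t by rewrite index_uniq // ltnW.
have -> : take t.+1 (behead s) = rcons (take t (behead s)) v.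
  rewrite (take_nth v0) ?size_behead ?nth_behead ?sv //.
  by case: (size s) ts.
rewrite -cats1 pairmap_cat.
have lastE : seq.last v0 (take t (behead s)) = p.
  rewrite /p; case: (s) v0E ts => //= y s' -> ts {IH sv pv pp p}.
  case: t ts => [|t] ts; first by rewrite take0.
  by rewrite (take_nth y) ?last_rcons //=; lia.
rewrite lastE flatten_cat [flatten (pairmap _ _ [:: v])]/= cats0 catA foldl_cat.
set tm := foldl _ (Vert v0 0) _ in IH *.
rewrite /row_ops foldl_cat; set tm1 := foldl _ tm _.
have ordp x : pos x < t.+1 -> (row x < row p) || (row x == row p) && (col x <= col p).
  rewrite ltnS leq_eqVlt => /orP[/eqP e|h]; last by apply: s_sorted; rewrite pp.
  by rewrite (@pos_inj x p) ?pp // eqxx leqnn orbT.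
have ordv x : pos x < t.+1 -> (row x < row v) || (row x == row v) && (col x <= col v).
  by move=> h; apply: s_sorted; rewrite pv.
(* [row_pre] turns the labels as seen from [p] into those as seen from [v]. The cases are: same
   bubble, next column of the same row, anything else. *)
have d1 : denotes G tm1 (fun x => pos x < t.+1) (cur_lab v).
  have pv' : (row p < row v) || (row p == row v) && (col p <= col v).
    by apply: s_sorted; rewrite pp pv.
  rewrite /tm1 /row_pre; case: ifP => [/andP[/eqP er /eqP ec]|neq].
    by apply: denotes_ext IH _ _ => // x _; rewrite /cur_lab er ec.
  have d2 := denotes_relabel (open_label (col p).+1) (col p).-1 IH.
  case: ifP => /= [/andP[/eqP er /eqP ec]|neq'].
    apply: denotes_ext d2 _ _ => // x px; rewrite /cur_lab -er -ec.
    have := ordp x px; rewrite /open_label; have := col_rng x; have := col_rng p.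
    case: (s2 x); rewrite ?andbF ?andbT /=; last first.
      by move=> cp cx _; case: eqP => //; case: (odd _); lia.
    move: (row x) (row p) (col x) (col p) => i' i j' j cp cx.
    case: (eqVneq i' i) => [->|ne] /=; rewrite ?ltnn /= => le.
      case: (eqVneq j' j) le => [->|ne] /= le.
        have -> : (j == j.+1) = false by lia.
        by rewrite eqSS eqxx; case: (odd j) => /=; rewrite ?eqn_add2l.
      case: (eqVneq j'.+1 j) => [<-|ne'] /=.
        rewrite negbK eqxx.
        have -> : (j' == j'.+2) = false by lia.
        by have -> : (j'.+1 == j'.+2) = false by lia.
      have -> : (j' == j.+1) = false by lia.
      rewrite ifN; last by case: (odd j); lia.
      by rewrite ifN //; lia.
    by rewrite ifN //; case: (odd j); lia.
  have d3 := denotes_relabel (open_label (col p)) (col p) d2.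
  apply: denotes_ext d3 _ _ => // x px.
  have -> : cur_lab v x = col x.
    rewrite /cur_lab ifN //; apply: contraFN neq => /and3P[/eqP er _ ec].
    by move: neq' pv' (ordp x px) ec; rewrite er; lia.
  rewrite /cur_lab /open_label; have := col_rng x; have := col_rng p.
  have plain c c' : 0 < c <= k -> 0 < c' <= k ->
      (if (if c' == k.+1 + ~~ odd c then c.-1 else c') == k.+1 + odd c then c
       else if c' == k.+1 + ~~ odd c then c.-1 else c') = c'.
    move=> cp cx; have -> : (c' == k.+1 + ~~ odd c) = false.
      by case: (odd c) => /=; lia.
    by have -> : (c' == k.+1 + odd c) = false by case: (odd c) => /=; lia.
  case: (s2 x); rewrite ?andbF /=; last exact: plain.
  move: (row x) (row p) (col x) (col p) => i' i j' j cp cx.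
  case: (eqVneq i' i) => [_|ne] /=; last exact: plain.
  case: (eqVneq j' j) => [->|ne] /=.
    by case: (odd j) => /=; rewrite !eqn_add2l /= ?eqxx.
  case: (eqVneq j'.+1 j) => [ej|ne'] /=; last exact: plain.
  by subst j; rewrite /= negbK eqxx; case: (odd j') => /=; case: eqP => //; lia.
rewrite /row_body -rcons_cons foldl_rcons.
have d2 := @denotes_insert _ _ _ _ _ v 0 (row_joins v) d1.
have {}d2 := d2 _ (in1W (cur_lab_pos v)) (row_joins0 v) _.
have d3 : denotes G (foldl (@app_op T) tm1 (OIns v 0 :: [seq OJn 0 j | j <- row_joins v]))
    (fun x => (x == v) || (pos x < t.+1))
    (fun x => if x == v then 0 else cur_lab v x).
  apply: d2; first by rewrite pv ltnn.
  move=> x px; apply: row_joins_adj; last exact: ordv.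
  by apply: contraTneq px => ->; rewrite /in_mem /= pv ltnn.
have := denotes_relabel 0 (if s2 v then open_label (col v) else col v) d3.
move=> d4; apply: denotes_ext d4 _ _ => x.
  rewrite [RHS]ltnS [RHS]leq_eqVlt -pv; congr (_ || _).
  by apply/eqP/eqP => [->//|/pos_inj].
move=> _; case: (eqVneq x v) => [->|ne] /=; first by rewrite postE.
by rewrite (negPf (cur_lab_pos v x)).
Qed.

Lemma row_term_constructs v0 : v0 = head v0 s -> constructs (row_term v0) G.
Proof.
move=> v0E; have ne : 0 < size s by case: (s) (s_all v0).
have := @row_term_prefix v0 (size s); rewrite ne leqnn => /(_ isT v0E).
rewrite -size_behead take_size => d.
by apply: (denotes_constructs d) => x; rewrite index_mem.
Qed.

Lemma row_term_nlabels v0 : nlabels (row_term v0) <= k + 3.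
Proof.
have oL c : open_label c < k + 3 by rewrite /open_label; case: (odd c); lia.
have cL v : col v < k + 3 by have := col_rng v; lia.
have k3 : 0 < k + 3 by rewrite addn3.
have bodyL v : all (fun o => all (gtn (k + 3)) (op_labels o)) (row_body v).
  rewrite /row_body -cats1 all_cat all_map /=; apply/andP; split; last first.
    by rewrite k3 !andbT /=; case: (s2 v).
  rewrite k3 cL oL /= all_cat.
  apply/andP; split; case: ifP => //= ck; rewrite k3 ?oL //= andbT; lia.
apply: nlabels_foldl; first by rewrite /= addn3.
rewrite all_cat bodyL /=; elim: (behead s) {1}v0 => //= v s' IH p.
rewrite all_cat IH andbT /row_ops -cat1s !all_cat bodyL andbT.
rewrite [all _ [:: OIns v 0]]/= k3 !andbT.
rewrite /row_pre; case: ifP => // _ /=.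
rewrite oL (leq_ltn_trans (leq_pred _) (cL p)) /=.
by case: ifP => //= _; rewrite oL cL.
Qed.

End RowTerm.

(** * Orders, labels and bubble structures *)

(** The number of predecessors is strictly monotone by transitivity, hence injective by totality, so
    its values are an initial segment and sorting by it makes it the index. The explicit formula for
    the index is what the programs compute. *)
Lemma strict_order_enum (T : finType) (lt : rel T) :
  irreflexive lt -> transitive lt -> (forall x y, x != y -> lt x y || lt y x) ->
  exists s : seq T, [/\ uniq s, (forall x, x \in s),
    (forall x, index x s = #|[pred w | lt w x]|) &
    forall x y, (index x s < index y s) = lt x y].
Proof.
move=> irr tr tot; pose rank x := #|[pred w | lt w x]|.
have mono x y : lt x y -> rank x < rank y.
  move=> xy; apply: proper_card; apply/properP; split.
    by apply/subsetP => w; rewrite !inE => /tr; apply.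
  by exists x; rewrite !inE // irr.
have inj : injective rank.
  move=> x y e; apply/eqP; apply/negPn/negP => /tot /orP[]/mono; by rewrite e ltnn.
have rkE x y : (rank x < rank y) = lt x y.
  apply/idP/idP => [h|/mono //]; have : x != y by apply: contraTneq h => ->; rewrite ltnn.
  by case/tot/orP => // /mono h'; move: (ltn_trans h h'); rewrite ltnn.
have rk_lt x : rank x < #|T|.
  apply: (@proper_card _ _ predT); apply/properP; split; first exact/subsetP.
  by exists x; rewrite ?inE ?irr.
pose s := sort (relpre rank leq) (enum T).
have us : uniq s by rewrite sort_uniq enum_uniq.
have ms x : x \in s by rewrite mem_sort mem_enum.
have szs : size s = #|T| by rewrite size_sort cardE.
have rkm : map rank s = iota 0 #|T|.
  rewrite /s -sort_map; apply: (sorted_eq leq_trans anti_leq).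
  - exact: sort_sorted leq_total _.
  - exact: iota_sorted.
  - apply: perm_trans (permEl (perm_sort _ _)) _.
    have ue : uniq (map rank (enum T)) by rewrite map_inj_uniq // enum_uniq.
    have [||_] := uniq_min_size ue (s2 := iota 0 #|T|); last by apply: uniq_perm; rewrite ?iota_uniq.
      by move=> i /mapP[x _ ->]; rewrite mem_iota /= rk_lt.
    by rewrite size_iota size_map -cardE.
have idx x : index x s = rank x.
  rewrite -(index_map inj) rkm; have := rk_lt x; move: (rank x) => r h.
  by rewrite -[X in index X _](nth_iota 0 0 h) index_uniq ?iota_uniq ?size_iota.
by exists s; split=> // x y; rewrite !idx rkE.
Qed.

Lemma uniq_map_inj (T1 T2 : eqType) (f : T1 -> T2) (r : seq T1) :
  uniq (map f r) -> {in r &, injective f}.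
Proof.
elim: r => //= z r IH /andP[zr ur] x y; rewrite !inE.
move=> /orP[/eqP->|xr] /orP[/eqP->|yr] // e.
- by case/negP: zr; rewrite e map_f.
- by case/negP: zr; rewrite -e map_f.
- exact: IH.
Qed.

(** * First-fit labels for live vertices *)

Section Labels.
Variables (T : finType) (s : seq T) (last : T -> nat) (bnd : nat).
Hypothesis s_uniq : uniq s.
Hypothesis s_all : forall x, x \in s.
Local Notation pos x := (index x s).
Hypothesis pos_last : forall x, pos x <= last x.
Hypothesis live_bnd : forall w us, uniq (map last us) ->
  (forall u, u \in us -> pos u < pos w <= last u) -> size us <= bnd.
Hypothesis last_lt : forall x, last x < size s.

(** First fit, stated as a relation because both the existence proof and the verified program have
    to meet it. *)
Definition newlab (t : nat) (lab : T -> nat) (v : T) (f : nat) : Prop :=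
  if last v == t then f = 0 else
  (exists u, [/\ pos u < t, last u = last v & f = lab u]) \/
  [/\ (forall u, pos u < t -> last u <> last v), 1 < f,
      (forall u, pos u < t -> t < last u -> lab u <> f) &
      (forall g, 1 < g < f -> exists u, [/\ pos u < t, t < last u & lab u = g])].

(** When first fit takes a new label [f], each of the labels [2..f-1] is carried by a live vertex.
    By [lok_eq] these vertices have different last neighbours, and [v] adds one more. All [f - 1] of
    them are alive at position [t + 1], so [live_bnd] yields [f - 1 <= bnd]. *)
Lemma newlab_ok t lab v f : pos v = t -> lab_ok s last bnd t lab ->
  newlab t lab v f -> lab_ok s last bnd t.+1 (fun x => if x == v then f else lab x).
Proof.
move=> pv [h0 h1 h2]; rewrite /newlab.
have old x : x != v -> pos x < t.+1 -> pos x < t.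
  move=> xv; rewrite ltnS leq_eqVlt => /orP[/eqP e|//].
  by case/eqP: xv; rewrite -(nth_index x (s_all x)) e -pv nth_index.
case: eqP => [lv f0|/eqP lv hf].
  have dead x : pos x < last x -> x != v.
    by move=> h; apply: contraTneq h => ->; rewrite lv pv ltnn.
  split=> [x px lx|x px lx|x y px py lx ly xy yx].
  - by case: eqVneq => [//|xv]; apply: h0 => //; apply: old.
  - by have xv := dead x lx; rewrite (negPf xv); apply: h1 => //; apply: old.
  - have xv := dead x lx; have yv := dead y ly; rewrite (negPf xv) (negPf yv).
    by apply: h2 => //; apply: old.
have tl : t < last v by rewrite ltn_neqAle eq_sym lv -pv pos_last.
have fE x : x != v -> pos x < t -> t < last x -> (f == lab x) = (last v == last x).
  move=> xv px lx; case: hf => [[u [pu lu ->]]|[nl f1 nf gf]].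
    by rewrite h2 ?lu // ?(ltn_trans pu) // (ltn_trans px).
  have -> : (f == lab x) = false by apply/eqP => e; apply: (nf x).
  by apply/esym/eqP => e; apply: (nl x).
have fB : 1 < f < bnd + 2.
  case: hf => [[u [pu lu ->]]|[nl f1 nf gf]].
    by apply: h1 => //; rewrite lu (ltn_trans pu).
  rewrite f1 /=.
  have [us [szu uus hus]] : exists us : seq T, [/\ size us = f - 2, uniq (map last us)
      & forall u, u \in us -> [/\ pos u < t, t < last u & lab u < f - 2 + 2]].
    have: f - 2 <= f - 2 by []; elim: {1 3 4}(f - 2) => [|m IH] mf.
      by exists [::]; split.
    have [us [szu uus hus]] := IH (ltnW mf).
    have [|u [pu lu labu]] := gf (m + 2); first by lia.
    exists (u :: us); split=> [|/=|z]; rewrite /= ?szu //.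
      rewrite uus andbT; apply/mapP => -[w /hus[pw lw labw] /eqP].
      rewrite -(h2 u w pu pw (ltn_trans pu lu) (ltn_trans pw lw)
        (ltn_trans pu lw) (ltn_trans pw lu)) labu => /eqP e.
      by rewrite -e ltnn in labw.
    rewrite inE => /orP[/eqP->|/hus[? ? ?]]; first by rewrite labu; split=> //; lia.
    by split=> //; lia.
  have tn : t.+1 < size s by apply: leq_ltn_trans (last_lt v).
  have := @live_bnd (nth v s t.+1) (v :: us); rewrite index_uniq //= szu uus andbT.
  have -> : last v \notin map last us.
    by apply/mapP => -[u /hus[pu _ _] e]; apply: (nl u).
  move=> lb; have : (f - 2).+1 <= bnd; last by lia.
  apply: lb => // u; rewrite inE => /orP[/eqP->|/hus[pu lu _]]; first by rewrite pv ltnSn.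
  by rewrite (ltn_trans pu).
split=> [x px lx|x px lx|x y px py lx ly xy yx].
- case: eqVneq => [e|xv]; last by apply: h0 => //; apply: old.
  by move: lx; rewrite e pv => e'; rewrite e' eqxx in lv.
- by case: eqVneq => [//|xv]; apply: h1 => //; apply: old.
- case: (eqVneq x v) => [ex|xv]; case: (eqVneq y v) => [ey|yv].
  + by rewrite ex ey !eqxx.
  + by rewrite ex fE // -?pv -?ex //; rewrite ex pv; apply: old.
  + by rewrite ey eq_sym [RHS]eq_sym fE // -?pv -?ey //; rewrite ey pv; apply: old.
  + by apply: h2 => //; apply: old.
Qed.

Lemma newlab_exists t lab v : pos v = t -> exists f, newlab t lab v f.
Proof.
move=> pv; rewrite /newlab; case: eqP => [_|_]; first by exists 0.
case: (pickP (fun u => (pos u < t) && (last u == last v))) => [u /andP[pu /eqP lu]|no].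
  by exists (lab u); left; exists u.
pose bad f := [exists u, [&& pos u < t, t < last u & lab u == f]].
have ex : exists f, (1 < f) && ~~ bad f.
  exists (\max_u lab u).+2; rewrite /=; apply/negP => /existsP[u /and3P[_ _ /eqP e]].
  by have := leq_bigmax (F := lab) u; rewrite e; lia.
exists (ex_minn ex); right; case: ex_minnP => f /andP[f1 nb] fmin; split=> //.
- by move=> u pu /eqP lu; have := no u; rewrite /= pu lu.
- by move=> u pu lu e; case/existsP: nb; exists u; rewrite pu lu e eqxx.
- move=> g /andP[g1 gf]; have : bad g.
    by case E: (bad g) => //; have := fmin g; rewrite g1 E leqNgt gf => /(_ isT).
  by case/existsP=> u /and3P[? ? /eqP]; exists u.
Qed.

Lemma lab_exists : exists lab, lab_ok s last bnd (size s) lab.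
Proof.
have: size s <= size s by []; elim: {1 3}(size s) => [|t IH] ts.
  by exists (fun=> 0); split.
have [lab h] := IH (ltnW ts).
have [v pv] : exists v, pos v = t.
  by case: (s) ts s_uniq => // x s' ts us; exists (nth x (x :: s') t); rewrite index_uniq.
have [f hf] := @newlab_exists t lab v pv.
by eexists; apply: newlab_ok pv h hf.
Qed.

End Labels.

(** * The left-endpoint order of a bubble structure *)

Section BubbleOrder.
Variables (T : finType) (G : sgraph T) (idx : T -> nat).
Variables (row col : T -> nat) (s1 s2 : T -> bool).
Hypothesis idx_inj : injective idx.
Hypothesis adjG : bub_adj G row col s1 s2.

(** Left endpoints, closed before open. *)
Definition left_lt (x y : T) : bool :=
  (col x < col y) || (col x == col y) &&
  ((row x < row y) || (row x == row y) &&
   ((s1 y < s1 x) || (s1 x == s1 y) && (idx x < idx y))).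

Lemma left_lt_irr : irreflexive left_lt.
Proof. by move=> x; rewrite /left_lt !ltnn !andbF. Qed.

Lemma left_lt_trans : transitive left_lt.
Proof.
by move=> y x z; rewrite /left_lt; case: (s1 x); case: (s1 y); case: (s1 z) => /=; lia.
Qed.

Lemma left_lt_total x y : x != y -> left_lt x y || left_lt y x.
Proof.
move=> xy; have : idx x != idx y by apply: contraNneq xy => /idx_inj ->.
by rewrite /left_lt; case: (s1 x); case: (s1 y) => /=; lia.
Qed.

(** Read as intervals: [y] starts no later than [z], hence before [x] has ended. Formally it is a
    finite check on signs and on the order of rows and columns. *)
Lemma left_lt_umbrella x y z : left_lt x y -> left_lt y z -> G x z -> G x y.
Proof.
rewrite !adjG /left_lt /bub_arc => xy yz /andP[_].
have -> : x != y by apply: contraTneq xy => ->; rewrite !ltnn !andbF.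
move: xy yz => /=; case: (s1 x); case: (s1 y); case: (s1 z); case: (s2 x); case: (s2 y);
  case: (s2 z) => /=; lia.
Qed.

Variable s : seq T.
Hypothesis s_all : forall x, x \in s.
Local Notation pos x := (index x s).
Hypothesis s_lt : forall x y, (pos x < pos y) = left_lt x y.

(** The vertex itself takes part in the maximum, so that a vertex without later neighbours gets its
    own position, as [lok_dead] expects. *)
Definition last_nbr (x : T) : nat := \max_(y | (y == x) || G x y) pos y.

Lemma pos_last_nbr x : pos x <= last_nbr x.
Proof. by apply: (leq_bigmax_cond (F := fun y => pos y)); rewrite eqxx. Qed.

Lemma last_nbr_lt x : last_nbr x < size s.
Proof.
have s0 : 0 < size s by case: (s) (s_all x).
rewrite -(prednK s0) ltnS; apply/bigmax_leqP => y _.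
by rewrite -ltnS prednK // index_mem.
Qed.

Lemma left_order_umbrella x y : pos x < pos y -> G x y = (pos y <= last_nbr x).
Proof.
move=> xy; apply/idP/idP => [gxy|].
  by apply: (leq_bigmax_cond (F := fun y => pos y)); rewrite gxy orbT.
have A0 : 0 < #|[pred y | (y == x) || G x y]|.
  by apply/card_gt0P; exists x; rewrite inE eqxx.
have [z hz ez] := eq_bigmax_cond (fun y => pos y) A0.
have -> : last_nbr x = pos z by rewrite -ez; apply: eq_bigl => i; rewrite inE.
move: hz; rewrite inE => /orP[/eqP->|gxz yz]; first by rewrite leqNgt xy.
move: yz; rewrite leq_eqVlt => /orP[/eqP e|yz].
  by rewrite -(nth_index y (s_all y)) e nth_index.
by apply: left_lt_umbrella gxz; rewrite -s_lt.
Qed.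

(** A later neighbour lies in the same column, where all vertices are adjacent, or in the next one.
    So the last neighbour is determined by the group, and distinct last neighbours mean distinct
    groups. *)
Lemma last_nbr_group u u' : col u = col u' ->
  (forall w, col w = (col u).+1 -> G u w = G u' w) -> last_nbr u = last_nbr u'.
Proof.
wlog suff le : u u' / col u = col u' ->
    (forall w, col w = (col u).+1 -> G u w = G u' w) -> last_nbr u <= last_nbr u'.
  move=> ec h; apply/eqP; rewrite eqn_leq !le // => w cw.
  by rewrite h // ec.
move=> ec h; apply/bigmax_leqP => w hw.
have [lt|] := ltnP (col w) (col u').
  apply: leq_trans (pos_last_nbr u'); apply: ltnW; rewrite s_lt /left_lt lt //.
rewrite leq_eqVlt => /orP[/eqP e|lt].
  apply: (leq_bigmax_cond (F := fun y => pos y)).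
  by rewrite adjG /bub_arc e eqxx orTb andbT eq_sym orbN.
have guw : G u w by case/orP: hw => // /eqP e; rewrite e ec ltnn in lt.
have cw : col w = (col u).+1.
  by move: guw; rewrite adjG /bub_arc; lia.
by apply: (leq_bigmax_cond (F := fun y => pos y)); rewrite -h // guw orbT.
Qed.

End BubbleOrder.

(** * Group number, cliques and independent sets in a bubble model *)

Section BubbleModel.
Variables (T : finType) (G : sgraph T) (B : ububble T).
Hypothesis modelB : ub_model B G.

Lemma model_bub_adj : bub_adj G (row B) (col B) (sgn1 B) (sgn2 B).
Proof.
move=> u v; rewrite (ubm_graph modelB) /= /ub_rel /= /ub_arc /bub_arc !inE !eqxx /=.
by rewrite !andb_orr.
Qed.

Lemma in_region i j (A : {set T}) u : (u \in region B i j A) =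
  [|| (col B u == j.-1) && (i < row B u), (col B u == j) && (row B u < i) | u \in A].
Proof.
have bcup m M (F : nat -> {set T}) :
    (u \in \bigcup_(m <= i < M) F i) = has (fun i => u \in F i) (index_iota m M).
  by elim: (index_iota m M) => [|x r IH]; rewrite ?big_nil ?inE // big_cons inE IH.
rewrite /region !inE !bcup -orbA; congr [|| _, _ | _]; apply/hasP/andP.
- by case=> x; rewrite mem_index_iota inE => ? /andP[/eqP-> ->]; split=> //; lia.
- case=> /eqP cu iu; exists (row B u); last by rewrite inE cu !eqxx.
  by rewrite mem_index_iota iu ltnS -cu; case/andP: (row_range B u).
- by case=> x; rewrite mem_index_iota inE => ? /andP[/eqP-> ->]; split=> //; lia.
- case=> /eqP cu iu; exists (row B u); last by rewrite inE cu !eqxx.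
  by rewrite mem_index_iota iu andbT; case/andP: (row_range B u).
Qed.

(** For both choices of [A] the region is a clique: it pairs low rows of column [j - 1] with high
    rows of column [j], and row [i] contributes to both columns only through quadrants that
    condition (c) makes adjacent. The neighbours of [v] in it form a clique with [v], and they are
    at least as many as their groups. *)
Lemma group_number_of_omega v : (group_number_of B G v).+1 <= omega G.
Proof.
have adjG := model_bub_adj.
have main A : {in region B (row B v) (col B v) A & , forall x y, x != y -> G x y} ->
    (ngroups B G (nbh G v :&: region B (row B v) (col B v) A)).+1 <= omega G.
  set R := region _ _ _ _ => cl; set X := _ :&: R.
  apply: leq_trans (_ : #|v |: X| <= _).
    by rewrite cardsU1 !inE adj_irr /= add1n ltnS leq_imset_card.
  apply: (leq_bigmax_cond (F := fun S : {set T} => #|S|)).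
  apply/forall_inP => x xX; apply/forall_inP => y yX; apply/implyP => xy.
  move: xX yX; rewrite !inE => /orP[/eqP ex|/andP[gx xR]] /orP[/eqP ey|/andP[gy yR]].
  - by rewrite ex ey eqxx in xy.
  - by rewrite ex.
  - by rewrite ey adj_sym.
  - by apply: cl => //; rewrite !inE.
rewrite /group_number_of gtn_max; apply/andP; split; apply: main => x y;
  rewrite !in_region !inE adjG /bub_arc => hx hy -> /=; have := col_range B x;
  have := col_range B y; have := col_range B v; move: hx hy;
  case: (sgn1 B x); case: (sgn2 B x); case: (sgn1 B y); case: (sgn2 B y) => /=; lia.
Qed.

Lemma group_number_omega : group_number B G + 2 <= omega G + 1.
Proof.
rewrite addn1 addn2 ltnS /group_number.
have [v ->] := eq_bigmax (group_number_of B G) (ub_nonempty B).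
exact: group_number_of_omega.
Qed.

Lemma ncol_alpha : ncol B <= 2 * alpha G.
Proof.
have pickcol (j : 'I_(uphalf (ncol B))) : exists v, col B v = (2 * j).+1.
  have rng : 1 <= (2 * j).+1 <= ncol B by have := ltn_ord j; lia.
  have [i /andP[_ /set0Pn[v]]] := ubm_col modelB rng.
  by rewrite inE => /andP[_ /eqP]; exists v.
have [f fP] := choice pickcol.
have f_inj : injective f by move=> i j e; apply: ord_inj; have := fP i; rewrite e fP; lia.
suff : uphalf (ncol B) <= alpha G by lia.
apply: leq_trans (_ : #|[set f j | j in 'I_(uphalf (ncol B))]| <= _).
  by rewrite card_imset // card_ord.
apply: (leq_bigmax_cond (F := fun S : {set T} => #|S|)).
apply/forall_inP => x /imsetP[i _ ->]; apply/forall_inP => y /imsetP[j _ ->].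
rewrite model_bub_adj /bub_arc !fP.
by case: (eqVneq i j) => [->|ij]; rewrite ?eqxx // ;
  have : (i : nat) != j by []; lia.
Qed.

Section Labelling.
Variables (idx : T -> nat) (s : seq T).
Hypothesis s_all : forall x, x \in s.
Local Notation pos x := (index x s).
Hypothesis s_lt : forall x y, (pos x < pos y) =
  left_lt idx (row B) (col B) (sgn1 B) x y.

(** The members of [us] are neighbours of [w] preceding it, so they lie in one of the two regions of
    [w]; by [last_nbr_group] they belong to different groups. *)
Lemma live_group_number w us : uniq (map (last_nbr G s) us) ->
  (forall u, u \in us -> pos u < pos w <= last_nbr G s u) ->
  size us <= group_number B G.
Proof.
have adjG := model_bub_adj; have umb := left_order_umbrella adjG s_all s_lt.
move=> uus hus.
apply: leq_trans (leq_bigmax (F := group_number_of B G) w).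
have main A : {in us, forall u, u \in region B (row B w) (col B w) A} ->
    size us <= ngroups B G (nbh G w :&: region B (row B w) (col B w) A).
  move=> hR; rewrite -(size_map (group B G)) /ngroups cardE.
  apply: uniq_leq_size; last first.
    move=> g /mapP[u uu ->]; rewrite mem_enum; apply: imset_f.
    by rewrite in_setI hR // andbT inE adj_sym umb; case/andP: (hus u uu).
  rewrite map_inj_in_uniq; first exact: map_uniq uus.
  move=> u u' hu hu' e; have : u \in group B G u' by rewrite -e inE !eqxx.
  rewrite inE => /andP[/eqP ec /eqP en].
  have el : last_nbr G s u = last_nbr G s u'.
    apply: (last_nbr_group adjG s_lt) => // x cx; have := congr1 (fun X : {set T} => x \in X) en.
    by rewrite !inE cx -ec eqxx !andbT.
  exact: (uniq_map_inj uus).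
have nb u : u \in us -> left_lt idx (row B) (col B) (sgn1 B) u w && G u w.
  by move=> /hus /andP[uw uwl]; rewrite -s_lt uw umb.
(* The first sign of [w] selects [A]. If it is [+], the predecessors of [w] in its bubble have it
   too, and row [i] of the previous column contributes its vertices with second sign [+]. If it is
   [-], that row has no neighbour of [w], while the whole bubble may precede it. *)
rewrite /group_number_of leq_max; case E: (sgn1 B w); apply/orP; [left|right];
  apply: main => u /nb; rewrite in_region !inE adjG /left_lt /bub_arc E;
  have := col_range B u; have := col_range B w;
  case: (sgn1 B u); case: (sgn2 B u) => /=; lia.
Qed.

End Labelling.

Lemma cwd_bubble : cwd G <= minn (2 * alpha G + 3) (group_number B G + 2).
Proof.
have T0 := ub_nonempty B; have [_ cwdmin] := cwdP G T0.
have adjG := model_bub_adj.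
have idx_inj : injective (fun x : T => enum_rank x : nat).
  by move=> x y /ord_inj/enum_rank_inj.
have head_ex (s : seq T) : (forall x, x \in s) -> exists v0, v0 = head v0 s.
  by case/card_gt0P: T0 => v _ /(_ v); case: s => // x s _; exists x.
rewrite leq_min; apply/andP; split.
  apply: (@leq_trans (ncol B + 3)); last by rewrite leq_add2r ncol_alpha.
  pose lt (x y : T) := (row B x < row B y) || (row B x == row B y) &&
    ((col B x < col B y) || (col B x == col B y) && (enum_rank x < enum_rank y)).
  have [||x y xy|s [us ms _ slt]] := @strict_order_enum T lt.
  - by move=> x; rewrite /lt !ltnn !andbF.
  - by move=> y x z; rewrite /lt; lia.
  - have : (enum_rank x : nat) != enum_rank y by apply: contraNneq xy => /idx_inj ->.
    by rewrite /lt; lia.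
  have [v0 v0E] := head_ex s ms.
  have srt x y : index x s < index y s ->
      (row B x < row B y) || (row B x == row B y) && (col B x <= col B y).
    by rewrite slt /lt; lia.
  apply: (cwdmin _ (row_term s (ncol B) (row B) (col B) (sgn1 B) (sgn2 B) v0)); split.
    by apply: row_term_constructs => //; first exact: col_range.
  exact: (row_term_nlabels _ _ _ us (col_range B)).
have [||x y xy|s [us ms _ slt]] :=
    @strict_order_enum T (left_lt (fun x : T => enum_rank x : nat) (row B) (col B) (sgn1 B)).
- exact: left_lt_irr.
- exact: left_lt_trans.
- exact: left_lt_total.
have [v0 v0E] := head_ex s ms.
have plast := @pos_last_nbr T G s.
have [lab labP] := lab_exists us ms plast (live_group_number ms slt) (last_nbr_lt G ms).
apply: (cwdmin _ (col_term s (fun v => enum (nbh G v)) (last_nbr G s) lab v0)); split.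
  apply: (col_term_constructs us ms _ _ plast labP v0E) => [v x|].
    by rewrite mem_enum.
  exact: (left_order_umbrella adjG ms slt).
apply: col_term_nlabels => [|x]; first by rewrite addn2.
have px : index x s < size s by rewrite index_mem.
have := plast x; rewrite leq_eqVlt => /orP[/eqP e|lt].
  by rewrite (lok_dead labP px) // addn2.
by case/andP: (lok_bnd labP px lt).
Qed.

End BubbleModel.

(** * Structured programs on the word RAM *)

(** Registers, and arrays [k < 64] stored at the addresses [64 * i + k]. *)
Record st := St { rg : nat -> nat; ar : nat -> nat -> nat; ou : seq nat }.

Inductive ex :=
| EC of nat
| ER of nat
| EI of ex
| EA of nat & ex
| EB of binop & ex & ex.

Inductive prog :=
| PSkip
| PSet of nat & ex
| PSto of nat & ex & ex
| POut of ex
| PSeq of prog & prog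
| PIf of ex & prog & prog
| PFor of nat & nat & ex & prog.

(** With [Nat.eqb], comparisons of literal register numbers vanish by computation. *)
Definition updr (f : nat -> nat) (r x : nat) : nat -> nat :=
  fun r' => if Nat.eqb r' r then x else f r'.
Definition setr r x s := St (updr (rg s) r x) (ar s) (ou s).
Definition seta k i x s :=
  St (rg s) (fun k' => if Nat.eqb k' k then updr (ar s k) i x else ar s k') (ou s).
Definition puto x s := St (rg s) (ar s) (rcons (ou s) x).

Section Interp.
Variable inp : seq nat.

Fixpoint ev (s : st) (e : ex) : nat :=
  match e with
  | EC x => x
  | ER r => rg s r
  | EI e1 => nth 0 inp (ev s e1)
  | EA k e1 => ar s k (ev s e1)
  | EB o e1 e2 => binop_val o (ev s e1) (ev s e2)
  end.

Fixpoint run (p : prog) (s : st) : st :=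
  match p with
  | PSkip => s
  | PSet r e => setr r (ev s e) s
  | PSto k e1 e2 => seta k (ev s e1) (ev s e2) s
  | POut e => puto (ev s e) s
  | PSeq p1 p2 => run p2 (run p1 s)
  | PIf e p1 p2 => if ev s e == 0 then run p2 s else run p1 s
  | PFor r rb e p1 =>
      iteri (ev s e) (fun i s' => setr r i.+1 (run p1 s'))
        (setr r 0 (setr rb (ev s e) s))
  end.

Fixpoint cost (p : prog) (s : st) : nat :=
  match p with
  | PSkip | PSet _ _ | PSto _ _ _ | POut _ => 1
  | PSeq p1 p2 => cost p1 s + cost p2 (run p1 s)
  | PIf e p1 p2 => (if ev s e == 0 then cost p2 s else cost p1 s).+1
  | PFor r rb e p1 =>
      (iteri (ev s e)
        (fun i sc => (setr r i.+1 (run p1 sc.1), sc.2 + cost p1 sc.1 + 2))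
        (setr r 0 (setr rb (ev s e) s), 3)).2
  end.

End Interp.

Fixpoint cex (e : ex) : expr :=
  match e with
  | EC x => Cst x
  | ER r => Reg r
  | EI e1 => Inp (cex e1)
  | EA k e1 => Mem (Bin OpAdd (Bin OpMul (cex e1) (Cst 64)) (Cst k))
  | EB o e1 e2 => Bin o (cex e1) (cex e2)
  end.

Fixpoint comp (p : prog) : cmd :=
  match p with
  | PSkip => Skip
  | PSet r e => Set_ r (cex e)
  | PSto k e1 e2 => Store (Bin OpAdd (Bin OpMul (cex e1) (Cst 64)) (Cst k)) (cex e2)
  | POut e => Out (cex e)
  | PSeq p1 p2 => Seq (comp p1) (comp p2)
  | PIf e p1 p2 => If (cex e) (comp p1) (comp p2)
  | PFor r rb e p1 =>
      Seq (Set_ rb (cex e)) (Seq (Set_ r (Cst 0))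
        (While (Bin OpLt (Reg r) (Reg rb))
           (Seq (comp p1) (Set_ r (Bin OpAdd (Reg r) (Cst 1))))))
  end.

Fixpoint rmods (p : prog) : seq nat :=
  match p with
  | PSkip | PSto _ _ _ | POut _ => [::]
  | PSet r _ => [:: r]
  | PSeq p1 p2 | PIf _ p1 p2 => rmods p1 ++ rmods p2
  | PFor r rb _ p1 => r :: rb :: rmods p1
  end.

Fixpoint amods (p : prog) : seq nat :=
  match p with
  | PSkip | PSet _ _ | POut _ => [::]
  | PSto k _ _ => [:: k]
  | PSeq p1 p2 | PIf _ p1 p2 => amods p1 ++ amods p2
  | PFor _ _ _ p1 => amods p1
  end.

Fixpoint noout (p : prog) : bool :=
  match p with
  | PSkip | PSet _ _ | PSto _ _ _ => true
  | POut _ => false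
  | PSeq p1 p2 | PIf _ p1 p2 => noout p1 && noout p2
  | PFor _ _ _ p1 => noout p1
  end.

(** [grow e = Some u]: the value of [e] exceeds the largest value in sight by at
    most [u] times the bound on constants and inputs. *)
Fixpoint grow (e : ex) : option nat :=
  match e with
  | EC _ | ER _ | EI _ | EA _ _ | EB OpEq _ _ | EB OpLt _ _ => Some 0
  | EB OpSub e1 _ | EB OpDiv e1 _ | EB OpMod e1 _ => grow e1
  | EB OpAdd e1 (EC _) | EB OpAdd e1 (EI _) => omap S (grow e1)
  | _ => None
  end.

Definition maxsize := 200.

Fixpoint ok_ex (e : ex) : bool :=
  match e with
  | EC x => x <= 64
  | ER _ => true
  | EI e1 => ok_ex e1
  | EA k e1 => (k < 64) && ok_ex e1
  | EB _ e1 e2 => ok_ex e1 && ok_ex e2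
  end.

Definition okx (e : ex) : bool := ok_ex e && (expr_size (cex e) <= maxsize - 10).
Definition oks (e : ex) : bool :=
  okx e && (if grow e is Some u then u <= 3 else false).

(** Stored values must grow by a bounded amount ([oks]); addresses, tests and outputs need only be
    small ([okx]), so products are allowed there because they do not accumulate. A loop body must
    leave the counter and its bound alone. *)
Fixpoint okp (p : prog) : bool :=
  match p with
  | PSkip => true
  | PSet _ e => oks e
  | PSto k e1 e2 => [&& k < 64, okx e1 & oks e2]
  | POut e => okx e
  | PSeq p1 p2 => okp p1 && okp p2
  | PIf e p1 p2 => [&& okx e, okp p1 & okp p2]
  | PFor r rb e p1 =>
      [&& oks e, okp p1, r != rb, r \notin rmods p1 & rb \notin rmods p1]
  end.

Section Frame.
Variable inp : seq nat.
Local Notation run := (run inp).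

Lemma updr_ne f r x q : q != r -> updr f r x q = f q.
Proof. by rewrite /updr; case: (PeanoNat.Nat.eqb_spec q r) => // ->; rewrite eqxx. Qed.

Lemma updr_eq f r x : updr f r x r = x.
Proof. by rewrite /updr PeanoNat.Nat.eqb_refl. Qed.

Lemma updrE f r x q : updr f r x q = if q == r then x else f q.
Proof. by case: eqP => [->|/eqP h]; rewrite ?updr_eq ?updr_ne. Qed.

Lemma rg_run p s r : r \notin rmods p -> rg (run p s) r = rg s r.
Proof.
elim: p s => [|q e|k e1 e2|e|p1 IH1 p2 IH2|e p1 IH1 p2 IH2|q qb e p1 IH1] s //=.
- by rewrite inE => h; rewrite updr_ne.
- by rewrite mem_cat negb_or => /andP[h1 h2]; rewrite IH2 ?IH1.
- by rewrite mem_cat negb_or => /andP[h1 h2]; case: ifP; rewrite ?IH2 ?IH1.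
- rewrite !inE !negb_or => /and3P[h1 h2 h3].
  set s0 := setr q 0 _; have <- : rg s0 r = rg s r by rewrite /= !updr_ne.
  by elim: (ev inp s e) => //= N IH; rewrite updr_ne // IH1.
Qed.

Lemma ar_run p s k : k \notin amods p -> ar (run p s) k = ar s k.
Proof.
elim: p s => [|q e|k' e1 e2|e|p1 IH1 p2 IH2|e p1 IH1 p2 IH2|q qb e p1 IH1] s //=.
- rewrite inE; case: (PeanoNat.Nat.eqb_spec k k') => // ->.
  by rewrite eqxx.
- by rewrite mem_cat negb_or => /andP[h1 h2]; rewrite IH2 ?IH1.
- by rewrite mem_cat negb_or => /andP[h1 h2]; case: ifP; rewrite ?IH2 ?IH1.
- move=> h; set s0 := setr q 0 _.
  by elim: (ev inp s e) => //= N IH; rewrite IH1.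
Qed.

Lemma ou_run p s : noout p -> ou (run p s) = ou s.
Proof.
elim: p s => [|q e|k' e1 e2|e|p1 IH1 p2 IH2|e p1 IH1 p2 IH2|q qb e p1 IH1] s //=.
- by move=> /andP[h1 h2]; rewrite IH2 ?IH1.
- by move=> /andP[h1 h2]; case: ifP; rewrite ?IH2 ?IH1.
- move=> h; set s0 := setr q 0 _.
  by elim: (ev inp s e) => //= N IH; rewrite IH1.
Qed.

Lemma costFor r rb e p s :
  cost inp (PFor r rb e p) s = 3 + \sum_(i < ev inp s e)
    (cost inp p (iteri i (fun i s' => setr r i.+1 (run p s'))
        (setr r 0 (setr rb (ev inp s e) s))) + 2).
Proof.
rewrite /=; set s0 := setr r 0 _; elim: (ev inp s e) => [|N IH]; first by rewrite big_ord0.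
rewrite big_ord_recr /= IH addnA addnA; congr (_ + cost _ _ _ + 2).
by elim: N {IH} => //= N ->.
Qed.

End Frame.

Section Simulation.
Variables (W : nat) (inp : seq nat) (C : nat).
Hypothesis C64 : 64 <= C.
Hypothesis inpC : forall i, nth 0 inp i <= C.

Definition simul (s : st) (o : state) : Prop :=
  [/\ regs o =1 rg s, (forall k i, k < 64 -> memo o (i * 64 + k) = ar s k i) &
      outp o = ou s].

Definition bounded (V : nat) (s : st) : Prop :=
  (forall r, rg s r <= V) /\ (forall k i, ar s k i <= V).

Lemma boundedW V V' s : V <= V' -> bounded V s -> bounded V' s.
Proof.
by move=> h [b1 b2]; split=> [r|k i]; apply: leq_trans h; rewrite ?b1 ?b2.
Qed.

(** Over values up to [V], an expression of size [m] has value at most [V ^ m], and so have its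
    subexpressions; this is why [maxsize] becomes the exponent in the word bound. *)
Lemma eval_ev V s o e : C <= V -> simul s o -> bounded V s -> ok_ex e ->
  V ^ expr_size (cex e) < W ->
  eval W inp o (cex e) = Some (ev inp s e) /\ ev inp s e <= V ^ expr_size (cex e).
Proof.
move=> CV [hr hm _] [b1 b2].
have V2 : 2 <= V by apply: leq_trans CV; apply: leq_trans C64.
have V0 : 0 < V := ltnW V2.
have wordP x m : x <= V ^ m -> V ^ m < W -> word W x = Some x.
  by move=> h1 h2; rewrite /word (leq_ltn_trans h1 h2).
have powW a b : a <= b -> V ^ b < W -> V ^ a < W.
  by move=> h; apply: leq_ltn_trans; rewrite leq_exp2l.
have lift x m : x <= V -> 0 < m -> x <= V ^ m.
  by case: m => // m h _; apply: leq_trans h _; rewrite expnS leq_pmulr // expn_gt0 V0.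
have addX x y a b : x <= V ^ a -> y <= V ^ b -> 0 < a -> 0 < b -> x + y <= V ^ (a + b).
  move=> h1 h2 a0 b0; rewrite expnD.
  have ha : 2 <= V ^ a by apply: leq_trans (lift _ _ (leqnn V) a0).
  have hb : 2 <= V ^ b by apply: leq_trans (lift _ _ (leqnn V) b0).
  nia.
have pos e' : 0 < expr_size (cex e') by case: e'.
elim: e => [x|r|e IH|k e IH|b e1 IH1 e2 IH2] /=.
- move=> x64; rewrite expn1 => VW; have h : x <= V ^ 1.
    by rewrite expn1 (leq_trans x64) // (leq_trans C64).
  by rewrite (wordP x 1) ?expn1 //; split=> //; rewrite -(expn1 V).
- by rewrite expn1 => _ VW; rewrite hr (wordP _ 1) ?expn1.
- move=> he VW; have [-> h] := IH he (powW _ _ (leqnSn _) VW).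
  have h' : nth 0 inp (ev inp s e) <= V ^ (expr_size (cex e)).+1.
    by apply: lift; rewrite ?(leq_trans (inpC _)).
  by rewrite /= (wordP _ _ h').
- case/andP=> k64 he VW; set z := expr_size (cex e) in VW *.
  have hz : V ^ z < W by apply: powW VW; lia.
  have [-> h] := IH he hz; rewrite /= -/z in h *.
  have w64 : 64 <= V by apply: leq_trans CV.
  have h1 : 64 <= V ^ 1 by rewrite expn1.
  have h2 : ev inp s e * 64 <= V ^ (z + 1).+1.
    apply: leq_trans (_ : V ^ (z + 1) <= _); last by rewrite leq_exp2l.
    by rewrite expnD expn1 leq_mul.
  have h3 : k <= V ^ 1 by rewrite expn1 (leq_trans (ltnW k64)).
  have h4 : ev inp s e * 64 + k <= V ^ ((z + 1).+1 + 1).+1.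
    apply: leq_trans (addX _ _ _ _ h2 h3 _ _) _ => //.
    by rewrite leq_exp2l //.
  have h5 : ar s k (ev inp s e) <= V ^ ((z + 1).+1 + 1).+2 by apply: lift.
  rewrite (wordP 64 1) //=; last by apply: powW VW; lia.
  rewrite (wordP _ _ h2) /=; last by apply: powW VW; lia.
  rewrite (wordP k 1) //=; last by apply: powW VW; lia.
  rewrite (wordP _ _ h4) /=; last by apply: powW VW; lia.
  by rewrite hm // (wordP _ _ h5).
- case/andP=> he1 he2 VW.
  have hz1 : V ^ expr_size (cex e1) < W by apply: powW VW; lia.
  have hz2 : V ^ expr_size (cex e2) < W by apply: powW VW; lia.
  have [-> h1] := IH1 he1 hz1; have [-> h2] := IH2 he2 hz2.
  have p1 := pos e1; have p2 := pos e2.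
  set z1 := expr_size _ in VW h1 p1 *; set z2 := expr_size _ in VW h2 p2 *.
  move: (ev inp s e1) (ev inp s e2) h1 h2 => x y h1 h2.
  have mono m : m <= V ^ (z1 + z2) -> m <= V ^ (z1 + z2).+1.
    by move=> h; apply: leq_trans h _; rewrite leq_exp2l.
  have hx : x <= V ^ (z1 + z2).+1.
    by apply: leq_trans h1 _; rewrite leq_exp2l //; lia.
  have h : binop_val b x y <= V ^ (z1 + z2).+1.
    case: b => /=.
    + exact/mono/addX.
    + exact: leq_trans (leq_subr _ _) _.
    + by apply: mono; rewrite expnD leq_mul.
    + exact: leq_trans (leq_div _ _) _.
    + exact: leq_trans (leq_mod _ _) _.
    + by case: (x == y); rewrite ?expn_gt0 ?V0.
    + by case: (x < y); rewrite ?expn_gt0 ?V0.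
  by rewrite /= (wordP _ _ h).
Qed.

Lemma ev_grow V s e u : C <= V -> bounded V s -> ok_ex e -> grow e = Some u ->
  ev inp s e <= V + u * C.
Proof.
move=> CV [b1 b2]; have V1 : 1 <= V by apply: leq_trans CV; apply: leq_trans C64.
elim: e u => [x|r|e IH|k e IH|b e1 IH1 e2 IH2] u /=.
- by move=> x64 [<-]; rewrite addn0 (leq_trans x64) // (leq_trans C64).
- by move=> _ [<-]; rewrite addn0.
- by move=> _ [<-]; rewrite addn0 (leq_trans (inpC _)).
- by move=> _ [<-]; rewrite addn0.
- case/andP=> he1 he2.
  case: b => /=.
  + case: e2 IH2 he2 => // [x|e2] IH2 he2; case E: (grow e1) => [u1|] //= [<-];
      rewrite mulSn addnCA addnC; apply: leq_add; try exact: IH1.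
      by rewrite /= (leq_trans he2).
    exact: inpC.
  + by move=> h; apply: leq_trans (leq_subr _ _) (IH1 _ _ h).
  + by [].
  + by move=> h; apply: leq_trans (leq_div _ _) (IH1 _ _ h).
  + by move=> h; apply: leq_trans (leq_mod _ _) (IH1 _ _ h).
  + by move=> [<-]; case: (_ == _); rewrite addn0.
  + by move=> [<-]; case: (_ < _); rewrite addn0.
Qed.

(** One step raises the largest stored value by at most [3 * C]. Linear growth makes the bound
    additive in the cost, which is used for sequences and loops. *)
Definition grown V c := V + 3 * C * c.

Lemma bounded_setr V s r x : bounded V s -> x <= V -> bounded V (setr r x s).
Proof. by move=> [b1 b2] xV; split=> //= q; rewrite updrE; case: eqP. Qed.

Lemma bounded_seta V s k i x : bounded V s -> x <= V -> bounded V (seta k i x s).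
Proof.
move=> [b1 b2] xV; split=> //= k' j; case: (PeanoNat.Nat.eqb_spec k' k) => // _.
by rewrite updrE; case: eqP.
Qed.

Lemma simul_setr s o r x : simul s o ->
  simul (setr r x s) (State (upd (regs o) r x) (memo o) (outp o)).
Proof. by case=> hr hm ho; split=> //= q; rewrite updrE /upd hr. Qed.

(** Every elementary step takes at most [timeK] units of machine time. *)
Definition timeK := 3 * maxsize.

(** The interpreter is total, so the cost of the whole run is known beforehand and the largest value
    ever reached can be compared with [W] at the start. Time and size of values have to be bounded
    in the same induction, since execution is possible only below the word bound. *)
Theorem simulation p s o V : okp p -> simul s o -> C <= V -> bounded V s ->
  grown V (cost inp p s) ^ maxsize < W ->
  exists t o', [/\ exec W inp (comp p) o t o', simul (run inp p s) o',
    t <= timeK * cost inp p s & bounded (grown V (cost inp p s)) (run inp p s)].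
Proof.
move: s o V; have growM V c c' : c <= c' -> grown V c <= grown V c'.
  by move=> h; rewrite /grown leq_add2l leq_mul2l h orbT.
have growV V c : V <= grown V c by rewrite leq_addr.
have powW V c a : C <= V -> grown V c ^ maxsize < W -> a <= maxsize -> V ^ a < W.
  move=> CV hW ha; apply: leq_ltn_trans hW; have V1 : 0 < V by lia.
  apply: leq_trans (_ : V ^ maxsize <= _); first by rewrite leq_pexp2l.
  by rewrite leq_exp2r // growV.
have sz10 a : a <= maxsize - 10 -> a <= maxsize by rewrite /maxsize; lia.
have sz e : okx e -> [/\ ok_ex e & expr_size (cex e) <= maxsize - 10].
  by case/andP.
elim: p => [|r e|k e1 e2|e|p1 IH1 p2 IH2|e p1 IH1 p2 IH2|r rb e p1 IH1] s o V.
- move=> _ so CV bV _; exists 1, o; split=> //; first exact: exec_skip.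
  by apply: boundedW bV; apply: growV.
- rewrite [okp _]/= => /andP[/sz[oke sze]]; case G: (grow e) => [u|] // u3 so CV bV hW.
  have [evE _] := eval_ev CV so bV oke (powW _ _ _ CV hW (sz10 _ sze)).
  exists (expr_size (cex e)).+1, (State (upd (regs o) r (ev inp s e)) (memo o) (outp o)).
  split; [exact: exec_set|exact: simul_setr| |].
    by rewrite muln1 /timeK; move: sze; rewrite /maxsize; lia.
  apply: bounded_setr; first by apply: boundedW bV; apply: growV.
  apply: leq_trans (ev_grow CV bV oke G) _; rewrite /grown /= muln1 leq_add2l.
  by rewrite leq_mul2r u3 orbT.
- rewrite [okp _]/= => /and3P[k64 /sz[oke1 sze1] /andP[/sz[oke2 sze2]]].
  case G: (grow e2) => [u|] // u3 so CV bV hW.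
  have [evE1 _] : eval W inp o (Bin OpAdd (Bin OpMul (cex e1) (Cst 64)) (Cst k)) =
      Some (ev inp s e1 * 64 + k) /\ True.
    have := @eval_ev V s o (EB OpAdd (EB OpMul e1 (EC 64)) (EC k)) CV so bV.
    rewrite /= oke1 (ltnW k64) => /(_ isT) h; split=> //; apply h.
    by apply: powW CV hW _; move: sze1; rewrite /maxsize; lia.
  have [evE2 _] := eval_ev CV so bV oke2 (powW _ _ _ CV hW (sz10 _ sze2)).
  exists (expr_size (Bin OpAdd (Bin OpMul (cex e1) (Cst 64)) (Cst k)) +
          expr_size (cex e2)).+1.
  exists (State (regs o) (upd (memo o) (ev inp s e1 * 64 + k) (ev inp s e2)) (outp o)).
  split; first exact: exec_store.
  + case: so => hr hm ho; split=> //= k' i' k'64; rewrite /upd.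
    case: (PeanoNat.Nat.eqb_spec k' k) => [->|ne].
      by rewrite updrE eqn_add2r eqn_pmul2r // hm.
    rewrite ifN ?hm //; apply/eqP => e; apply: ne.
    (* Cells of different arrays have addresses that differ modulo 64. *)
    have := congr1 (modn^~ 64) e; rewrite !modnMDl !modn_small //.
  + by rewrite muln1 /timeK; move: sze1 sze2; rewrite /maxsize /=; lia.
  + apply: bounded_seta; first by apply: boundedW bV; apply: growV.
    apply: leq_trans (ev_grow CV bV oke2 G) _; rewrite /grown /= muln1 leq_add2l.
    by rewrite leq_mul2r u3 orbT.
- move=> /sz[oke sze] so CV bV hW.
  have [evE _] := eval_ev CV so bV oke (powW _ _ _ CV hW (sz10 _ sze)).
  exists (expr_size (cex e)).+1, (State (regs o) (memo o) (rcons (outp o) (ev inp s e))).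
  split; first exact: exec_out.
  + by case: so => hr hm ho; split=> //=; rewrite ho.
  + by rewrite muln1 /timeK; move: sze; rewrite /maxsize; lia.
  + by apply: boundedW (bV : bounded V (puto _ _)); apply: growV.
- rewrite /= => /andP[ok1 ok2] so CV bV hW.
  have [|t1 [o1 [x1 so1 h1 b1]]] := IH1 s o V ok1 so CV bV.
    by apply: leq_ltn_trans hW; rewrite leq_exp2r // growM // leq_addr.
  have gg : grown (grown V (cost inp p1 s)) (cost inp p2 (run inp p1 s)) =
      grown V (cost inp p1 s + cost inp p2 (run inp p1 s)).
    by rewrite /grown mulnDr addnA.
  have [||t2 [o2 [x2 so2 h2 b2]]] := IH2 _ o1 (grown V (cost inp p1 s)) ok2 so1 _ b1.
  + exact: leq_trans (growV _ _).
  + by rewrite gg.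
  exists (t1 + t2), o2; split=> //; last by rewrite -gg.
    exact: exec_seq x1 x2.
  by rewrite mulnDr leq_add.
- rewrite /= => /and3P[/sz[oke sze] ok1 ok2] so CV bV hW.
  have [evE _] := eval_ev CV so bV oke (powW _ _ _ CV hW (sz10 _ sze)).
  set c := (if _ then _ else _) in hW *.
  have : exists t o', [/\ exec W inp (if ev inp s e != 0 then comp p1 else comp p2) o t o',
      simul (if ev inp s e == 0 then run inp p2 s else run inp p1 s) o',
      t <= timeK * c & bounded (grown V c)
        (if ev inp s e == 0 then run inp p2 s else run inp p1 s)].
    have hW' : grown V c ^ maxsize < W.
      by apply: leq_ltn_trans hW; rewrite leq_exp2r // growM.
    by rewrite /c in hW' *; case: eqP hW' => _ hW' /=; [apply: IH2|apply: IH1].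
  case=> t [o' [x so' ht b']]; exists (expr_size (cex e) + t).+1, o'; split=> //.
  + exact: exec_if evE x.
  + by rewrite mulnS; move: ht sze; rewrite /timeK /maxsize; lia.
  + by apply: boundedW b'; apply: growM.
- rewrite [okp _]/= => /and5P[/andP[/sz[oke sze]]].
  case G: (grow e) => [u|] // u3 ok1 rrb r1 rb1 so CV bV; rewrite costFor [run _ _ _]/=.
  set N := ev inp s e; set it := iteri _ _ _.
  pose f := fun i s' => setr r i.+1 (run inp p1 s').
  pose s0 := setr r 0 (setr rb N s).
  pose cst m := 3 + \sum_(i < m) (cost inp p1 (iteri i f s0) + 2).
  rewrite -/(cst N) => hW.
  have cstS m : cst m.+1 = cst m + (cost inp p1 (iteri m f s0) + 2).
    by rewrite /cst big_ord_recr /= addnA.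
  have cstM m : m <= N -> cst m <= cst N.
    move=> mN; rewrite -(subnKC mN); elim: (N - m) => [|d IH]; first by rewrite addn0.
    by rewrite addnS cstS (leq_trans IH) // leq_addr.
  have hWm m : m <= cst N -> grown V m ^ maxsize < W.
    by move=> h; apply: leq_ltn_trans hW; rewrite leq_exp2r // growM.
  have rE m : m <= N -> rg (iteri m f s0) r = m.
    by case: m => [|m] _ /=; rewrite updr_eq.
  have rbE m : rg (iteri m f s0) rb = N.
    elim: m => [|m IH] /=.
      by rewrite updr_ne ?updr_eq // eq_sym.
    by rewrite updr_ne ?rg_run // eq_sym.
  have [evE _] := eval_ev CV so bV oke (powW _ _ _ CV hW (sz10 _ sze)).
  (* Induction on the number [d] of remaining rounds; [cst m] is the cost spent after [m] rounds,
     including the set-up. *)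
  have loop d : forall m o1, m + d = N -> simul (iteri m f s0) o1 ->
      bounded (grown V (cst m)) (iteri m f s0) ->
      exists t o', [/\ exec W inp (While (Bin OpLt (Reg r) (Reg rb))
           (Seq (comp p1) (Set_ r (Bin OpAdd (Reg r) (Cst 1))))) o1 t o',
        simul (iteri N f s0) o', t <= 4 + timeK * (cst N - cst m) &
        bounded (grown V (cst N)) (iteri N f s0)].
    elim: d => [|d IHd] m o1 mN so1 bm.
      rewrite addn0 in mN; subst m; exists 4, o1; split=> //.
      apply: exec_while_stop.
      have [||-> _] := eval_ev (leq_trans CV (growV _ _)) so1 bm
        (e := EB OpLt (ER r) (ER rb)) => //.
        apply: leq_ltn_trans hW; rewrite leq_pexp2l //.
        by apply: leq_trans (growV _ _); lia.
      by rewrite /= rE // rbE ltnn.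
    have mlt : m < N by rewrite -mN addnS ltnS leq_addr.
    have [||eE _] := eval_ev (leq_trans CV (growV _ _)) so1 bm
        (e := EB OpLt (ER r) (ER rb)) => //.
      apply: leq_ltn_trans (hWm _ (cstM _ (ltnW mlt))); rewrite leq_pexp2l //.
      by apply: leq_trans (growV _ _); lia.
    have gg : grown (grown V (cst m)) (cost inp p1 (iteri m f s0)) =
        grown V (cst m + cost inp p1 (iteri m f s0)).
      by rewrite /grown mulnDr addnA.
    have cle : cst m + cost inp p1 (iteri m f s0) + 2 <= cst N.
      by apply: leq_trans (cstM _ mlt); rewrite cstS addnA.
    have [|t1 [o2 [x1 so2 ht1 b1]]] := IH1 _ o1 _ ok1 so1 (leq_trans CV (growV _ _)) bm.
      by rewrite gg; apply: hWm; lia.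
    rewrite gg in b1.
    have [||eE2 _] := eval_ev (leq_trans CV (growV _ _)) so2 b1
        (e := EB OpAdd (ER r) (EC 1)) => //.
      have cle' : cst m + cost inp p1 (iteri m f s0) <= cst N by lia.
      apply: leq_ltn_trans (hWm _ cle'); rewrite leq_pexp2l //.
      by apply: leq_trans (growV _ _); lia.
    have so3 : simul (iteri m.+1 f s0) (State (upd (regs o2) r m.+1) (memo o2) (outp o2)).
      exact: simul_setr so2.
    have b3 : bounded (grown V (cst m.+1)) (iteri m.+1 f s0).
      rewrite /= /f; apply: bounded_setr.
        by apply: boundedW b1; apply: growM; rewrite cstS; lia.
      have mV : m <= grown V (cst m) by case: bm => h _; have := h r; rewrite rE // ltnW.
      apply: leq_trans (_ : (grown V (cst m)).+1 <= _) => //.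
      by rewrite /grown cstS; nia.
    have [|t2 [o' [x2 so' ht2 b']]] := IHd m.+1 _ _ so3 b3; first by rewrite -mN addnS.
    exists (expr_size (Bin OpLt (Reg r) (Reg rb)) + (t1 + 4) + t2).+1, o'; split=> //.
      apply: exec_while_loop eE _ _ x2.
        by rewrite /= rE ?rbE ?mlt // ltnW.
      apply: exec_seq x1 _.
      have -> : 4 = (expr_size (Bin OpAdd (Reg r) (Cst 1))).+1 by [].
      have := @exec_set W inp r _ _ _ eE2; rewrite /= (rg_run inp) // rE ?addn1 //.
      exact: ltnW.
    rewrite /=; have := cstM _ mlt; rewrite cstS in ht2 *; move: ht1 ht2.
    rewrite /timeK /maxsize; lia.
  have b0 : bounded (grown V 3) s0.
    apply: bounded_setr => //; apply: bounded_setr; first by apply: boundedW bV; apply: growV.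
    apply: leq_trans (ev_grow CV bV oke G) _; rewrite /grown leq_add2l mulnAC.
    by rewrite leq_mul2r (leq_trans u3) ?orbT.
  have so0 := simul_setr r 0 (simul_setr rb N so).
  have [|t [o' [x so' ht b']]] := loop N 0 _ (add0n N) so0.
    by rewrite /= /cst big_ord0.
  exists ((expr_size (cex e)).+1 + (2 + t)), o'; split=> //.
    apply: exec_seq; first exact: exec_set evE.
    apply: exec_seq x; apply: exec_set; rewrite /= /word ifT //.
    exact: leq_ltn_trans hW.
  have : 3 <= cst N by rewrite leq_addr.
  have cst0 : cst 0 = 3 by rewrite /cst big_ord0.
  by move: ht sze; rewrite cst0 /timeK /maxsize; lia.
Qed.

End Simulation.

(** * Loop rules *)

(** [fr Rs Ks s s']: [s'] differs from [s] at most in the registers [Rs], in the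
    arrays [Ks] and in the output. *)
Definition fr (Rs Ks : seq nat) (s s' : st) : Prop :=
  (forall r, r \notin Rs -> rg s' r = rg s r) /\
  (forall k, k \notin Ks -> ar s' k = ar s k).

(** Convention for all programs: inner loops run on registers 4 and 5 with the current element in
    register 8, loops over vertices on registers 2 and 3. *)
Definition elP (e el : ex) (body : prog) : prog :=
  PFor 4 5 e (PSeq (PSet 8 el) body).

Definition cntP (r : nat) (e el c : ex) : prog :=
  elP e el (PIf c (PSet r (EB OpAdd (ER r) (EC 1))) PSkip).

Definition maxP (r : nat) (e el c v : ex) : prog :=
  elP e el (PIf (EB OpMul c (EB OpLt (ER r) v)) (PSet r v) PSkip).

(** The value [n] in register [r] means that no candidate has been seen. In that case [pr r] reads a
    meaningless cell, but the equality already decides the test. *)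
Definition argminP (r : nat) (c : ex) (pr : nat -> ex) : prog :=
  PSeq (PSet r (ER 0))
    (elP (ER 0) (ER 4)
       (PIf (EB OpMul c (EB OpAdd (EB OpEq (ER r) (ER 0)) (EB OpLt (pr 8) (pr r))))
          (PSet r (ER 8)) PSkip)).

Definition tabP (k : nat) (body : prog) (es : ex) : prog :=
  PFor 2 3 (ER 0) (PSeq body (PSto k (ER 2) es)).

Section Rules.
Variable inp : seq nat.
Local Notation run := (run inp).
Local Notation cost := (cost inp).
Local Notation ev := (ev inp).

Lemma fr_trans Rs Ks s s1 s2 : fr Rs Ks s s1 -> fr Rs Ks s1 s2 -> fr Rs Ks s s2.
Proof.
by move=> [h1 h2] [h3 h4]; split=> [r hr|k hk]; rewrite ?h3 ?h1 ?h4 ?h2.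
Qed.

Lemma fr_run Rs Ks p s : {subset rmods p <= Rs} -> {subset amods p <= Ks} ->
  fr Rs Ks s (run p s).
Proof.
move=> h1 h2; split=> [r|k] h.
  by apply: rg_run; apply: contra h => /h1.
by apply: ar_run; apply: contra h => /h2.
Qed.

Lemma fr_setr Rs Ks r x s : r \in Rs -> fr Rs Ks s (setr r x s).
Proof.
by move=> h; split=> // q hq /=; rewrite updr_ne //; apply: contraNneq hq => ->.
Qed.

(** The bound [tau] may vary with the round: degrees are summed over all vertices later, which gives
    time linear in the number of edges. *)
Lemma for_rule r rb e p s (I : nat -> st -> Prop) (tau : nat -> nat) :
  r != rb -> r \notin rmods p -> rb \notin rmods p ->
  I 0 (setr r 0 (setr rb (ev s e) s)) ->
  (forall i s', i < ev s e -> fr [:: r, rb & rmods p] (amods p) s s' ->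
     rg s' r = i -> I i s' ->
     cost p s' <= tau i /\ I i.+1 (setr r i.+1 (run p s'))) ->
  cost (PFor r rb e p) s <= 3 + \sum_(i < ev s e) (tau i + 2) /\
  I (ev s e) (run (PFor r rb e p) s).
Proof.
move=> rrb r1 rb1 I0 step; rewrite costFor [run _ _]/=.
set N := ev s e in I0 step *; set s0 := setr r 0 _ in I0 *.
pose f := fun (i : nat) s' => setr r i.+1 (run p s').
have inv m : m <= N -> [/\ fr [:: r, rb & rmods p] (amods p) s (iteri m f s0),
    rg (iteri m f s0) r = m & I m (iteri m f s0)].
  elim: m => [|m IH] mN.
    split=> //=; last by rewrite updr_eq.
    by apply: fr_trans (fr_setr _ _ _ _) (fr_setr _ _ _ _); rewrite !inE eqxx ?orbT.
  have [h1 h2 h3] := IH (ltnW mN); have [_ h4] := step m _ mN h1 h2 h3.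
  split=> //=; last by rewrite updr_eq.
  apply: fr_trans h1 _; apply: fr_trans (fr_run _ _ _) (fr_setr _ _ _ _) => //.
    by move=> q hq; rewrite !inE hq !orbT.
  by rewrite inE eqxx.
split; last by case: (inv N (leqnn _)).
rewrite leq_add2l; apply: leq_sum => i _; rewrite leq_add2r.
have [h1 h2 h3] := inv i (ltnW (ltn_ord i)).
by case: (step i _ (ltn_ord i) h1 h2 h3).
Qed.

Lemma for_rule_const r rb e p s (I : nat -> st -> Prop) t :
  r != rb -> r \notin rmods p -> rb \notin rmods p ->
  I 0 (setr r 0 (setr rb (ev s e) s)) ->
  (forall i s', i < ev s e -> fr [:: r, rb & rmods p] (amods p) s s' ->
     rg s' r = i -> I i s' ->
     cost p s' <= t /\ I i.+1 (setr r i.+1 (run p s'))) ->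
  cost (PFor r rb e p) s <= 3 + ev s e * (t + 2) /\
  I (ev s e) (run (PFor r rb e p) s).
Proof.
move=> h1 h2 h3 h4 h5; have [hc hi] := for_rule h1 h2 h3 h4 h5.
by split=> //; apply: leq_trans hc _; rewrite sum_nat_const card_ord.
Qed.

Lemma el_rule e el body s (l : seq nat) (I : nat -> st -> Prop) t :
  4 \notin rmods body -> 5 \notin rmods body ->
  ev s e = size l ->
  (forall i s', i < size l -> fr [:: 4, 5, 8 & rmods body] (amods body) s s' ->
     rg s' 4 = i -> ev s' el = nth 0 l i) ->
  (forall i s1 r x, r \in [:: 4; 5; 8] -> I i s1 -> I i (setr r x s1)) ->
  I 0 s ->
  (forall i s', i < size l -> fr [:: 4, 5, 8 & rmods body] (amods body) s s' ->
     rg s' 8 = nth 0 l i -> I i s' -> cost body s' <= t /\ I i.+1 (run body s')) ->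
  cost (elP e el body) s <= 3 + size l * (t + 3) /\
  I (size l) (run (elP e el body) s).
Proof.
move=> h4 h5 eN elE Iset I0 step.
have := @for_rule_const 4 5 e (PSeq (PSet 8 el) body) s I (1 + t).
rewrite eN add1n !addSn -!addnS; apply=> //=.
- by apply: (Iset); rewrite ?inE //; apply: (Iset); rewrite ?inE.
- move=> i s' iN frs ri Ii.
  have E := elE i s' iN frs ri.
  have [|||hc hI] := step i (setr 8 (ev s' el) s') iN.
  + by apply: fr_trans frs _; apply: fr_setr; rewrite !inE.
  + by rewrite /= E.
  + exact: (Iset).
  + by split; [rewrite add1n ltnS|apply: (Iset)].
Qed.

Lemma cnt_rule r e el c s (l : seq nat) (P : nat -> bool) :
  r \notin [:: 4; 5; 8] -> ev s e = size l ->
  (forall i s', i < size l -> fr [:: 4; 5; 8; r] [::] s s' ->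
     rg s' 4 = i -> ev s' el = nth 0 l i) ->
  (forall i s', i < size l -> fr [:: 4; 5; 8; r] [::] s s' ->
     rg s' 8 = nth 0 l i -> (ev s' c != 0) = P (nth 0 l i)) ->
  cost (cntP r e el c) s <= 3 + size l * 5 /\
  rg (run (cntP r e el c) s) r = rg s r + \sum_(u <- l) P u.
Proof.
move=> hr eN elE cE; move: (hr); rewrite !inE !negb_or => /and3P[r4 r5 r8].
pose I i s1 := rg s1 r = rg s r + \sum_(u <- take i l) P u.
have := @el_rule e el (PIf c (PSet r (EB OpAdd (ER r) (EC 1))) PSkip) s l I 2.
rewrite /I take_size; apply=> //=; rewrite ?inE 1?eq_sym ?r4 ?r5 //.
- by move=> i s1 q x hq e1; rewrite updr_ne //; apply: contraNneq hr => ->.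
- by rewrite take0 big_nil addn0.
- move=> i s' iN frs ei Ii.
  rewrite (take_nth 0) // -cats1 big_cat big_seq1 /= addnA -Ii -(cE i s' iN frs ei).
  by case: eqP => /= _; rewrite ?addn0 ?updr_eq.
Qed.

Lemma max_rule r e el c v s (l : seq nat) (P : nat -> bool) (F : nat -> nat) :
  r \notin [:: 4; 5; 8] -> ev s e = size l ->
  (forall i s', i < size l -> fr [:: 4; 5; 8; r] [::] s s' ->
     rg s' 4 = i -> ev s' el = nth 0 l i) ->
  (forall i s', i < size l -> fr [:: 4; 5; 8; r] [::] s s' ->
     rg s' 8 = nth 0 l i -> (ev s' c != 0) = P (nth 0 l i) /\ ev s' v = F (nth 0 l i)) ->
  cost (maxP r e el c v) s <= 3 + size l * 5 /\
  rg (run (maxP r e el c v) s) r = maxn (rg s r) (\max_(u <- l | P u) F u).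
Proof.
move=> hr eN elE cE; move: (hr); rewrite !inE !negb_or => /and3P[r4 r5 r8].
pose I i s1 := rg s1 r = maxn (rg s r) (\max_(u <- take i l | P u) F u).
have := @el_rule e el (PIf (EB OpMul c (EB OpLt (ER r) v)) (PSet r v) PSkip) s l I 2.
rewrite /I take_size; apply=> //=; rewrite ?inE 1?eq_sym ?r4 ?r5 //.
- by move=> i s1 q x hq e1; rewrite updr_ne //; apply: contraNneq hr => ->.
- by rewrite take0 big_nil maxn0.
- move=> i s' iN frs ei Ii; have [cP vF] := cE i s' iN frs ei.
  have -> : \max_(u <- take i.+1 l | P u) F u = maxn (\max_(u <- take i l | P u) F u)
      (if P (nth 0 l i) then F (nth 0 l i) else 0).
    by rewrite (take_nth 0) // -cats1 big_cat /= big_cons big_nil;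
      case: (P _); rewrite ?maxn0.
  split; first by case: ifP.
  rewrite maxnA -Ii -cP vF.
  rewrite muln_eq0 eqb0 -leqNgt; case: eqP => /= _; first by rewrite maxn0.
  by case: leqP => /= h; rewrite ?updr_eq.
Qed.

Lemma argmin_rule r c pr s (P : nat -> bool) (F : nat -> nat) :
  r \notin [:: 0; 4; 5; 8] ->
  (forall i s', i < rg s 0 -> fr [:: 4; 5; 8; r] [::] s s' -> rg s' 8 = i ->
     (ev s' c != 0) = P i) ->
  (forall q i s', i < rg s 0 -> fr [:: 4; 5; 8; r] [::] s s' -> q \in [:: 8; r] ->
     rg s' q = i -> ev s' (pr q) = F i) ->
  let s' := run (argminP r c pr) s in
  cost (argminP r c pr) s <= 4 + rg s 0 * 5 /\
  ((rg s' r = rg s 0 /\ forall i, i < rg s 0 -> ~~ P i) \/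
   [/\ rg s' r < rg s 0, P (rg s' r) &
       forall i, i < rg s 0 -> P i -> F (rg s' r) <= F i]).
Proof.
move=> hr cE pE; move: (hr); rewrite !inE !negb_or => /and4P[r0 r4 r5 r8].
set n := rg s 0 in cE pE *.
pose body := PIf (EB OpMul c (EB OpAdd (EB OpEq (ER r) (ER 0)) (EB OpLt (pr 8) (pr r))))
  (PSet r (ER 8)) PSkip.
pose I i s1 := (rg s1 r = n /\ forall j, j < i -> ~~ P j) \/
   [/\ rg s1 r < i, P (rg s1 r) & forall j, j < i -> P j -> F (rg s1 r) <= F j].
have frr s1 : fr [:: 4; 5; 8; r] [::] (setr r n s) s1 -> fr [:: 4; 5; 8; r] [::] s s1.
  by apply: fr_trans; apply: fr_setr; rewrite !inE eqxx !orbT.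
have := @el_rule (ER 0) (ER 4) body (setr r n s) (iota 0 n) I 2.
rewrite size_iota /I /=; case=> //; rewrite ?inE 1?eq_sym ?r4 ?r5 //.
- by rewrite updr_ne // eq_sym.
- by move=> i s' iN _ ->; rewrite nth_iota.
- move=> i s1 q x hq; have qr : r != q.
    by apply: contraNneq hr => ->; rewrite inE hq orbT.
  by rewrite updr_ne.
- by left; rewrite updr_eq.
- move=> i s' iN frs; rewrite nth_iota // add0n => ei Ii.
  have frs' := frr _ frs.
  have rg0 : rg s' 0 = n by case: frs' => -> //; rewrite !inE negb_or /= eq_sym.
  have cP := cE i s' iN frs' ei.
  have pi := pE 8 i s' iN frs' isT ei.
  split; first by case: ifP.
  rewrite muln_eq0 addn_eq0 !eqb0 -leqNgt.
  have -> : (ev s' c == 0) = ~~ P i by rewrite -cP negbK.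
  rewrite rg0; case: Ii => [[er hn]|[lt Pr hm]].
    rewrite er eqxx /= orbF; case: (boolP (P i)) => Pi /=.
      right; rewrite updr_eq ei; split=> // j; rewrite ltnS leq_eqVlt.
      by move=> /orP[/eqP->//|/hn/negPf->].
    left; split=> // j; rewrite ltnS leq_eqVlt.
    by move=> /orP[/eqP->//|/hn].
  have prr : ev s' (pr r) = F (rg s' r).
    by apply: (pE r) => //; [apply: ltn_trans lt iN|rewrite !inE eqxx orbT].
  rewrite prr pi; have -> : (rg s' r == n) = false by apply/eqP; lia.
  right; case: (boolP (P i)) => Pi /=; last first.
    split=> [||j]; [exact: ltnW|by []|rewrite ltnS leq_eqVlt].
    by move=> /orP[/eqP->|/hm//]; rewrite (negPf Pi).
  case: (leqP (F (rg s' r)) (F i)) => h /=; rewrite ?updr_eq ?ei.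
    split=> // [|j]; rewrite ltnS; first exact: ltnW.
    by rewrite leq_eqVlt => /orP[/eqP->//|/hm].
  split=> // j; rewrite ltnS leq_eqVlt => /orP[/eqP->//|jl Pj].
  exact: leq_trans (ltnW h) (hm j jl Pj).
Qed.

Lemma map_rule k body es s (F : nat -> nat) (tau : nat -> nat) :
  2 \notin rmods body -> 3 \notin rmods body -> amods body = [::] ->
  (forall i s', i < rg s 0 -> fr [:: 2, 3 & rmods body] [:: k] s s' ->
     rg s' 2 = i -> (forall j, j < i -> ar s' k j = F j) ->
     cost body s' <= tau i /\ ev (run body s') es = F i) ->
  cost (tabP k body es) s <= 3 + \sum_(i < rg s 0) (tau i + 3) /\
  forall i, i < rg s 0 -> ar (run (tabP k body es) s) k i = F i.
Proof.
move=> h2 h3 am step.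
pose I i s1 := forall j, j < i -> ar s1 k j = F j.
have := @for_rule 2 3 (ER 0) (PSeq body (PSto k (ER 2) es)) s I (fun i => tau i + 1).
case=> //; rewrite /= ?cats0 ?mem_cat ?inE ?orbF //; last first.
  move=> hc hI; split=> //; apply: leq_trans hc _; rewrite leq_add2l.
  by apply: leq_sum => i _; rewrite -addnA.
rewrite am /= => i s' iN frs ri Ii.
have [hc he] := step i s' iN frs ri Ii.
split; first by rewrite leq_add2r.
move=> j; rewrite /= PeanoNat.Nat.eqb_refl updrE rg_run // ri he.
case: eqP => [->//|ne] jl; rewrite ar_run ?am //.
by apply: Ii; rewrite ltn_neqAle; move: jl; rewrite ltnS => ->; rewrite andbT; apply/eqP.
Qed.

Lemma run_skip s : run PSkip s = s. Proof. by []. Qed.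
Lemma run_set r e s : run (PSet r e) s = setr r (ev s e) s. Proof. by []. Qed.
Lemma run_sto k e1 e2 s : run (PSto k e1 e2) s = seta k (ev s e1) (ev s e2) s.
Proof. by []. Qed.
Lemma run_out e s : run (POut e) s = puto (ev s e) s. Proof. by []. Qed.
Lemma run_seq p q s : run (PSeq p q) s = run q (run p s). Proof. by []. Qed.
Lemma run_if e p q s : run (PIf e p q) s = if ev s e == 0 then run q s else run p s.
Proof. by []. Qed.
Lemma cost_skip s : cost PSkip s = 1. Proof. by []. Qed.
Lemma cost_set r e s : cost (PSet r e) s = 1. Proof. by []. Qed.
Lemma cost_sto k e1 e2 s : cost (PSto k e1 e2) s = 1. Proof. by []. Qed.
Lemma cost_out e s : cost (POut e) s = 1. Proof. by []. Qed.
Lemma cost_seq p q s : cost (PSeq p q) s = cost p s + cost q (run p s).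
Proof. by []. Qed.
Lemma cost_if e p q s :
  cost (PIf e p q) s = (if ev s e == 0 then cost q s else cost p s).+1.
Proof. by []. Qed.

Lemma ar_seta k i x s j : ar (seta k i x s) k j = if j == i then x else ar s k j.
Proof. by rewrite /= PeanoNat.Nat.eqb_refl updrE. Qed.

End Rules.

Definition runE := (run_skip, run_set, run_sto, run_out, run_seq, run_if).
Definition costE := (cost_skip, cost_set, cost_sto, cost_out, cost_seq, cost_if).
Arguments run : simpl never.
Arguments cost : simpl never.
Arguments updr _ !_ _ !_ /.

(** * Computing the expression from a bubble structure *)

(** Register 0 holds [n] and register 1 the number of columns. Array 0 holds the input position of
    each degree, arrays 1 to 4 row, column and the two signs, 5 and 11 the bucket offsets of columns
    and rows, 6 and 7 the left-endpoint order and its inverse, 8 last neighbours, 9 labels, 10 time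
    stamps of labels, 12 the row order. *)
Definition eN := ER 0.
Definition eDeg (q : nat) := EI (EA 0 (ER q)).
Definition eNbr (q : nat) := EI (EB OpAdd (EB OpAdd (EA 0 (ER q)) (EC 1)) (ER 4)).
Definition eAnd a b := EB OpMul a b.
Definition eOr a b := EB OpAdd a b.
Definition eEq a b := EB OpEq a b.
Definition eLt a b := EB OpLt a b.
Definition eS a := EB OpAdd a (EC 1).
Fixpoint seqs (l : seq prog) : prog :=
  if l is p :: l' then if l' is [::] then p else PSeq p (seqs l') else PSkip.

Definition offsetP : prog :=
  PSeq (PSet 6 (EC 1))
    (PFor 2 3 eN (PSeq (PSto 0 (ER 2) (ER 6))
                       (PSet 6 (EB OpAdd (EB OpAdd (ER 6) (EC 1)) (EI (ER 6)))))).

(** Offsets of a counting sort. A count is added to register 6 by single increments, because a sum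
    of two variable values may not be stored; the counts add up to [n], so this stays linear. *)
Definition bucketP (D S : nat) : prog :=
  seqs [:: PFor 2 3 eN (PSto D (EA S (ER 2)) (eS (EA D (EA S (ER 2)))));
    PSet 6 (EC 0);
    PFor 2 3 (eS eN) (seqs [:: PSet 7 (EA D (ER 2)); PSto D (ER 2) (ER 6);
      PFor 4 5 (ER 7) (PSet 6 (eS (ER 6)))])].

Definition left_ltE : ex :=
  eAnd (eEq (EA 2 (ER 8)) (EA 2 (ER 2)))
    (eOr (eLt (EA 1 (ER 8)) (EA 1 (ER 2)))
       (eAnd (eEq (EA 1 (ER 8)) (EA 1 (ER 2)))
          (eOr (eLt (EA 3 (ER 2)) (EA 3 (ER 8)))
             (eAnd (eEq (EA 3 (ER 8)) (EA 3 (ER 2))) (eLt (ER 8) (ER 2)))))).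

(** The position of [v] is the number of vertices in earlier columns plus that of its predecessors
    in its own column. A column is a clique, so the latter are all found in the adjacency list of
    [v]. *)
Definition posP : prog :=
  PFor 2 3 eN (seqs [:: PSet 6 (EA 5 (EA 2 (ER 2)));
    cntP 6 (eDeg 2) (eNbr 2) left_ltE;
    PSto 6 (ER 2) (ER 6); PSto 7 (ER 6) (ER 2)]).

Definition lastP : prog :=
  tabP 8 (PSeq (PSet 6 (EA 6 (ER 2)))
               (maxP 6 (eDeg 2) (eNbr 2) (EC 1) (EA 6 (ER 8)))) (ER 6).

(** First fit in time proportional to the degree: by the umbrella property, the vertices alive
    around [v] are neighbours of [v], so one scan finds a label to share and marks the labels in
    use. Marks are stamps [t + 1] and need no erasing. Register 6 is 0 while undecided; one of the
    [deg + 1] candidates from 2 on is free. Register 9 records the largest label. *)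
Definition labP : prog :=
  PSeq (PSet 9 (EC 1)) (PFor 2 3 eN (seqs [::
    PSet 10 (EA 7 (ER 2)); PSet 6 (EC 0);
    elP (eDeg 10) (eNbr 10)
      (PIf (eAnd (eLt (EA 6 (ER 8)) (ER 2)) (eLt (ER 2) (EA 8 (ER 8))))
         (PSeq (PSto 10 (EA 9 (ER 8)) (eS (ER 2)))
            (PIf (eEq (EA 8 (ER 8)) (EA 8 (ER 10))) (PSet 6 (EA 9 (ER 8))) PSkip))
         PSkip);
    PIf (eEq (EA 8 (ER 10)) (ER 2)) (PSet 6 (EC 0))
      (PIf (eEq (ER 6) (EC 0))
         (PFor 4 5 (eS (eDeg 10))
            (PIf (eAnd (eEq (ER 6) (EC 0))
                   (eEq (eEq (EA 10 (EB OpAdd (ER 4) (EC 2))) (eS (ER 2))) (EC 0)))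
               (PSet 6 (EB OpAdd (ER 4) (EC 2))) PSkip))
         PSkip);
    PSto 9 (ER 10) (ER 6);
    PIf (eLt (ER 9) (ER 6)) (PSet 9 (ER 6)) PSkip])).

(** In postfix notation the code 1 of a union follows every leaf except the first. *)
Definition colP : prog :=
  PFor 2 3 eN (seqs [:: PSet 10 (EA 7 (ER 2)); POut (EC 0); POut (ER 10); POut (EC 1);
    PIf (ER 2) (POut (EC 1)) PSkip;
    elP (eDeg 10) (eNbr 10) (PIf (eLt (EA 6 (ER 8)) (ER 2))
      (seqs [:: POut (EC 3); POut (EC 1); POut (EA 9 (ER 8))]) PSkip);
    elP (eDeg 10) (eNbr 10)
      (PIf (eAnd (eLt (EA 6 (ER 8)) (ER 2)) (eEq (EA 8 (ER 8)) (ER 2)))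
        (seqs [:: POut (EC 2); POut (EA 9 (ER 8)); POut (EC 0)]) PSkip);
    POut (EC 2); POut (EC 1); POut (EA 9 (ER 10))]).

(** Vertices enter the buckets of their rows in the order of positions, so every row comes out
    sorted by columns. *)
Definition rowposP : prog :=
  PFor 2 3 eN (seqs [:: PSet 10 (EA 7 (ER 2)); PSet 6 (EA 11 (EA 1 (ER 10)));
    PSto 12 (ER 6) (ER 10); PSto 11 (EA 1 (ER 10)) (eS (ER 6))]).

Definition eOpen (c : ex) : ex := EB OpAdd (eS (ER 1)) (EB OpMod c (EC 2)).
Definition out3 (x y z : ex) : prog := seqs [:: POut x; POut y; POut z].

Definition preP : prog :=
  PIf (ER 2)
    (PIf (eAnd (eEq (ER 11) (EA 1 (ER 10))) (eEq (ER 12) (EA 2 (ER 10)))) PSkip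
       (PSeq (out3 (EC 2) (eOpen (eS (ER 12))) (EB OpSub (ER 12) (EC 1)))
          (PIf (eAnd (eEq (ER 11) (EA 1 (ER 10))) (eEq (eS (ER 12)) (EA 2 (ER 10))))
             PSkip (out3 (EC 2) (eOpen (ER 12)) (ER 12)))))
    PSkip.

Definition rowP : prog :=
  PFor 2 3 eN (seqs [:: PSet 10 (EA 12 (ER 2)); preP;
    out3 (EC 0) (ER 10) (EC 0); PIf (ER 2) (POut (EC 1)) PSkip;
    PSet 11 (EA 1 (ER 10)); PSet 12 (EA 2 (ER 10));
    out3 (EC 3) (EC 0) (ER 12); out3 (EC 3) (EC 0) (eOpen (ER 12));
    PIf (eLt (ER 12) (ER 1)) (out3 (EC 3) (EC 0) (eS (ER 12))) PSkip;
    PIf (EA 3 (ER 10)) (out3 (EC 3) (EC 0) (eOpen (eS (ER 12)))) PSkip;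
    PIf (EA 4 (ER 10)) (out3 (EC 2) (EC 0) (eOpen (ER 12))) (out3 (EC 2) (EC 0) (ER 12))]).

(** The expression by left endpoints needs at most one label more than the content of register 9,
    the one by rows at most [k + 3]; the test picks the smaller of these bounds. *)
Definition coreP : prog :=
  seqs [:: bucketP 5 2; posP; lastP; labP;
    PIf (eLt (ER 9) (EB OpAdd (ER 1) (EC 3))) colP
      (seqs [:: bucketP 11 1; rowposP; rowP])].

Lemma fr_ar (k : nat) Rs Ks s s' : fr Rs Ks s s' -> k \notin Ks -> ar s' k = ar s k.
Proof. by case=> _ h; apply: h. Qed.
Lemma fr_rg (r : nat) Rs Ks s s' : fr Rs Ks s s' -> r \notin Rs -> rg s' r = rg s r.
Proof. by case=> h _; apply: h. Qed.

Lemma out_rule inp e el c p s (l : seq nat) (P : nat -> bool) (g : nat -> seq nat) :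
  rmods p = [::] -> amods p = [::] -> ev inp s e = size l ->
  (forall i s', i < size l -> fr [:: 4; 5; 8] [::] s s' ->
     rg s' 4 = i -> ev inp s' el = nth 0 l i) ->
  (forall i s', i < size l -> fr [:: 4; 5; 8] [::] s s' -> rg s' 8 = nth 0 l i ->
     [/\ (ev inp s' c != 0) = P (nth 0 l i), cost inp p s' <= 3 &
         ou (run inp p s') = ou s' ++ g (nth 0 l i)]) ->
  cost inp (elP e el (PIf c p PSkip)) s <= 3 + size l * 7 /\
  ou (run inp (elP e el (PIf c p PSkip)) s) = ou s ++ flatten [seq g u | u <- l & P u].
Proof.
move=> rp ap eN elE step.
pose I i s1 := ou s1 = ou s ++ flatten [seq g u | u <- take i l & P u].
have := @el_rule inp e el (PIf c p PSkip) s l I 4.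
rewrite /I take_size; apply=> //; rewrite /= ?rp ?ap //.
- by rewrite take0 cats0.
- move=> i s' iN frs ei Ii; have [cP hc ho] := step i s' iN frs ei.
  rewrite costE runE (take_nth 0) // filter_rcons -cP.
  case: (eqVneq (ev inp s' c) 0) => h /=; first by [].
  by split=> //; rewrite ho Ii map_rcons flatten_rcons catA.
Qed.

(** Output never influences evaluation. Keeping it apart lets the long output sequence of [rowP] be
    executed symbolically with small terms. *)
Definition addo (l : seq nat) (s : st) : st := St (rg s) (ar s) (ou s ++ l).

Lemma ev_addo inp l s e : ev inp (addo l s) e = ev inp s e.
Proof.
by elim: e => //= [e ->|k e ->|o e1 -> e2 ->].
Qed.

Lemma addo_nil s : addo [::] s = s.
Proof. by case: s => r a o; rewrite /addo /= cats0. Qed.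

Lemma addo_cat l l' s : addo l' (addo l s) = addo (l ++ l') s.
Proof. by rewrite /addo /= catA. Qed.

Lemma setr_addo r x l s : setr r x (addo l s) = addo l (setr r x s).
Proof. by []. Qed.

Lemma run_out_addo inp e s : run inp (POut e) s = addo [:: ev inp s e] s.
Proof. by rewrite run_out /puto /addo cats1. Qed.

Lemma run_out3 inp x y z s :
  run inp (out3 x y z) s = addo [:: ev inp s x; ev inp s y; ev inp s z] s.
Proof. by rewrite /out3 /seqs !run_seq !run_out_addo !ev_addo !addo_cat. Qed.

Lemma cost_out3 inp x y z s : cost inp (out3 x y z) s = 3.
Proof. by rewrite /out3 /seqs !costE. Qed.

Lemma run_if_addo inp e p q l l' s : run inp p s = addo l s -> run inp q s = addo l' s ->
  run inp (PIf e p q) s = addo (if ev inp s e == 0 then l' else l) s.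
Proof. by rewrite run_if; case: ifP. Qed.

Lemma run_seqs inp p l s : run inp (seqs (p :: l)) s = run inp (seqs l) (run inp p s).
Proof. by case: l. Qed.

Lemma cost_seqs inp p q l s : cost inp (seqs [:: p, q & l]) s =
  cost inp p s + cost inp (seqs (q :: l)) (run inp p s).
Proof. by []. Qed.

Section Core.
Variables (n : nat) (G : sgraph 'I_n) (a : 'I_n -> seq 'I_n).
Variables (row col : 'I_n -> nat) (s1 s2 : 'I_n -> bool) (k : nat).
Variable inp : seq nat.
Hypothesis n_gt0 : 0 < n.
Hypothesis aP : adjacency_lists G a.
Hypothesis adjG : bub_adj G row col s1 s2.
Hypothesis col_rng : forall v, 0 < col v <= k.
Hypothesis k_le : k <= n.
Hypothesis row_le : forall v, row v <= n.
Local Notation run := (run inp).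
Local Notation cost := (cost inp).
Local Notation ev := (ev inp).

Definition adj_input (s : st) : Prop := forall v : 'I_n,
  nth 0 inp (ar s 0 v) = size (a v) /\
  forall i, i < size (a v) -> nth 0 inp (ar s 0 v + 1 + i) = nth 0 (map val (a v)) i.

Lemma bucket_spec D S (f : 'I_n -> nat) s : D != S -> rg s 0 = n ->
  (forall v : 'I_n, ar s S v = f v) -> (forall v, f v <= n) ->
  (forall c, c <= n -> ar s D c = 0) ->
  cost (bucketP D S) s <= 30 * n /\
  forall c, c <= n -> ar (run (bucketP D S) s) D c = \sum_(u : 'I_n) (f u < c).
Proof.
move=> DS rn hS fn hD; rewrite /bucketP /seqs !costE !runE.
set p1 := PFor 2 3 eN _; set p2 := PFor 2 3 (eS eN) _.
have [c1 h1] : cost p1 s <= 3 + n * 3 /\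
    forall c, c <= n -> ar (run p1 s) D c = \sum_(u < n | u < n) (f u == c).
  pose I i s1 := forall c, c <= n -> ar s1 D c = \sum_(u : 'I_n | u < i) (f u == c).
  have := @for_rule_const inp 2 3 eN (PSto D (EA S (ER 2)) (eS (EA D (EA S (ER 2))))) s I 1.
  rewrite /= rn; apply=> //.
    by move=> c cn; rewrite /= hD // big_pred0.
  move=> i s' iN frs ri Ii; split=> // c cn; rewrite runE /=.
  have eS' : ar s' S i = f (Ordinal iN).
    by rewrite (fr_ar frs) -?(hS (Ordinal iN)) // inE eq_sym.
  rewrite PeanoNat.Nat.eqb_refl ri eS' updrE eq_sym.
  rewrite (bigD1 (Ordinal iN)) //= addnC.
  have -> : \sum_(u < n | (u < i.+1) && (u != Ordinal iN)) (f u == c) =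
      \sum_(u < n | u < i) (f u == c).
    by apply: eq_bigl => u; rewrite -val_eqE /=; lia.
  by case: eqP => [e|ne]; rewrite Ii ?fn //= ?addn0 // e.
have rn1 : rg (setr 6 0 (run p1 s)) 0 = n by rewrite /= rg_run.
set s1' := setr 6 0 (run p1 s) in rn1 *.
pose cn c := \sum_(u : 'I_n) (f u == c).
have h1' c : c <= n -> ar s1' D c = cn c.
  by move=> cN; rewrite /= h1 //; apply: eq_bigl => u; rewrite ltn_ord.
(* Cells below [i] have become offsets, the others still hold counts. *)
pose I i s2 := rg s2 6 = \sum_(u : 'I_n) (f u < i) /\
  forall c, c <= n -> ar s2 D c = if c < i then \sum_(u : 'I_n) (f u < c) else cn c.
have sumS i : \sum_(u : 'I_n) (f u < i.+1) = \sum_(u : 'I_n) (f u < i) + cn i.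
  rewrite -big_split /=; apply: eq_bigr => u _; rewrite ltnS leq_eqVlt.
  by case: ltngtP.
have [c2 [_ h2]] : cost p2 s1' <= 3 + \sum_(i < n.+1) (5 + cn i * 3 + 2) /\ I n.+1 (run p2 s1').
  have := @for_rule inp 2 3 (eS eN) (seqs [:: PSet 7 (EA D (ER 2)); PSto D (ER 2) (ER 6);
      PFor 4 5 (ER 7) (PSet 6 (eS (ER 6)))]) s1' I (fun i => 5 + cn i * 3).
  have -> : ev s1' (eS eN) = n.+1 by rewrite -[LHS]/(rg s1' 0 + 1) rn1 addn1.
  apply=> //.
    split=> [|c cN] /=; last exact: h1'.
    by rewrite big1.
  move=> i s' iN frs ri [I1 I2]; rewrite /seqs !costE !runE /=.
  set s2' := seta D _ _ _.
  have Di : ar s' D i = cn i by rewrite I2 ?ltnn // -ltnS.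
  pose J j s3 := rg s3 6 = \sum_(u : 'I_n) (f u < i) + j.
  have := @for_rule_const inp 4 5 (ER 7) (PSet 6 (eS (ER 6))) s2' J 1.
  have -> : ev s2' (ER 7) = cn i by rewrite /= ri Di.
  case=> //.
  - by rewrite /J /= I1 addn0.
  - by move=> j s3 jN fr3 r4 Jj; split=> //; rewrite /J runE /= Jj addn1 addnS.
  move=> hc hJ; split; first by rewrite -?addnA; move: hc; lia.
  have := @ar_run inp (PFor 4 5 (ER 7) (PSet 6 (eS (ER 6)))) s2' D isT => hD'.
  rewrite /I; split.
    by rewrite sumS; apply: hJ.
  move=> c cN; rewrite [ar _ _]hD' /= PeanoNat.Nat.eqb_refl updrE ri I1.
  case: eqP => [->|ne]; first by rewrite ltnSn.
  by rewrite I2 // [in RHS]ltnS [in RHS]leq_eqVlt; case: eqP.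
split; last by move=> c cN; rewrite h2 // ltnS cN.
have sumcn : \sum_(i < n.+1) cn i = n.
  rewrite exchange_big /= -[RHS]card_ord -sum1_card; apply: eq_bigr => u _.
  have hu : f u < n.+1 by rewrite ltnS.
  rewrite (bigD1 (Ordinal hu)) //= eqxx big1 // => i ne.
  by case: eqP => // e; case/eqP: ne; apply: val_inj.
have : \sum_(i < n.+1) (5 + cn i * 3 + 2) = 7 * n.+1 + 3 * n.
  under eq_bigr do rewrite -addnA [cn _ * 3 + 2]addnC addnA.
  rewrite big_split /= -big_distrl /= sumcn sum_nat_const card_ord; lia.
move: c1 c2; rewrite -/s1' => c1 c2 e; rewrite e in c2; lia.
Qed.

Definition model_in (s : st) : Prop :=
  [/\ rg s 0 = n, rg s 1 = k, adj_input s &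
      forall v : 'I_n, [/\ ar s 1 v = row v, ar s 2 v = col v, ar s 3 v = s1 v :> nat &
        ar s 4 v = s2 v :> nat]].

Lemma model_fr Rs Ks s s' : fr Rs Ks s s' -> 0 \notin Rs -> 1 \notin Rs ->
  ~~ has (mem [:: 0; 1; 2; 3; 4]) Ks -> model_in s -> model_in s'.
Proof.
move=> frs r0 r1 hK [h0 h1 h2 h3].
have hk q : q \in [:: 0; 1; 2; 3; 4] -> ar s' q = ar s q.
  move=> hq; apply: (fr_ar frs); apply: contra hK => hq'.
  by apply/hasP; exists q.
split; [by rewrite (fr_rg frs)|by rewrite (fr_rg frs)| |] => v.
  by rewrite hk //; apply: h2.
by rewrite !hk //; apply: h3.
Qed.

Lemma model_run p s : 0 \notin rmods p -> 1 \notin rmods p ->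
  ~~ has (mem [:: 0; 1; 2; 3; 4]) (amods p) -> model_in s -> model_in (run p s).
Proof. by apply: model_fr; apply: fr_run. Qed.

Lemma nbr_ev s s' q i (v : 'I_n) : adj_input s -> ar s' 0 = ar s 0 -> rg s' q = v ->
  rg s' 4 = i -> i < size (a v) -> ev s' (eNbr q) = nth 0 (map val (a v)) i.
Proof. by move=> h e ev4 e4 iN; rewrite /= e ev4 e4; apply: (h v).2. Qed.

Lemma deg_ev s q (v : 'I_n) : adj_input s -> rg s q = v ->
  ev s (eDeg q) = size (map val (a v)).
Proof. by move=> h e; rewrite /= e (h v).1 size_map. Qed.

Lemma sum_nbrs (v : 'I_n) (P : pred 'I_n) :
  \sum_(u <- a v) P u = #|[pred u | G v u && P u]|.
Proof.
have [ua ma] := aP v; rewrite -big_mkcond /= -sum1_card -big_filter.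
rewrite big_uniq ?filter_uniq //=.
by apply: eq_bigl => u; rewrite mem_filter ma !inE andbC.
Qed.

Local Notation lt := (left_lt (@nat_of_ord n) row col s1).
Variable sq : seq 'I_n.
Hypothesis sq_uniq : uniq sq.
Hypothesis sq_all : forall x, x \in sq.
Hypothesis sq_idx : forall x, index x sq = #|[pred w | lt w x]|.
Hypothesis sq_lt : forall x y, (index x sq < index y sq) = lt x y.
Local Notation pos v := (index v sq).
Local Notation last := (last_nbr G sq).
Variable bnd : nat.
Hypothesis live_bnd : forall w us, uniq (map last us) ->
  (forall u, u \in us -> pos u < pos w <= last u) -> size us <= bnd.

Lemma sq_size : size sq = n.
Proof.
rewrite -[RHS]card_ord cardE; apply/eqP; rewrite -uniq_size_uniq ?enum_uniq // => x.
by rewrite mem_enum sq_all.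
Qed.

Lemma pos_inj : injective (fun v => pos v).
Proof. by move=> x y e; rewrite -(nth_index x (sq_all x)) e nth_index. Qed.

Lemma pos_lt v : pos v < n. Proof. by have := sq_all v; rewrite -index_mem sq_size. Qed.

Lemma left_ltE_ev s (u v : 'I_n) : model_in s -> rg s 8 = u -> rg s 2 = v ->
  (ev s left_ltE != 0) = (col u == col v) && lt u v.
Proof.
move=> [_ _ _ h] hu hv; have [r1 c1 a1 _] := h u; have [r2 c2 a2 _] := h v.
rewrite /= hu hv r1 c1 a1 r2 c2 a2 /left_lt.
case: (eqVneq (col u) (col v)) => [->|//]; rewrite ltnn /=.
by case: (s1 u); case: (s1 v); rewrite /=; lia.
Qed.

Lemma pos_split (v : 'I_n) : pos v = \sum_(u : 'I_n) (col u < col v) +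
  \sum_(u <- a v) ((col u == col v) && lt u v).
Proof.
rewrite sum_nbrs sq_idx -sum1_card big_mkcond /=.
have -> : #|[pred u | G v u && ((col u == col v) && lt u v)]| =
    \sum_(u : 'I_n) ((col u == col v) && lt u v).
  rewrite -big_mkcond /= -sum1_card; apply: eq_bigl => u; rewrite !inE.
  have [/andP[/eqP e l]|] := boolP ((col u == col v) && lt u v); rewrite ?andbF //.
  rewrite andbT adjG /bub_arc e eqxx /= andbT; apply: contraTneq l => ->.
  by rewrite left_lt_irr.
rewrite -big_split /=; apply: eq_bigr => u _; rewrite inE /left_lt.
by case: ltngtP => //= _; case: (_ || _).
Qed.

Definition deg i := if insub i is Some v then size (a v) else 0.

Lemma deg_ord (v : 'I_n) : deg v = size (a v). Proof. by rewrite /deg valK. Qed.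

Lemma pos_spec s : model_in s ->
  (forall c, c <= n -> ar s 5 c = \sum_(u : 'I_n) (col u < c)) ->
  cost posP s <= 3 + \sum_(v < n) (5 * deg v + 20) /\
  forall v : 'I_n, ar (run posP s) 6 v = pos v /\ ar (run posP s) 7 (pos v) = v.
Proof.
move=> ms h5; set body := seqs [:: PSet 6 (EA 5 (EA 2 (ER 2)));
    cntP 6 (eDeg 2) (eNbr 2) left_ltE; PSto 6 (ER 2) (ER 6); PSto 7 (ER 6) (ER 2)].
pose I i s1' := forall v : 'I_n, v < i -> ar s1' 6 v = pos v /\ ar s1' 7 (pos v) = v.
have rn : ev s eN = n by case: ms.
have := @for_rule inp 2 3 eN body s I (fun i => 5 * deg i + 18); rewrite rn; case=> //.
  move=> i s' iN frs ri Ii; rewrite /body /seqs !costE !runE.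
  set v := Ordinal iN; have degE : deg i = size (a v) := deg_ord v.
  have ms' : model_in s' by apply: model_fr frs _ _ _ ms.
  have [_ _ ai' hm] := ms'; have [rv cv s1v s2v] := hm v.
  set s6 := setr 6 _ s'; have ms6 : model_in s6 := ms'.
  have e6 : rg s6 6 = \sum_(u : 'I_n) (col u < col v).
    by rewrite /= ri cv (fr_ar frs) // h5 //; have := col_rng v; lia.
  have := @cnt_rule inp 6 (eDeg 2) (eNbr 2) left_ltE s6 (map val (a v))
    (fun u => if insub u is Some u' then (col u' == col v) && lt u' v else false).
  case=> //.
  - exact: deg_ev.
  - move=> j s'' jN fr6 r4; rewrite size_map in jN.
    by apply: (@nbr_ev s6 _ _ _ v) => //; rewrite ?(fr_ar fr6) ?(fr_rg fr6).
  - move=> j s'' jN fr6; rewrite size_map in jN.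
    rewrite (nth_map v) // => r8; rewrite valK.
    by apply: left_ltE_ev; [apply: model_fr fr6 _ _ _ ms6| |rewrite (fr_rg fr6)].
  rewrite size_map e6 big_map => hc hr.
  set s7 := run (cntP _ _ _ _) s6 in hr *.
  have rr : rg s7 6 = pos v.
    rewrite hr pos_split; congr (_ + _); apply: eq_bigr => u _.
    by rewrite valK.
  have rr2 : rg s7 2 = v by rewrite rg_run.
  have aa q : ar s7 q = ar s' q by rewrite ar_run.
  split; first by rewrite degE; move: (size (a v)) (cost _ s6) hc => x y hc; lia.
  move=> u; rewrite ltnS leq_eqVlt => ui; rewrite /= rr rr2 !aa !updrE.
  case: (eqVneq (u : nat) v) => [/ord_inj->|ne]; first by rewrite eqxx.
  have [|h6 h7] := Ii u; first by case/orP: ui => // /eqP e; rewrite e eqxx in ne.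
  rewrite h6; case: eqP => [/pos_inj e|_]; first by rewrite e eqxx in ne.
  by split.
move=> hc hI; split; last by move=> v; apply: hI.
by apply: leq_trans hc _; rewrite leq_add2l; apply: leq_sum => v _; rewrite -addnA.
Qed.

Lemma last_spec s : model_in s -> (forall v : 'I_n, ar s 6 v = pos v) ->
  cost lastP s <= 3 + \sum_(v < n) (5 * deg v + 10) /\
  forall v : 'I_n, ar (run lastP s) 8 v = last v.
Proof.
move=> ms h6; pose body := PSeq (PSet 6 (EA 6 (ER 2)))
  (maxP 6 (eDeg 2) (eNbr 2) (EC 1) (EA 6 (ER 8))).
pose F i := if insub i is Some v then last v else 0.
have rn : rg s 0 = n by case: ms.
have := @map_rule inp 8 body (ER 6) s F (fun i => 5 * deg i + 5).
case=> //; last first.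
  rewrite rn => hc hF; split; last by move=> v; rewrite hF // /F valK.
  by apply: leq_trans hc _; rewrite leq_add2l; apply: leq_sum => v _; lia.
rewrite rn => i s' iN frs ri _; rewrite /body !costE !runE.
set v := Ordinal iN; have degE : deg i = size (a v) := deg_ord v.
have ms' : model_in s' by apply: model_fr frs _ _ _ ms.
set s6 := setr 6 _ s'; have ms6 : model_in s6 := ms'; have [_ _ ai6 _] := ms6.
have e6 (u : 'I_n) : ar s6 6 u = pos u by rewrite /= (fr_ar frs).
have r6 : rg s6 6 = pos v by rewrite -[LHS]/(ar s' 6 (rg s' 2)) ri; exact: (e6 v).
have := @max_rule inp 6 (eDeg 2) (eNbr 2) (EC 1) (EA 6 (ER 8)) s6 (map val (a v)) xpredT
  (fun u => if insub u is Some u' then pos u' else 0).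
case=> //.
- exact: deg_ev.
- move=> j s'' jN fr6 r4; rewrite size_map in jN.
  by apply: (@nbr_ev s6 _ _ _ v) => //; rewrite ?(fr_ar fr6) ?(fr_rg fr6).
- move=> j s'' jN fr6; rewrite size_map in jN.
  rewrite (nth_map v) // => r8; rewrite valK; split=> //.
  by rewrite -[LHS]/(ar s'' 6 (rg s'' 8)) r8 (fr_ar fr6) //; apply: e6.
rewrite size_map r6 big_map => hc hr; split.
  by rewrite degE; move: (size (a v)) (cost _ s6) hc => x y hc; lia.
have -> : F i = last v by rewrite /F -[i]/(val v) valK.
rewrite [LHS]hr /last_nbr [RHS](bigD1 v) ?eqxx //=; congr maxn.
have [ua ma] := aP v.
rewrite (eq_bigr (fun u : 'I_n => pos u)); last by move=> u _; rewrite valK.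
rewrite big_uniq //=; apply: eq_bigl => u; rewrite ma inE.
by case: (eqVneq u v) => [->|]; rewrite ?adj_irr ?andbT.
Qed.

Lemma lab_ok_ext t l l' : (forall x, pos x < t -> l x = l' x) ->
  lab_ok sq last bnd t l -> lab_ok sq last bnd t l'.
Proof.
move=> e [h0 h1 h2]; split=> [x px|x px|x y px py]; rewrite -!e //.
- exact: h0.
- exact: h1.
- exact: h2.
Qed.

Definition order_in (s : st) : Prop := forall v : 'I_n,
  [/\ ar s 6 v = pos v, ar s 7 (pos v) = v & ar s 8 v = last v].

Lemma order_run p s : ~~ has (mem [:: 6; 7; 8]) (amods p) -> order_in s ->
  order_in (run p s).
Proof.
move=> hp h v; have hk q : q \in [:: 6; 7; 8] -> ar (run p s) q = ar s q.
  by move=> hq; apply: ar_run; apply: contra hp => hq'; apply/hasP; exists q.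
by rewrite !hk.
Qed.

Lemma order_fr Rs Ks s s' : fr Rs Ks s s' -> ~~ has (mem [:: 6; 7; 8]) Ks ->
  order_in s -> order_in s'.
Proof.
move=> [_ frs] hp h v; have hk q : q \in [:: 6; 7; 8] -> ar s' q = ar s q.
  by move=> hq; apply: frs; apply: contra hp => hq'; apply/hasP; exists q.
by rewrite !hk.
Qed.

Lemma pos_surj t : t < n -> {v : 'I_n | pos v = t}.
Proof.
move=> tn; exists (nth (Ordinal tn) sq t).
by rewrite index_uniq // sq_size.
Qed.

Lemma lab_spec s : model_in s -> order_in s -> (forall g, ar s 10 g = 0) ->
  cost labP s <= 4 + \sum_(t < n) (12 * deg (ar s 7 t) + 40) /\
  let s' := run labP s in
  [/\ lab_ok sq last bnd n (fun v => ar s' 9 v),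
      0 < rg s' 9 < bnd + 2 & forall v : 'I_n, ar s' 9 v <= rg s' 9].
Proof.
move=> ms os z10; rewrite /labP !costE !runE.
set body := seqs _; set s0 := setr 9 _ s.
have pl := @pos_last_nbr _ G sq; have ll := last_nbr_lt G sq_all.
have umb := left_order_umbrella adjG sq_all sq_lt.
pose I t s1' := [/\ lab_ok sq last bnd t (fun v => ar s1' 9 v),
  (forall g, ar s1' 10 g <= t), 0 < rg s1' 9 < bnd + 2 &
  forall v : 'I_n, pos v < t -> ar s1' 9 v <= rg s1' 9].
have rn : ev s0 eN = n by case: ms.
have := @for_rule inp 2 3 eN body s0 I (fun t => 12 * deg (ar s 7 t) + 38).
rewrite rn; case=> //; last first.
- move=> hc [h1 _ h2 h3]; split; last by split=> // v; apply: h3; apply: pos_lt.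
  have -> : 4 = 1 + 3 by []; rewrite -addnA leq_add2l.
  by apply: leq_trans hc _; rewrite leq_add2l; apply: leq_sum => v _; rewrite -addnA.
- move=> t s' tN frs r2 [lok m10 r9 mx].
  have [v pv] := pos_surj tN.
  have ms' : model_in s' by apply: model_fr frs _ _ _ ms.
  have os' : order_in s' by apply: order_fr frs _ os.
  have ot u : [/\ ar s' 6 (nat_of_ord u) = pos u, ar s' 7 (pos u) = u & ar s' 8 u = last u] := os' u.
  have e7 : ar s' 7 t = v by rewrite -pv; case: (ot v).
  have degE : deg (ar s 7 t) = size (a v) by rewrite -(fr_ar frs) // e7 deg_ord.
  pose nb := PIf (eAnd (eLt (EA 6 (ER 8)) (ER 2)) (eLt (ER 2) (EA 8 (ER 8))))
    (PSeq (PSto 10 (EA 9 (ER 8)) (eS (ER 2)))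
       (PIf (eEq (EA 8 (ER 8)) (EA 8 (ER 10))) (PSet 6 (EA 9 (ER 8))) PSkip)) PSkip.
  pose mex := PFor 4 5 (eS (eDeg 10))
    (PIf (eAnd (eEq (ER 6) (EC 0))
           (eEq (eEq (EA 10 (EB OpAdd (ER 4) (EC 2))) (eS (ER 2))) (EC 0)))
       (PSet 6 (EB OpAdd (ER 4) (EC 2))) PSkip).
  pose P := PIf (eEq (EA 8 (ER 10)) (ER 2)) (PSet 6 (EC 0))
    (PIf (eEq (ER 6) (EC 0)) mex PSkip).
  pose Q := PIf (eLt (ER 9) (ER 6)) (PSet 9 (ER 6)) PSkip.
  rewrite -[body]/(PSeq (PSet 10 (EA 7 (ER 2))) (PSeq (PSet 6 (EC 0))
    (PSeq (elP (eDeg 10) (eNbr 10) nb) (PSeq P (PSeq (PSto 9 (ER 10) (ER 6)) Q))))).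
  rewrite !cost_seq !run_seq !cost_set !run_set cost_sto run_sto.
  set s1' := setr 6 _ _; have ms1 : model_in s1' := ms'; have [_ _ ai1 _] := ms1.
  have r10 : rg s1' 10 = v by rewrite /= r2.
  set lab := fun u : 'I_n => ar s' 9 u.
  pose live (u : 'I_n) := (pos u < t) && (t < last u).
  have [ua ma] := aP v.
  have livea u : live u -> u \in a v.
    move=> /andP[pu lu]; rewrite ma inE adj_sym umb ?pv //; exact: ltnW.
  (* Among the first [j] neighbours, the stamp [t + 1] marks exactly the labels of live ones. Older
     stamps are smaller, and register 6 is 0 or the label to be shared. *)
  pose J j s2' := [/\ forall g, (ar s2' 10 g == t.+1) =
        has (fun u => live u && (lab u == g)) (take j (a v)),
      forall g, ar s2' 10 g <= t.+1 &
      (rg s2' 6 = 0 /\ ~~ has (fun u => live u && (last u == last v)) (take j (a v))) \/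
      exists u, [/\ u \in take j (a v), live u, last u = last v & rg s2' 6 = lab u]].
  have := @el_rule inp (eDeg 10) (eNbr 10) nb s1' (map val (a v)) J 5.
  case=> //.
  - exact: deg_ev.
  - move=> j s'' jN fr6 r4; rewrite size_map in jN.
    by apply: (@nbr_ev s1' _ _ _ v) => //; rewrite ?(fr_ar fr6) ?(fr_rg fr6).
  - by move=> j s2' q x; rewrite !inE => /or3P[]/eqP->.
  - rewrite /J take0 /=; split=> [g|g|]; last by left.
      by apply/eqP => e; have := m10 g; rewrite [ar _ _ _]e ltnn.
    exact: leq_trans (m10 g) _.
  - move=> j s'' jN fr6; rewrite size_map in jN; rewrite (nth_map v) //.
    set u := nth v _ _ => r8 [J1 J2 J3].
    have [o6 _ o8] := ot u; have [_ _ o8v] := ot v.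
    have r2' : rg s'' 2 = t by rewrite (fr_rg fr6) //= r2.
    have r10' : rg s'' 10 = v by rewrite (fr_rg fr6).
    rewrite /J /nb !costE !runE (take_nth v) // -/u.
    set c := ev s'' _; have cE : (c == 0) = ~~ live u.
      rewrite /c /= r8 r2' (fr_ar fr6 (k := 6)) // (fr_ar fr6 (k := 8)) //= o6 o8 /live.
      by case: (_ < _); case: (_ < _).
    have h9 : ar s'' 9 u = lab u by rewrite (fr_ar fr6).
    rewrite cE; case: (boolP (live u)) => lu /=; last first.
      split=> //; split=> [g|//|].
        by rewrite J1 has_rcons (negPf lu).
      case: J3 => [[e h]|[w [w1 w2 w3 w4]]].
        by left; rewrite has_rcons (negPf lu).
      by right; exists w; rewrite mem_rcons inE w1 orbT.
    have dE : ((ar s'' 8 (rg s'' 8) == ar s'' 8 (rg s'' 10) : nat) == 0) =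
        (last u != last v).
      have -> : ar s'' 8 = ar s' 8 by rewrite (fr_ar fr6).
      by rewrite r8 r10' /= o8 o8v eqb0.
    rewrite dE; split; first by case: ifP.
    have a10 g : ar (if last u != last v then seta 10 (ar s'' 9 (rg s'' 8)) (rg s'' 2 + 1) s''
        else setr 6 (ar s'' 9 (rg s'' 8)) (seta 10 (ar s'' 9 (rg s'' 8)) (rg s'' 2 + 1) s'')) 10 g =
        if g == lab u then t.+1 else ar s'' 10 g.
      by case: ifP => _; rewrite /= updrE r8 h9 r2' addn1.
    split=> [g|g|].
    + rewrite [ar _ _ _]a10 has_rcons lu /=.
      case: (eqVneq g (lab u)) => [->|ne]; first by rewrite !eqxx.
      by rewrite J1.
    + by rewrite [ar _ _ _]a10; case: eqP.
    + case: (eqVneq (last u) (last v)) => [e|ne] /=.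
        right; exists u; rewrite mem_rcons inE eqxx; split=> //.
        by rewrite r8 h9.
      case: J3 => [[e h]|[w [w1 w2 w3 w4]]].
        by left; rewrite has_rcons (negPf ne) andbF.
      by right; exists w; rewrite mem_rcons inE w1 orbT.
  rewrite size_map => hc [J1 J2 J3]; set s3 := run (elP _ _ _) s1' in J1 J2 J3 *.
  rewrite take_oversize // in J1 J3.
  have a9 : ar s3 9 = ar s' 9 by rewrite ar_run.
  have r2s : rg s3 2 = t by rewrite rg_run //= r2.
  have r10s : rg s3 10 = v by rewrite rg_run.
  have r9s : rg s3 9 = rg s' 9 by rewrite rg_run.
  have e8 : ar s3 8 v = last v by rewrite ar_run //; case: (ot v).
  have ai3 : adj_input s3.
    by move=> u; rewrite ar_run //; apply: ai1.
  set s4 := run P s3.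
  have hP : cost P s3 <= 15 + 4 * size (a v) /\ newlab sq last t lab v (rg s4 6) /\
      (forall g, ar s4 10 g <= t.+1).
    rewrite /s4 /P !costE !runE /newlab.
    have -> : (ev s3 (eEq (EA 8 (ER 10)) (ER 2)) == 0) = (last v != t).
      by rewrite /= r10s e8 r2s eqb0.
    case: (eqVneq (last v) t) => [e|ne] /=; first by [].
    have tlv : t < last v by rewrite ltn_neqAle eq_sym ne -pv pl.
    have -> : ((rg s3 6 == 0 : nat) == 0) = (rg s3 6 != 0) by rewrite eqb0.
    case: J3 => [[e6 nh]|[u [ua' lu lu' e6]]]; last first.
      have : rg s3 6 != 0.
        rewrite e6; case/andP: lu => pu lu.
        by have := lok_bnd lok pu (ltn_trans pu lu); rewrite -/(lab u); case: (lab u).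
      move=> -> /=; split=> //; split=> //; left; exists u; split=> //.
      by case/andP: lu.
    rewrite e6 eqxx /=.
    (* Either all candidates tried so far are taken, or register 6 holds the least free one. *)
    pose K i s5 := (rg s5 6 = 0 /\ forall g, g < i -> ar s5 10 (g + 2) = t.+1) \/
      [/\ 1 < rg s5 6, ar s5 10 (rg s5 6) <> t.+1 &
          forall g, 1 < g < rg s5 6 -> ar s5 10 g = t.+1].
    have := @for_rule_const inp 4 5 (eS (eDeg 10)) (PIf (eAnd (eEq (ER 6) (EC 0))
        (eEq (eEq (EA 10 (EB OpAdd (ER 4) (EC 2))) (eS (ER 2))) (EC 0)))
        (PSet 6 (EB OpAdd (ER 4) (EC 2))) PSkip) s3 K 2.
    have -> : ev s3 (eS (eDeg 10)) = (size (a v)).+1.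
      by rewrite -[LHS]/(ev s3 (eDeg 10) + 1) (deg_ev ai3 r10s) size_map addn1.
    case=> //.
    - by left; split.
    - move=> i s5 iN fr5 r4 Ki; rewrite !costE !runE /= r4 (fr_rg fr5 (r := 2)) // r2s.
      rewrite addn1; case: Ki => [[k1 k2]|[k1 k2 k3]]; last first.
        have -> : (rg s5 6 == 0) = false by case: (rg s5 6) k1.
        by rewrite mul0n eqxx; split=> //; right.
      rewrite k1 eqxx mul1n !eqb0 negbK; case: eqP => h; split=> //; last first.
        right; split=> [||g gi]; [by rewrite /= addn2|exact: h|move: gi; rewrite /= => gi].
        have e : g = g - 2 + 2 by lia.
        by rewrite e; apply: k2; lia.
      left; split=> // g; rewrite ltnS leq_eqVlt => /orP[/eqP->//|]; exact: k2.
    move=> hc2 hK; set s5 := run _ s3 in hK *.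
    have a10 : ar s5 10 = ar s3 10 by rewrite ar_run.
    split; first by move: hc2; rewrite -/mex; lia.
    split; last by move=> g; rewrite a10.
    rewrite /K a10 in hK; right; case: hK => [[_ hall]|[k1 k2 k3]].
      (* If no candidate were free, [deg + 1] labels would occur on [deg] neighbours. *)
      have sub : {subset iota 2 (size (a v)).+1 <= map lab (a v)}.
        move=> g; rewrite mem_iota => hg; have := J1 g.
        have -> : g = g - 2 + 2 by lia.
        rewrite hall ?eqxx; last by lia.
        by move/esym/hasP=> [u uu /andP[_ /eqP <-]]; apply: map_f.
      by have := uniq_leq_size (iota_uniq _ _) sub; rewrite size_iota size_map ltnn.
    split=> //.
    - move=> u pu lu; case/hasP: nh; exists u; first by apply: livea; rewrite /live pu lu.
      by rewrite /live pu lu eqxx tlv.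
    - move=> u pu lu e; apply: k2; apply/eqP; rewrite J1; apply/hasP; exists u.
        by apply: livea; rewrite /live pu lu.
      by rewrite /live pu lu e eqxx.
    - move=> g /k3 /eqP; rewrite J1 => /hasP[u _ /andP[/andP[pu lu] /eqP e]].
      by exists u.
  have [hcP [nl m10']] := hP.
  have lok' : lab_ok sq last bnd t.+1 (fun x => if x == v then rg s4 6 else lab x).
    by apply: newlab_ok pv lok nl => //; apply: live_bnd.
  have aP9 : ar s4 9 = ar s' 9 by rewrite ar_run.
  have rP10 : rg s4 10 = v by rewrite rg_run.
  have rP9 : rg s4 9 = rg s' 9 by rewrite rg_run.
  have lab9 (u : 'I_n) : ar (seta 9 (ev s4 (ER 10)) (ev s4 (ER 6)) s4) 9 u =
      if u == v then rg s4 6 else lab u.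
    by rewrite ar_seta /= rP10 aP9.
  set s6 := seta 9 _ _ s4.
  have fb : rg s4 6 < bnd + 2.
    move: nl; rewrite /newlab; case: eqP => [_ ->|/eqP ne _]; first by rewrite addn2.
    have px : pos v < t.+1 by rewrite pv.
    have tlv : pos v < last v by rewrite ltn_neqAle pl pv eq_sym ne.
    by have := lok_bnd lok' px tlv; rewrite eqxx => /andP[].
  split.
    have -> : cost Q s6 = 2 by rewrite /Q !costE; case: (_ == _).
    by rewrite degE; move: (cost _ s1') (cost P s3) (size (a v)) hc hcP => x y z; lia.
  rewrite /I; set s7 := run Q s6.
  have a7 q : ar s7 q = ar s6 q by rewrite /s7 ar_run.
  have r7 : rg s7 9 = maxn (rg s' 9) (rg s4 6).
    by rewrite /s7 /Q !runE /= rP9; case: (ltnP (rg s' 9) (rg s4 6)) => h //=; rewrite rP9.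
  split=> /=.
  - by apply: lab_ok_ext lok' => x px; rewrite a7 lab9.
  - by move=> g; rewrite a7 /=.
  - by rewrite r7; case/andP: r9 => h1 h2; rewrite leq_max h1 gtn_max h2 fb.
  - move=> u pu; rewrite r7 a7 lab9 leq_max.
    case: eqP => [_|ne]; first by rewrite leqnn orbT.
    rewrite mx //; move: pu; rewrite ltnS leq_eqVlt => /orP[/eqP e|//].
    by case: ne; apply: pos_inj; rewrite e pv.
- split=> //=.
  + by move=> g; rewrite z10.
  + by rewrite addn2.
Qed.

Definition col_enc (lab : 'I_n -> nat) (v : 'I_n) : seq nat :=
  [:: 0; nat_of_ord v; 1] ++ (if pos v == 0 then [::] else [:: 1])
  ++ flatten [seq [:: 3; 1; lab u] | u <- a v & pos u < pos v]
  ++ flatten [seq [:: 2; lab u; 0] | u <- a v & (pos u < pos v) && (last u == pos v)]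
  ++ [:: 2; 1; lab v].

Lemma encode_col_term lab v0 : v0 = head v0 sq ->
  encode_term (col_term sq a last lab v0) = flatten [seq col_enc lab v | v <- sq].
Proof.
move=> v0E; rewrite /col_term encode_foldl; set E := fun o => _.
have enc v : pos v != 0 -> flatten (map E (col_ops sq a last lab v)) = col_enc lab v.
  move=> pv; rewrite /col_ops /col_enc (negPf pv) /= !map_cat !flatten_cat /=.
  by rewrite -!map_comp.
have {}v0E : sq = v0 :: behead sq by rewrite {1}v0E; case: (sq) (sq_all v0).
have pv0 : pos v0 = 0 by rewrite v0E /= eqxx.
have gen X (h : 'I_n -> seq X) :
    flatten [seq h v | v <- sq] = h v0 ++ flatten [seq h v | v <- behead sq].
  by rewrite {1}v0E.
rewrite (gen _ (col_ops sq a last lab)) (gen _ (col_enc lab)).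
have -> : behead (col_ops sq a last lab v0 ++
      flatten [seq col_ops sq a last lab v | v <- behead sq]) =
    behead (col_ops sq a last lab v0) ++
      flatten [seq col_ops sq a last lab v | v <- behead sq] by [].
rewrite map_cat flatten_cat catA; congr (_ ++ _).
  by rewrite /col_enc /col_ops pv0 /= !map_cat !flatten_cat /= -!map_comp.
have : all (fun v => pos v != 0) (behead sq).
  apply/allP => v hv; apply/eqP => e; have vv : v = v0 by apply: pos_inj; rewrite e pv0.
  by move: sq_uniq; rewrite v0E /= -vv hv.
elim: (behead sq) => // v r IH /andP[pv hr].
rewrite -[flatten [seq col_ops _ _ _ _ _ | _ <- v :: r]]/(col_ops sq a last lab v ++
  flatten [seq col_ops sq a last lab v1 | v1 <- r]).
by rewrite map_cat flatten_cat enc // IH.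
Qed.

Lemma col_spec s : model_in s -> order_in s ->
  cost colP s <= 3 + \sum_(t < n) (14 * deg (ar s 7 t) + 40) /\
  ou (run colP s) = ou s ++ flatten [seq col_enc (fun u => ar s 9 u) v | v <- sq].
Proof.
move=> ms os; rewrite /colP; set body := seqs _.
set lab := fun u : 'I_n => ar s 9 u.
pose I t s1' := ou s1' = ou s ++ flatten [seq col_enc lab v | v <- take t sq].
have rn : ev s eN = n by case: ms.
have := @for_rule inp 2 3 eN body s I (fun t => 14 * deg (ar s 7 t) + 38).
rewrite rn; case=> //.
- by rewrite /I take0 cats0.
- move=> t s' tN frs r2 It.
  have [v pv] := pos_surj tN.
  have ms' : model_in s' by apply: model_fr frs _ _ _ ms.
  have os' : order_in s' by apply: order_fr frs _ os.
  have [_ _ ai' _] := ms'.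
  have e7 : ar s' 7 t = v by rewrite -pv; case: (os' v).
  have degE : deg (ar s 7 t) = size (a v) by rewrite -(fr_ar frs) // e7 deg_ord.
  have a9 : ar s' 9 = ar s 9 by rewrite (fr_ar frs).
  pose pr := seqs [:: PSet 10 (EA 7 (ER 2)); POut (EC 0); POut (ER 10); POut (EC 1);
    PIf (ER 2) (POut (EC 1)) PSkip].
  pose l1 := elP (eDeg 10) (eNbr 10) (PIf (eLt (EA 6 (ER 8)) (ER 2))
      (seqs [:: POut (EC 3); POut (EC 1); POut (EA 9 (ER 8))]) PSkip).
  pose l2 := elP (eDeg 10) (eNbr 10)
      (PIf (eAnd (eLt (EA 6 (ER 8)) (ER 2)) (eEq (EA 8 (ER 8)) (ER 2)))
        (seqs [:: POut (EC 2); POut (EA 9 (ER 8)); POut (EC 0)]) PSkip).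
  set s3 := run pr s'.
  have -> : run body s' = run (out3 (EC 2) (EC 1) (EA 9 (ER 10))) (run l2 (run l1 s3)) by [].
  have -> : cost body s' = cost pr s' + (cost l1 s3 + (cost l2 (run l1 s3) + 3)).
    by rewrite /body /s3 /pr [seqs _]/= !cost_seq !run_seq -!addnA !cost_out.
  have cpr : cost pr s' <= 8 by rewrite /pr [seqs _]/= !costE; case: (_ == _).
  have fr3 : fr [:: 10] [::] s' s3.
    by apply: fr_run.
  have e3 : ou s3 = ou s' ++ [:: 0; nat_of_ord v; 1] ++ (if pos v == 0 then [::] else [:: 1]).
    rewrite /s3 /pr [seqs _]/= !runE /= r2 e7 pv; case: eqP => _; rewrite /= -!cats1 -!catA //.
  have r10 : rg s3 10 = v.
    by rewrite /s3 /pr [seqs _]/= !runE; case: ifP => _ /=; rewrite r2 e7.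
  have r23 : rg s3 2 = t by rewrite (fr_rg fr3).
  have el_ok s4 : fr [:: 4; 5; 8] [::] s3 s4 -> forall j s5, j < size (map val (a v)) ->
      fr [:: 4; 5; 8] [::] s4 s5 -> rg s5 4 = j -> ev s5 (eNbr 10) = nth 0 (map val (a v)) j.
    move=> f4 j s5; rewrite size_map => jN f5 r4.
    apply: (@nbr_ev s' _ _ _ v) => //.
      by rewrite (fr_ar f5) // (fr_ar f4) // (fr_ar fr3).
    by rewrite (fr_rg f5) // (fr_rg f4).
  have de s4 : fr [:: 4; 5; 8] [::] s3 s4 -> ev s4 (eDeg 10) = size (map val (a v)).
    move=> f4; apply: deg_ev; last by rewrite (fr_rg f4).
    by move=> u; rewrite (fr_ar f4) // (fr_ar fr3) //; apply: ai'.
  have frl : fr [:: 4; 5; 8] [::] s3 (run l1 s3) by apply: fr_run.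
  have rd s4 (u : 'I_n) : fr [:: 4; 5; 8] [::] s3 s4 -> rg s4 8 = u ->
      [/\ ar s4 6 (rg s4 8) = pos u, ar s4 8 (rg s4 8) = last u, ar s4 9 (rg s4 8) = lab u &
          rg s4 2 = t].
    move=> f4 ->; rewrite !(fr_ar f4) // !(fr_ar fr3) // a9 (fr_rg f4) // r23.
    by have [-> _ ->] := os' u.
  have [c1 o1] : cost l1 s3 <= 3 + size (a v) * 7 /\ ou (run l1 s3) =
      ou s3 ++ flatten [seq [:: 3; 1; lab u] | u <- a v & pos u < pos v].
    have := @out_rule inp (eDeg 10) (eNbr 10) (eLt (EA 6 (ER 8)) (ER 2))
      (seqs [:: POut (EC 3); POut (EC 1); POut (EA 9 (ER 8))]) s3 (map val (a v))
      (fun u => if insub u is Some u' then pos u' < pos v else false)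
      (fun u => if insub u is Some u' then [:: 3; 1; lab u'] else [::]).
    case=> //.
    + exact: de.
    + exact: el_ok.
    + move=> j s4; rewrite size_map => jN f4; rewrite (nth_map v) // => r8; rewrite !valK.
      have [d6 d8 d9 d2] := rd _ _ f4 r8.
      rewrite [seqs _]/= !costE !runE /= d6 d9 d2 pv -!cats1 -!catA; split=> //.
      by case: (_ < _).
    rewrite size_map => hc ->; split=> //; congr (_ ++ flatten _).
    rewrite filter_map -map_comp; rewrite (eq_filter (a2 := fun u => pos u < pos v)).
      by apply: eq_map => u /=; rewrite valK.
    by move=> u /=; rewrite valK.
  have [c2 o2] : cost l2 (run l1 s3) <= 3 + size (a v) * 7 /\ ou (run l2 (run l1 s3)) =
      ou (run l1 s3) ++ flatten [seq [:: 2; lab u; 0] | u <- a v &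
        (pos u < pos v) && (last u == pos v)].
    have := @out_rule inp (eDeg 10) (eNbr 10)
      (eAnd (eLt (EA 6 (ER 8)) (ER 2)) (eEq (EA 8 (ER 8)) (ER 2)))
      (seqs [:: POut (EC 2); POut (EA 9 (ER 8)); POut (EC 0)]) (run l1 s3) (map val (a v))
      (fun u => if insub u is Some u' then (pos u' < pos v) && (last u' == pos v) else false)
      (fun u => if insub u is Some u' then [:: 2; lab u'; 0] else [::]).
    case=> //.
    + exact: de.
    + exact: el_ok.
    + move=> j s4; rewrite size_map => jN f4; rewrite (nth_map v) // => r8; rewrite !valK.
      have [d6 d8 d9 d2] := rd _ _ (fr_trans frl f4) r8.
      rewrite [seqs _]/= !costE !runE /= d6 d8 d9 d2 pv -!cats1 -!catA; split=> //.
      by rewrite mulnb eqb0 negbK.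
    rewrite size_map => hc ->; split=> //; congr (_ ++ flatten _).
    rewrite filter_map -map_comp.
    rewrite (eq_filter (a2 := fun u => (pos u < pos v) && (last u == pos v))).
      by apply: eq_map => u /=; rewrite valK.
    by move=> u /=; rewrite valK.
  set s5 := run l2 _ in o2 *.
  have f5 : fr [:: 4; 5; 8] [::] s3 s5 by apply: fr_trans frl _; apply: fr_run.
  have r5 : ar s5 9 (rg s5 10) = lab v.
    by rewrite (fr_ar f5) // (fr_rg f5) // r10 (fr_ar fr3) // a9.
  split.
    by rewrite degE; move: c1 c2 cpr; move: (cost pr _) (cost l1 _) (cost l2 _) (size (a v)); lia.
  rewrite /I run_out3 /= r5 o2 o1 e3 It (take_nth v) ?sq_size // map_rcons flatten_rcons /col_enc.
  have -> : nth v sq t = v by rewrite -pv nth_index.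
  by rewrite -!catA.
move=> hc; rewrite /I take_oversize ?sq_size // => ->; split=> //.
apply: leq_trans hc _; rewrite leq_add2l.
by apply: leq_sum => t _; rewrite -addnA.
Qed.

(** Ties within a row are broken by position. This respects columns, as the row expression requires,
    and it is the order in which [rowposP] meets the vertices. *)
Definition row_lt (x y : 'I_n) : bool :=
  (row x < row y) || (row x == row y) && (pos x < pos y).

Variable sr : seq 'I_n.
Hypothesis sr_uniq : uniq sr.
Hypothesis sr_all : forall x, x \in sr.
Hypothesis sr_idx : forall x, index x sr = #|[pred w | row_lt w x]|.
Hypothesis sr_lt : forall x y, (index x sr < index y sr) = row_lt x y.
Local Notation posr v := (index v sr).

Lemma sr_size : size sr = n.
Proof.
rewrite -[RHS]card_ord cardE; apply/eqP; rewrite -uniq_size_uniq ?enum_uniq // => x.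
by rewrite mem_enum sr_all.
Qed.

Lemma posr_inj : injective (fun v => posr v).
Proof. by move=> x y e; rewrite -(nth_index x (sr_all x)) e nth_index. Qed.

Lemma rowpos_spec s : model_in s -> order_in s ->
  (forall c, c <= n -> ar s 11 c = \sum_(u : 'I_n) (row u < c)) ->
  cost rowposP s <= 3 + n * 6 /\ forall v : 'I_n, ar (run rowposP s) 12 (posr v) = v.
Proof.
move=> ms os h11; rewrite /rowposP; set body := seqs _.
(* The next free slot of a row is its offset plus the number of its vertices placed so far. *)
pose I t s1' := (forall c, c <= n -> ar s1' 11 c = \sum_(u : 'I_n) (row u < c) +
    \sum_(u : 'I_n) ((row u == c) && (pos u < t))) /\
  forall v : 'I_n, pos v < t -> ar s1' 12 (posr v) = v.
have rn : ev s eN = n by case: ms.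
have := @for_rule_const inp 2 3 eN body s I 4.
rewrite rn; case=> //.
- split=> // c cn /=; rewrite h11 // [X in _ + X]big1 ?addn0 // => u _.
  by rewrite andbF.
- move=> t s' tN frs r2 [I1 I2].
  have [v pv] := pos_surj tN.
  have ms' : model_in s' by apply: model_fr frs _ _ _ ms.
  have os' : order_in s' by apply: order_fr frs _ os.
  have [_ _ _ hm] := ms'; have [rv _ _ _] := hm v.
  have e7 : ar s' 7 t = v by rewrite -pv; case: (os' v).
  have prE : ar s' 11 (row v) = posr v.
    rewrite I1 ?row_le // sr_idx -sum1_card [RHS]big_mkcond -big_split /=.
    apply: eq_bigr => u _; rewrite inE /row_lt pv.
    by case: ltngtP => //= _; case: (_ < _).
  rewrite /body [seqs _]/= !costE !runE /= r2 e7 rv prE; split=> //; split.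
  + move=> c cn; rewrite /= updrE addn1; case: eqP => [->|ne].
      rewrite -prE I1 ?row_le // -addnS; congr (_ + _).
      rewrite (bigD1 v) //= pv ltnn eqxx andbF add0n [RHS](bigD1 v) //= pv ltnSn eqxx add1n.
      congr S; apply: eq_bigr => u uv; congr (nat_of_bool (_ && _)).
      rewrite [in RHS]ltnS [in RHS]leq_eqVlt; case: eqP => // e; case/eqP: uv; apply: pos_inj.
      by rewrite e.
    rewrite I1 //; congr (_ + _); apply: eq_bigr => u _; congr nat_of_bool.
    case: (eqVneq (row u) c) => //= e; rewrite [in RHS]ltnS [in RHS]leq_eqVlt; case: eqP => // e'.
    by case: ne; rewrite -e; congr row; apply: pos_inj; rewrite e' pv.
  + move=> u pu; rewrite /= updrE; case: eqP => [/posr_inj->//|ne].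
    apply: I2; move: pu; rewrite ltnS leq_eqVlt => /orP[/eqP e|//].
    by case: ne; congr index; apply: pos_inj; rewrite e pv.
by move=> hc [_ hI]; split=> // v; apply: hI; apply: pos_lt.
Qed.

Local Notation opl := (open_label k).

Definition body_enc (v : 'I_n) : seq nat :=
  [:: 3; 0; col v] ++ [:: 3; 0; opl (col v)]
  ++ (if col v < k then [:: 3; 0; (col v).+1] else [::])
  ++ (if s1 v then [:: 3; 0; opl (col v).+1] else [::])
  ++ [:: 2; 0; if s2 v then opl (col v) else col v].

Arguments body_enc : simpl never.

Definition pre_enc (p v : 'I_n) : seq nat :=
  if (row p == row v) && (col p == col v) then [::] else
    [:: 2; opl (col p).+1; (col p).-1]
    ++ (if (row p == row v) && ((col p).+1 == col v) then [::]
        else [:: 2; opl (col p); col p]).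

Definition row_enc (p v : 'I_n) : seq nat :=
  pre_enc p v ++ [:: 0; nat_of_ord v; 0; 1] ++ body_enc v.

Lemma encode_row_term v0 :
  encode_term (row_term sr k row col s1 s2 v0) =
  [:: 0; nat_of_ord v0; 0] ++ body_enc v0 ++ flatten (pairmap row_enc v0 (behead sr)).
Proof.
rewrite /row_term encode_foldl; set E := fun o => _.
have bodyE v : flatten (map E (row_body k col s1 s2 v)) = body_enc v.
  rewrite /row_body map_rcons flatten_rcons /row_joins /body_enc /= map_cat map_cat flatten_cat.
  by case: ifP => _; case: (s1 v) => /=.
have opsE p v : flatten (map E (row_ops k row col s1 s2 p v)) = row_enc p v.
  rewrite /row_ops /row_enc -cat1s !map_cat !flatten_cat bodyE; congr (_ ++ _).
  by rewrite /row_pre /pre_enc; case: ifP => // _; case: ifP.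
rewrite map_cat flatten_cat bodyE; congr (_ ++ (_ ++ _)).
elim: (behead sr) v0 => // v r IH p.
rewrite -[flatten (pairmap (row_ops k row col s1 s2) p (v :: r))]/(row_ops k row col s1 s2 p v
  ++ flatten (pairmap (row_ops k row col s1 s2) v r)).
by rewrite map_cat flatten_cat opsE IH.
Qed.

Lemma row_spec s v0 : model_in s -> (forall v : 'I_n, ar s 12 (posr v) = v) ->
  v0 = head v0 sr ->
  cost rowP s <= 3 + n * 80 /\
  ou (run rowP s) = ou s ++ [:: 0; nat_of_ord v0; 0] ++ body_enc v0 ++
    flatten (pairmap row_enc v0 (behead sr)).
Proof.
move=> ms h12 v0E; rewrite /rowP; set body := seqs _.
have sE : sr = v0 :: behead sr by rewrite {1}v0E; case: (sr) (sr_all v0).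
(* Registers 11 and 12 keep row and column of the previous vertex, from which [preP] derives the
   closing relabellings. *)
pose I t s1' := if t is t'.+1 then [/\ ou s1' = ou s ++ [:: 0; nat_of_ord v0; 0] ++
    body_enc v0 ++ flatten (pairmap row_enc v0 (take t' (behead sr))),
    rg s1' 11 = row (nth v0 sr t') & rg s1' 12 = col (nth v0 sr t')]
  else ou s1' = ou s.
have rn : ev s eN = n by case: ms.
have := @for_rule_const inp 2 3 eN body s I 60.
rewrite rn; case=> //; last first.
  move=> hc hI; split; first by apply: leq_trans hc _; lia.
  have [-> _ _] : I n.-1.+1 (run (PFor 2 3 eN body) s) by rewrite prednK.
  have -> : n.-1 = size (behead sr) by rewrite size_behead sr_size.
  by rewrite take_size.
move=> t s' tN frs r2 It.
set v := nth v0 sr t.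
have pv : posr v = t by rewrite index_uniq ?sr_size.
have ms' : model_in s' by apply: model_fr frs _ _ _ ms.
have [_ r1 _ hm] := ms'; have [rv cv s1v s2v] := hm v.
have e12 : ar s' 12 t = v by rewrite -pv (fr_ar frs) // h12.
have opE c : rg s' 1 + 1 + c %% 2 = opl c.
  by rewrite r1 /open_label addn1 modn2.
split.
  rewrite /body /preP [seqs _]/= !costE.
  by do ![case: ifP => _]; rewrite ?costE ?cost_out3.
pose pre := if t is t'.+1 then pre_enc (nth v0 sr t') v else [::].
have preE : run preP (setr 10 v s') = addo pre (setr 10 v s').
  rewrite /preP; rewrite run_if [ev _ _]/= r2 /pre; case: (t) It => [|t'] It /=.
    by rewrite runE addo_nil.
  have [_ e11 e12'] := It.
  rewrite run_if [ev _ _]/= e11 e12' rv cv /pre_enc mulnb eqb0.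
  case: ifP => [h|/negbFE ->]; last by rewrite runE addo_nil.
  rewrite (negPf h) run_seq run_out3 run_if ev_addo [ev _ _]/= e11 e12' rv cv addn1 mulnb eqb0.
  rewrite /= !opE e12' addn1 subn1.
  case: ifP => [h'|/negbFE ->]; last by rewrite runE.
  by rewrite (negPf h') run_out3 addo_cat /= e12' !opE.
have runB : run body s' = addo (pre ++ [:: 0; nat_of_ord v; 0] ++
    (if t == 0 then [::] else [:: 1]) ++ body_enc v)
    (setr 12 (col v) (setr 11 (row v) (setr 10 v s'))).
  have skip q : run PSkip q = addo [::] q by rewrite runE addo_nil.
  rewrite /body 11!run_seqs run_skip.
  rewrite [run (PSet 10 _) _]run_set [ev _ _]/= r2 e12 preE.
  rewrite [run (out3 (EC 0) _ _) _]run_out3 !ev_addo addo_cat.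
  rewrite [run (PIf (ER 2) _ _) _](run_if_addo _ (run_out_addo _ _ _) (skip _)).
  rewrite !ev_addo addo_cat [run (PSet 11 _) _]run_set ev_addo setr_addo.
  rewrite [run (PSet 12 _) _]run_set ev_addo setr_addo.
  have -> : ev (setr 10 v s') (EA 1 (ER 10)) = row v by rewrite /= rv.
  have -> : ev (setr 11 (row v) (setr 10 v s')) (EA 2 (ER 10)) = col v by rewrite /= cv.
  set sb := setr 12 _ _.
  rewrite !run_out3 !ev_addo !addo_cat.
  rewrite [run (PIf (eLt _ _) _ _) _](run_if_addo _ (run_out3 _ _ _ _ _) (skip _)) !ev_addo !addo_cat.
  rewrite [run (PIf (EA 3 _) _ _) _](run_if_addo _ (run_out3 _ _ _ _ _) (skip _)) !ev_addo !addo_cat.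
  rewrite (run_if_addo _ (run_out3 _ _ _ _ _) (run_out3 _ _ _ _ _)) !ev_addo !addo_cat.
  have e12b : ev sb (ER 12) = col v by [].
  have e10b : ev sb (ER 10) = v by [].
  have e1b : ev sb (ER 1) = k by [].
  have opb e : ev sb (eOpen e) = opl (ev sb e) by rewrite -opE.
  have eSb e : ev sb (eS e) = (ev sb e).+1 by rewrite -addn1.
  have e3b : ev sb (EA 3 (ER 10)) = s1 v by rewrite -s1v.
  have e4b : ev sb (EA 4 (ER 10)) = s2 v by rewrite -s2v.
  rewrite !opb !eSb e12b e3b e4b [ev sb (eLt _ _)]/= r1.
  have -> : ev (setr 10 v s') (ER 10) = v by [].
  have -> : ev (setr 10 v s') (ER 2) = t by rewrite /= r2.
  congr (addo _ sb); rewrite /body_enc -!catA.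
  by case: (t == 0); case: (_ < _); case: (s1 v); case: (s2 v).
rewrite runB setr_addo; move: It; rewrite /pre; case et: t => [|t'] It; rewrite /I.
  have vE : v = v0 by rewrite /v et sE.
  rewrite vE take0 [pairmap _ _ _]/= cats0 /= -It; split=> //; by rewrite sE.
have [e _ _] := It; rewrite -et; split=> //.
rewrite [LHS]/= e et (take_nth v0) ?size_behead ?sr_size; last by lia.
rewrite -cats1 pairmap_cat flatten_cat [flatten (pairmap _ _ [:: _])]/= cats0 nth_behead.
have -> : seq.last v0 (take t' (behead sr)) = nth v0 sr t'.
  case: (t') et => [|m] et'; first by rewrite take0 sE.
  by rewrite (take_nth v0) ?size_behead ?sr_size ?last_rcons ?nth_behead //; lia.
have -> : nth v0 sr t'.+1 = v by rewrite /v et.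
by rewrite /row_enc -!catA.
Qed.

Lemma sum_deg_order s : order_in s ->
  \sum_(t < n) deg (ar s 7 t) = \sum_(v : 'I_n) size (a v).
Proof.
move=> os; pose h v := Ordinal (pos_lt v).
have hb : bijective h by apply: injF_bij => u v e; apply: pos_inj; exact: (congr1 val e).
rewrite (reindex h) /=; last exact: onW_bij.
by apply: eq_bigr => v _; have [_ -> _] := os v; rewrite deg_ord.
Qed.

Lemma sum_affine (F : 'I_n -> nat) A C :
  \sum_(t < n) (A * F t + C) = A * \sum_(t < n) F t + C * n.
Proof. by rewrite big_split /= -big_distrr sum_nat_const card_ord [n * _]mulnC. Qed.

Lemma core_spec s : model_in s -> ou s = [::] ->
  (forall g, [/\ ar s 5 g = 0, ar s 10 g = 0 & ar s 11 g = 0]) ->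
  exists t, [/\ constructs t G, nlabels t <= minn (k + 3) (bnd + 2),
    ou (run coreP s) = encode_term t &
    cost coreP s <= 300 * (n + \sum_(v : 'I_n) size (a v))].
Proof.
move=> ms o0 z; set S := \sum_v _.
pose v0 := head (Ordinal n_gt0) sq; pose w0 := head (Ordinal n_gt0) sr.
have v0E : v0 = head v0 sq by rewrite /v0; case: (sq) (sq_all (Ordinal n_gt0)).
have w0E : w0 = head w0 sr by rewrite /w0; case: (sr) (sr_all (Ordinal n_gt0)).
pose PI := PIf (eLt (ER 9) (EB OpAdd (ER 1) (EC 3))) colP
  (seqs [:: bucketP 11 1; rowposP; rowP]).
pose t1 := run (bucketP 5 2) s; pose t2 := run posP t1; pose t3 := run lastP t2.
pose t4 := run labP t3.
have cE : cost coreP s = cost (bucketP 5 2) s + (cost posP t1 + (cost lastP t2 +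
  (cost labP t3 + cost PI t4))).
  by rewrite /coreP 4!cost_seqs.
have rE : run coreP s = run PI t4 by rewrite /coreP 5!run_seqs run_skip.
have [rn rk _ hm] := ms.
have [c1 h1] := @bucket_spec 5 2 col s isT rn (fun v => let: And4 _ h _ _ := hm v in h)
  (fun v => leq_trans (proj2 (andP (col_rng v))) k_le)
  (fun c _ => let: And3 h _ _ := z c in h).
have m1 : model_in t1 by apply: model_run.
have [c2 h2] := pos_spec m1 h1.
have m2 : model_in t2 by apply: model_run.
have [c3 h3] := last_spec m2 (fun v => proj1 (h2 v)).
have m3 : model_in t3 by apply: model_run.
have o3 : order_in t3.
  by move=> v; have [e6 e7] := h2 v; split; rewrite ?h3 // ar_run.
have z10 g : ar t3 10 g = 0 by rewrite !ar_run //; case: (z g).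
have [c4 [lok mxb labmx]] := lab_spec m3 o3 z10.
rewrite -/t4 in lok mxb labmx.
have m4 : model_in t4 by apply: model_run.
have o4 : order_in t4 by apply: order_run.
have ou4 : ou t4 = [::] by rewrite !ou_run.
have r14 : rg t4 1 = k by case: m4.
rewrite (sum_affine (fun t => deg (ar t3 7 t))) (sum_deg_order o3) -/S in c4.
have sdeg : \sum_(v < n) deg v = S by apply: eq_bigr => v _; rewrite deg_ord.
rewrite (sum_affine (fun v => deg v)) sdeg in c2.
rewrite (sum_affine (fun v => deg v)) sdeg in c3.
have cI : ev t4 (eLt (ER 9) (EB OpAdd (ER 1) (EC 3))) = (rg t4 9 < k + 3).
  by rewrite /= r14.
rewrite cE rE /PI cost_if run_if cI eqb0 -leqNgt.
(* The largest label is below [bnd + 2]. If it reaches [k + 3], then [k + 3] is the minimum;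
   otherwise the column expression is within both bounds. *)
case: leqP => mx.
- pose t5 := run (bucketP 11 1) t4; pose t6 := run rowposP t5.
  exists (row_term sr k row col s1 s2 w0).
  have [rn4 _ _ hm4] := m4.
  have z11 c : ar t4 11 c = 0 by rewrite !ar_run //; case: (z c).
  have [c5 h5] := @bucket_spec 11 1 row t4 isT rn4 (fun v => let: And4 h _ _ _ := hm4 v in h)
    row_le (fun c _ => z11 c).
  have m5 : model_in t5 by apply: model_run.
  have o5 : order_in t5 by apply: order_run.
  have [c6 h6] := rowpos_spec m5 o5 h5.
  have m6 : model_in t6 by apply: model_run.
  have [c7 h7] := row_spec m6 h6 w0E.
  split.
  + apply: row_term_constructs => // x y; rewrite sr_lt /row_lt => /orP[->//|/andP[-> xy]].
    apply/orP; right; move: xy; rewrite sq_lt /left_lt => /orP[/ltnW->//|/andP[/eqP-> _]].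
    by rewrite leqnn.
  + have h := row_term_nlabels row s1 s2 sr_uniq col_rng w0.
    by rewrite leq_min h /= (leq_trans h) //; move: mxb mx; lia.
  + by rewrite encode_row_term 3!run_seqs run_skip h7 !ou_run // o0.
  + rewrite 2!cost_seqs -/t5 -/t6; move: c1 c2 c3 c4 c5 c6 c7; rewrite -/t1 -/t2 -/t3 -/t4 -/t5 -/t6.
    move: (cost _ s) (cost _ t1) (cost _ t2) (cost _ t3) (cost _ t4) (cost _ t5) (cost _ t6).
    by move: n_gt0; lia.
- exists (col_term sq a last (fun v => ar t4 9 v) v0).
  have [c5 h5] := col_spec m4 o4.
  rewrite (sum_affine (fun t => deg (ar t4 7 t))) (sum_deg_order o4) -/S in c5.
  split.
  + apply: (@col_term_constructs _ G sq a last _ bnd) v0E => //.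
    * by move=> v; case: (aP v).
    * by move=> x y; apply: (left_order_umbrella adjG sq_all sq_lt).
    * exact: pos_last_nbr.
    * by rewrite sq_size; apply: lok.
  + apply: leq_trans (_ : (rg t4 9).+1 <= _); last by rewrite leq_min mx; case/andP: mxb.
    apply: col_term_nlabels => [|x]; first by case/andP: mxb.
    by rewrite ltnS.
  + by rewrite encode_col_term // h5 ou4.
  + move: c1 c2 c3 c4 c5; rewrite -/t1 -/t2 -/t3 -/t4.
    move: (cost _ s) (cost _ t1) (cost _ t2) (cost _ t3) (cost _ t4).
    by move: n_gt0; lia.
Qed.

End Core.

(** * Word size and running time *)

Definition st0 : st := St (fun=> 0) (fun _ _ => 0) [::].

(** The constant factor is absorbed into the exponent by [A < 2 ^ A <= n.+1 ^ A]. *)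
Lemma poly_lt_exp A M n g c : 0 < n -> 0 < M -> g <= A * n.+1 ^ 3 -> (A + 3) * M <= c ->
  g ^ M < n.+1 ^ c.
Proof.
move=> n0 M0 hg hc; apply: leq_trans (leq_pexp2l (ltn0Sn n) hc).
rewrite expnM ltn_exp2r //; apply: leq_ltn_trans hg _.
rewrite expnD ltn_pmul2r ?expn_gt0 //.
apply: (@leq_trans (2 ^ A)); first exact: ltn_expl.
by case: A {hc} => // A; rewrite leq_exp2r.
Qed.

Lemma grown_poly A D n c X : 0 < A -> c <= D * X -> X <= n.+1 ^ 2 ->
  grown (n + A) (n + A) c <= (A + 3 * A * D) * n.+1 ^ 3.
Proof.
move=> A0 hc hX.
have hA : n + A <= A * n.+1 by rewrite mulnS addnC leq_add2l leq_pmull.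
have h2 : c <= D * n.+1 ^ 2 by apply: leq_trans hc _; rewrite leq_mul2l hX orbT.
rewrite /grown; apply: leq_trans (leq_add hA (leq_mul (leq_mul (leqnn 3) hA) h2)) _.
have e3 : n.+1 ^ 3 = n.+1 * n.+1 ^ 2 by rewrite expnS.
have h3 : n.+1 <= n.+1 ^ 3 by rewrite e3 leq_pmulr // expn_gt0.
have -> : 3 * (A * n.+1) * (D * n.+1 ^ 2) = 3 * A * D * n.+1 ^ 3.
  by rewrite e3 [3 * (A * _)]mulnA mulnACA.
by rewrite mulnDl leq_add2r leq_mul2l h3 orbT.
Qed.

(** The value [n + 64] dominates the input and the constants of programs. Cost at most [D * X] with
    [X] at most quadratic keeps all values cubic, and [maxsize] turns this into the word bound. The
    constant [c0] is the sum of that exponent and the time factor [timeK * D]. *)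
Lemma outputs_of_cost p D : okp p -> exists c0, forall c n inp out X, c0 <= c -> 0 < n ->
  (forall i, nth 0 inp i <= n) -> X <= n.+1 ^ 2 -> cost inp p st0 <= D * X ->
  ou (run inp p st0) = out ->
  outputs_within (word_bound c n) (comp p) inp out (c * X).
Proof.
move=> pok; exists ((64 + 3 * 64 * D + 3) * maxsize + timeK * D).
move=> c n inp out X cc n0 hi hX hc ho.
have i64 i : nth 0 inp i <= n + 64 by apply: leq_trans (hi i) (leq_addr _ _).
have sim0 : simul st0 init_state by [].
have b0 : bounded (n + 64) st0 by [].
have hW := poly_lt_exp n0 (isT : 0 < maxsize) (grown_poly (isT : 0 < 64) hc hX)
  (leq_trans (leq_addr _ _) cc).
have [t [o' [ex [_ _ oo] ht _]]] := simulation (leq_addl n 64) i64 pok sim0 (leqnn _) b0 hW.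
exists t, o'; split=> //; last by rewrite oo.
apply: leq_trans ht _; apply: leq_trans (leq_mul (leqnn _) hc) _.
rewrite mulnA; exact: leq_mul (leq_trans (leq_addl _ _) cc) (leqnn _).
Qed.

Lemma nth_flatten_block (L : seq (seq nat)) r i j : i < size L -> j < size (nth [::] L i) ->
  nth 0 (flatten L ++ r) (size (flatten (take i L)) + j) = nth 0 (nth [::] L i) j.
Proof.
move=> iL jL; rewrite -{1}(cat_take_drop i L) flatten_cat -catA nth_cat ltnNge leq_addr addKn.
by rewrite (drop_nth [::]) //= -catA nth_cat jL.
Qed.

(** * Decoding the adjacency lists *)

Section Reading.
Variables (n : nat) (G : sgraph 'I_n) (a : 'I_n -> seq 'I_n) (rest : seq nat).
Hypothesis aP : adjacency_lists G a.
Let inp := encode_graph a ++ rest.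

Lemma offset_spec s : rg s 0 = n ->
  let s' := run inp offsetP s in
  [/\ cost inp offsetP s <= 4 + n * 4, adj_input a inp s' & rg s' 6 = size (encode_graph a)].
Proof.
move=> rn; rewrite /offsetP cost_seq run_seq cost_set run_set.
set L := [seq size (a v) :: map val (a v) | v <- enum 'I_n].
have szL : size L = n by rewrite size_map size_enum_ord.
have nthL (v : 'I_n) : nth [::] L v = size (a v) :: map val (a v).
  by rewrite (nth_map v) ?size_enum_ord // nth_ord_enum.
have inpE i j : i < n -> j < size (nth [::] L i) ->
    nth 0 inp (1 + size (flatten (take i L)) + j) = nth 0 (nth [::] L i) j.
  by move=> iN jN; rewrite -[RHS](@nth_flatten_block L rest) ?szL // add1n addSn.
set s1 := setr 6 1 s.
pose I i s2 := rg s2 6 = 1 + size (flatten (take i L)) /\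
  forall v : 'I_n, v < i -> ar s2 0 v = 1 + size (flatten (take v L)).
have := @for_rule_const inp 2 3 eN (PSeq (PSto 0 (ER 2) (ER 6))
  (PSet 6 (EB OpAdd (EB OpAdd (ER 6) (EC 1)) (EI (ER 6))))) s1 I 2.
have -> : ev inp s1 eN = n by [].
case=> //.
- by split=> //=; rewrite take0.
- move=> i s' iN frs ri [I1 I2]; rewrite !costE !runE; split=> //; split=> /=.
    rewrite I1 (take_nth [::]) ?szL // flatten_rcons size_cat -[i]/(val (Ordinal iN)) nthL /=.
    have := inpE i 0 iN; rewrite addn0 -[i]/(val (Ordinal iN)) nthL /= => -> //.
    by rewrite size_map; lia.
  move=> v vi; rewrite ri I1 updrE; case: eqP => [->//|ne]; apply: I2.
  by move: vi; rewrite ltnS leq_eqVlt => /orP[/eqP|].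
move=> hc [h6 h0]; split.
- by move: hc; lia.
- move=> v; rewrite h0 //; split.
    by have := inpE v 0 (ltn_ord v); rewrite addn0 nthL => ->.
  move=> i iN; have := inpE v i.+1 (ltn_ord v); rewrite nthL /= size_map ltnS => /(_ iN) <-.
  by rewrite -addnA add1n.
- by rewrite h6 take_oversize ?szL.
Qed.

Lemma size_adj v : size (a v) <= n.
Proof. by have [ua _] := aP v; rewrite -[leqRHS]card_ord cardE uniq_leq_size // => x; rewrite mem_enum. Qed.

Lemma encode_graph_le : all (fun x => x <= n) (encode_graph a).
Proof.
rewrite /= leqnn /=; apply/allP => x /flattenP[l /mapP[v _ ->]].
rewrite inE => /orP[/eqP->|/mapP[u _ ->]]; first exact: size_adj.
by apply: ltnW; apply: ltn_ord.
Qed.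

Lemma sum_adj_edges : \sum_(v : 'I_n) size (a v) <= 2 * #|edges G|.
Proof.
have -> : \sum_v size (a v) = \sum_(p : 'I_n * 'I_n | G p.1 p.2) 1.
  rewrite -(pair_big_dep xpredT (fun v u => G v u) (fun _ _ => 1)) /=.
  apply: eq_bigr => v _; have [ua ma] := aP v.
  by rewrite -(card_uniqP ua) -sum1_card; apply: eq_bigl => u; rewrite ma inE.
rewrite (partition_big (fun p : 'I_n * 'I_n => [set p.1; p.2]) (mem (edges G))) /=; last first.
  by move=> p gp; apply/imsetP; exists p.
rewrite mulnC -sum_nat_const; apply: leq_sum => e /imsetP[q gq ->].
rewrite sum1_card; apply: leq_trans (_ : #|[set q; (q.2, q.1)]| <= 2); last first.
  by rewrite cards2; case: (_ != _).
apply: subset_leq_card; apply/subsetP => -[x y]; rewrite !inE => /andP[/= gxy /eqP xyE].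
have hx : x \in [set q.1; q.2] by rewrite -xyE !inE eqxx.
have hy : y \in [set q.1; q.2] by rewrite -xyE !inE eqxx orbT.
have xy : x != y by apply: contraTneq gxy => ->; rewrite adj_irr.
move: hx hy xy; rewrite !inE; case: (q) => q1 q2 /=; rewrite !xpair_eqE.
by case/orP=> /eqP-> /orP[]/eqP->; rewrite ?eqxx ?orbT.
Qed.

Lemma card_edges_le : #|edges G| <= n ^ 2.
Proof.
apply: leq_trans (leq_imset_card _ _) _; apply: leq_trans (max_card _) _.
by rewrite card_prod card_ord.
Qed.

End Reading.

Lemma surj_leq_card (T : finType) (f : T -> nat) K :
  (forall j, 1 <= j <= K -> exists v, f v = j) -> K <= #|T|.
Proof.
move=> h; rewrite cardE -(size_map f) -(size_iota 1 K); apply: uniq_leq_size.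
  exact: iota_uniq.
move=> j; rewrite mem_iota add1n ltnS => /h[v <-]; apply: map_f.
by rewrite mem_enum.
Qed.

(** * The program for a given bubble model *)

Definition modelP : prog :=
  seqs [:: PSet 0 (EI (EC 0)); offsetP; PSet 1 (EI (ER 6));
    PSet 7 (EB OpAdd (EB OpAdd (ER 6) (EC 1)) (EI (ER 6)));
    PFor 2 3 eN (seqs [:: PSto 1 (ER 2) (EI (ER 7));
      PSto 2 (ER 2) (EI (EB OpAdd (ER 7) (EC 1)));
      PSto 3 (ER 2) (EI (EB OpAdd (ER 7) (EC 2)));
      PSto 4 (ER 2) (EI (EB OpAdd (ER 7) (EC 3)));
      PSet 7 (EB OpAdd (ER 7) (EC 4))]);
    coreP].

Lemma row_lt_order n (row : 'I_n -> nat) (sq : seq 'I_n) : (forall x, x \in sq) ->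
  exists sr, [/\ uniq sr, (forall x, x \in sr),
    (forall x, index x sr = #|[pred w | row_lt row sq w x]|) &
    forall x y, (index x sr < index y sr) = row_lt row sq x y].
Proof.
move=> sa; apply: strict_order_enum => [x|y x z|x y xy]; rewrite /row_lt.
- by rewrite !ltnn andbF.
- by lia.
- have : index x sq <> index y sq.
    by move=> e; case/eqP: xy; rewrite -(nth_index x (sa x)) e nth_index.
  by move: (index x sq) (index y sq) (row x) (row y) => p q i j; lia.
Qed.

Section ModelProgram.
Variables (n : nat) (G : sgraph 'I_n) (B : ububble 'I_n) (a : 'I_n -> seq 'I_n).
Hypothesis modelB : ub_model B G.
Hypothesis aP : adjacency_lists G a.
Let inp := encode_graph a ++ encode_ububble B.

Lemma bubble_n_gt0 : 0 < n. Proof. by have := ub_nonempty B; rewrite card_ord. Qed.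

Lemma ncol_le : ncol B <= n.
Proof.
rewrite -[leqRHS]card_ord; apply: (@surj_leq_card _ (col B)) => j /(ubm_col modelB)[i].
by move=> /andP[_ /set0Pn[v]]; rewrite inE => /andP[_ /eqP]; exists v.
Qed.

Lemma nrow_le j : 1 <= j <= ncol B -> nrow B j <= n.
Proof.
move=> hj; rewrite -[leqRHS]card_ord; apply: (@surj_leq_card _ (row B)) => i hi.
have [j' /andP[_ /set0Pn[v]]] := ubm_row modelB hj hi.
by rewrite inE => /andP[/eqP]; exists v.
Qed.

Lemma row_le_n v : row B v <= n.
Proof.
by have /andP[_ h] := row_range B v; apply: leq_trans h _; apply/nrow_le/col_range.
Qed.

(** In a model every row and column contains a vertex, so all row and column numbers are at most
    [n]; this is what makes the input fit into words. *)
Lemma model_input_le i : nth 0 inp i <= n.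
Proof.
suff h : all (fun x => x <= n) inp.
  have [iN|iN] := ltnP i (size inp); last by rewrite nth_default.
  exact: (all_nthP 0 h).
rewrite all_cat (encode_graph_le aP) /= ncol_le /= all_cat; apply/andP; split.
  apply/allP => x /mapP[j]; rewrite mem_iota add1n ltnS => hj ->; exact: nrow_le.
apply/allP => x /flattenP[l /mapP[v _ ->]]; rewrite !inE.
have b (c : bool) : c <= n by apply: leq_trans bubble_n_gt0; case: c.
have /andP[_ cv] := col_range B v.
by case/or4P=> /eqP-> //; [apply: row_le_n|apply: leq_trans cv ncol_le].
Qed.

Lemma model_spec : exists t,
  [/\ is_kexpression (minn (2 * alpha G + 3) (group_number B G + 2)) t G,
      ou (run inp modelP st0) = encode_term t &
      cost inp modelP st0 <= 700 * (n + #|edges G|)].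
Proof.
have n0 := bubble_n_gt0.
have idx_inj : injective (@nat_of_ord n) by apply: ord_inj.
have [sq [u1 u2 u3 u4]] := strict_order_enum
  (left_lt_irr (@nat_of_ord n) (row B) (col B) (sgn1 B)) (@left_lt_trans _ _ _ _ _)
  (fun x y => @left_lt_total _ _ (row B) (col B) (sgn1 B) idx_inj x y).
have [sr [v1 v2 v3 v4]] := row_lt_order (row B) u2.
have adjG := model_bub_adj modelB.
pose s1 := setr 0 n st0.
have [co ai r6] := @offset_spec n a (encode_ububble B) s1 erefl.
set s2 := run inp offsetP s1 in ai r6.
pose b := size (encode_graph a).
have ib : nth 0 inp b = ncol B by rewrite nth_cat ltnn subnn.
(* The records of four numbers per vertex start after the number of columns and the [ncol B] column
   heights, which are skipped. *)
pose s3 := setr 7 (b + 1 + ncol B) (setr 1 (ncol B) s2).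
pose rd := PFor 2 3 eN (seqs [:: PSto 1 (ER 2) (EI (ER 7));
      PSto 2 (ER 2) (EI (EB OpAdd (ER 7) (EC 1)));
      PSto 3 (ER 2) (EI (EB OpAdd (ER 7) (EC 2)));
      PSto 4 (ER 2) (EI (EB OpAdd (ER 7) (EC 3)));
      PSet 7 (EB OpAdd (ER 7) (EC 4))]).
pose s4 := run inp rd s3.
have e1 : run inp (PSet 0 (EI (EC 0))) st0 = s1 by [].
have e3 : run inp (PSet 7 (EB OpAdd (EB OpAdd (ER 6) (EC 1)) (EI (ER 6))))
    (run inp (PSet 1 (EI (ER 6))) s2) = s3.
  by rewrite !run_set /= r6 -/b ib.
have rE : run inp modelP st0 = run inp coreP s4.
  by rewrite /modelP 6!run_seqs run_skip e1 e3.
have cE : cost inp modelP st0 = 1 + (cost inp offsetP s1 + (1 + (1 + (cost inp rd s3 + cost inp coreP s4)))).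
  by rewrite /modelP 5!cost_seqs e1 e3 !cost_set.
pose L := [seq [:: row B v; col B v; nat_of_bool (sgn1 B v); nat_of_bool (sgn2 B v)] | v <- enum 'I_n].
have szL : size L = n by rewrite size_map size_enum_ord.
have nthL (v : 'I_n) : nth [::] L v = [:: row B v; col B v; nat_of_bool (sgn1 B v); nat_of_bool (sgn2 B v)].
  by rewrite (nth_map v) ?size_enum_ord // nth_ord_enum.
have szt i : i <= n -> size (flatten (take i L)) = 4 * i.
  elim: i => [|i IH] iN; first by rewrite take0.
  rewrite (take_nth [::]) ?szL // flatten_rcons size_cat IH ?(ltnW iN) //.
  by rewrite -[i]/(val (Ordinal iN)) nthL /=; lia.
have inpE i j : i < n -> j < 4 -> nth 0 inp (b + 1 + ncol B + 4 * i + j) = nth 0 (nth [::] L i) j.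
  move=> iN jN; rewrite nth_cat -/b.
  have -> : (b + 1 + ncol B + 4 * i + j < b) = false by lia.
  have -> : b + 1 + ncol B + 4 * i + j - b = (ncol B + (4 * i + j)).+1 by lia.
  rewrite /= nth_cat size_map size_iota ltnNge leq_addr /= addKn -(szt i (ltnW iN)).
  rewrite -[flatten _]cats0; apply: nth_flatten_block; rewrite ?szL //.
  by rewrite -[i]/(val (Ordinal iN)) nthL.
have rn3 : ev inp s3 eN = n by rewrite /= rg_run.
pose I i s := rg s 7 = b + 1 + ncol B + 4 * i /\ forall v : 'I_n, v < i ->
  [/\ ar s 1 v = row B v, ar s 2 v = col B v, ar s 3 v = sgn1 B v :> nat & ar s 4 v = sgn2 B v :> nat].
have [cr [_ h4]] : cost inp rd s3 <= 3 + n * (5 + 2) /\ I n s4.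
  rewrite -{1}rn3; have := @for_rule_const inp 2 3 eN (seqs [:: PSto 1 (ER 2) (EI (ER 7));
      PSto 2 (ER 2) (EI (EB OpAdd (ER 7) (EC 1)));
      PSto 3 (ER 2) (EI (EB OpAdd (ER 7) (EC 2)));
      PSto 4 (ER 2) (EI (EB OpAdd (ER 7) (EC 3)));
      PSet 7 (EB OpAdd (ER 7) (EC 4))]) s3 I 5.
  rewrite rn3; apply=> //.
  - by split=> //=; rewrite addn0.
  - move=> i s' iN frs ri [I1 I2]; rewrite [seqs _]/= !costE !runE; split=> //; split=> /=.
      by rewrite I1; lia.
    move=> v vi; rewrite ri I1 !updrE; case: eqP => [ev|ne]; last first.
      by apply: I2; move: vi; rewrite ltnS leq_eqVlt => /orP[/eqP|].
    have g j : j < 4 -> nth 0 inp (b + 1 + ncol B + 4 * i + j) =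
        nth 0 [:: row B v; col B v; nat_of_bool (sgn1 B v); nat_of_bool (sgn2 B v)] j.
      by move=> jN; rewrite inpE // -nthL ev.
    by split; [rewrite -[X in nth 0 inp X]addn0; exact: (g 0)|exact: (g 1)|exact: (g 2)|exact: (g 3)].
have m4 : model_in a (row B) (col B) (sgn1 B) (sgn2 B) (ncol B) inp s4.
  split; [by rewrite rg_run //= rg_run|by rewrite rg_run| |by move=> v; apply: h4].
  by move=> v; rewrite ar_run //=; apply: ai.
have [||t [t1 t2 t3 t4]] := core_spec n0 aP adjG (col_range B) ncol_le row_le_n
  u1 u2 u3 u4 (live_group_number modelB u2 u4) v1 v2 v3 v4 m4.
- by rewrite !ou_run.
- by move=> g; rewrite !ar_run.
exists t; split.
- split=> //; apply: leq_trans t2 _; rewrite leq_min !geq_min leq_add2r.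
  by rewrite (ncol_alpha modelB) leqnn orbT.
- by rewrite rE.
- rewrite cE; have := sum_adj_edges aP; move: co cr t4 n0.
  move: (cost _ _ s1) (cost _ _ s3) (cost _ _ s4) (\sum_v _) => x y z S; lia.
Qed.

End ModelProgram.

Lemma model_okp : okp modelP. Proof. by vm_compute. Qed.

(** * Integer representations and breadth-first layers *)

(** Clears the hypotheses about adjacency and connectivity and the quantified ones, so that [lia] is
    left with the arithmetic. *)
Ltac clia :=
  repeat match goal with
  | H : forall _, _ |- _ => clear H
  | H : is_true (adj _ _ _) |- _ => clear H
  | H : is_true (connect _ _ _) |- _ => clear H
  | H : is_true (~~ adj _ _ _) |- _ => clear H
  | H : adj _ _ _ = _ |- _ => clear H
  | H : is_true (subset _ _) |- _ => clear H
  end; lia.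

Section Rep.
Variables (T : finType) (G : sgraph T) (U : nat).
Hypothesis U_gt0 : 0 < U.

(** The interval of [v] has endpoints [ix v] and [ix v + U]; [io1], [io2] tell
    which of them are missing. In doubled coordinates a missing endpoint moves
    the bound by one, so that adjacency becomes intersection of closed
    intervals. *)
Record irep := IRep { ix : T -> nat; io1 : T -> bool; io2 : T -> bool }.

Definition lft R v := 2 * ix R v + io1 R v.
Definition rgt R v := 2 * ix R v + 2 * U - io2 R v.
Definition is_rep R := forall u v, u != v ->
  G u v = (lft R u <= rgt R v) && (lft R v <= rgt R u).

Lemma lrP R v : [/\ 2 * ix R v <= lft R v <= (2 * ix R v).+1,
  2 * ix R v + 2 * U <= (rgt R v).+1, rgt R v <= 2 * ix R v + 2 * U & lft R v <= rgt R v].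
Proof. by rewrite /lft /rgt; case: (io1 R v); case: (io2 R v); split; rewrite /=; lia. Qed.

(** Doubled bounds deviate from the endpoints by at most one, so strict containment at both ends
    forces equal endpoints, a closed outer and an open inner interval. The point [t] separating the
    left bounds is then the common left endpoint. All rigidity arguments below rest on this. *)
Lemma inside_num x x' l r l' r' t :
  t < l' -> l <= t -> r' < r ->
  [/\ 2 * x <= l <= (2 * x).+1, 2 * x + 2 * U <= r.+1, r <= 2 * x + 2 * U & l <= r] ->
  [/\ 2 * x' <= l' <= (2 * x').+1, 2 * x' + 2 * U <= r'.+1, r' <= 2 * x' + 2 * U & l' <= r'] ->
  [/\ l' = (2 * x).+1, r'.+1 = 2 * x + 2 * U & t = 2 * x].
Proof.
move=> h1 h2 h3 [/andP[a1 a2] a3 a4 _] [/andP[b1 b2] b3 b4 _].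
have e : x = x' by lia.
by split; lia.
Qed.

(** The tool for changing representations: it moves a vertex onto the interval of a twin and
    exchanges two classes. The map need not be injective, since vertices with the same image are
    adjacent. *)
Lemma rep_pullback R f : is_rep R ->
  (forall u v, u != v -> G u v = (f u == f v) || G (f u) (f v)) ->
  is_rep (IRep (ix R \o f) (io1 R \o f) (io2 R \o f)).
Proof.
move=> rR hf u v uv; rewrite hf //.
rewrite -[lft _ u]/(lft R (f u)) -[lft _ v]/(lft R (f v)).
rewrite -[rgt _ u]/(rgt R (f u)) -[rgt _ v]/(rgt R (f v)).
case: eqVneq => [->|ne]; last by rewrite rR.
by have [_ _ _ ->] := lrP R (f v).
Qed.

Lemma rep_mirror R : is_rep R -> exists R' N, is_rep R' /\
  forall v, lft R' v + rgt R v = N /\ rgt R' v + lft R v = N.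
Proof.
move=> rR; pose N := \max_v ix R v.
have hN v : ix R v <= N by apply: leq_bigmax.
pose R' := IRep (fun v => N - ix R v) (io2 R) (io1 R).
have e v : lft R' v + rgt R v = 2 * N + 2 * U /\ rgt R' v + lft R v = 2 * N + 2 * U.
  by have := hN v; rewrite /lft /rgt /=; case: (io1 R v); case: (io2 R v); split; rewrite /=; lia.
exists R', (2 * N + 2 * U); split=> // u v uv; rewrite rR //.
by have [e1 e2] := e u; have [e3 e4] := e v; lia.
Qed.

Lemma nonadj_lt R u v : is_rep R -> u != v -> ~~ G u v ->
  rgt R u < lft R v \/ rgt R v < lft R u.
Proof. by move=> rR uv; rewrite rR // negb_and -!ltnNge => /orP[]; [right|left]. Qed.

Lemma adj_lt R u v : is_rep R -> G u v -> lft R u <= rgt R v /\ lft R v <= rgt R u.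
Proof.
move=> rR g; have uv : u != v by apply: contraTneq g => ->; rewrite adj_irr.
by move: g; rewrite rR // => /andP.
Qed.

(** Levels are numbered through all components: each new component starts at a fresh level, occupied
    by its root alone, and the root has the least [key] among the vertices not reached before. *)
Record bfs_root (key lev : T -> nat) (s : T) : Prop := BfsRoot {
  root_sep : forall u w, lev u < lev s -> lev s <= lev w -> ~~ G u w;
  root_single : forall u, lev u = lev s -> u = s;
  root_min : forall w, lev s <= lev w -> key s <= key w }.

Record bfs_spec (key lev : T -> nat) : Prop := BfsSpec {
  bfs_adj : forall u v, G u v -> lev v <= (lev u).+1;
  bfs_par : forall v, (exists2 u, G u v & (lev u).+1 = lev v) \/ bfs_root key lev v;
  bfs_pos : forall v, 0 < lev v;
  bfs_cont : forall v i, 0 < i <= lev v -> exists u, lev u = i }.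

Local Notation conn := (connect (adj G)).

Lemma conn_sym : connect_sym (adj G).
Proof. by apply: sym_connect_sym => u v; apply: adj_sym. Qed.

Lemma closed_adj (P : pred T) : (forall u v, G u v -> P u -> P v) ->
  forall u v, conn u v -> P u = P v.
Proof.
move=> h; apply: closed_connect => u v g; apply/idP/idP; first exact: h.
by apply: h; rewrite adj_sym.
Qed.

(** * Breadth-first layers and extremal vertices of components *)

Section Layers.
Variables key lev : T -> nat.
Hypothesis bfs : bfs_spec key lev.
Local Notation root := (bfs_root key lev).

Lemma root_low s u v : root s -> conn u v -> (lev u < lev s) = (lev v < lev s).
Proof.
move=> rs; apply: (@closed_adj (fun w => lev w < lev s)) => x y g hx.
by rewrite ltnNge; apply/negP => hy; have := root_sep rs hx hy; rewrite g.
Qed.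

Lemma root_uniq s t : root s -> root t -> conn s t -> s = t.
Proof.
move=> rs rt st; have h1 := root_low rs st; have h2 := root_low rt st.
by apply: (root_single rt); move: h1 h2; rewrite !ltnn; lia.
Qed.

Lemma root_of v : exists s, [/\ root s, conn s v & lev s <= lev v].
Proof.
elim: {v}(lev v).+1 {-2}v (ltnSn (lev v)) => // m IH v hv.
case: (bfs_par bfs v) => [[u g e]|rv]; last by exists v; rewrite connect0.
have [|s [rs cs ls]] := IH u; first by lia.
exists s; split=> //; last by lia.
by apply: connect_trans cs (connect1 g).
Qed.

Lemma root_bot s v : root s -> conn s v -> lev s <= lev v.
Proof. by move=> rs /(root_low rs); rewrite ltnn ltnNge => /esym/negbFE. Qed.

Lemma par_conn s v : root s -> conn s v -> v != s ->
  exists p, [/\ conn s p, G p v & (lev p).+1 = lev v].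
Proof.
move=> rs sv vs; case: (bfs_par bfs v) => [[p g e]|rv].
  exists p; split=> //; apply: connect_trans sv _; rewrite conn_sym; exact: connect1.
by case/eqP: vs; apply: root_uniq rv rs _; rewrite conn_sym.
Qed.

Definition npv v := #|[set w | G v w && ((lev w).+1 == lev v)]|.
Definition nnx v := #|[set w | G v w && (lev w == (lev v).+1)]|.

Section EndRep.
Variables (R : irep) (r y : T).
Hypothesis rR : is_rep R.
Hypothesis rr : root r.
Hypothesis ry : conn r y.
Hypothesis y_last : forall u w, lev u = lev y -> G u w -> lev w != (lev u).+1.
Hypothesis y_min : forall u, lev u = lev y ->
  (npv y < npv u) || (npv y == npv u) && (#|nbh G y| <= #|nbh G u|).
Hypothesis e2 : lev r + 2 <= lev y.
Hypothesis y_left : rgt R y < lft R r.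

Lemma end_top v : conn y v -> lev v <= lev y.
Proof.
move=> yv; rewrite -(@closed_adj (fun w => lev w <= lev y) _ y v yv) // => u w g hu.
by have := bfs_adj bfs g; have := @y_last u w; rewrite g; clia.
Qed.

(** Induction along parents, starting from the root: a vertex that far from [v] in level is not
    adjacent to [v], and it meets its parent on the right of [v], so it cannot lie on the left. *)
Lemma end_right v p : lev v = lev y -> conn r v -> rgt R v < lft R r -> conn r p ->
  lev p + 2 <= lev v -> rgt R v < lft R p.
Proof.
move=> lv cv vr; elim: {p}(lev p).+1 {-2}p (ltnSn (lev p)) => // m IH p hp cp lp.
have [->//|pr] := eqVneq p r.
have [q [cq g e]] := par_conn rr cp pr.
have hq : rgt R v < lft R q by apply: IH => //; clia.
have [h1 h2] := adj_lt rR g.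
have nvp : ~~ G v p.
  by apply/negP; rewrite adj_sym => h; have := bfs_adj bfs h; clia.
have vp : v != p by apply: contraTneq lp => ->; rewrite -ltnNge; clia.
by have [//|h3] := nonadj_lt rR vp nvp; have [_ _ _ hv] := lrP R v; clia.
Qed.

(** Let [z] end first in the component. It also lies in the last level, and its neighbours one level
    below are neighbours of [y], so the choice of [y] makes these sets equal. If [y] and [z] are
    adjacent, the degrees make them twins and [y] moves onto [z]. If not, the vertices with the
    interval of [y] and those ending like [z] have the same neighbours outside, and the two classes
    are exchanged. *)
Lemma end_rep_left : exists R', is_rep R' /\ forall v, conn y v -> rgt R' y <= rgt R' v.
Proof.
have yK v : conn y v -> conn r v by apply: connect_trans ry.
case: (arg_minnP (rgt R) (connect0 (adj G) y)) => z yz zmin.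
have [yz'|zy] := leqP (rgt R y) (rgt R z).
  by exists R; split=> // v /zmin; apply: leq_trans.
have nyr : y != r by apply: contraTneq e2 => ->; rewrite -ltnNge; clia.
have zr : z != r.
  by apply: contraTneq zy => ->; rewrite -leqNgt; have [_ _ _ h] := lrP R r; clia.
have zP : rgt R z < lft R r by clia.
have lz : lev z = lev y.
  apply/eqP; rewrite eqn_leq end_top //= leqNgt; apply/negP => lz.
  have [p [cp g e]] := par_conn rr (yK _ yz) zr.
  have h : rgt R y < lft R p by apply: end_right => //; clia.
  by have [h1 _] := adj_lt rR g; clia.
have par c v : G c z -> (lev c).+1 = lev y -> lev v = lev y -> conn y v -> rgt R v < lft R r ->
    lft R c <= rgt R z /\ rgt R v < rgt R c.
  move=> g lc lv yv vr; have [h1 _] := adj_lt rR g; split=> //.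
  have cc : conn r c.
    by apply: connect_trans (yK _ yz) _; apply: connect1; rewrite adj_sym.
  have cr : c != r by apply: contraTneq e2 => <-; rewrite -ltnNge; clia.
  have [p [cp g' e]] := par_conn rr cc cr.
  have h : rgt R v < lft R p by apply: end_right => //; [exact: yK|clia].
  by have [h2 _] := adj_lt rR g'; clia.
have zmin' v : conn y v -> rgt R z <= rgt R v by move/zmin.
have sub : [set w | G z w && ((lev w).+1 == lev z)] \subset [set w | G y w && ((lev w).+1 == lev y)].
  apply/subsetP => c; rewrite !inE lz => /andP[g /eqP lc]; rewrite lc eqxx andbT.
  rewrite adj_sym in g; have [h1 h2] := par c y g lc erefl (connect0 _ _) y_left.
  have cy : c != y by apply/eqP => e; move: lc; rewrite e; clia.
  rewrite adj_sym rR //; have [_ _ _ hy] := lrP R y; clia.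
have pvE : npv z = npv y /\ forall c, (lev c).+1 = lev y -> G y c = G z c.
  have le1 := subset_leq_card sub.
  have le2 : npv y <= npv z by have := y_min lz; clia.
  have eqs : [set w | G z w && ((lev w).+1 == lev z)] = [set w | G y w && ((lev w).+1 == lev y)].
    by apply/eqP; rewrite eqEcard sub.
  split; first by rewrite /npv eqs.
  by move=> c lc; have /setP/(_ c) := eqs; rewrite !inE lz lc eqxx !andbT.
have [pe prevE] := pvE.
have degE : #|nbh G y| <= #|nbh G z| by have := y_min lz; rewrite pe; clia.
have yzne : y != z by apply: contraTneq zy => ->; rewrite ltnn.
case: (boolP (G y z)) => gyz.
  have zsub w : w != y -> G z w -> G y w.
    move=> wy g; have yw : conn y w by apply: connect_trans yz (connect1 g).
    have [h1 h2] := adj_lt rR g; have [h3 h4] := adj_lt rR gyz.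
    rewrite rR 1?eq_sym //; have := zmin' _ yw; clia.
  have tw w : w != y -> w != z -> G y w = G z w.
    have s1 : nbh G z :\ y \subset nbh G y :\ z.
      apply/subsetP => x; rewrite !inE => /andP[xy g]; rewrite zsub // andbT.
      by apply: contraTneq g => ->; rewrite adj_irr.
    have e1 : nbh G z :\ y = nbh G y :\ z.
      apply/eqP; rewrite eqEcard s1 /=.
      have := cardsD1 y (nbh G z); have := cardsD1 z (nbh G y).
      by rewrite !inE [G z y]adj_sym gyz; move: degE; clia.
    by move=> wy wz; have /setP/(_ w) := e1; rewrite !inE wy wz.
  exists (IRep (ix R \o [fun v => v with y |-> z]) (io1 R \o [fun v => v with y |-> z])
    (io2 R \o [fun v => v with y |-> z])); split; last first.
    move=> v yv; rewrite -[rgt _ y]/(rgt R (if y == y then z else y)) eqxx.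
    by rewrite -[rgt _ v]/(rgt R (if v == y then z else v)); apply: zmin'; case: ifP.
  apply: rep_pullback => // u v uv /=.
  have [eu|nu] := eqVneq u y; have [ev|nv] := eqVneq v y.
  - by rewrite eu ev eqxx in uv.
  - by rewrite eu; have [e|ne] := eqVneq z v; [rewrite -e gyz|rewrite tw // eq_sym].
  - by rewrite ev; have [->|ne] := eqVneq u z; [rewrite adj_sym gyz|rewrite ![G u _]adj_sym tw].
  - by rewrite (negPf uv).
have zlty : rgt R z < lft R y.
  by have [h|//] := nonadj_lt rR yzne gyz; have [_ _ _ h'] := lrP R z; clia.
(* A parent [c0] of [z] extends beyond [y] on both sides, so [inside_num] applies: [y] is open, [c0]
   is closed with the same endpoints, and [z] ends at their left endpoint. The same holds for any
   vertex placed like [y]. *)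
have [c0 [cc0 gc0 lc0]] := par_conn rr (yK _ yz) zr.
rewrite lz in lc0.
have num v : conn y v -> lev v = lev y -> rgt R v < lft R r -> rgt R z < lft R v ->
    [/\ lft R v = (2 * ix R c0).+1, (rgt R v).+1 = 2 * ix R c0 + 2 * U & rgt R z = 2 * ix R c0].
  move=> yv lv vr zv; have [h1 h2] := par c0 v gc0 lc0 lv yv vr.
  by have := lrP R v; have := lrP R c0; move: zv h1 h2; apply: inside_num.
have [ny1 ny2 nz] := num y (connect0 _ _) erefl y_left zlty.
pose A v := [&& conn y v, lft R v == lft R y & rgt R v == rgt R y].
pose D v := conn y v && (rgt R v == rgt R z).
have Ay : A y by rewrite /A connect0 !eqxx.
have Dz : D z by rewrite /D yz eqxx.
have AD v : A v -> D v = false.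
  by case/and3P=> _ _ /eqP e; rewrite /D e; apply/andP => -[_ /eqP]; clia.
have cG u v : G u v -> conn y u -> conn y v.
  by move=> g h; apply: connect_trans h (connect1 g).
have GA u w : A u -> ~~ A w -> G u w = G y w.
  move=> Au Aw; have [_ /eqP e1 /eqP e2'] := and3P Au.
  have uw : u != w by apply: contraTneq Au => ->.
  have yw : y != w by apply: contraTneq Ay => ->.
  by rewrite !rR // e1 e2'.
have GD u w : D u -> ~~ D w -> G u w = G z w.
  move=> Du Dw; have [yu /eqP e1] := andP Du.
  have uw : u != w by apply: contraTneq Du => ->.
  have zw : z != w by apply: contraTneq Dz => ->.
  case: (boolP (conn y w)) => yw.
    by rewrite !rR // e1; have := zmin' _ yw; have [_ _ _ h1] := lrP R u; have [_ _ _ h2] := lrP R z; clia.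
  have n1 : G u w = false by apply: contraNF yw => /cG; apply.
  by rewrite n1; apply/esym; apply: contraNF yw => /cG; apply.
have key_eq w : ~~ A w -> ~~ D w -> G y w = G z w.
  move=> Aw Dw; have yw : y != w by apply: contraTneq Ay => ->.
  have zw : z != w by apply: contraTneq Dz => ->.
  apply/idP/idP => g.
    have cw := cG _ _ g (connect0 _ _); have tw := end_top cw.
    have := bfs_adj bfs g; rewrite adj_sym in g; have := bfs_adj bfs g => l1 l2.
    have [lw|lw] : (lev w).+1 = lev y \/ lev w = lev y by clia.
      by rewrite -prevE // adj_sym.
    have [h1 h2] := adj_lt rR g.
    have wr : rgt R w < lft R r.
      have wr : w != r by apply: contraTneq e2 => <-; rewrite -ltnNge; clia.
      have nwr : ~~ G w r by apply/negP; rewrite adj_sym => h; have := bfs_adj bfs h; clia.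
      by have [//|h] := nonadj_lt rR wr nwr; have [_ _ _ h'] := lrP R r; clia.
    apply: contraNT Aw => nzw.
    have [h3|h3] := nonadj_lt rR zw nzw; last first.
      by have := zmin' _ cw; have [_ _ _ h'] := lrP R z; clia.
    have [n1 n2 _] := num w cw lw wr h3.
    by rewrite /A cw /=; clia.
  have [h1 h2] := adj_lt rR g; have cw := cG _ _ g yz.
  have := zmin' _ cw; have : rgt R w != rgt R z by move: Dw; rewrite /D cw.
  by rewrite rR //; clia.
have AA u v : A u -> A v -> u != v -> G u v.
  move=> /and3P[_ /eqP e1 /eqP e2'] /and3P[_ /eqP e3 /eqP e4] uv.
  by rewrite rR //; have [_ _ _ h] := lrP R y; clia.
have DD u v : D u -> D v -> u != v -> G u v.
  move=> /andP[_ /eqP e1] /andP[_ /eqP e3] uv.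
  by rewrite rR //; have [_ _ _ h] := lrP R u; have [_ _ _ h'] := lrP R v; clia.
have ADn u v : A u -> D v -> G u v = false.
  move=> Au Dv; apply/negP => /(adj_lt rR)[h1 h2].
  by case/and3P: Au => _ /eqP e1 _; case/andP: Dv => _ /eqP e3; clia.
have gzy : G z y = false by rewrite adj_sym (negPf gyz).
pose f v := if A v then z else if D v then y else v.
exists (IRep (ix R \o f) (io1 R \o f) (io2 R \o f)); split; last first.
  move=> v yv; rewrite -[rgt _ y]/(rgt R (f y)) -[rgt _ v]/(rgt R (f v)) /f Ay.
  by apply: zmin'; case: ifP => // _; case: ifP => // _; rewrite connect0.
apply: rep_pullback => // u v uv; rewrite /f.
case: (boolP (A u)) => Au; case: (boolP (A v)) => Av.
- by rewrite eqxx AA.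
- case: (boolP (D v)) => Dv; first by rewrite ADn // gzy orbF eq_sym (negPf yzne).
  rewrite GA // key_eq //; have [e|//] := eqVneq z v.
  by rewrite -e Dz in Dv.
- case: (boolP (D u)) => Du; first by rewrite adj_sym ADn // (negPf yzne) (negPf gyz).
  rewrite adj_sym GA // key_eq // [G z u]adj_sym; have [e|//] := eqVneq u z.
  by rewrite e Dz in Du.
- case: (boolP (D u)) => Du; case: (boolP (D v)) => Dv.
  + by rewrite eqxx DD.
  + rewrite GD // -key_eq //; have [e|//] := eqVneq y v.
    by rewrite -e Ay in Av.
  + rewrite adj_sym GD // -key_eq // [G y u]adj_sym; have [e|//] := eqVneq u y.
    by rewrite e Ay in Au.
  + by rewrite (negPf uv).
Qed.

End EndRep.

(** If [y] is at least two levels above the root, it lies on one side of the root, and a mirror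
    image makes this the left side. Otherwise the root is adjacent to the whole component; having
    least degree, it forces a clique, which can be collapsed onto the interval of [y]. *)
Lemma end_rep R y : is_rep R -> (forall v, key v = #|nbh G v|) ->
  (forall u w, lev u = lev y -> G u w -> lev w != (lev u).+1) ->
  (forall u, lev u = lev y ->
    (npv y < npv u) || (npv y == npv u) && (#|nbh G y| <= #|nbh G u|)) ->
  exists R', is_rep R' /\ forall v, conn y v -> rgt R' y <= rgt R' v.
Proof.
move=> rR keyE ylast ymin; have [r [rr ry lr]] := root_of y.
have [e2|e2] := leqP (lev r + 2) (lev y).
  have nry : r != y by apply: contraTneq e2 => ->; rewrite -ltnNge; clia.
  have nadj : ~~ G r y by apply/negP => h; have := bfs_adj bfs h; clia.
  have [h|h] := nonadj_lt rR nry nadj; last exact: (@end_rep_left R r y).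
  have [R1 [N [r1 mir]]] := rep_mirror rR.
  apply: (@end_rep_left R1 r y) => //.
  by have [m1 m2] := mir r; have [m3 m4] := mir y; clia.
have cr v : conn y v -> conn r v by apply: connect_trans ry.
have top v : conn y v -> lev v <= lev y.
  move=> yv; rewrite -(@closed_adj (fun w => lev w <= lev y) _ y v yv) // => u w g hu.
  by have := bfs_adj bfs g; have := @ylast u w; rewrite g; clia.
have star v : conn y v -> v != r -> G r v.
  move=> /[dup] yv /cr rv vr; have [p [cp g e]] := par_conn rr rv vr.
  suff <- : p = r by [].
  by apply: (root_single rr); have := top _ yv; have := root_bot rr cp; clia.
have clique u v : conn y u -> conn y v -> u != v -> G u v.
  move=> yu yv uv.
  have sub w : conn y w -> nbh G w \subset [set x | conn y x] :\ w.
    move=> yw; apply/subsetP => x; rewrite !inE => g; rewrite (connect_trans yw (connect1 g)) andbT.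
    by apply: contraTneq g => ->; rewrite adj_irr.
  have nr : nbh G r = [set x | conn y x] :\ r.
    apply/eqP; rewrite eqEsubset sub; last by rewrite conn_sym.
    by apply/subsetP => x; rewrite !inE => /andP[xr yx]; apply: star.
  have degu : #|nbh G r| <= #|nbh G u|.
    by rewrite -!keyE; apply: (root_min rr); apply: root_bot rr (cr _ yu).
  have : nbh G u = [set x | conn y x] :\ u.
    apply/eqP; rewrite eqEcard sub //=; move: degu; rewrite nr.
    have := cardsD1 r [set x | conn y x]; have := cardsD1 u [set x | conn y x].
    by rewrite !inE yu conn_sym ry; clia.
  by move/setP/(_ v); rewrite !inE eq_sym uv yv.
pose f v := if conn y v then y else v.
exists (IRep (ix R \o f) (io1 R \o f) (io2 R \o f)); split; last first.
  by move=> v yv; rewrite -[rgt _ y]/(rgt R (f y)) -[rgt _ v]/(rgt R (f v)) /f yv connect0.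
apply: rep_pullback => // u v uv; rewrite /f.
have cG a b : G a b -> conn y a -> conn y b by move=> g h; apply: connect_trans h (connect1 g).
case: (boolP (conn y u)) => cu; case: (boolP (conn y v)) => cv.
- by rewrite eqxx clique.
- have [e|_] := eqVneq y v; first by rewrite -e connect0 in cv.
  by rewrite (contraNF (fun g => cG _ _ g cu) cv) (contraNF (fun g => cG _ _ g (connect0 _ y)) cv).
- have [e|_] := eqVneq u y; first by rewrite e connect0 in cu.
  rewrite ![G u _]adj_sym.
  by rewrite (contraNF (fun g => cG _ _ g cv) cu) (contraNF (fun g => cG _ _ g (connect0 _ y)) cu).
- by rewrite (negPf uv).
Qed.

Definition star R := forall s v, root s -> lev s <= lev v -> rgt R s <= rgt R v.

(** Each component gets a representation in which its root ends first. The components are laid out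
    in the order of the levels of their roots, with offsets in multiples of [BIG], which exceeds the
    extent of each. *)
Lemma star_rep (flag : pred T) :
  (forall y, flag y -> exists R', is_rep R' /\ forall v, conn y v -> rgt R' y <= rgt R' v) ->
  (forall s, root s -> flag s) -> exists R, is_rep R /\ star R.
Proof.
move=> hf rf; have [s sP] := choice root_of.
have hs v : exists R', is_rep R' /\ forall w, conn (s v) w -> rgt R' (s v) <= rgt R' w.
  by apply: hf; apply: rf; case: (sP v).
have [F FP] := choice hs.
have seq u v : conn u v -> s u = s v.
  move=> uv; have [r1 c1 _] := sP u; have [r2 c2 _] := sP v.
  apply: root_uniq r1 r2 _; apply: connect_trans c1 (connect_trans uv _).
  by rewrite conn_sym.
have ss v : s (s v) = s v by apply: seq; case: (sP v).
pose N := \max_(p : T * T) ix (F p.1) p.2.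
have hN u v : ix (F u) v <= N by apply: (leq_bigmax (F := fun p : T * T => ix (F p.1) p.2) (u, v)).
pose BIG := N + U + 1.
pose R := IRep (fun v => ix (F (s v)) v + BIG * lev (s v)) (fun v => io1 (F (s v)) v)
  (fun v => io2 (F (s v)) v).
have lE v : lft R v = lft (F (s v)) v + 2 * (BIG * lev (s v)) by rewrite /lft /=; clia.
have rE v : rgt R v = rgt (F (s v)) v + 2 * (BIG * lev (s v)).
  by rewrite /rgt /=; case: (io2 _ _) => /=; clia.
have far u v : lev (s u) < lev (s v) -> rgt R u < lft R v.
  move=> h; rewrite lE rE; have [_ _ a1 _] := lrP (F (s u)) u; have [b1 _ _ _] := lrP (F (s v)) v.
  have := hN (s u) u; have : BIG * (lev (s u)).+1 <= BIG * lev (s v) by rewrite leq_mul2l h orbT.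
  by rewrite mulnS {1}/BIG; clia.
exists R; split.
  move=> u v uv; have [e|ne] := eqVneq (s u) (s v).
    have [rF _] := FP (s v).
    by rewrite !lE !rE e rF // !leq_add2r.
  have -> : G u v = false by apply: contraNF ne => g; apply/eqP/seq/connect1.
  have : lev (s u) != lev (s v).
    by have [rv _ _] := sP v; apply: contraNneq ne => e; apply/eqP; apply: (root_single rv).
  by rewrite neq_ltn => /orP[] /far h; clia.
move=> r v rr lv; have [rsv csv lsv] := sP v; have [rsr csr lsr] := sP r.
have er : s r = r by apply: root_uniq rsr rr csr.
have [e|ne] := eqVneq (s v) r.
  have [_ h] := FP r; rewrite er in h.
  by rewrite !rE er e leq_add2r; apply: h; rewrite -e.
have h : lev r <= lev (s v) by have := root_low rr csv; clia.
have : lev r != lev (s v) by apply: contraNneq ne => e; apply/eqP; apply: (root_single rr).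
move=> ne'; have lt : lev (s r) < lev (s v) by rewrite er; clia.
by have := far _ _ lt; have [_ _ _ h'] := lrP R v; clia.
Qed.

End Layers.
End Rep.

(** * From layers to columns *)

Section Columns.
Variables (T : finType) (G : sgraph T) (U : nat).
Hypothesis U_gt0 : 0 < U.
Variables (key lev idx : T -> nat) (n : nat).
Hypothesis bfs : bfs_spec G key lev.
Hypothesis nE : n = #|T|.
Hypothesis idx_lt : forall v, idx v < n.
Hypothesis idx_inj : injective idx.
Local Notation root := (bfs_root G key lev).
Local Notation irep := (irep T).
Local Notation is_rep := (is_rep G U).
Local Notation rgt := (rgt U).
Local Notation star := (star G U key lev).
Local Notation npv := (npv G lev).
Local Notation nnx := (nnx G lev).
Local Notation lrP := (lrP U_gt0).
Local Notation nonadj_lt := (@nonadj_lt T G U).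
Local Notation adj_lt := (@adj_lt T G U).

Section Star.
Variable R : irep.
Hypothesis rR : is_rep R.
Hypothesis sR : star R.

(** Induction on the level of [u]. A root ends first by [star]. Otherwise the parent of [u] is not
    adjacent to [v] and lies to its left, so [u], which meets the parent, cannot lie to the right of
    [v]. *)
Lemma next_lt u v : lev u < lev v -> ~~ G u v -> rgt R u < lft R v.
Proof.
elim: {u}(lev u).+1 {-2}u (ltnSn (lev u)) v => // m IH u hu v uv nuv.
have ne : u != v by apply: contraTneq uv => ->; rewrite ltnn.
have [//|h] := nonadj_lt rR ne nuv.
case: (bfs_par bfs u) => [[p g e]|ru]; last first.
  by have := sR ru (ltnW uv); have [_ _ _ h'] := lrP R u; clia.
have npv' : ~~ G p v by apply/negP => h'; have := bfs_adj bfs h'; clia.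
have h1 : rgt R p < lft R v by apply: IH => //; clia.
by have [h2 h3] := adj_lt rR g; have [_ _ _ h'] := lrP R v; clia.
Qed.

Lemma far_lt u v : lev u + 2 <= lev v -> rgt R u < lft R v.
Proof.
move=> uv; apply: next_lt; first by clia.
by apply/negP => h; have := bfs_adj bfs h; clia.
Qed.

(** Let [c] be a parent of [w] and [c0] one of [c]. Then [c0] lies left of [u], and [c] meets both
    [c0] and [w], so it contains [u] strictly and [inside_num] fixes the endpoints. A root could not
    play the part of [c], since it would end no later than [u]. *)
Lemma claw u w : lev u = lev w -> u != w -> rgt R u < lft R w -> exists x c c0,
  [/\ [/\ (lev c).+1 = lev u, lev c0 + 2 = lev u & ~ root c],
      lft R u = (2 * x).+1, (rgt R u).+1 = 2 * x + 2 * U, lft R w = 2 * x + 2 * U &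
      rgt R c0 = 2 * x /\ rgt R c = 2 * x + 2 * U].
Proof.
move=> luw uw lt.
case: (bfs_par bfs w) => [[c g e]|rw]; last by case/eqP: uw; apply: (root_single rw).
have [h1 h2] := adj_lt rR g.
case: (bfs_par bfs c) => [[c0 g0 e0]|rc]; last first.
  by have := sR rc (_ : lev c <= lev u); clia.
have nrc : ~ root c.
  move=> rc; have h : lev c0 < lev c by clia.
  by have := root_sep rc h (leqnn _); rewrite g0.
have far : rgt R c0 < lft R u by apply: far_lt; clia.
have [h3 h4] := adj_lt rR g0.
have h5 : rgt R u < rgt R c by clia.
have [n1 n2 n3] : [/\ lft R u = (2 * ix R c).+1, (rgt R u).+1 = 2 * ix R c + 2 * U &
    rgt R c0 = 2 * ix R c].
  by have := lrP R u; have := lrP R c; move: far h4 h5; apply: inside_num.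
have [_ _ b3 _] := lrP R c.
exists (ix R c), c, c0; split=> //; first by split=> //; clia.
  by clia.
by split=> //; clia.
Qed.

End Star.

Definition nun v := #|[set w | [&& lev w == lev v, w != v & ~~ G v w]]|.
(** Lexicographic: first many neighbours in the next level, then few in the previous one, then the
    index. The minimum is meant to pick a vertex in the right part of a level that is not a
    clique. *)
Definition zprio v := ((n - nnx v) * n.+1 + npv v) * n.+1 + idx v.
Definition isz v := (0 < nun v) &&
  (#|[set u | [&& lev u == lev v, 0 < nun u & zprio u < zprio v]]| == 0).
(** The nonneighbours of the chosen vertex in its level. After an adjustment of the representation
    they lie to its left, and they move one column back. *)
Definition isA v := [exists z, [&& lev z == lev v, isz z, z != v & ~~ G v z]].

Lemma nunP v : reflect (exists w, [/\ lev w = lev v, w != v & ~~ G v w]) (0 < nun v).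
Proof.
apply: (iffP idP) => [|[w [h1 h2 h3]]].
  by case/card_gt0P=> w; rewrite inE => /and3P[/eqP h1 h2 h3]; exists w.
by apply/card_gt0P; exists w; rewrite inE h1 eqxx h2 h3.
Qed.

Lemma isz_min z u : isz z -> lev u = lev z -> 0 < nun u -> zprio z <= zprio u.
Proof.
case/andP=> _ /eqP/cards0_eq e lu nu; rewrite leqNgt; apply/negP => h.
by have /setP/(_ u) := e; rewrite !inE lu eqxx nu h.
Qed.

Lemma zprio_inj u v : zprio u = zprio v -> u = v.
Proof.
move=> e; apply: idx_inj; move: e; rewrite /zprio.
move: (_ + npv u) (_ + npv v) (idx_lt u) (idx_lt v) => a b.
move: (idx u) (idx v) => i j hi hj e.
have : (a * n.+1 + i) %% n.+1 = (b * n.+1 + j) %% n.+1 by rewrite e.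
by rewrite !modnMDl !modn_small //; apply: leq_trans (leqnSn n).
Qed.

Lemma isz_uniq z z' : isz z -> isz z' -> lev z = lev z' -> z = z'.
Proof.
move=> hz hz' e; apply: zprio_inj; apply/eqP; rewrite eqn_leq.
by rewrite !isz_min //; [case/andP: hz|case/andP: hz'].
Qed.

Lemma isz_ex v : 0 < nun v -> exists2 z, isz z & lev z = lev v.
Proof.
move=> nv; pose P := [pred u | (lev u == lev v) && (0 < nun u)].
have Pv : P v by rewrite /= eqxx.
case: (arg_minnP zprio Pv) => z /andP[/eqP lz nz] zmin; exists z => //.
rewrite /isz nz /= cards_eq0; apply/eqP/setP => u; rewrite !inE.
by apply/negP => /and3P[/eqP lu nu]; rewrite ltnNge zmin //= lu lz eqxx.
Qed.

Section Swap.
Variable R : irep.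
Hypothesis rR : is_rep R.
Hypothesis sR : star R.

(** The chosen vertex lies in the left part of its level, against the intention. Then its class [Lo]
    and its nonneighbours [Up] have to be exchanged. *)
Definition bad z := isz z &&
  [exists v, [&& lev v == lev z, v != z, ~~ G v z & rgt R z < lft R v]].
Definition Up z v := [&& lev v == lev z, v != z & ~~ G v z].
Definition Lo z v := [&& lev v == lev z, lft R v == lft R z & rgt R v == rgt R z].

Lemma bad_uniq z z' : bad z -> bad z' -> lev z = lev z' -> z = z'.
Proof. by move=> /andP[h _] /andP[h' _]; apply: isz_uniq. Qed.

Lemma badP z : bad z -> exists x c,
  [/\ lft R z = (2 * x).+1, (rgt R z).+1 = 2 * x + 2 * U, (lev c).+1 = lev z,
      rgt R c = 2 * x + 2 * U & forall v, Up z v -> lft R v = 2 * x + 2 * U].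
Proof.
case/andP=> _ /existsP[v /and4P[/eqP lv vz _ lt]].
have zv : z != v by rewrite eq_sym.
have [x [c [c0 [[l1 l2 _] n1 n2 _ [_ n4]]]]] := claw rR sR (esym lv) zv lt.
exists x, c; split=> // u /and3P[/eqP lu uz nuz].
have [h|h] := nonadj_lt rR uz nuz.
  have [x' [c' [c0' [_ _ _ e _]]]] := claw rR sR lu uz h.
  by clia.
have zu : z != u by rewrite eq_sym.
have [x' [c' [c0' [_ m1 _ m3 _]]]] := claw rR sR (esym lu) zu h.
by clia.
Qed.

Lemma up_lt z v : bad z -> Up z v -> rgt R z < lft R v.
Proof. by move=> hb hu; have [x [c [n1 n2 _ _ h]]] := badP hb; have := h _ hu; clia. Qed.

Lemma up_not_lo z v : bad z -> Up z v -> ~~ Lo z v.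
Proof.
move=> hb hu; apply/negP => /and3P[_ /eqP e _]; have := up_lt hb hu.
by have [_ _ _ h] := lrP R z; clia.
Qed.

Lemma lo_self z : Lo z z. Proof. by rewrite /Lo !eqxx. Qed.

Lemma up_ex z : bad z -> exists v, Up z v.
Proof. by case/andP=> _ /existsP[v /and4P[h1 h2 h3 _]]; exists v; rewrite /Up h1 h2. Qed.

Lemma lo_clique z u v : Lo z u -> Lo z v -> u != v -> G u v.
Proof.
move=> /and3P[_ /eqP a1 /eqP a2] /and3P[_ /eqP b1 /eqP b2] uv.
by rewrite rR //; have [_ _ _ h] := lrP R z; clia.
Qed.

Lemma up_clique z u v : bad z -> Up z u -> Up z v -> u != v -> G u v.
Proof.
move=> hb hu hv uv; have [x [c [_ _ _ _ h]]] := badP hb.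
rewrite rR // (h _ hu) (h _ hv).
by have [_ _ _ h1] := lrP R u; have [_ _ _ h2] := lrP R v; move: h1 h2; rewrite (h _ hu) (h _ hv); clia.
Qed.

Lemma lo_up z u v : bad z -> Lo z u -> Up z v -> G u v = false.
Proof.
move=> hb /and3P[_ _ /eqP a] hv; apply/negP => /(adj_lt rR)[_ h].
by have := up_lt hb hv; clia.
Qed.

(** Outside [Up], a nonneighbour of a vertex of [Up] would be the left member of a claw at the same
    place as [z], hence would have the interval of [z]. *)
Lemma other_adj z w u : bad z -> lev w = lev z -> ~~ Lo z w -> ~~ Up z w ->
  Lo z u || Up z u -> G w u.
Proof.
move=> hb lw nlo nup.
have wz : w != z by apply: contraNneq nlo => ->; apply: lo_self.
have gwz : G w z by move: nup; rewrite /Up lw eqxx wz /= negbK.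
case/orP=> [lo|up].
  have wu : w != u by apply: contraNneq nlo => ->.
  by have [_ /eqP e1 /eqP e2] := and3P lo; rewrite rR // e1 e2 -rR.
have wu : w != u by apply: contraNneq nup => ->.
have lu : lev w = lev u by have [/eqP e _ _] := and3P up; rewrite lw.
have [x [c [n1 n2 _ _ hup]]] := badP hb; have eu := hup _ up.
apply: contraNT nlo => nwu; have [h|h] := nonadj_lt rR wu nwu.
  have [x' [c' [c0' [_ m1 m2 m3 _]]]] := claw rR sR lu wu h.
  by rewrite /Lo lw eqxx /=; clia.
have uw : u != w by rewrite eq_sym.
have [x' [c' [c0' [_ m1 m2 m3 _]]]] := claw rR sR (esym lu) uw h.
by clia.
Qed.

(** As [z] ends before a vertex of the previous level, it has no neighbour in the next level. Since
    [z] was preferred, no vertex of [Up] has one either, nor fewer neighbours in the previous level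
    than [z]. Conversely, those neighbours are neighbours of [z], so the sets agree. *)
Lemma special_out z v w : bad z -> Lo z v || Up z v -> lev w != lev z -> G v w = G z w.
Proof.
move=> hb sp lw.
have lv : lev v = lev z by case/orP: sp => /and3P[/eqP].
have [x [c [n1 n2 lc n4 hup]]] := badP hb.
have nz : nnx z = 0.
  apply/eqP; rewrite cards_eq0; apply/eqP/setP => t; rewrite !inE.
  apply/negP => /andP[/(adj_lt rR)[_ h] /eqP lt].
  by have := @far_lt R rR sR c t; clia.
have szT (P : pred T) : #|[set t | P t]| <= n by rewrite nE max_card.
case/orP: sp => [lo|up].
  have [_ /eqP e1 /eqP e2] := and3P lo.
  have vw : v != w by apply: contraNneq lw => <-; rewrite lv.
  have zw : z != w by apply: contraNneq lw => <-.
  by rewrite !rR // e1 e2.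
have [_ vz nvz] := and3P up.
have nv : 0 < nun v by apply/nunP; exists z; rewrite lv eq_sym.
have [isz_z _] := andP hb.
have := isz_min isz_z lv nv; rewrite /zprio nz subn0 => hmin.
have pz : npv z <= n by apply: szT.
have pv : npv v <= n by apply: szT.
have nnv : nnx v = 0 /\ npv z <= npv v.
  have xv : nnx v <= n by apply: szT.
  have [j1 j2] : idx v < n /\ idx z < n by split.
  move: hmin pz pv xv j1 j2; move: (nnx v) (npv z) (npv v) (idx z) (idx v) => a b d i j.
  move=> hmin hb' hd ha hj hi.
  have k1 : n * n.+1 + b <= (n - a) * n.+1 + d.
    rewrite leqNgt; apply/negP => k2.
    have : ((n - a) * n.+1 + d).+1 * n.+1 <= (n * n.+1 + b) * n.+1 by rewrite leq_mul2r k2 orbT.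
    by rewrite mulSn; lia.
  have a0 : a = 0.
    case: a ha k1 {hmin} => // a ha k1.
    have : (n - a.+1).+1 * n.+1 <= n * n.+1 by rewrite leq_mul2r; apply/orP; right; lia.
    by rewrite mulSn; lia.
  by split=> //; move: k1; rewrite a0 subn0; lia.
have [nv0 pzv] := nnv.
have sub : [set t | G v t && ((lev t).+1 == lev v)] \subset [set t | G z t && ((lev t).+1 == lev z)].
  apply/subsetP => c'; rewrite !inE lv => /andP[g /eqP lc']; rewrite lc' eqxx andbT.
  rewrite adj_sym in g; have [h1 h2] := adj_lt rR g.
  have eu := hup _ up.
  have zc : z != c' by apply/eqP => e; move: lc'; rewrite -e; clia.
  case: (bfs_par bfs c') => [[c0 g0 e0]|rc]; last first.
    by have := sR rc (_ : lev c' <= lev z); clia.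
  have [h3 h4] := adj_lt rR g0.
  have h5 : rgt R c0 < lft R z by apply: far_lt => //; clia.
  by rewrite rR //; clia.
have eqs : [set t | G v t && ((lev t).+1 == lev v)] = [set t | G z t && ((lev t).+1 == lev z)].
  by apply/eqP; rewrite eqEcard sub.
case: (eqVneq (lev w).+1 (lev z)) => [e|ne1].
  by have /setP/(_ w) := eqs; rewrite !inE lv e eqxx !andbT.
case: (eqVneq (lev w) (lev z).+1) => [e|ne2].
  move: nv0 nz => /eqP; rewrite cards_eq0 => /eqP/setP/(_ w).
  rewrite !inE lv e eqxx andbT => -> /eqP; rewrite cards_eq0 => /eqP/setP/(_ w).
  by rewrite !inE e eqxx andbT => ->.
have nG u : lev u = lev z -> G u w = false.
  move=> lu; apply/negP => g; have := bfs_adj bfs g; rewrite adj_sym in g.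
  by have := bfs_adj bfs g; clia.
by rewrite !nG.
Qed.

(** Not a permutation: [Lo] goes to a single vertex of [Up], and [Up] goes to [z]. This suffices for
    [rep_pullback] because both are cliques. *)
Definition swp v : T :=
  if [pick z | bad z && (lev z == lev v)] is Some z then
    if Lo z v then odflt v [pick u | Up z u] else if Up z v then z else v
  else v.

Lemma swpP v : (swp v = v /\ forall z, bad z -> lev z = lev v -> ~~ Lo z v && ~~ Up z v) \/
  exists z, [/\ bad z, lev z = lev v & Lo z v && Up z (swp v) || Up z v && (swp v == z)].
Proof.
rewrite /swp; case: pickP => [z /andP[hb /eqP lz]|no]; last first.
  by left; split=> // z hb lz; have := no z; rewrite hb lz eqxx.
case: (boolP (Lo z v)) => lo.
  right; exists z; split=> //; case: pickP => [u' hu'|no]; first by rewrite lo hu'.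
  by have [u hu] := up_ex hb; rewrite no in hu.
case: (boolP (Up z v)) => up; first by right; exists z; rewrite up eqxx orbT.
by left; split=> // z' hb' lz'; rewrite (bad_uniq hb' hb) ?lo ?lz.
Qed.

Lemma swp_lev v : lev (swp v) = lev v.
Proof.
case: (swpP v) => [[->]//|[z [hb lz /orP[/andP[_ /and3P[/eqP]]|/andP[_ /eqP->]]]]] //.
by rewrite lz.
Qed.

Lemma swp_out v w : lev w != lev v -> G v w = G (swp v) w.
Proof.
move=> lw; case: (swpP v) => [[->]//|[z [hb lz h]]]; rewrite -lz in lw.
have s1 : Lo z v || Up z v by case/orP: h => /andP[-> _]; rewrite ?orbT.
have s2 : Lo z (swp v) || Up z (swp v).
  by case/orP: h => /andP[_] => [->|/eqP->]; rewrite ?orbT ?lo_self.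
by rewrite (special_out hb s1 lw) (special_out hb s2 lw).
Qed.

Lemma swap_rep : exists R', [/\ is_rep R', star R' &
  forall z v, isz z -> lev v = lev z -> v != z -> ~~ G v z -> rgt R' v < lft R' z].
Proof.
exists (IRep (ix R \o swp) (io1 R \o swp) (io2 R \o swp)); split.
- apply: rep_pullback => // u v uv.
  case: (eqVneq (lev u) (lev v)) => [e|ne]; last first.
    have ne' : swp u == swp v = false.
      by apply/negP => /eqP e; case/eqP: ne; rewrite -(swp_lev u) e swp_lev.
    rewrite ne' /= swp_out 1?eq_sym // adj_sym swp_out 1?adj_sym //.
    by rewrite swp_lev.
  case: (swpP u) => [[eu nu]|[z [hb lz hu]]].
    case: (swpP v) => [[ev nv]|[z [hb lz hv]]]; first by rewrite eu ev (negPf uv).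
    have lzu : lev z = lev u by rewrite lz e.
    have /andP[n1 n2] := nu z hb lzu.
    have s1 : Lo z v || Up z v by case/orP: hv => /andP[-> _]; rewrite ?orbT.
    have s2 : Lo z (swp v) || Up z (swp v).
      by case/orP: hv => /andP[_] => [->|/eqP->]; rewrite ?orbT ?lo_self.
    by rewrite eu !(other_adj hb (esym lzu) n1 n2) ?orbT.
  have lzv : lev z = lev v by rewrite lz.
  have s1 : Lo z u || Up z u by case/orP: hu => /andP[-> _]; rewrite ?orbT.
  have s2 : Lo z (swp u) || Up z (swp u).
    by case/orP: hu => /andP[_] => [->|/eqP->]; rewrite ?orbT ?lo_self.
  case: (swpP v) => [[ev nv]|[z' [hb' lz' hv]]].
    have /andP[n1 n2] := nv z hb lzv.
    by rewrite ev adj_sym [G _ v]adj_sym !(other_adj hb (esym lzv) n1 n2) ?orbT.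
  have ez : z' = z by apply: bad_uniq => //; rewrite lz' lzv.
  rewrite {}ez {lz' hb'} in hv.
  case/orP: hu => /andP[hu /= su]; case/orP: hv => /andP[hv sv].
  + rewrite (lo_clique hu hv uv); case: eqVneq => //= ne.
    by rewrite (up_clique hb su sv ne).
  + rewrite (lo_up hb hu hv) (eqP sv) adj_sym (lo_up hb (lo_self z) su) orbF.
    by case/and3P: su => _ /negPf->.
  + rewrite adj_sym (lo_up hb hv hu) (eqP su) (lo_up hb (lo_self z) sv) orbF eq_sym.
    by case/and3P: sv => _ /negPf->.
  + by rewrite (up_clique hb hu hv uv) (eqP su) (eqP sv) eqxx.
- move=> s v rs lsv; have es : swp s = s.
    by apply: (root_single rs); rewrite swp_lev.
  rewrite -[leqLHS]/(rgt R (swp s)) -[leqRHS]/(rgt R (swp v)) es.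
  by apply: sR => //; rewrite swp_lev.
- move=> z v hz lv vz nvz; rewrite -[ltnLHS]/(rgt R (swp v)) -[ltnRHS]/(lft R (swp z)).
  case: (boolP (bad z)) => hb.
    have upv : Up z v by rewrite /Up lv eqxx vz.
    have -> : swp v = z.
      case: (swpP v) => [[_ h]|[z' [hb' lz' h]]].
        by have := h z hb (esym lv); rewrite upv andbF.
      have ez : z' = z by apply: bad_uniq => //; rewrite lz'.
      by move: h; rewrite ez (negPf (up_not_lo hb upv)) /= => /andP[_ /eqP].
    apply: up_lt => //; case: (swpP z) => [[_ h]|[z' [hb' lz' h]]].
      by have := h z hb erefl; rewrite lo_self.
    have ez : z' = z by apply: bad_uniq.
    by move: h; rewrite ez lo_self => /orP[//|/andP[/and3P[_ /eqP]]].
  have fixed u : lev u = lev z -> swp u = u.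
    move=> lu; case: (swpP u) => [[]//|[z' [hb' lz' _]]].
    by case/negP: hb; rewrite (isz_uniq hz _ (_ : lev z = lev z')) ?lz' //; case/andP: hb'.
  rewrite !fixed //; have [//|h] := nonadj_lt rR vz nvz.
  case/negP: hb; rewrite /bad hz; apply/existsP; exists v.
  by rewrite lv eqxx vz nvz.
Qed.

End Swap.

(** The vertices moved one column back. A vertex moved out of the next level enters the column of
    [v]; a column must be a clique, so its nonneighbours there have to move too. *)
Variable M : pred T.
Hypothesis ME : forall v, M v = isA v ||
  [exists w, [&& lev w == (lev v).+1, M w & ~~ G v w]].

Section Shift.
Variable R : irep.
Hypothesis rR : is_rep R.
Hypothesis sR : star R.
Hypothesis goodz : forall z v, isz z -> lev v = lev z -> v != z -> ~~ G v z -> rgt R v < lft R z.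

(** Induction from the last level downwards. A claw gives the claim for [isA]. When [w] forces [v]
    to move, the vertex ending at the left endpoint of [w] covers [v] on the right, and its own
    parent, if there is one, plays the same part for [v]. *)
Lemma shifted v : M v -> [/\ ~ root v, (exists2 c, (lev c).+1 = lev v & rgt R v <= rgt R c) &
  (exists2 s, root s & (lev s).+1 = lev v) \/
  lft R v = (2 * ix R v).+1 /\ exists2 c0, lev c0 + 2 = lev v & rgt R c0 = 2 * ix R v].
Proof.
have notroot u c : (lev c).+1 = lev u -> rgt R u <= rgt R c -> ~ root u.
  move=> lc rc ru; have ngc : ~~ G c u by apply: (root_sep ru); clia.
  by have := next_lt rR sR (_ : lev c < lev u) ngc; have [_ _ _ h] := lrP R u; clia.
have lmax u : lev u <= \max_w lev w by apply: leq_bigmax.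
elim: {v}(\max_w lev w - lev v).+1 {-2}v (ltnSn (\max_w lev w - lev v)) => // m IH v hv.
rewrite ME => /orP[/existsP[z /and4P[/eqP lz hz zv nvz]]|/existsP[w /and3P[/eqP lw Mw nvw]]].
  have vz : v != z by rewrite eq_sym.
  have lt := goodz hz (esym lz) vz nvz.
  have [x [c [c0 [[l1 l2 nrc] n1 n2 n3 [n4 n5]]]]] := claw rR sR (esym lz) vz lt.
  have ex : ix R v = x by have [/andP[a1 a2] a3 a4 _] := lrP R v; clia.
  have rvc : rgt R v <= rgt R c by clia.
  split; [exact: notroot rvc|by exists c|right; rewrite ex; split=> //].
  by exists c0.
have lvw : lev v < lev w by clia.
have rlt := next_lt rR sR lvw nvw.
have [nrw [c lc rwc] h2] : [/\ ~ root w, (exists2 c, (lev c).+1 = lev w & rgt R w <= rgt R c) &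
  (exists2 s, root s & (lev s).+1 = lev w) \/
  lft R w = (2 * ix R w).+1 /\ exists2 c0, lev c0 + 2 = lev w & rgt R c0 = 2 * ix R w].
  by apply: IH => //; have := lmax w; clia.
case: h2 => [[s rs ls]|[lftw [c0 lc0 rc0]]].
  case: (bfs_par bfs w) => [[u g e]|//].
  have us : u = s by apply: (root_single rs); clia.
  have vs : v = s by apply: (root_single rs); clia.
  by rewrite vs -us g in nvw.
have rv0 : rgt R v <= rgt R c0 by clia.
have lc0' : (lev c0).+1 = lev v by clia.
split; [exact: notroot rv0|by exists c0|].
case: (bfs_par bfs c0) => [[p g e]|rc]; last by left; exists c0.
right; have far : rgt R p < lft R v by apply: far_lt => //; clia.
have [h3 h4] := adj_lt rR g.
have [/andP[a1 a2] a3 a4 _] := lrP R v; have [/andP[b1 b2] b3 b4 _] := lrP R c0.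
have ex : ix R v = ix R c0 by clia.
by split; [clia|exists p; clia].
Qed.

Definition scol v := lev v - M v.

Lemma scol_lev v : M v -> (scol v).+1 = lev v.
Proof. by move=> Mv; rewrite /scol Mv; have [_ [c h _] _] := shifted Mv; clia. Qed.

Lemma scol_levN v : ~~ M v -> scol v = lev v.
Proof. by rewrite /scol => /negPf->; rewrite subn0. Qed.

(** By [claw] the right member of the pair has an even left bound and a parent that is no root,
    while [shifted] gives an odd left bound or a root on the previous level. *)
Lemma shifted_not_upper u v : M v -> lev u = lev v -> u != v -> rgt R u < lft R v -> False.
Proof.
move=> Mv luv uv lt; have [x [c [c0 [[l1 l2 nrc] n1 n2 n3 _]]]] := claw rR sR luv uv lt.
have [_ _ [[s rs ls]|[lftv _]]] := shifted Mv; last by clia.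
by apply: nrc; have -> : c = s by apply: (root_single rs); clia.
Qed.

(** A moved and an unmoved vertex of one column are adjacent by the closure of [M]. Two nonadjacent
    vertices of one level form a claw: its right member cannot be moved, and its left member must
    be. *)
Lemma scol_clique u v : scol u = scol v -> u != v -> G u v.
Proof.
move=> e uv; apply: contraT => nuv.
have cross a b : M a -> ~~ M b -> scol a = scol b -> ~~ G a b -> False.
  move=> Ma Mb eab nab; have lb := scol_levN Mb; case/negP: Mb; rewrite ME.
  apply/orP; right; apply/existsP; exists a.
  by rewrite -(scol_lev Ma) eab lb eqxx Ma adj_sym nab.
case: (boolP (M u)) => Mu; case: (boolP (M v)) => Mv.
- have luv : lev u = lev v by rewrite -!scol_lev // e.
  have [h|h] := nonadj_lt rR uv nuv.
    by case: (shifted_not_upper Mv luv uv h).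
  by case: (@shifted_not_upper v u) => //; rewrite eq_sym.
- by case: (cross u v).
- by case: (cross v u) => //; rewrite adj_sym.
- have luv : lev u = lev v by rewrite -!scol_levN.
  have key_case a b : ~~ M a -> lev a = lev b -> a != b -> ~~ G a b -> rgt R a < lft R b -> False.
    move=> Ma lab ab nab lt.
    have na : 0 < nun a by apply/nunP; exists b; rewrite eq_sym.
    have [z hz lz] := isz_ex na.
    case/negP: Ma; rewrite ME; apply/orP; left; apply/existsP; exists z.
    have [x [c [c0 [[l1 l2 nrc] n1 n2 n3 [n4 n5]]]]] := claw rR sR lab ab lt.
    have [/nunP[w [lw wz nzw]] _] := andP hz.
    have zw : z != w by rewrite eq_sym.
    have nwz : ~~ G w z by rewrite adj_sym.
    have ltw := goodz hz lw wz nwz.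
    have [x' [c' [c0' [[m1 m2 mrc] k1 k2 k3 [k4 k5]]]]] := claw rR sR lw wz ltw.
    have h1 : rgt R c0 < lft R w by apply: far_lt => //; clia.
    have h2 : rgt R c0' < lft R a by apply: far_lt => //; clia.
    (* The two claws of a level sit at the same place, since each grandparent ends before the open
       interval of the other claw. So [a] lies left of [z] and is marked by [isA]. *)
    have ex : x = x' by clia.
    have za : z != a by apply/eqP => e'; move: k3; rewrite e'; clia.
    rewrite lz eqxx hz za /= rR 1?eq_sym //.
    by clia.
  have [h|h] := nonadj_lt rR uv nuv; first by case: (key_case u v).
  by case: (key_case v u) => //; rewrite 1?eq_sym 1?adj_sym.
Qed.

Lemma scol_adj u v : G u v -> scol v <= (scol u).+1.
Proof.
move=> g; have l1 := bfs_adj bfs g.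
case: (boolP (M u)) => Mu; case: (boolP (M v)) => Mv; rewrite ?(scol_levN Mv) ?(scol_levN Mu).
- by have := scol_lev Mu; have := scol_lev Mv; clia.
- have := scol_lev Mu => e; rewrite leqNgt; apply/negP => h.
  have [_ [c lc rc] _] := shifted Mu.
  have h1 : rgt R c < lft R v by apply: far_lt => //; clia.
  by have [_ h2] := adj_lt rR g; clia.
- by have := scol_lev Mv; clia.
- by [].
Qed.

Lemma scol_nonadj u w : scol w = (scol u).+1 -> ~~ G u w -> rgt R u < lft R w.
Proof.
move=> e nuw; have [lt|ge] := ltnP (lev u) (lev w); first exact: next_lt.
case: (boolP (M u)) => Mu; last first.
  by move: e; rewrite (scol_levN Mu) /scol; case: (M w); clia.
have eu := scol_lev Mu.
have luw : lev w = lev u by move: e ge eu; rewrite /scol; case: (M w); clia.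
have uw : u != w by apply/eqP => e'; move: e; rewrite e'; clia.
have [//|h] := nonadj_lt rR uw nuw.
by case: (shifted_not_upper Mu luw _ h); rewrite eq_sym.
Qed.

Lemma scol_pos v : 0 < scol v.
Proof.
case: (boolP (M v)) => Mv; last by rewrite scol_levN //; apply: bfs_pos bfs _.
have := scol_lev Mv; have [_ [c lc _] _] := shifted Mv; have := bfs_pos bfs c; clia.
Qed.

(** If an edge leads from level [i] to the next, its lower end stays, since a moved vertex ends no
    later than some vertex of the previous level. Otherwise nothing in level [i] moves by
    propagation, and the chosen vertex of the level stays. *)
Lemma scol_cont v i : 0 < i <= scol v -> exists u, scol u = i.
Proof.
move=> hi; have hi' : 0 < i <= lev v by move: hi; rewrite /scol; clia.
have [u lu] := bfs_cont bfs hi'.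
case: (boolP [exists w, (lev w == i.+1) && [exists p, G p w && (lev p == i)]]).
  case/existsP=> w /andP[/eqP lw /existsP[p /andP[g /eqP lp]]].
  exists p; rewrite scol_levN //; apply/negP => Mp.
  have [_ [c lc rc] _] := shifted Mp.
  have h1 : rgt R c < lft R w by apply: far_lt => //; clia.
  by have [_ h2] := adj_lt rR g; clia.
move/existsPn => no.
case: (boolP (M u)) => Mu; last by exists u; rewrite scol_levN.
have noM x : lev x = i -> M x -> isA x.
  move=> lx; rewrite ME => /orP[//|/existsP[w /and3P[/eqP lw Mw _]]].
  case: (bfs_par bfs w) => [[p g e]|rw]; last by have [nr _ _] := shifted Mw.
  by case/negP: (no w); rewrite lw lx eqxx; apply/existsP; exists p; rewrite g; apply/eqP; clia.
have /existsP[z /and4P[/eqP lz hz _ _]] := noM _ lu Mu.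
exists z; rewrite scol_levN ?lz //; apply/negP => /(noM _ (etrans lz lu)).
case/existsP=> z' /and4P[/eqP lz' hz' nz _].
by case/eqP: nz; apply: isz_uniq.
Qed.

End Shift.
End Columns.

(** * From columns to rows *)

Section Rows.
Variables (T : finType) (G : sgraph T) (U : nat) (R : irep T) (col idx : T -> nat) (n : nat).
Hypothesis U_gt0 : 0 < U.
Hypothesis rR : is_rep G U R.
Hypothesis nE : n = #|T|.
Hypothesis idx_lt : forall v, idx v < n.
Hypothesis idx_inj : injective idx.
Hypothesis col_clique : forall u v, col u = col v -> u != v -> G u v.
Hypothesis col_adj : forall u v, G u v -> col v <= (col u).+1.
Hypothesis col_nonadj : forall u w, col w = (col u).+1 -> ~~ G u w -> rgt U R u < lft R w.

Definition nextc v := [set w | G v w && (col w == (col v).+1)].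
Definition prevc v := [set w | G v w && ((col w).+1 == col v)].
(** Further right in a column means more neighbours in the next column and fewer in the previous
    one, so small keys stand for large coordinates. *)
Definition rkey v := (n - #|nextc v|) * n.+1 + #|prevc v|.
Definition rprio v := rkey v * n.+1 + (n - idx v).
(** Columns are shifted onto each other by multiples of [U]. Adjacency of consecutive columns then
    becomes comparison of these coordinates, with the open endpoints deciding ties; the maximum only
    keeps the numbers natural. *)
Definition yv v := ix R v + (\max_w col w - col v) * U.

Lemma y_step u w : col w = (col u).+1 ->
  [/\ G u w -> yv w <= yv u, ~~ G u w -> yv u <= yv w &
      yv u = yv w -> G u w = ~~ io2 R u && ~~ io1 R w].
Proof.
move=> e; have kw : col w <= \max_v col v by apply: leq_bigmax.
have uw : u != w by apply/eqP => e'; move: e; rewrite e'; lia.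
have eK : (\max_v col v - col u) * U = U + (\max_v col v - col w) * U.
  by rewrite -mulSn; congr (_ * _); lia.
rewrite /yv eK; move: ((\max_v _ - col w) * U) => t.
split=> [/(adj_lt rR)[_ h]|/(col_nonadj e) h|h].
- have [/andP[a1 _] _ _ _] := lrP U_gt0 R w; have [_ _ a3 _] := lrP U_gt0 R u; clia.
- have [/andP[_ a1] _ _ _] := lrP U_gt0 R w; have [_ a2 _ _] := lrP U_gt0 R u; clia.
- have ex : ix R w = ix R u + U by clia.
  rewrite rR // /lft /rgt ex; move: (ix R u) => z; clear -U_gt0.
  by case: (io1 R u); case: (io2 R u); case: (io1 R w); case: (io2 R w); rewrite /=; lia.
Qed.

Lemma next_sub u v : col u = col v -> yv u <= yv v -> (yv u = yv v -> io2 R v -> io2 R u) ->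
  nextc u \subset nextc v.
Proof.
move=> cuv le tie; apply/subsetP => w; rewrite !inE cuv => /andP[g /eqP cw].
rewrite cw eqxx andbT; apply: contraT => ng.
have [a1 _ a3] := @y_step u w (etrans cw (congr1 S (esym cuv))).
have [_ b2 b3] := y_step cw; have e := a1 g; have e' := b2 ng.
have e1 : yv u = yv w by clia.
have e2 : yv v = yv w by clia.
move: (a3 e1) (b3 e2); rewrite g (negPf ng) => /esym/andP[o2 o1] /esym.
rewrite o1 andbT => /negbFE o2v; case/negP: o2; apply: tie => //.
by rewrite e1.
Qed.

Lemma prev_sub u v : col u = col v -> yv u <= yv v -> (yv u = yv v -> io1 R u -> io1 R v) ->
  prevc v \subset prevc u.
Proof.
move=> cuv le tie; apply/subsetP => w; rewrite !inE cuv => /andP[g /eqP cw].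
rewrite cw eqxx andbT; apply: contraT => ng; rewrite adj_sym in g; rewrite adj_sym in ng.
have [a1 _ a3] := @y_step w v (esym cw).
have [_ b2 b3] := @y_step w u (etrans cuv (esym cw)); have e := a1 g; have e' := b2 ng.
have e1 : yv w = yv v by clia.
have e2 : yv w = yv u by clia.
move: (a3 e1) (b3 e2); rewrite g (negPf ng) => /esym/andP[o2 o1] /esym.
rewrite o2 /= => /negbFE o1u; case/negP: o1; apply: tie => //.
by rewrite -e2.
Qed.

(** Neighbourhoods in the adjacent columns are nested along the coordinate, and by the signs in case
    of ties, so equal cardinalities mean equal sets. *)
Lemma class_nbrs u v : col u = col v -> #|prevc u| = #|prevc v| -> #|nextc u| = #|nextc v| ->
  nextc u = nextc v /\ prevc u = prevc v.
Proof.
move=> cuv ep eq; have [lt|gt|e] := ltngtP (yv u) (yv v).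
- split; apply/eqP; first by rewrite eqEcard next_sub ?eq //; clia.
  by rewrite eq_sym eqEcard prev_sub ?ep //; clia.
- split; apply/eqP; last by rewrite eqEcard prev_sub ?ep //; clia.
  by rewrite eq_sym eqEcard next_sub ?eq //; clia.
- have le : yv u <= yv v by rewrite e.
  have ge : yv v <= yv u by rewrite e.
  split; apply/eqP.
    case: (boolP (io2 R u)) => o.
      by rewrite eqEcard eq leqnn andbT; apply: next_sub.
    by rewrite eq_sym eqEcard eq leqnn andbT; apply: next_sub => // _; rewrite (negPf o).
  case: (boolP (io1 R u)) => o.
    by rewrite eqEcard ep leqnn andbT; apply: prev_sub.
  by rewrite eq_sym eqEcard ep leqnn andbT; apply: prev_sub => // _; rewrite (negPf o).
Qed.

(** A common representative for vertices that the program cannot tell apart. By [class_nbrs] it may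
    replace them, so coordinates become compatible with the order by [rkey]. *)
Definition canon v := odflt v [pick u | [&& col u == col v, #|prevc u| == #|prevc v| &
  #|nextc u| == #|nextc v|]].

Lemma canonP v : [/\ col (canon v) = col v, #|prevc (canon v)| = #|prevc v| &
  #|nextc (canon v)| = #|nextc v|].
Proof. by rewrite /canon; case: pickP => [u /and3P[/eqP h1 /eqP h2 /eqP h3]|]. Qed.

Lemma canon_eq u v : col u = col v -> #|prevc u| = #|prevc v| -> #|nextc u| = #|nextc v| ->
  canon u = canon v.
Proof. by move=> e1 e2 e3; rewrite /canon e1 e2 e3; case: pickP => // /(_ v); rewrite !eqxx. Qed.

Lemma canon_adj u w : col w = (col u).+1 -> G (canon u) (canon w) = G u w.
Proof.
move=> e; have [cu1 cu2 cu3] := canonP u; have [cw1 cw2 cw3] := canonP w.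
have [n1 _] := class_nbrs cu1 cu2 cu3; have [_ p2] := class_nbrs cw1 cw2 cw3.
have h1 : G (canon u) w = G u w.
  by have /setP/(_ w) := n1; rewrite !inE cu1 e eqxx !andbT.
have /setP/(_ (canon u)) := p2; rewrite !inE cw1 cu1 e eqxx !andbT.
by rewrite [G (canon w) _]adj_sym [G w _]adj_sym h1.
Qed.

Definition yh v := yv (canon v).

Lemma yh_step u w : col w = (col u).+1 ->
  [/\ G u w -> yh w <= yh u, ~~ G u w -> yh u <= yh w &
      yh u = yh w -> G u w = ~~ io2 R (canon u) && ~~ io1 R (canon w)].
Proof.
move=> e; have [cu1 _ _] := canonP u; have [cw1 _ _] := canonP w.
by rewrite -canon_adj //; apply: y_step; rewrite cu1 cw1.
Qed.

Lemma yh_key u v : col u = col v -> rkey v <= rkey u -> yh u <= yh v.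
Proof.
move=> e le; rewrite leqNgt; apply/negP => lt.
have [cu1 cu2 cu3] := canonP u; have [cv1 cv2 cv3] := canonP v.
have ec : col (canon v) = col (canon u) by rewrite cu1 cv1.
have nt : yv (canon v) = yv (canon u) -> False by rewrite /yh in lt; clia.
have h1 := subset_leq_card (@next_sub (canon v) (canon u) ec (ltnW lt) (fun e => False_ind _ (nt e))).
have h2 := subset_leq_card (@prev_sub (canon v) (canon u) ec (ltnW lt) (fun e => False_ind _ (nt e))).
rewrite cu3 cv3 in h1; rewrite cu2 cv2 in h2.
have b1 : #|nextc u| <= n by rewrite nE max_card.
have b2 : #|prevc v| <= n by rewrite nE max_card.
suff [e1 e2] : #|nextc u| = #|nextc v| /\ #|prevc u| = #|prevc v|.
  by move: lt; rewrite /yh (canon_eq e e2 e1) ltnn.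
move: le h1 h2 b1 b2; rewrite /rkey; move: #|nextc u| #|nextc v| #|prevc u| #|prevc v| => a b c d.
move=> le h1 h2 b1 b2; have ab : a = b.
  apply/eqP; rewrite eqn_leq h1 andbT leqNgt; apply/negP => ba.
  have : (n - a).+1 * n.+1 <= (n - b) * n.+1 by rewrite leq_mul2r; apply/orP; right; lia.
  by rewrite mulSn; lia.
by split=> //; move: le; rewrite ab leq_add2l; lia.
Qed.

(** An arrow from [v] to [w] records that the row of [w] is at most that of [v]. Three arrows per
    vertex suffice: to the successor in its column and, with least [rprio], to a neighbour in the
    next column and to a nonneighbour in the previous one. The other inequalities follow along the
    chain of a column. *)
Variable e : rel T.
Hypothesis e_ok : forall v w, e v w -> [\/ col w = col v /\ rprio v < rprio w,
  col w = (col v).+1 /\ G v w | col v = (col w).+1 /\ ~~ G w v].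
Hypothesis e_pred : forall v u, col u = col v -> rprio v < rprio u ->
  exists p, [/\ e v p, col p = col v, rprio v < rprio p & rprio p <= rprio u].
Hypothesis e_next : forall u w, col w = (col u).+1 -> G u w ->
  exists w', [/\ e u w', col w' = col w & rprio w' <= rprio w].
Hypothesis e_prev : forall u w, col w = (col u).+1 -> ~~ G u w ->
  exists u', [/\ e w u', col u' = col u & rprio u' <= rprio u].

Lemma rprio_inj : injective rprio.
Proof.
move=> u v; rewrite /rprio => h; apply: idx_inj.
have : (rkey u * n.+1 + (n - idx u)) %% n.+1 = (rkey v * n.+1 + (n - idx v)) %% n.+1 by rewrite h.
rewrite !modnMDl !modn_small ?ltnS ?leq_subr // => h'.
by have := idx_lt u; have := idx_lt v; clia.
Qed.

Lemma rprio_key u v : rprio u < rprio v -> rkey u <= rkey v.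
Proof.
move=> h; have := leq_div2r n.+1 (ltnW h); rewrite /rprio !divnMDl //.
by rewrite !divn_small ?ltnS ?leq_subr // !addn0.
Qed.

Lemma chain_conn v u : col u = col v -> rprio v <= rprio u -> connect e v u.
Proof.
elim: {v}(rprio u - rprio v).+1 {-2}v (ltnSn (rprio u - rprio v)) => // m IH v hm cuv le.
have [eq|ne] := eqVneq (rprio v) (rprio u); first by rewrite (rprio_inj eq) connect0.
have lt : rprio v < rprio u by rewrite ltn_neqAle ne.
have [p [ep cp l1 l2]] := e_pred cuv lt.
by apply: connect_trans (connect1 ep) _; apply: IH => //; [clia|rewrite cp].
Qed.

Lemma next_conn u w : col w = (col u).+1 -> G u w -> connect e u w.
Proof.
move=> h g; have [w' [ew cw l]] := e_next h g.
by apply: connect_trans (connect1 ew) _; apply: chain_conn.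
Qed.

Lemma prev_conn u w : col w = (col u).+1 -> ~~ G u w -> connect e w u.
Proof.
move=> h g; have [w' [ew cw l]] := e_prev h g.
by apply: connect_trans (connect1 ew) _; apply: chain_conn.
Qed.

Lemma conn_yh v w : connect e v w -> yh w <= yh v.
Proof.
case/connectP=> p; elim: p v => [|x p IH] v /=; first by move=> _ ->.
case/andP=> evx hp hw; apply: leq_trans (IH _ hp hw) _.
case: (e_ok evx) => [[c lt]|[c g]|[c g]].
- by apply: yh_key => //; apply: rprio_key.
- by have [h _ _] := yh_step c; apply: h.
- by have [_ h _] := yh_step c; apply: h.
Qed.

Definition rrow v := #|connect e v|.

Lemma conn_row v w : connect e v w -> rrow w <= rrow v.
Proof.
by move=> h; apply: subset_leq_card; apply/subsetP => x; apply: connect_trans h.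
Qed.

(** The set reachable from [w] is contained in that of [v]; equal size makes them equal, so [v] is
    reachable from [w] as well. *)
Lemma conn_row_eq v w : connect e v w -> rrow w = rrow v -> yh w = yh v.
Proof.
move=> h eq; apply/eqP; rewrite eqn_leq conn_yh //=; apply: conn_yh.
have sub : connect e w \subset connect e v by apply/subsetP => x; apply: connect_trans h.
have /subset_cardP/(_ sub)/(_ v) := eq; rewrite !inE => ->.
exact: connect0.
Qed.

Definition rs2 u := [exists w, [&& G u w, col w == (col u).+1 & rrow w == rrow u]].
Definition rs1 w := [exists u, [&& G w u, (col u).+1 == col w & rrow u == rrow w]].

(** Adjacency gives a path from [u] to [v], nonadjacency one from [v] to [u], so only equal rows
    leave a doubt. Then the coordinates of all vertices involved coincide, and by [yh_step]
    adjacency is a conjunction of one condition on each end, whose truth is attested by the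
    witnesses in [rs2] and [rs1]. *)
Lemma rows_step u v : col v = (col u).+1 ->
  G u v = (rrow v < rrow u) || (rrow u == rrow v) && (rs2 u && rs1 v).
Proof.
move=> c; apply/idP/idP => [g|].
  have le := conn_row (next_conn c g); move: le; rewrite leq_eqVlt => /orP[/eqP eq|-> //].
  rewrite eq eqxx /=; apply/orP; right; apply/andP; split; apply/existsP.
    by exists v; rewrite g c eqxx eq eqxx.
  by exists u; rewrite adj_sym g c eqxx eq eqxx.
move=> h; apply: contraT => ng; have cn := prev_conn c ng; have le := conn_row cn.
case/orP: h => [h|/andP[/eqP eq /andP[/existsP[w /and3P[g1 /eqP c1 /eqP e1]]
    /existsP[u' /and3P[g2 /eqP c2 /eqP e2]]]]]; first by clia.
rewrite adj_sym in g2.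
have y1 := conn_row_eq (next_conn c1 g1) e1.
have y2 := conn_row_eq (next_conn (esym c2) g2) (esym e2).
have y3 := conn_row_eq cn eq.
have [_ _ h1] := yh_step c1; have [_ _ h2] := yh_step (esym c2); have [_ _ h3] := yh_step c.
move: (h1 (esym y1)) (h2 (esym y2)) (h3 y3).
by rewrite g1 g2 (negPf ng) => /esym/andP[-> _] /esym/andP[_ ->].
Qed.

Lemma rows_bub_adj : bub_adj G rrow col rs1 rs2.
Proof.
move=> u v; have [->|uv] := eqVneq u v; first by rewrite adj_irr.
rewrite /bub_arc /=; have [eq|ne] := eqVneq (col u) (col v); first by rewrite col_clique.
have [c|n1] := eqVneq (col u).+1 (col v).
  have -> : ((col v).+1 == col u) = false by apply/eqP; clia.
  by rewrite /= orbF; apply: rows_step.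
have [c|n2] := eqVneq (col v).+1 (col u).
  by rewrite /= adj_sym; apply: rows_step.
rewrite /=; apply/negP => g; have h1 := col_adj g.
by rewrite adj_sym in g; have h2 := col_adj g; clia.
Qed.

End Rows.

Lemma bub_adj_alpha (T : finType) (G : sgraph T) row col s1 s2 k :
  bub_adj G row col s1 s2 -> (forall j, 0 < j <= k -> exists v, col v = j) -> k <= 2 * alpha G.
Proof.
move=> adjG hcol.
have pickcol (j : 'I_(uphalf k)) : exists v, col v = (2 * j).+1.
  by apply: hcol; have := ltn_ord j; lia.
have [f fP] := choice pickcol.
have f_inj : injective f by move=> i j e; apply: ord_inj; have := fP i; rewrite e fP; lia.
suff : uphalf k <= alpha G by lia.
apply: leq_trans (_ : #|[set f j | j in 'I_(uphalf k)]| <= _).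
  by rewrite card_imset // card_ord.
apply: (leq_bigmax_cond (F := fun S : {set T} => #|S|)).
apply/forall_inP => x /imsetP[i _ ->]; apply/forall_inP => y /imsetP[j _ ->].
rewrite adjG /bub_arc !fP.
by case: (eqVneq i j) => [->|ij]; rewrite ?eqxx // ; have : (i : nat) != j by []; lia.
Qed.

(** * A normalised bubble model from integer coordinates *)

Section Bubbles.
Variables (T : finType) (G : sgraph T) (U : nat) (x : T -> nat) (cl cr : T -> bool).
Hypothesis U_gt0 : 0 < U.
Hypothesis T_gt0 : 0 < #|T|.
Definition touch u v := (x u < x v + U) || [&& x u == x v + U, cl u & cr v].
Hypothesis xP : forall u v, u != v -> G u v = touch u v && touch v u.

Lemma x_min_ex : exists v0, forall v, x v0 <= x v.
Proof.
have [v _] := card_gt0P T_gt0.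
by case: (@arg_minnP _ v xpredT x) => // v0 _ h; exists v0 => w; apply: h.
Qed.

Variable v0 : T.
Hypothesis v0P : forall v, x v0 <= x v.
Let x0 := x v0.

(** The start of the column containing coordinate [t], and its number. *)
Fixpoint gs (t : nat) : nat * nat :=
  if t is t'.+1 then
    if [exists v, x v == t] && ((gs t').1 + U <= t) then (t, (gs t').2.+1) else gs t'
  else (x0, 1).

Lemma gs_step t t' : t <= t' -> exists d, [/\ (gs t').2 = (gs t).2 + d,
  (gs t).1 + d * U <= (gs t').1 & d = 0 -> gs t' = gs t].
Proof.
move=> /subnK <-; elim: (t' - t) => [|m [d [h1 h2 h3]]]; first by exists 0; rewrite !addn0.
rewrite addSn /=; case: ifP => [/andP[_ h]|_]; last by exists d.
exists d.+1; split=> //=; first by rewrite h1 addnS.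
by rewrite mulSn; lia.
Qed.

Lemma gs_occ v : x v < (gs (x v)).1 + U.
Proof.
case e: (x v) => [|t] /=; first by rewrite /x0; lia.
have -> : [exists w, x w == t.+1] by apply/existsP; exists v; rewrite e.
by case: (leqP ((gs t).1 + U) t.+1) => h /=; lia.
Qed.

Lemma gs_low t : t < x0 + U -> gs t = (x0, 1).
Proof.
elim: t => // t IH h /=; rewrite IH /=; last by lia.
by case: ifP => // /andP[_]; lia.
Qed.

Lemma gs_le t : (gs t).1 <= maxn x0 t.
Proof.
elim: t => [|t IH] /=; first by rewrite maxn0.
by case: ifP => _ /=; lia.
Qed.

Lemma gs_start t : exists v, x v = (gs t).1 /\ gs (x v) = gs t.
Proof.
elim: t => [|t [v [h1 h2]]] /=.
  by exists v0; split=> //; apply: gs_low; rewrite -/x0; lia.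
case: ifP => [|_]; last by exists v.
move=> /[dup] c /andP[/existsP[v' /eqP e] _]; exists v'; split=> //.
by rewrite e /= c.
Qed.

Lemma gs_cont t i : 0 < i <= (gs t).2 -> exists v, (gs (x v)).2 = i.
Proof.
elim: t => [|t IH] /= hi.
  have i1 : i = 1 by lia.
  by exists v0; rewrite gs_low ?i1 // -/x0; lia.
move: hi; case: ifP => [c|_]; last exact: IH.
move=> hi; have [h|h] := leqP i (gs t).2; first by apply: IH; case/andP: hi => -> _.
have [/existsP[v' /eqP e] _] := andP c; exists v'; rewrite e /= c /=; move: hi => /=; lia.
Qed.

Definition bcol v := (gs (x v)).2.
Definition bst v := (gs (x v)).1.
Definition bk := \max_v bcol v.
Definition by_ v := x v + (bk - bcol v) * U.

Lemma bst_le v : bst v <= x v.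
Proof. by have := gs_le (x v); have := v0P v; rewrite /bst /x0; lia. Qed.

Lemma bst_eq u v : bcol u = bcol v -> bst u = bst v.
Proof.
rewrite /bcol /bst => e; have [/gs_step|/ltnW/gs_step] := leqP (x u) (x v);
  case=> d [h1 _ h3]; have d0 : d = 0 by lia.
- by rewrite h3.
- by rewrite h3.
Qed.

Lemma bst_step u v : bcol u <= bcol v -> bst u + (bcol v - bcol u) * U <= bst v.
Proof.
rewrite /bcol /bst => le; have [/gs_step[d [h1 h2 _]]|/ltnW/gs_step[d [h1 h2 h3]]] := leqP (x u) (x v).
  by rewrite h1 addKn.
have d0 : d = 0 by lia.
by rewrite h3 // subnn mul0n addn0.
Qed.

Lemma bcol_le_bk v : bcol v <= bk. Proof. exact: leq_bigmax. Qed.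

Lemma bcol_mono u v : x u <= x v -> bcol u <= bcol v.
Proof. by move=> /gs_step[d [h _ _]]; rewrite /bcol h leq_addr. Qed.

Lemma bcol_gt0 v : 0 < bcol v.
Proof. by have [d [h _ _]] := gs_step (leq0n (x v)); rewrite /bcol h. Qed.

(** Rows are ranks among the occurring values, so that none is empty. *)
Definition bvals : seq nat := sort leq (undup (map by_ (enum T))).
Definition brow v := (index (by_ v) bvals).+1.

Lemma bvals_in v : by_ v \in bvals.
Proof. by rewrite mem_sort mem_undup map_f // mem_enum. Qed.

Lemma bvals_sorted : sorted ltn bvals.
Proof. by rewrite ltn_sorted_uniq_leq sort_uniq undup_uniq sort_sorted //; apply: leq_total. Qed.

Lemma brow_lt u v : (brow u < brow v) = (by_ u < by_ v).
Proof.
rewrite /brow ltnS; have hlt a b : a \in bvals -> b \in bvals -> index a bvals < index b bvals -> a < b.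
  by move=> ha hb; apply: (sorted_ltn_index ltn_trans bvals_sorted).
have [lt|gt|e] := ltngtP (index (by_ u) bvals) (index (by_ v) bvals).
- by rewrite hlt ?bvals_in.
- by apply/esym; rewrite ltnNge ltnW // hlt ?bvals_in.
- have -> : by_ u = by_ v by rewrite -(nth_index 0 (bvals_in u)) e nth_index ?bvals_in.
  by rewrite ltnn.
Qed.

Lemma brow_eq u v : (brow u == brow v) = (by_ u == by_ v).
Proof. by rewrite !eqn_leq !(leqNgt (brow _)) !(leqNgt (by_ _)) !brow_lt. Qed.

Lemma brow_cont v i : 0 < i <= brow v -> exists u, brow u = i.
Proof.
case: i => // i /= hi; have iN : i < size bvals.
  by move: hi; rewrite /brow ltnS => hi; apply: leq_ltn_trans hi _; rewrite index_mem bvals_in.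
have : nth 0 bvals i \in map by_ (enum T) by rewrite -mem_undup -(mem_sort leq) mem_nth.
case/mapP=> u _ e; exists u; rewrite /brow -e index_uniq //.
by rewrite sort_uniq undup_uniq.
Qed.

Definition bnrow j := \max_(v | bcol v == j) brow v.

Lemma bcol_range v : 1 <= bcol v <= bk. Proof. by rewrite bcol_gt0 bcol_le_bk. Qed.
Lemma brow_range v : 1 <= brow v <= bnrow (bcol v).
Proof. by rewrite /=; apply: leq_bigmax_cond. Qed.

Definition bmodel : ububble T :=
  @UBubble T bk bnrow brow bcol cl cr T_gt0 bcol_range brow_range.

Lemma by_step u v : bcol v = (bcol u).+1 ->
  (by_ v < by_ u) = (x v < x u + U) /\ (by_ v == by_ u) = (x v == x u + U).
Proof.
move=> e; have kv := bcol_le_bk v; rewrite /by_.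
have -> : (bk - bcol u) * U = U + (bk - bcol v) * U by rewrite -mulSn; congr (_ * _); lia.
by rewrite addnA ltn_add2r eqn_add2r.
Qed.

(** Columns cut greedily are shorter than [U], hence cliques. Two columns further on, the start is
    at least [2 * U] away, out of reach. *)
Lemma bmodel_adj u v : u != v -> bcol u <= bcol v ->
  G u v = (bcol u == bcol v) || ((bcol u).+1 == bcol v) &&
    ((brow v < brow u) || (brow u == brow v) && (cr u && cl v)).
Proof.
move=> uv le; rewrite xP //.
have a1 := bst_le u; have a2 := bst_le v; have a3 := gs_occ u; have a4 := gs_occ v.
rewrite -/(bst u) in a3; rewrite -/(bst v) in a4.
have [e|ne] := eqVneq (bcol u) (bcol v).
  by rewrite /touch; have := bst_eq e; case: ltnP => //=; case: ltnP => //=; lia.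
have tuv : touch u v.
  have := bst_step le; have : 1 * U <= (bcol v - bcol u) * U by rewrite leq_mul2r; apply/orP; right; lia.
  by rewrite /touch; case: ltnP => //; lia.
rewrite tuv /=; have [e|ne'] := eqVneq (bcol u).+1 (bcol v).
  have [h1 h2] := by_step (esym e).
  by rewrite /touch /= brow_lt [brow u == _]eq_sym brow_eq h1 h2 [cr u && _]andbC.
have := bst_step le; have : 2 * U <= (bcol v - bcol u) * U by rewrite leq_mul2r; apply/orP; right; lia.
by rewrite /touch; case: ltnP => //=; [lia|]; case: eqP => //=; lia.
Qed.

Lemma bigmin_le (r : seq nat) (P : pred nat) d i : i \in r -> P i ->
  \big[minn/d]_(j <- r | P j) j <= i.
Proof.
elim: r => // a r IH; rewrite inE big_cons => /orP[/eqP<- ->|ir Pi].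
  exact: geq_minl.
by case: ifP => _; [apply: leq_trans (geq_minr _ _) _|]; apply: IH.
Qed.

Lemma btop v : (forall w, bcol w = bcol v -> brow v <= brow w) ->
  ub_top bmodel (bcol v) = brow v.
Proof.
move=> h; have rv := brow_range v; apply/eqP; rewrite eqn_leq; apply/andP; split.
  apply: bigmin_le; first by rewrite mem_index_iota ltnS.
  by apply/set0Pn; exists v; rewrite inE /= !eqxx.
rewrite /ub_top big_seq_cond; apply: (big_ind (fun m => brow v <= m)) => /=.
- by case/andP: rv.
- by move=> a b ha hb; rewrite leq_min ha.
- move=> i /andP[_ /set0Pn[w]]; rewrite inE /= => /andP[/eqP<- /eqP]; exact: h.
Qed.

Lemma bstart v : exists w, [/\ bcol w = bcol v, x w = bst v &
  forall u, bcol u = bcol v -> brow w <= brow u].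
Proof.
have [w [h1 h2]] := gs_start (x v); exists w; rewrite -/(bst v) in h1.
have cw : bcol w = bcol v by rewrite /bcol h2.
split=> // u cu; rewrite leqNgt brow_lt -leqNgt /by_ cu cw leq_add2r h1.
by rewrite -(bst_eq cu) bst_le.
Qed.

(** The starting vertex of a column lies in its top row. Consecutive starts are at least [U] apart,
    and rows are compared after shifting by [U] per column, so tops do not decrease and the first
    column contains the least row. *)
Lemma bmodelP : ub_model bmodel G.
Proof.
have hcol j : 1 <= j <= bk -> exists v, bcol v = j.
  move=> /andP[j1 j2]; have [v hv] : exists v, bk = bcol v.
    by have [v hv] := eq_bigmax bcol T_gt0; exists v.
  by apply: (@gs_cont (x v)); rewrite j1 -/(bcol v) -hv.
split.
- move=> u v; rewrite /= /ub_rel /=; have [->|uv] := eqVneq u v; first by rewrite adj_irr.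
  rewrite /= /ub_arc /= !inE /= !eqxx /=.
  have [le|/ltnW le] := leqP (bcol u) (bcol v).
    rewrite bmodel_adj //; have [e|ne] := eqVneq (bcol u) (bcol v) => //=.
    have -> : ((bcol v).+1 == bcol u) = false by apply/eqP; lia.
    by case: (_.+1 == _); rewrite /= ?orbF.
  rewrite adj_sym bmodel_adj 1?eq_sym //; have [e|ne] := eqVneq (bcol v) (bcol u) => /=.
    by [].
  have -> : ((bcol u).+1 == bcol v) = false by apply/eqP; move: ne; lia.
  by case: (_.+1 == _).
- move=> i j /= /hcol[v <-] hi.
  have [w cw hw] : exists2 w, bcol w = bcol v & bnrow (bcol v) = brow w.
    have A0 : 0 < #|[pred w | bcol w == bcol v]| by apply/card_gt0P; exists v; rewrite inE.
    by have [w /eqP h1 h2] := eq_bigmax_cond brow A0; exists w.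
  have [u hu] : exists u, brow u = i by apply: (@brow_cont w); rewrite -hw.
  by exists (bcol u); rewrite bcol_range; apply/set0Pn; exists u; rewrite inE /= hu !eqxx.
- move=> j /= /hcol[v <-]; exists (brow v); rewrite brow_range.
  by apply/set0Pn; exists v; rewrite inE /= !eqxx.
- move=> j /= /hcol[v <-].
  have A0 : 0 < #|[pred w | bcol w == bcol v]| by apply/card_gt0P; exists v; rewrite inE.
  have [w /eqP h1 h2] := eq_bigmax_cond brow A0.
  by apply/set0Pn; exists w; rewrite inE /= /bnrow h2 h1 !eqxx.
- have c0 : bcol v0 = 1 by rewrite /bcol gs_low // -/x0; lia.
  have min w : by_ v0 <= by_ w.
    have s0 : bst v0 = x0 by rewrite /bst gs_low // -/x0; lia.
    have := @bst_step v0 w; rewrite c0 => /(_ (bcol_gt0 w)); have := bst_le w.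
    have kw := bcol_le_bk w; rewrite /by_ c0 s0 -/x0.
    have -> : (bk - 1) * U = (bcol w - 1) * U + (bk - bcol w) * U.
      by rewrite -mulnDl; congr (_ * _); have := bcol_gt0 w; lia.
    by lia.
  rewrite -{1}c0 btop; last by move=> w _; rewrite leqNgt brow_lt -leqNgt.
  have [u hu] : exists u, brow u = 1 by apply: (@brow_cont v0).
  apply/eqP; rewrite eqn_leq {2}/brow andbT -hu leqNgt brow_lt -leqNgt; exact: min.
- move=> j /= hj; have [v cv] : exists v, bcol v = j by apply: hcol; lia.
  have [w cw] : exists w, bcol w = j.+1 by apply: hcol; lia.
  have [v' [a1 a2 a3]] := bstart v; have [w' [b1 b2 b3]] := bstart w.
  rewrite -cw -cv -a1 -b1 btop ?btop; last first.
  + by move=> u; rewrite a1; apply: a3.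
  + by move=> u; rewrite b1; apply: b3.
  rewrite leqNgt brow_lt -leqNgt /by_ a1 b1 a2 b2 cv cw.
  have h : bst v + U <= bst w.
    by have := @bst_step v w; rewrite cv cw subSnn mul1n; apply; lia.
  have -> : (bk - j) * U = U + (bk - j.+1) * U by rewrite -mulSn; congr (_ * _); lia.
  by lia.
Qed.

(** Columns are intervals of the coordinate and rows are monotone inside a column, so the order of
    left endpoints does not depend on where the columns are cut. This carries the group number of
    the model over to the columns that the program uses. *)
Lemma bmodel_order idx u v :
  left_lt idx (row bmodel) (Defs.col bmodel) (sgn1 bmodel) u v = left_lt idx x (fun=> 0) cl u v.
Proof.
rewrite /left_lt /= brow_lt brow_eq /by_.
have h a b : x a < x b -> bcol a < bcol b \/ bcol a = bcol b.
  by move=> /ltnW/bcol_mono; rewrite leq_eqVlt => /orP[/eqP|]; [right|left].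
have [lt|gt|e] := ltngtP (x u) (x v).
- have [->//|e] := h _ _ lt.
  by rewrite e ltnn eqxx ltn_add2r lt.
- have [h'|e] := h _ _ gt.
    have -> : (bcol u < bcol v) = false by lia.
    by have -> : (bcol u == bcol v) = false by lia.
  by rewrite e ltnn eqxx ltn_add2r eqn_add2r ltnNge (ltnW gt) /= gtn_eqF.
- have -> : bcol u = bcol v by rewrite /bcol e.
  by rewrite e !ltnn !eqxx.
Qed.

End Bubbles.

(** * From real to integer endpoints *)

Section RealRep.
Import Order.TTheory GRing.Theory Num.Theory.
Local Open Scope ring_scope.

(** Comparing [x u] with [x v + 1] needs only integer parts and the order of fractional parts. A
    fractional part may therefore be replaced by its rank, with [#|T|] as the new unit. *)
Lemma nat_rep (R : realType) (T : finType) (G : sgraph T) : (0 < #|T|)%N ->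
  mixed_unit_interval R G -> exists U, (0 < U)%N /\ exists Rp : irep T, is_rep G U Rp.
Proof.
move=> T0 [x [cl [cr GE]]].
pose N : nat := (\max_v Num.bound `|x v|)%N.
pose z v : R := x v + N%:R.
have z0 v : 0 <= z v.
  have h1 : - x v <= `|x v| by rewrite -normrN ler_norm.
  have h2 := archi_boundP (normr_ge0 (x v)).
  have : (Num.bound `|x v|)%:R <= N%:R :> R.
    by rewrite ler_nat; apply: (leq_bigmax (F := fun v => Num.bound `|x v|)).
  by rewrite /z; lra.
pose t v : nat := Num.trunc (z v); pose fr v : R := z v - (t v)%:R.
have tP v : (t v)%:R <= z v < (t v).+1%:R := truncn_itv (z0 v).
pose U := #|T|; pose rk v := #|[set w | fr w < fr v]|.
have rkU v : (rk v < U)%N.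
  rewrite /U -cardsT; apply: proper_card; apply/properP; split; first exact/subsetP.
  by exists v; rewrite !inE ?ltxx.
have rk_lt u v : fr u < fr v -> (rk u < rk v)%N.
  move=> h; apply: proper_card; apply/properP; split.
    by apply/subsetP => w; rewrite !inE => /lt_trans; apply.
  by exists u; rewrite !inE ?ltxx.
have rk_eq u v : fr u = fr v -> rk u = rk v by rewrite /rk => ->.
pose X v := (t v * U + rk v)%N.
have zE v : x v = (t v)%:R + fr v - N%:R by rewrite /fr /z; lra.
have fr01 v : 0 <= fr v < 1 by have := tP v; rewrite /fr -natr1; lra.
have cmp u v : [\/ (x u < x v + 1) /\ (X u < X v + U)%N,
    (x u = x v + 1) /\ (X u = X v + U)%N | (x v + 1 < x u) /\ (X v + U < X u)%N].
  have fu := fr01 u; have fv := fr01 v; have ru := rkU u; have rv := rkU v.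
  have eX : (X v + U = (t v).+1 * U + rk v)%N by rewrite mulSn /X; lia.
  rewrite !zE eX /X.
  have [lt|gt|e] := ltngtP (t u) (t v).+1.
  - constructor 1; split.
      have : (t u).+1%:R <= (t v).+1%:R :> R by rewrite ler_nat.
      by rewrite -!natr1; lra.
    have : ((t u).+1 * U <= (t v).+1 * U)%N by rewrite leq_mul2r lt orbT.
    by rewrite mulSn; lia.
  - constructor 3; split.
      have : (t v).+2%:R <= (t u)%:R :> R by rewrite ler_nat.
      by rewrite -!natr1; lra.
    have : ((t v).+2 * U <= t u * U)%N by rewrite leq_mul2r gt orbT.
    by rewrite mulSn; lia.
  - rewrite e -natr1; have [lt|gt|ef] := ltgtP (fr u) (fr v).
    + by constructor 1; have := rk_lt _ _ lt; split; [lra|lia].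
    + by constructor 3; have := rk_lt _ _ gt; split; [lra|lia].
    + by constructor 2; have := rk_eq _ _ ef; split; [lra|lia].
have meet u v : (exists y : R, (y \in unit_itv (x u) (cl u) (cr u)) /\
      (y \in unit_itv (x v) (cl v) (cr v))) <->
    ((x u < x v + 1) \/ [/\ x u = x v + 1, cl u & cr v]) /\
    ((x v < x u + 1) \/ [/\ x v = x u + 1, cl v & cr u]).
  split.
    case=> y [hu hv]; split.
    - have [h|h|h] := ltgtP (x u) (x v + 1); [by left| |right].
        by move: hu hv h; rewrite /unit_itv; case: (cl u); case: (cr u); case: (cl v); case: (cr v);
          rewrite !in_itv /=; lra.
      by move: hu hv h; rewrite /unit_itv; case: (cl u); case: (cr u); case: (cl v); case: (cr v);
        rewrite !in_itv /= => ? ? ?; split=> //; lra.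
    - have [h|h|h] := ltgtP (x v) (x u + 1); [by left| |right].
        by move: hu hv h; rewrite /unit_itv; case: (cl u); case: (cr u); case: (cl v); case: (cr v);
          rewrite !in_itv /=; lra.
      by move: hu hv h; rewrite /unit_itv; case: (cl u); case: (cr u); case: (cl v); case: (cr v);
        rewrite !in_itv /= => ? ? ?; split=> //; lra.
  case=> -[h1|[h1 c1 c2]] [h2|[h2 c3 c4]].
  (* The midpoint of the overlap, interior to both intervals. *)
  - exists ((x u + x v + 1) / 2); rewrite /unit_itv.
    by case: (cl u); case: (cr u); case: (cl v); case: (cr v); rewrite !in_itv /=; split; lra.
  - exists (x v); rewrite /unit_itv c3 c4.
    by case: (cl u); case: (cr v); rewrite !in_itv /=; split; lra.
  - exists (x u); rewrite /unit_itv c1 c2.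
    by case: (cl v); case: (cr u); rewrite !in_itv /=; split; lra.
  - by exfalso; lra.
exists U; split=> //; exists (IRep X (fun v => ~~ cl v) (fun v => ~~ cr v)) => u v uv.
have side a b : (lft (IRep X (fun v => ~~ cl v) (fun v => ~~ cr v)) a <=
    rgt U (IRep X (fun v => ~~ cl v) (fun v => ~~ cr v)) b)%N <->
    (x a < x b + 1) \/ [/\ x a = x b + 1, cl a & cr b].
  rewrite /lft /rgt /=; case: (cmp a b) => -[h1 h2].
  - by split=> _; [left|case: (cl a); case: (cr b) => /=; lia].
  - rewrite h2; case: (cl a); case: (cr b) => /=; split=> //; try lia; try (by right);
      by case=> [|[]//]; lra.
  - split; first by case: (cl a); case: (cr b) => /=; lia.
    by case=> [|[e _ _]]; lra.
apply/idP/andP => [/GE|[/side h1 /side h2]]; last by apply/GE => //; apply/meet.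
by move=> /(_ uv)/meet[/side h1 /side h2].
Qed.

End RealRep.

(** * Computing a bubble structure from the graph *)

Lemma fr_sub Rs Rs' Ks Ks' s s' : fr Rs Ks s s' -> all (fun r => r \in Rs') Rs ->
  all (fun r => r \in Ks') Ks -> fr Rs' Ks' s s'.
Proof.
move=> [h1 h2] /allP a1 /allP a2; split=> q hq; [apply: h1|apply: h2].
- by apply: contra hq => /a1.
- by apply: contra hq => /a2.
Qed.


Lemma fr_runb inp Rs Ks p s : all (fun r => r \in Rs) (rmods p) ->
  all (fun r => r \in Ks) (amods p) -> fr Rs Ks s (run inp p s).
Proof. by move=> /allP h1 /allP h2; apply: fr_run. Qed.

(** Array 20 is the adjacency matrix, 21 to 23 hold keys, levels and marks of the search, 24 the
    keys of the second search, 25 and 26 the numbers of neighbours in the next and previous level,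
    29 to 32 the data for moving vertices, 33 and 34 the neighbour counts between columns, 35 to 37
    the three arrows, 38 a queue, 39 its stamps. *)
Definition eAdj p q := EA 20 (EB OpAdd (EB OpMul (ER p) (ER 0)) (ER q)).
Definition tabcntP k c es := tabP k (PSeq (PSet 6 (EC 0)) (cntP 6 eN (ER 4) c)) es.
Definition tabargP k c pr := tabP k (argminP 6 c pr) (ER 6).

Section Tables.
Variables (n : nat) (inp : seq nat).
Local Notation run := (run inp).
Local Notation cost := (cost inp).
Local Notation ev := (ev inp).

Lemma sum_iota_ord (P : 'I_n -> bool) :
  \sum_(u <- iota 0 n) nat_of_bool (if insub u is Some w then P w else false) = #|[set w | P w]|.
Proof.
have -> : iota 0 n = index_iota 0 n by rewrite /index_iota subn0.
rewrite big_mkord -sum1_card [RHS]big_mkcond /=; apply: eq_bigr => w _.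
by rewrite valK inE; case: (P w).
Qed.

Lemma tabcnt_rule k c es (g : nat -> nat) s (P : 'I_n -> 'I_n -> bool) : rg s 0 = n ->
  (forall s', ev s' es = g (rg s' 6)) ->
  (forall (v w : 'I_n) s', fr [:: 2; 3; 4; 5; 6; 8] [:: k] s s' -> rg s' 2 = v -> rg s' 8 = w ->
     (ev s' c != 0) = P v w) ->
  cost (tabcntP k c es) s <= 3 + n * (5 * n + 8) /\
  forall v : 'I_n, ar (run (tabcntP k c es) s) k v = g #|[set w | P v w]|.
Proof.
move=> rn hes hc.
have := @map_rule inp k (PSeq (PSet 6 (EC 0)) (cntP 6 eN (ER 4) c)) es s
  (fun i => if insub i is Some v then g #|[set w | P v w]| else 0) (fun=> 5 * n + 5).
case=> //; last first.
  rewrite rn sum_nat_const card_ord => h1 h2; split; first by move: h1; rewrite -addnA.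
  by move=> v; rewrite h2 // valK.
rewrite rn => i s' iN frs ri _; rewrite cost_seq run_seq cost_set run_set.
set s6 := setr 6 _ s'; pose v := Ordinal iN.
have := @cnt_rule inp 6 eN (ER 4) c s6 (iota 0 n)
  (fun u => if insub u is Some w then P v w else false).
have rn' : rg s' 0 = n by rewrite (fr_rg frs).
case=> //.
- by rewrite size_iota.
- by move=> j s'' jN _ /= ->; rewrite nth_iota // -(size_iota 0 n).
- move=> j s'' jN fr6; rewrite size_iota in jN; rewrite nth_iota // add0n => r8.
  rewrite (insubT (fun i => i < n) jN); apply: hc => //.
    apply: fr_trans (fr_sub frs _ _) _ => //.
    by apply: fr_trans (fr_sub fr6 _ _) => //; apply: fr_setr.
  by rewrite (fr_rg fr6).
rewrite size_iota sum_iota_ord => h1 h2; split; first by move: h1; lia.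
by rewrite hes h2 /= (insubT (fun i => i < n) iN).
Qed.

Lemma tabarg_rule k c pr s (P : 'I_n -> 'I_n -> bool) (F : 'I_n -> nat) : rg s 0 = n ->
  (forall (v w : 'I_n) s', fr [:: 2; 3; 4; 5; 6; 8] [:: k] s s' -> rg s' 2 = v -> rg s' 8 = w ->
     (ev s' c != 0) = P v w) ->
  (forall (w : 'I_n) q s', fr [:: 2; 3; 4; 5; 6; 8] [:: k] s s' -> rg s' q = w ->
     q \in [:: 8; 6] -> ev s' (pr q) = F w) ->
  cost (tabargP k c pr) s <= 3 + n * (5 * n + 8) /\
  forall v : 'I_n, (ar (run (tabargP k c pr) s) k v = n /\ forall w, ~~ P v w) \/
    exists w : 'I_n, [/\ ar (run (tabargP k c pr) s) k v = w, P v w &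
      forall w', P v w' -> F w <= F w'].
Proof.
move=> rn hc hp.
pose res (v : 'I_n) r := (r = n /\ forall w, ~~ P v w) \/
    exists w : 'I_n, [/\ r = w, P v w & forall w', P v w' -> F w <= F w'].
pose I i s1 := forall v : 'I_n, v < i -> res v (ar s1 k v).
have := @for_rule_const inp 2 3 (ER 0) (PSeq (argminP 6 c pr) (PSto k (ER 2) (ER 6))) s I
  (5 * n + 5).
have -> : ev s (ER 0) = n by [].
case=> //; last first.
  move=> h1 h2; split; last by move=> v; apply: h2.
  by apply: leq_trans h1 _; rewrite !mulnDr; lia.
move=> i s' iN frs ri Ii; rewrite cost_seq run_seq cost_sto run_sto.
pose v := Ordinal iN; have rn' : rg s' 0 = n by rewrite (fr_rg frs).
have frs6 s'' : fr [:: 4; 5; 8; 6] [::] s' s'' -> fr [:: 2; 3; 4; 5; 6; 8] [:: k] s s''.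
  by move=> h; apply: fr_trans (fr_sub frs _ _) (fr_sub h _ _) => //=; rewrite inE eqxx.
have := @argmin_rule inp 6 c pr s' (fun u => if insub u is Some w then P v w else false)
  (fun u => if insub u is Some w then F w else 0).
rewrite rn'; case=> //.
- move=> j s'' jN fr6 r8; rewrite (insubT (fun i => i < n) jN); apply: hc => //; first exact: frs6.
  by rewrite (fr_rg fr6).
- move=> q j s'' jN fr6 hq rq; rewrite (insubT (fun i => i < n) jN); apply: hp => //.
  exact: frs6.
move=> h1 h2; set s'' := run (argminP 6 c pr) s' in h2 *.
split; first by move: h1; lia.
have r2 : rg s'' 2 = i by rewrite rg_run.
have ak : ar s'' k = ar s' k by rewrite ar_run.
move=> u ui; rewrite /= PeanoNat.Nat.eqb_refl updrE r2 ak; case: eqP => [eu|ne]; last first.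
  by apply: Ii; move: ui; rewrite ltnS leq_eqVlt => /orP[/eqP|].
have -> : u = v by apply: val_inj.
case: h2 => [[-> hno]|[hlt hP hmin]].
  by left; split=> // w; have := hno w (ltn_ord w); rewrite valK.
right; exists (Ordinal hlt); move: hP; rewrite (insubT (fun i => i < n) hlt) => hP.
split=> // w' hw'; have := hmin w' (ltn_ord w'); rewrite valK => /(_ hw').
by rewrite (insubT (fun i => i < n) hlt).
Qed.

End Tables.

Definition matP : prog :=
  PFor 2 3 eN (elP (eDeg 2) (eNbr 2)
    (PSto 20 (EB OpAdd (EB OpMul (ER 2) (ER 0)) (ER 8)) (EC 1))).

(** Vertices with a level come first, in the order of levels, which stay below [n + 2]; those
    without one follow in the order of keys. So a new root is chosen only when everything reached
    has been processed. *)
Definition bprio q := EB OpAdd (EB OpMul (eEq (EA 22 (ER q)) (EC 0))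
  (EB OpAdd (EB OpAdd (ER 0) (EC 2)) (EA 21 (ER q)))) (EA 22 (ER q)).

Definition bfsP : prog :=
  PSeq (PSet 7 (EC 0)) (PFor 2 3 eN (seqs [::
    argminP 10 (eEq (EA 23 (ER 8)) (EC 0)) bprio;
    PIf (EA 22 (ER 10)) PSkip (PSto 22 (ER 10) (eS (ER 7)));
    PSet 7 (EA 22 (ER 10)); PSto 23 (ER 10) (EC 1);
    elP eN (ER 4) (PIf (eAnd (eAdj 10 8) (eEq (EA 22 (ER 8)) (EC 0)))
      (PSto 22 (ER 8) (eS (ER 7))) PSkip)])).

Lemma pair_index_eq n u v u' v' : v < n -> v' < n ->
  (u * n + v == u' * n + v') = (u == u') && (v == v').
Proof.
move=> hv hv'; apply/eqP/andP => [e|[/eqP-> /eqP->] //].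
have n0 : 0 < n by apply: leq_ltn_trans hv.
have : (u * n + v) %/ n = (u' * n + v') %/ n by rewrite e.
have : (u * n + v) %% n = (u' * n + v') %% n by rewrite e.
rewrite !modnMDl !modn_small // !divnMDl // !divn_small // !addn0 => -> ->.
by rewrite !eqxx.
Qed.

Section Graph.
Variables (n : nat) (G : sgraph 'I_n) (a : 'I_n -> seq 'I_n) (inp : seq nat).
Hypothesis n_gt0 : 0 < n.
Hypothesis aP : adjacency_lists G a.
Local Notation run := (run inp).
Local Notation cost := (cost inp).
Local Notation ev := (ev inp).

Definition madj (s : st) := forall u v : 'I_n, ar s 20 (u * n + v) = G u v :> nat.

Lemma mat_spec s : rg s 0 = n -> adj_input a inp s -> (forall i, ar s 20 i = 0) ->
  cost matP s <= 3 + n * (4 * n + 5) /\ madj (run matP s).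
Proof.
move=> rn ai z; rewrite /matP; set body := elP _ _ _.
pose I i s1 := forall u v : 'I_n, ar s1 20 (u * n + v) = (u < i) && G u v :> nat.
have := @for_rule_const inp 2 3 eN body s I (4 * n + 3).
have -> : ev s eN = n by [].
case=> //; last first.
- move=> h1 h2; split; first by move: h1; rewrite -addnA.
  by move=> u v; rewrite h2 ltn_ord.
- move=> i s' iN frs ri Ii; pose u0 := Ordinal iN.
  have a0 : ar s' 0 = ar s 0 by rewrite (fr_ar frs).
  have rn' : rg s' 0 = n by rewrite (fr_rg frs).
  have ai' : adj_input a inp s' by move=> v; rewrite a0; apply: ai.
  pose J j s1 := forall u v : 'I_n, ar s1 20 (u * n + v) =
    (u < i) && G u v || (u == u0) && (v \in take j (a u0)) :> nat.
  have := @el_rule inp (eDeg 2) (eNbr 2)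
    (PSto 20 (EB OpAdd (EB OpMul (ER 2) (ER 0)) (ER 8)) (EC 1)) s' (map val (a u0)) J 1.
  case=> //.
  + by apply: deg_ev ai' _.
  + move=> j s'' jN fr6 r4; rewrite size_map in jN.
    by apply: (@nbr_ev _ a inp s' _ _ _ u0) => //; rewrite ?(fr_ar fr6) ?(fr_rg fr6).
  + by move=> u v; rewrite take0 andbF orbF; apply: Ii.
  + move=> j s'' jN fr6; rewrite size_map in jN; rewrite (nth_map u0) //.
    set w := nth u0 _ _ => r8 Jj; split=> // u v; rewrite run_sto ar_seta /= r8.
    rewrite (fr_rg fr6) // (fr_rg fr6 (r := 0)) // ri rn'.
    rewrite -[i * n + _]/(u0 * n + w) pair_index_eq // (take_nth u0) // mem_rcons inE -/w Jj.
    rewrite !val_eqE; case: (eqVneq u u0) => [->|_] //=; rewrite ltnn /=.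
    by case: (v == w).
  rewrite size_map => h1 h2; split.
    have := size_adj aP u0; move: h1; rewrite -/body; move: (cost _ s') (size _) => x y; lia.
  have [ua ma] := aP u0.
  move=> u v; rewrite -[ar _ _ _]/(ar (run body s') 20 (u * n + v)) h2 take_oversize // ma inE.
  have -> : (u < i.+1) = (u == u0) || (u < i) by rewrite ltnS leq_eqVlt.
  by case: (eqVneq u u0) => [->|_] /=; rewrite ?ltnn ?orbF.
- by move=> u v; rewrite /= z.
Qed.

Section BFS.
Variable key : 'I_n -> nat.

(** [D] marks the processed vertices, level 0 stands for not yet reached, and [cur] is the level of
    the vertex processed last. *)
Record binv (lev : 'I_n -> nat) (D : 'I_n -> bool) (cur : nat) : Prop := BInv {
  b1 : forall v, D v -> 0 < lev v <= cur;
  b2 : forall v, ~~ D v -> 0 < lev v -> cur <= lev v <= cur.+1;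
  b3 : forall u v, D u -> G u v -> 0 < lev v <= (lev u).+1;
  b4 : forall v, 0 < lev v -> (exists u, [/\ D u, G u v & (lev u).+1 = lev v]) \/
    [/\ D v, (forall u w, 0 < lev u < lev v -> G u w -> 0 < lev w < lev v),
        (forall u, lev u = lev v -> u = v) &
        (forall w, lev w = 0 \/ lev v <= lev w -> key v <= key w)];
  b5 : forall i, 0 < i <= cur -> exists u, D u /\ lev u = i }.

Lemma binv_spec lev D cur : binv lev D cur -> (forall v, D v) -> bfs_spec G key lev.
Proof.
move=> [h1 _ h3 h4 h5] Dall; split.
- by move=> u v g; have /andP[] := h3 _ _ (Dall u) g.
- move=> v; have /andP[v0 _] := h1 _ (Dall v).
  case: (h4 _ v0) => [[u [_ g e]]|[_ r1 r2 r3]]; first by left; exists u.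
  right; split=> //; last by move=> w h; apply: r3; right.
  move=> u w lu lw; apply/negP => g; have /andP[u0 _] := h1 _ (Dall u).
  have lu' : 0 < lev u < lev v by rewrite u0.
  by have := r1 u w lu' g; lia.
- by move=> v; have /andP[] := h1 _ (Dall v).
- move=> v i hi; have /andP[_ h] := h1 _ (Dall v).
  by have [|u [_ e]] := h5 i; [lia|exists u].
Qed.

(** If the selected vertex has no level, its minimality shows that every reached vertex is
    processed, so a new component starts at the fresh level [cur.+1]. Otherwise it has the least
    level among the reached unprocessed vertices. *)
Lemma binv_step lev D cur v : binv lev D cur -> cur <= n -> ~~ D v ->
  (forall w, ~~ D w -> (lev v == 0) * (n + 2 + key v) + lev v <=
    (lev w == 0) * (n + 2 + key w) + lev w) ->
  let lv := if lev v == 0 then cur.+1 else lev v in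
  binv (fun w => if w == v then lv else if G v w && (lev w == 0) then lv.+1 else lev w)
    (fun w => D w || (w == v)) lv.
Proof.
move=> [h1 h2 h3 h4 h5] cn Dv pmin lv.
have p2 : cur <= lv <= cur.+1.
  by rewrite /lv; case: eqP => [_|/eqP]; [rewrite leqnSn leqnn|rewrite -lt0n => /(h2 _ Dv)].
have p1 w : ~~ D w -> 0 < lev w -> lv <= lev w <= lv.+1 /\ 0 < lev v.
  move=> Dw w0; have lw := h2 _ Dw w0; have := pmin w Dw.
  rewrite [lev w == 0]gtn_eqF // mul0n add0n.
  case: (posnP (lev v)) => v0; first by rewrite mul1n; clia.
  rewrite mul0n add0n => le; have lvv := h2 _ Dv v0.
  by split=> //; rewrite /lv gtn_eqF //; clia.
have p3 w : lev v = 0 -> 0 < lev w -> D w.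
  by move=> v0 w0; apply: contraT => Dw; have [_] := p1 _ Dw w0; rewrite v0.
have p3' : lev v = 0 -> lv = cur.+1 by rewrite /lv => ->.
have p3k w : lev v = 0 -> lev w = 0 -> key v <= key w.
  move=> v0 w0; have Dw : ~~ D w by apply/negP => /h1; rewrite w0.
  by have := pmin w Dw; rewrite v0 w0 !mul1n !addn0 leq_add2l.
have p4 : 0 < lev v -> lv = lev v by rewrite /lv => h; rewrite gtn_eqF.
clearbody lv.
pose lev' w := if w == v then lv else if G v w && (lev w == 0) then lv.+1 else lev w.
have levv : lev' v = lv by rewrite /lev' eqxx.
have old w : 0 < lev w -> lev' w = lev w.
  rewrite /lev'; case: eqP => [-> /p4 //|_ w0]; by rewrite [lev w == 0]gtn_eqF // andbF.
have new w : w != v -> lev w = 0 -> lev' w = if G v w then lv.+1 else 0.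
  by rewrite /lev' => /negPf-> ->; rewrite eqxx andbT.
have lev'P w : [\/ w = v /\ lev' w = lv, 0 < lev w /\ lev' w = lev w,
    [/\ w != v, lev w = 0, G v w & lev' w = lv.+1] |
    [/\ w != v, lev w = 0, ~~ G v w & lev' w = 0]].
  case: (eqVneq w v) => [->|wv]; first by constructor 1.
  case: (posnP (lev w)) => w0; last by constructor 2; rewrite old.
  case: (boolP (G v w)) => g; [constructor 3|constructor 4]; split=> //.
    by rewrite new // g.
  by rewrite new // (negPf g).
have lv0 : 0 < lv.
  by case: (posnP (lev v)) => [/p3'->//|h]; rewrite p4.
rewrite -/lev'; split.
- move=> w /orP[Dw|/eqP->]; last by rewrite levv lv0 leqnn.
  by have /andP[w0 wc] := h1 _ Dw; rewrite old //; clia.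
- move=> w; rewrite negb_or => /andP[Dw wv]; case: (lev'P w) => [[e _]|[w0 ->]|[_ _ _ ->]|[_ _ _ ->]] //.
  + by rewrite e eqxx in wv.
  + by move=> _; have [h _] := p1 _ Dw w0.
  + by move=> _; rewrite leqnSn leqnn.
- move=> u w /orP[Du|/eqP->] g.
    have hw := h3 _ _ Du g; have hu := h1 _ Du.
    by rewrite !old //; case/andP: hw => // ; case/andP: hu.
  rewrite levv; case: (lev'P w) => [[e _]|[w0 ->]|[_ _ _ ->]|[_ _ ng _]].
  + by rewrite e adj_irr in g.
  + rewrite w0 /=; case: (boolP (D w)) => Dw; first by have := h1 _ Dw; clia.
    by have [h _] := p1 _ Dw w0; clia.
  + by rewrite leqnn.
  + by rewrite g in ng.
- have roots w : 0 < lev w -> D w ->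
      (forall u t, 0 < lev u < lev w -> G u t -> 0 < lev t < lev w) ->
      (forall u, lev u = lev w -> u = w) ->
      (forall t, lev t = 0 \/ lev w <= lev t -> key w <= key t) ->
      [/\ D w || (w == v), (forall u t, 0 < lev' u < lev' w -> G u t -> 0 < lev' t < lev' w),
        (forall u, lev' u = lev' w -> u = w) &
        (forall t, lev' t = 0 \/ lev' w <= lev' t -> key w <= key t)].
    move=> w0 Dw r1 r2 r3; rewrite Dw (old _ w0); have lw := h1 _ Dw.
    have wv : w != v by apply: contraTneq Dw => ->.
    split=> // [u t|u|t].
    + case: (lev'P u) => [[-> ->]|[u0 ->]|[_ _ _ ->]|[_ _ _ ->]] //; last by clia.
        case: (posnP (lev v)) => [/p3' -> |v0]; first by clia.
        rewrite p4 // => hv g; have := r1 _ _ hv g => ht.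
        by rewrite old //; case/andP: ht.
      by move=> hu g; have := r1 _ _ hu g => ht; rewrite old //; case/andP: ht.
    + case: (lev'P u) => [[-> ->]|[u0 ->]|[_ _ _ ->]|[_ _ _ ->]]; [|exact: r2|by clia|by clia].
      case: (posnP (lev v)) => [/p3' -> |v0]; first by clia.
      by rewrite p4 //; apply: r2.
    + case: (lev'P t) => [[-> ->]|[t0 ->]|[_ t0 _ ->]|[_ t0 _ ->]] h; apply: r3; [|by []|by left|by left].
      case: (posnP (lev v)) => v0; first by left.
      by right; rewrite -(p4 v0); case: h => //; clia.
  move=> w; case: (lev'P w) => [[-> _]|[w0 ew]|[_ _ g ->]|[_ _ _ ->]] // _.
  + case: (posnP (lev v)) => v0; last first.
      case: (h4 _ v0) => [[u [Du g e]]|[]]; last by rewrite (negPf Dv).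
      by left; exists u; rewrite Du levv p4 // old //; case/andP: (h1 _ Du).
    right; rewrite eqxx orbT levv p3' //; split=> // [u t|u|t].
    * case: (lev'P u) => [[-> ->]|[u0 ->]|[_ _ _ ->]|[_ _ _ ->]]; rewrite ?(p3' v0); try by clia.
      move=> _ g; have Du := p3 _ v0 u0; have /andP[t0 _] := h3 _ _ Du g.
      by rewrite old // t0 ltnS; case/andP: (h1 _ (p3 _ v0 t0)).
    * case: (lev'P u) => [[-> //]|[u0 ->]|[_ _ _ ->]|[_ _ _ ->]]; rewrite ?(p3' v0); try by clia.
      by have := h1 _ (p3 _ v0 u0); clia.
    * case: (lev'P t) => [[-> //]|[t0 ->]|[_ t0 _ _]|[_ t0 _ _]]; [|by move=> _; apply: p3k..].
      by have := h1 _ (p3 _ v0 t0) => h [] h'; clia.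
  + case: (h4 _ w0) => [[u [Du g e]]|[Dw r1 r2 r3]].
      by left; exists u; rewrite Du ew old //; case/andP: (h1 _ Du).
    by right; apply: roots.
  + by left; exists v; rewrite eqxx orbT levv.
- move=> i hi; have [ic|ic] := leqP i cur.
    have [|u [Du e]] := h5 i; first by clia.
    by exists u; rewrite Du old // e; clia.
  by exists v; rewrite eqxx orbT levv; split=> //; clia.
Qed.

Lemma bfs_run s : rg s 0 = n -> madj s -> (forall v : 'I_n, ar s 21 v = key v) ->
  (forall v : 'I_n, ar s 22 v = 0) -> (forall v : 'I_n, ar s 23 v = 0) ->
  cost bfsP s <= 10 + n * (10 * n + 30) /\
  bfs_spec G key (fun v => ar (run bfsP s) 22 v).
Proof.
move=> rn mj hk z22 z23; rewrite /bfsP cost_seq run_seq cost_set run_set.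
set s0 := setr 7 _ s; set body := seqs _.
pose I i s1 := [/\ binv (fun v => ar s1 22 v) (fun v => ar s1 23 v != 0) (rg s1 7),
  rg s1 7 <= i & #|[set v : 'I_n | ar s1 23 v != 0]| = i].
have := @for_rule_const inp 2 3 eN body s0 I (10 * n + 20).
have -> : ev s0 eN = n by [].
case=> //; last first.
- move=> h1 [h2 _ h3]; split; first by move: h1; rewrite !mulnDr; lia.
  apply: binv_spec h2 _ => v.
  have /eqP : [set v : 'I_n | ar (run (PFor 2 3 eN body) s0) 23 v != 0] = setT.
    by apply/eqP; rewrite eqEcard subsetT cardsT card_ord; apply: eq_leq (esym h3).
  by rewrite eqEsubset => /andP[_ /subsetP/(_ v)]; rewrite !inE; apply.
- move=> i s' iN frs ri [Ib Ic Id].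
  have rn' : rg s' 0 = n by rewrite (fr_rg frs).
  have mj' : madj s' by move=> u v; rewrite (fr_ar frs) //; apply: mj.
  have k' (v : 'I_n) : ar s' 21 v = key v by rewrite (fr_ar frs) // hk.
  pose D (v : 'I_n) := ar s' 23 v != 0; pose lev (v : 'I_n) := ar s' 22 v.
  have := @argmin_rule inp 10 (eEq (EA 23 (ER 8)) (EC 0)) bprio s'
    (fun u => if insub u is Some w then ~~ D w else false)
    (fun u => if insub u is Some w then (lev w == 0) * (n + 2 + key w) + lev w else 0).
  rewrite rn'; case=> //.
  + move=> j s'' jN fr6 r8; rewrite (insubT (fun i => i < n) jN) /= r8 (fr_ar fr6) //.
    by rewrite /D /= eqb0 negbK; case: (_ == 0).
  + move=> q j s'' jN fr6 hq rq; rewrite (insubT (fun i => i < n) jN) /= rq !(fr_ar fr6) //.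
    by rewrite (fr_rg fr6) // rn' -[j]/(nat_of_ord (Ordinal jN)) k'.
  move=> c1 h1; set s1 := run (argminP _ _ _) s' in h1 *.
  have fr1 : fr [:: 4; 5; 8; 10] [::] s' s1 by apply: fr_runb.
  case: h1 => [[_ hno]|[hlt hP hmin]].
    have : #|[set v : 'I_n | ar s' 23 v != 0]| = n.
      rewrite -[RHS]card_ord -cardsT; congr #|pred_of_set _|; apply/setP => v; rewrite !inE.
      by have := hno v (ltn_ord v); rewrite valK negbK.
    by rewrite Id => e; rewrite e ltnn in iN.
  pose v := Ordinal hlt; rewrite (insubT (fun i => i < n) hlt) -/v in hP hmin.
  have pmin w : ~~ D w -> (lev v == 0) * (n + 2 + key v) + lev v <=
      (lev w == 0) * (n + 2 + key w) + lev w.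
    by move=> Dw; have := hmin w (ltn_ord w); rewrite valK => /(_ Dw).
  have st := binv_step Ib (leq_trans Ic (ltnW iN)) hP pmin.
  pose lv := if lev v == 0 then (rg s' 7).+1 else lev v.
  pose PI := PIf (EA 22 (ER 10)) PSkip (PSto 22 (ER 10) (eS (ER 7))).
  pose s2 := run PI s1.
  have r10 : rg s1 10 = v by [].
  have a1 q : ar s1 q = ar s' q by rewrite (fr_ar fr1).
  have r7 : rg s1 7 = rg s' 7 by rewrite (fr_rg fr1).
  have a2 (w : 'I_n) : ar s2 22 w = if w == v then lv else lev w.
    rewrite /s2 /PI !runE -[ev s1 (EA 22 (ER 10))]/(ar s1 22 (rg s1 10)) r10 a1 -/(lev v) /lv.
    case: eqP => [e|ne].
      by rewrite ar_seta /= r10 r7 a1 addn1 val_eqE.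
    by rewrite a1; case: (eqVneq w v) => [->|].
  have r2' q : rg s2 q = rg s1 q by rewrite rg_run.
  pose s4 := seta 23 v 1 (setr 7 lv s2).
  pose lp := elP eN (ER 4) (PIf (eAnd (eAdj 10 8) (eEq (EA 22 (ER 8)) (EC 0)))
      (PSto 22 (ER 8) (eS (ER 7))) PSkip).
  have s4E : run (PSto 23 (ER 10) (EC 1)) (run (PSet 7 (EA 22 (ER 10))) s2) = s4.
    rewrite run_sto run_set; congr (seta 23 _ _ (setr 7 _ _)).
      by rewrite /= r2' r10.
    by rewrite /= r2' r10 a2 eqxx.
  have rE : run body s' = run lp s4.
    by rewrite /body 5!run_seqs run_skip -/s1 -/PI -/s2 s4E.
  have cE : cost body s' = cost (argminP 10 (eEq (EA 23 (ER 8)) (EC 0)) bprio) s' +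
      (cost PI s1 + (1 + (1 + cost lp s4))).
    by rewrite /body 4!cost_seqs -/s1 -/PI -/s2 s4E.
  have cPI : cost PI s1 <= 3 by rewrite /PI !costE; case: (_ == _).
  have rn4 : rg s4 0 = n by rewrite /= r2' (fr_rg fr1).
  have r104 : rg s4 10 = v by rewrite /= r2' r10.
  pose lev' (w : 'I_n) := if w == v then lv else if G v w && (lev w == 0) then lv.+1 else lev w.
  pose J j s5 := forall w : 'I_n, ar s5 22 w = if w < j then lev' w else if w == v then lv else lev w.
  have := @el_rule inp eN (ER 4) (PIf (eAnd (eAdj 10 8) (eEq (EA 22 (ER 8)) (EC 0)))
      (PSto 22 (ER 8) (eS (ER 7))) PSkip) s4 (iota 0 n) J 2.
  have lv0 : 0 < lv by rewrite /lv; case: eqP => // /eqP; rewrite -lt0n.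
  have adjE s5 (w : 'I_n) : fr [:: 4; 5; 8] [:: 22] s4 s5 -> rg s5 8 = w ->
      ev s5 (eAdj 10 8) = G v w.
    move=> f5 r8; rewrite /= r8 (fr_rg f5) // (fr_rg f5 (r := 0)) // r104 rn4 (fr_ar f5) //=.
    by rewrite /s2 ar_run // a1; apply: (mj' v w).
  case=> //.
  + by rewrite size_iota.
  + by move=> j s5 jN _ /= ->; rewrite nth_iota // -(size_iota 0 n).
  + move=> j s5 jN; rewrite size_iota in jN; rewrite nth_iota // add0n => f5 r8 Jj.
    pose w := Ordinal jN; have {}f5 : fr [:: 4; 5; 8] [:: 22] s4 s5 by apply: fr_sub f5 _ _.
    have e7 : rg s5 7 = lv by rewrite (fr_rg f5).
    have Jw : ar s5 22 j = if w == v then lv else lev w by have := Jj w; rewrite /= ltnn.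
    rewrite !costE !runE; set c := ev s5 _.
    have cv : (c != 0) = G v w && ((if w == v then lv else lev w) == 0).
      rewrite /c -[ev _ _]/(ev s5 (eAdj 10 8) * (ar s5 22 (rg s5 8) == 0)).
      by rewrite (adjE s5 w) // r8 Jw mulnb eqb0 negbK.
    split; first by case: ifP.
    have cw : (c != 0) = (w != v) && (G v w && (lev w == 0)).
      rewrite cv; case: (eqVneq w v) => [->|//]; by rewrite adj_irr.
    have wj (u : 'I_n) : (u < j.+1) = (u == w) || (u < j) by rewrite ltnS leq_eqVlt.
    have lw' : lev' w = if c != 0 then lv.+1 else if w == v then lv else lev w.
      by rewrite cw /lev'; case: (eqVneq w v).
    move=> u; rewrite wj; have [->|uw] := eqVneq u w.
      rewrite /= lw'; case: (c == 0) => /=; first exact: Jw.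
      by rewrite updrE r8 eqxx e7 addn1.
    have -> : ar (if c == 0 then s5 else seta 22 (ev s5 (ER 8)) (ev s5 (eS (ER 7))) s5) 22 u =
        ar s5 22 u.
      by case: ifP => // _; rewrite ar_seta /= r8 -[(u : nat) == j]/(u == w) (negPf uw).
    exact: Jj.
  rewrite size_iota => c2 h2; rewrite rE cE; split.
    by move: c1 c2 cPI; rewrite -/lp; move: (cost _ s') (cost _ s1) (cost _ s4) => x y z; lia.
  have f6 : fr [:: 4; 5; 8] [:: 22] s4 (run lp s4) by apply: fr_runb.
  have e23 (w : 'I_n) : (ar (run lp s4) 23 w != 0) = D w || (w == v).
    rewrite (fr_ar f6) // ar_seta -[ar (setr _ _ _) _]/(ar s2 23) /s2 ar_run // a1 /D.
    rewrite (_ : (nat_of_ord w == nat_of_ord v) = (w == v)) //.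
    by case: (w == v); rewrite ?orbT ?orbF.
  have e22 (w : 'I_n) : ar (run lp s4) 22 w = lev' w by rewrite h2 ltn_ord.
  have e7 : rg (run lp s4) 7 = lv by rewrite (fr_rg f6).
  split.
  + rewrite [rg _ 7]/= e7.
    have -> : (fun w : 'I_n => ar (setr 2 i.+1 (run lp s4)) 22 w) = lev' by apply/funext.
    have -> : (fun w : 'I_n => ar (setr 2 i.+1 (run lp s4)) 23 w != 0) = fun w => D w || (w == v).
      by apply/funext.
    exact: st.
  + rewrite [rg _ 7]/= e7 /lv; case: eqP => // /eqP; rewrite -lt0n => v0.
    by have := b2 Ib hP v0; move: Ic; rewrite -/(lev v); lia.
  + have -> : [set w : 'I_n | ar (setr 2 i.+1 (run lp s4)) 23 w != 0] = v |: [set w | D w].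
      by apply/setP => w; rewrite !inE; apply: etrans (e23 w) _; rewrite orbC.
    by rewrite cardsU1 inE hP add1n; congr S.
- split=> //=.
  + split=> [v|v|u v|v|j]; rewrite /= ?z22 ?z23 //.
    by case: j.
  + by apply/eqP; rewrite cards_eq0; apply/eqP/setP => v; rewrite !inE z23.
Qed.

End BFS.
End Graph.

Arguments seqs : simpl never.

Definition eNot x := eEq x (EC 0).
Definition eLev q := EA 22 (ER q).
Definition eCol q := EA 2 (ER q).
Definition eRow q := EA 1 (ER q).
Definition nextE f := eAnd (eAdj 2 8) (eEq (f 8) (eS (f 2))) : ex.
Definition prevE f := eAnd (eAdj 2 8) (eEq (eS (f 8)) (f 2)) : ex.
Definition dprioE q := EB OpAdd (EB OpMul (EA 26 (ER q)) (eS (ER 0))) (eDeg q).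
Definition flagE := eAnd (eEq (eLev 8) (eLev 2))
  (eOr (eLt (EC 0) (EA 25 (ER 8))) (eLt (dprioE 8) (dprioE 2))).
Definition zeroP k := tabP k PSkip (EC 0).
(** Two searches. The first starts from vertices of least degree. For each vertex, [flagE] then
    counts what disqualifies it as an end in the sense of [end_rep]; with this count as key, the
    second search starts every component at a vertex of count 0. *)
Definition layersP : prog := seqs [:: matP; tabP 21 PSkip (eDeg 2); bfsP;
  tabcntP 25 (nextE eLev) (ER 6); tabcntP 26 (prevE eLev) (ER 6); tabcntP 24 flagE (ER 6);
  tabP 21 PSkip (EA 24 (ER 2)); zeroP 22; zeroP 23; bfsP].

Definition apartE := eAnd (eNot (eEq (ER 8) (ER 2))) (eNot (eAdj 2 8)).
Definition nunE := eAnd (eEq (eLev 8) (eLev 2)) apartE.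
Definition zprioE q := EB OpAdd (EB OpMul (EB OpAdd (EB OpMul (EB OpSub (ER 0) (EA 25 (ER q)))
  (eS (ER 0))) (EA 26 (ER q))) (eS (ER 0))) (ER q).
Definition betterE := eAnd (eEq (eLev 8) (eLev 2))
  (eAnd (eLt (EC 0) (EA 29 (ER 8))) (eLt (zprioE 8) (zprioE 2))).
Definition isAE := eAnd (eEq (eLev 8) (eLev 2))
  (eAnd (eAnd (eLt (EC 0) (EA 29 (ER 8))) (eNot (EA 30 (ER 8)))) apartE).
Definition posE := eLt (EC 0) (ER 6).
Definition mE := eAnd (eEq (eLev 8) (eS (eLev 2))) (eAnd (EA 32 (ER 8)) (eNot (eAdj 2 8))).
(** Levels [n - t] are treated downwards, because [M] on a level depends on the next one. A vertex
    has only one level, so the linear count runs at most once per vertex and the total is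
    quadratic. *)
Definition markP : prog := PFor 11 12 eN (PFor 2 3 eN
  (PIf (eEq (eLev 2) (EB OpSub (ER 0) (ER 11)))
    (seqs [:: PSet 6 (EC 0); cntP 6 eN (ER 4) mE;
       PSto 32 (ER 2) (eLt (EC 0) (eOr (ER 6) (EA 31 (ER 2))))])
    PSkip)).
Definition columnsP : prog := seqs [:: tabcntP 25 (nextE eLev) (ER 6);
  tabcntP 26 (prevE eLev) (ER 6); tabcntP 29 nunE (ER 6); tabcntP 30 betterE (ER 6);
  tabcntP 31 isAE posE; markP; tabP 2 PSkip (EB OpSub (eLev 2) (EA 32 (ER 2)))].

Lemma tab_copy inp n k es s (F : 'I_n -> nat) : rg s 0 = n ->
  (forall (v : 'I_n) s', fr [:: 2; 3] [:: k] s s' -> rg s' 2 = v -> ev inp s' es = F v) ->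
  cost inp (tabP k PSkip es) s <= 3 + n * 4 /\
  forall v : 'I_n, ar (run inp (tabP k PSkip es) s) k v = F v.
Proof.
move=> rn h; have := @map_rule inp k PSkip es s (fun i => if insub i is Some v then F v else 0)
  (fun=> 1).
case=> //; last first.
  rewrite rn sum_nat_const card_ord => h1 h2; split=> // v.
  by rewrite h2 // valK.
rewrite rn => i s' iN frs ri _; split=> //; rewrite run_skip (insubT (fun i => i < n) iN).
exact: h.
Qed.

Definition bE := (muln_eq0, addn_eq0, eqb0, negb_or, negb_and, negbK).

Section Solve.
Variables (n : nat) (G : sgraph 'I_n) (a : 'I_n -> seq 'I_n) (inp : seq nat).
Hypothesis n_gt0 : 0 < n.
Hypothesis aP : adjacency_lists G a.
Local Notation run := (run inp).
Local Notation cost := (cost inp).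
Local Notation ev := (ev inp).
Local Notation madj := (madj G).
Local Notation conn := (connect (adj G)).

Lemma size_nbh v : size (a v) = #|nbh G v|.
Proof. by have [ua ma] := aP v; rewrite -(card_uniqP ua); apply: eq_card. Qed.

Lemma deg_val s q (v : 'I_n) : adj_input a inp s -> rg s q = v -> ev s (eDeg q) = #|nbh G v|.
Proof. by move=> h e; rewrite (deg_ev h e) size_map size_nbh. Qed.

Lemma input_fr Rs Ks s s' : fr Rs Ks s s' -> 0 \notin Ks -> adj_input a inp s -> adj_input a inp s'.
Proof. by move=> f h m v; rewrite (fr_ar f h); apply: m. Qed.

Section Levels.
Variable lev : 'I_n -> nat.

Lemma nnx_table k s : k \notin [:: 0; 20; 22] -> rg s 0 = n -> madj s ->
  (forall v : 'I_n, ar s 22 v = lev v) ->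
  cost (tabcntP k (nextE eLev) (ER 6)) s <= 3 + n * (5 * n + 8) /\
  forall v : 'I_n, ar (run (tabcntP k (nextE eLev) (ER 6)) s) k v = nnx G lev v.
Proof.
rewrite !inE !negb_or => /and3P[k0 k20 k22] rn mj hL.
apply: (@tabcnt_rule n inp k _ (ER 6) id) => // v w s' f r2 r8.
have n20 : 20 \notin [:: k] by rewrite inE eq_sym.
have n22 : 22 \notin [:: k] by rewrite inE eq_sym.
by rewrite /= r2 r8 !(fr_ar f) // (fr_rg f (r := 0)) // rn mj !hL addn1 !bE.
Qed.

Lemma npv_table k s : k \notin [:: 0; 20; 22] -> rg s 0 = n -> madj s ->
  (forall v : 'I_n, ar s 22 v = lev v) ->
  cost (tabcntP k (prevE eLev) (ER 6)) s <= 3 + n * (5 * n + 8) /\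
  forall v : 'I_n, ar (run (tabcntP k (prevE eLev) (ER 6)) s) k v = npv G lev v.
Proof.
rewrite !inE !negb_or => /and3P[k0 k20 k22] rn mj hL.
apply: (@tabcnt_rule n inp k _ (ER 6) id) => // v w s' f r2 r8.
have n20 : 20 \notin [:: k] by rewrite inE eq_sym.
have n22 : 22 \notin [:: k] by rewrite inE eq_sym.
by rewrite /= r2 r8 !(fr_ar f) // (fr_rg f (r := 0)) // rn mj !hL addn1 !bE.
Qed.

End Levels.

Definition dprio lev v := npv G lev v * n.+1 + #|nbh G v|.
Definition key2 lev v := #|[set u | (lev u == lev v) && ((0 < nnx G lev u) || (dprio lev u < dprio lev v))]|.

(** No edge crosses the level of a root, so of two components the one with the later root lies
    entirely above the other. *)
Lemma same_level_conn key lev u v : bfs_spec G key lev -> lev u = lev v -> conn u v.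
Proof.
move=> bfs e; have [r [rr cr lr]] := @root_of _ G 1 isT _ _ bfs u.
have [t [rt ct lt]] := @root_of _ G 1 isT _ _ bfs v.
have h1 := root_low rr ct; have h2 := root_low rt cr.
have rt' : r = t by apply: (root_single rt); lia.
rewrite -rt' in ct; apply: connect_trans ct.
by rewrite conn_sym.
Qed.

(** Take the top level of the component, which belongs to it as a whole, and minimise [dprio]
    there. *)
Lemma flagged_ex key lev s : bfs_spec G key lev -> exists2 y, conn s y & key2 lev y = 0.
Proof.
move=> bfs; have [t st tmax] : exists2 t, conn s t & forall w, conn s w -> lev w <= lev t.
  by case: (arg_maxnP lev (connect0 (adj G) s)) => t h1 h2; exists t.
have Pt : lev t == lev t by [].
case: (@arg_minnP _ t (fun u => lev u == lev t) (dprio lev) Pt) => y /eqP ly ymin.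
have sy w : lev w = lev t -> conn s w.
  by move=> e; apply: connect_trans st (same_level_conn bfs (esym e)).
exists y; first exact: sy.
apply/eqP; rewrite cards_eq0; apply/eqP/setP => u; rewrite !inE ly.
apply/negP => /andP[/eqP lu /orP[/card_gt0P[w]|]]; last by rewrite ltnNge ymin // lu.
rewrite inE => /andP[g /eqP lw].
by have := tmax w (connect_trans (sy _ lu) (connect1 g)); lia.
Qed.

Lemma layers_spec s : rg s 0 = n -> adj_input a inp s ->
  (forall k i, 20 <= k -> ar s k i = 0) ->
  let s' := run layersP s in
  [/\ cost layersP s <= 400 * n ^ 2, madj s' & exists key lev,
    [/\ bfs_spec G key lev, (forall v : 'I_n, ar s' 22 v = lev v) &
      forall U R, 0 < U -> is_rep G U R -> exists R', is_rep G U R' /\ star G U key lev R']].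
Proof.
move=> rn ai z.
pose q1 := run matP s; have [c1 m1] := mat_spec n_gt0 aP rn ai (fun i => z 20 i isT).
pose q2 := run (tabP 21 PSkip (eDeg 2)) q1.
have [c2 h2] : cost (tabP 21 PSkip (eDeg 2)) q1 <= 3 + n * 4 /\
    forall v : 'I_n, ar q2 21 v = #|nbh G v|.
  apply: tab_copy; first by rewrite rg_run.
  move=> v s' f r2; apply: deg_val => //; apply: input_fr f _ _ => //.
  by move=> u; rewrite ar_run //; apply: ai.
have m2 : madj q2 by move=> u v; rewrite ar_run //; apply: m1.
pose q3 := run bfsP q2.
have rn2 : rg q2 0 = n by rewrite !rg_run.
have z22 (v : 'I_n) : ar q2 22 v = 0 by rewrite !ar_run // z.
have z23 (v : 'I_n) : ar q2 23 v = 0 by rewrite !ar_run // z.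
have [c3 h3] := @bfs_run n G inp n_gt0 (fun v => #|nbh G v|) q2 rn2 m2 h2 z22 z23.
rewrite -/q3 in h3; set lev1 := fun v : 'I_n => ar q3 22 v in h3.
have rn3 : rg q3 0 = n by rewrite !rg_run.
have m3 : madj q3 by move=> u v; rewrite ar_run //; apply: m2.
have ai3 : adj_input a inp q3 by move=> v; rewrite !ar_run //; apply: ai.
have [c4 h4] := @nnx_table lev1 25 q3 isT rn3 m3 (fun=> erefl).
set q4 := run (tabcntP 25 _ _) q3 in h4.
have rn4 : rg q4 0 = n by rewrite rg_run.
have m4 : madj q4 by move=> u v; rewrite ar_run //; apply: m3.
have l4 (v : 'I_n) : ar q4 22 v = lev1 v by rewrite ar_run.
have [c5 h5] := @npv_table lev1 26 q4 isT rn4 m4 l4.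
set q5 := run (tabcntP 26 _ _) q4 in h5.
have rn5 : rg q5 0 = n by rewrite rg_run.
have [c6 h6] : cost (tabcntP 24 flagE (ER 6)) q5 <= 3 + n * (5 * n + 8) /\
    forall v : 'I_n, ar (run (tabcntP 24 flagE (ER 6)) q5) 24 v = key2 lev1 v.
  apply: (@tabcnt_rule n inp 24 _ (ER 6) id) => // v w s' f r2 r8.
  have ai' : adj_input a inp s'.
    by apply: input_fr f _ _ => // u; rewrite !ar_run //; apply: ai3.
  have dE q (u : 'I_n) : rg s' q = u -> ev s' (dprioE q) = dprio lev1 u.
    move=> rq; rewrite -[LHS]/(ar s' 26 (rg s' q) * (rg s' 0 + 1) + ev s' (eDeg q)).
    by rewrite (deg_val ai' rq) rq (fr_ar f) // h5 (fr_rg f) // rn5 addn1.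
  have lE (u : 'I_n) : ar s' 22 u = lev1 u by rewrite (fr_ar f) // ar_run // l4.
  have xE (u : 'I_n) : ar s' 25 u = nnx G lev1 u by rewrite (fr_ar f) // ar_run // h4.
  rewrite -[ev _ _]/((ar s' 22 (rg s' 8) == ar s' 22 (rg s' 2)) *
    ((0 < ar s' 25 (rg s' 8)) + (ev s' (dprioE 8) < ev s' (dprioE 2)))).
  by rewrite (dE _ _ r2) (dE _ _ r8) r2 r8 !lE xE !bE.
set q6 := run (tabcntP 24 _ _) q5 in h6.
have rn6 : rg q6 0 = n by rewrite rg_run.
have [c7 h7] : cost (tabP 21 PSkip (EA 24 (ER 2))) q6 <= 3 + n * 4 /\
    forall v : 'I_n, ar (run (tabP 21 PSkip (EA 24 (ER 2))) q6) 21 v = key2 lev1 v.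
  by apply: tab_copy => // v s' f r2; rewrite /= r2 (fr_ar f) // h6.
set q7 := run (tabP 21 _ _) q6 in h7.
have rn7 : rg q7 0 = n by rewrite rg_run.
have [c8 h8] : cost (zeroP 22) q7 <= 3 + n * 4 /\
    forall v : 'I_n, ar (run (zeroP 22) q7) 22 v = 0 by apply: (@tab_copy _ n _ _ _ (fun=> 0)).
set q8 := run (zeroP 22) q7 in h8.
have rn8 : rg q8 0 = n by rewrite rg_run.
have [c9 h9] : cost (zeroP 23) q8 <= 3 + n * 4 /\
    forall v : 'I_n, ar (run (zeroP 23) q8) 23 v = 0 by apply: (@tab_copy _ n _ _ _ (fun=> 0)).
set q9 := run (zeroP 23) q8 in h9.
have rn9 : rg q9 0 = n by rewrite rg_run.
have m5 : madj q5 by move=> u v; rewrite ar_run //; apply: m4.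
have m6 : madj q6 by move=> u v; rewrite ar_run //; apply: m5.
have m7 : madj q7 by move=> u v; rewrite ar_run //; apply: m6.
have m8 : madj q8 by move=> u v; rewrite ar_run //; apply: m7.
have m9 : madj q9 by move=> u v; rewrite ar_run //; apply: m8.
have k9 (v : 'I_n) : ar q9 21 v = key2 lev1 v by rewrite ar_run // ar_run // h7.
have l9 (v : 'I_n) : ar q9 22 v = 0 by rewrite ar_run // h8.
have [c10 h10] := @bfs_run n G inp n_gt0 (key2 lev1) q9 rn9 m9 k9 l9 h9.
have rE : run layersP s = run bfsP q9 by rewrite /layersP 10!run_seqs run_skip.
split.
- rewrite /layersP 9!cost_seqs -/q1 -/q2 -/q3 -/q4 -/q5 -/q6 -/q7 -/q8 -/q9 -/(zeroP _) -/(zeroP _) -/bfsP.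
  rewrite -[seqs [:: bfsP]]/bfsP; move: c1 c2 c3 c4 c5 c6 c7 c8 c9 c10; rewrite -/q1 -/q2 -/q3.
  move: (cost _ s) (cost _ q1) (cost _ q2) (cost _ q3) (cost _ q4) (cost _ q5) (cost _ q6).
  have hn := leq_pmulr n n_gt0; move: (cost _ q7) (cost _ q8) (cost _ q9) => *; rewrite -mulnn; nia.
- by rewrite rE => u v; rewrite ar_run //; apply: m9.
- rewrite rE; exists (key2 lev1), (fun v : 'I_n => ar (run bfsP q9) 22 v); split=> // U R U0 rR.
  apply: (star_rep U0 h10 (flag := fun y => key2 lev1 y == 0)) => [y /eqP fl|t rt].
    apply: (end_rep U0 h3 rR) => //.
      move=> u w lu g; apply/eqP => lw; move: fl => /eqP; rewrite cards_eq0 => /eqP/setP/(_ u).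
      rewrite !inE lu eqxx /=; suff -> : 0 < nnx G lev1 u by [].
      by apply/card_gt0P; exists w; rewrite inE g lw eqxx.
    move=> u lu; move: fl => /eqP; rewrite cards_eq0 => /eqP/setP/(_ u).
    rewrite !inE lu eqxx /= => /negbT; rewrite negb_or -leqNgt => /andP[_].
    rewrite /dprio; move: (npv _ _ y) (npv _ _ u) => p q.
    have d1 : #|nbh G u| <= n by rewrite -[leqRHS]card_ord max_card.
    move=> le; case: (ltngtP p q) => //= [qp|e].
      have : q.+1 * n.+1 <= p * n.+1 by rewrite leq_mul2r qp orbT.
      by rewrite mulSn; move: (q * n.+1) (p * n.+1) le d1 => *; clia.
    by move: le; rewrite -leqNgt e leq_add2l.
  (* A root has the least key in its component, and some vertex there has key 0. *)
  have [y ty fy] := flagged_ex t h3.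
  have := root_min rt (root_bot rt ty); rewrite fy; lia.
Qed.

Section Shifting.
Variables (key lev : 'I_n -> nat).
Hypothesis bfs : bfs_spec G key lev.
Local Notation isA := (isA G lev (@nat_of_ord n) n).
Local Notation isz := (isz G lev (@nat_of_ord n) n).
Local Notation nun := (nun G lev).
Local Notation zprio := (zprio G lev (@nat_of_ord n) n).

Lemma lev_le v : lev v <= n.
Proof.
rewrite -[leqRHS]card_ord; apply: (@surj_leq_card _ lev) => j hj.
exact: (bfs_cont bfs hj).
Qed.

Lemma mark_spec s : rg s 0 = n -> madj s -> (forall v : 'I_n, ar s 22 v = lev v) ->
  (forall v : 'I_n, ar s 31 v = isA v :> nat) ->
  let s' := run markP s in
  cost markP s <= 3 + 40 * n ^ 2 /\
  forall v : 'I_n, ar s' 32 v = isA v ||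
    [exists w : 'I_n, [&& lev w == (lev v).+1, ar s' 32 w != 0 & ~~ G v w]] :> nat.
Proof.
move=> rn mj hL hA.
pose eqn s1 v := ar s1 32 (nat_of_ord v) = isA v ||
  [exists w : 'I_n, [&& lev w == (lev v).+1, ar s1 32 w != 0 & ~~ G v w]] :> nat.
pose I t s1 := forall v, n - t < lev v -> eqn s1 v.
pose ib := PIf (eEq (eLev 2) (EB OpSub (ER 0) (ER 11)))
    (seqs [:: PSet 6 (EC 0); cntP 6 eN (ER 4) mE;
       PSto 32 (ER 2) (eLt (EC 0) (eOr (ER 6) (EA 31 (ER 2))))]) PSkip.
pose tau t := 3 + \sum_(v < n) ((lev v == n - t) * (5 * n + 8) + 4).
have := @for_rule inp 11 12 eN (PFor 2 3 eN ib) s I tau.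
have -> : ev s eN = n by [].
have card_ex (P : pred 'I_n) : (0 < #|[set w | P w]|) = [exists w, P w].
  by apply/card_gt0P/existsP => -[w]; rewrite ?inE => h; exists w; rewrite ?inE.
case=> //; last first.
- move=> h1 h2; split; last by move=> v; apply: h2; rewrite subnn; apply: bfs_pos bfs v.
  apply: leq_trans h1 _; rewrite leq_add2l.
  have one v : \sum_(t < n) (lev v == n - t) <= 1.
    have -> : \sum_(t < n) (lev v == n - t) = #|[set t : 'I_n | lev v == n - t]|.
      by rewrite -sum1_card [RHS]big_mkcond; apply: eq_bigr => t _; rewrite inE; case: (_ == _).
    apply/card_le1_eqP => x y; rewrite !inE => /eqP e1 /eqP e2; apply: ord_inj.
    by have := ltn_ord x; have := ltn_ord y; lia.
  rewrite /tau; under eq_bigr do rewrite addnAC.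
  rewrite big_split /= sum_nat_const card_ord exchange_big /=.
  have : \sum_(v < n) \sum_(t < n) ((lev v == n - t) * (5 * n + 8) + 4) <= n * (5 * n + 8 + 4 * n).
    apply: leq_trans (_ : \sum_(v < n) (5 * n + 8 + 4 * n) <= _); last first.
      by rewrite sum_nat_const card_ord.
    apply: leq_sum => v _.
    rewrite big_split /= sum_nat_const card_ord -big_distrl /= [n * 4]mulnC leq_add2r.
    by rewrite -[leqRHS]mul1n leq_mul2r one orbT.
  move: (\sum_(v < n) \sum_(t < n) _) => X hX; have hn := leq_pmulr n n_gt0.
  by rewrite -mulnn; nia.
- move=> t s' tN frs rt It.
  have rn' : rg s' 0 = n by rewrite (fr_rg frs).
  pose L := n - t.
  pose J i s1 := (forall v, L < lev v -> eqn s1 v) /\ (forall v : 'I_n, v < i -> lev v = L -> eqn s1 v).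
  pose tau' i := if insub i is Some v then (lev v == L) * (5 * n + 8) + 2 else 0.
  have := @for_rule inp 2 3 eN ib s' J tau'.
  have -> : ev s' eN = n by [].
  case=> //; last first.
  + move=> h1 [j1 j2]; split.
      apply: leq_trans h1 _; rewrite /tau leq_add2l; apply: leq_sum => v _.
      by rewrite /tau' valK -addnA.
    move=> v hv; have [h|h] := ltnP L (lev v); first exact: j1.
    by apply: j2 => //; move: h hv; rewrite /L; lia.
  + move=> i s1 iN f1 r2 [J1 J2]; pose v := Ordinal iN.
    have r11 : rg s1 11 = t by rewrite (fr_rg f1).
    have {}f1 : fr [:: 2; 3; 4; 5; 6; 8; 11; 12] [:: 32] s s1.
      by apply: fr_trans (fr_sub frs _ _) (fr_sub f1 _ _).
    have tE : tau' i = (lev v == L) * (5 * n + 8) + 2 by rewrite /tau' -[i]/(val v) valK.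
    have rn1 : rg s1 0 = n by rewrite (fr_rg f1).
    have cE : (ev s1 (eEq (eLev 2) (EB OpSub (ER 0) (ER 11))) == 0) = (lev v != L).
      by rewrite /= r2 rn1 r11 (fr_ar f1) // -[i]/(nat_of_ord v) hL eqb0.
    have vi (u : 'I_n) : (u < i.+1) = (u == v) || (u < i) by rewrite ltnS leq_eqVlt.
    rewrite /ib cost_if run_if cE tE; case: (eqVneq (lev v) L) => [lv|nl] /=; last first.
      split=> //; split=> [u /J1 //|u]; rewrite vi => /orP[/eqP-> e|h1 h2]; last exact: (J2 u).
      by rewrite e eqxx in nl.
    rewrite 2!cost_seqs 3!run_seqs run_skip cost_set run_set.
    rewrite -[seqs [:: PSto _ _ _]]/(PSto 32 (ER 2) (eLt (EC 0) (eOr (ER 6) (EA 31 (ER 2))))).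
    rewrite cost_sto run_sto; set s2 := setr 6 _ s1.
    have := @cnt_rule inp 6 eN (ER 4) mE s2 (iota 0 n) (fun u => if insub u is Some w then
      [&& lev w == (lev v).+1, ar s1 32 w != 0 & ~~ G v w] else false).
    case=> //.
    * by rewrite size_iota.
    * by move=> j s3 jN _ /= ->; rewrite nth_iota // -(size_iota 0 n).
    * move=> j s3 jN f3; rewrite size_iota in jN; rewrite nth_iota // add0n => r8.
      rewrite (insubT (fun i => i < n) jN); set w := Sub j jN.
      have f3' : fr [:: 2; 3; 4; 5; 6; 8; 11; 12] [:: 32] s s3.
        apply: fr_trans f1 _; apply: fr_trans (fr_sub f3 _ _) => //; exact: fr_setr.
      have e32 : ar s3 32 = ar s1 32 by rewrite (fr_ar f3).
      have e2 : rg s3 2 = v by rewrite (fr_rg f3).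
      rewrite -[ev _ _]/((ar s3 22 (rg s3 8) == ar s3 22 (rg s3 2) + 1) *
        (ar s3 32 (rg s3 8) * (ar s3 20 (rg s3 2 * rg s3 0 + rg s3 8) == 0))).
      rewrite r8 e2 (fr_rg f3' (r := 0)) // rn e32 !(fr_ar f3') // -[j]/(nat_of_ord w).
      by rewrite mj !hL addn1 !bE.
    rewrite size_iota sum_iota_ord => h1 h2; set s3 := run (cntP _ _ _ _) s2 in h2 *.
    have e2 : rg s3 2 = v by rewrite rg_run.
    have e31 : ar s3 31 v = isA v by rewrite ar_run // -[ar s2 31]/(ar s1 31) (fr_ar f1).
    have e32 : ar s3 32 = ar s1 32 by rewrite ar_run.
    split; first by move: h1; move: (cost _ s2); lia.
    rewrite -[ev s3 (eLt _ _)]/(nat_of_bool (0 < rg s3 6 + ar s3 31 (rg s3 2))).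
    rewrite -[ev s3 (ER 2)]/(rg s3 2) e2 e31 h2 add0n.
    set val0 := nat_of_bool _; set s4 := seta 32 _ _ s3.
    have a4 (u : 'I_n) : ar s4 32 u = if u == v then val0 else ar s1 32 u.
      by rewrite ar_seta e32.
    (* Writing at level [L] cannot disturb what is known about levels from [L] on, as these
       conditions look at higher levels only. *)
    have same (u : 'I_n) : L <= lev u ->
        [exists w : 'I_n, [&& lev w == (lev u).+1, ar s4 32 w != 0 & ~~ G u w]] =
        [exists w : 'I_n, [&& lev w == (lev u).+1, ar s1 32 w != 0 & ~~ G u w]].
      move=> lu; apply: eq_existsb => w; rewrite a4; have [->|//] := eqVneq w v.
      by have -> : (lev v == (lev u).+1) = false by apply/eqP; lia.
    have valE : val0 = isA v ||
        [exists w : 'I_n, [&& lev w == (lev v).+1, ar s1 32 w != 0 & ~~ G v w]] :> nat.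
      by rewrite /val0 -card_ex addn_gt0 lt0b orbC.
    have keep (u : 'I_n) : u != v -> L <= lev u -> eqn s1 u -> eqn (setr 2 i.+1 s4) u.
      by move=> uv lu; rewrite /eqn -[ar (setr _ _ _) 32]/(ar s4 32) same // a4 (negPf uv).
    split=> [u hu|u].
      apply: keep => //; [|exact: ltnW|exact: J1].
      by apply/eqP => e; move: hu; rewrite e lv ltnn.
    rewrite vi; have [-> _ _|uv /= ui lu] := eqVneq u v.
      rewrite /eqn -[ar (setr _ _ _) 32]/(ar s4 32) same; last by rewrite lv.
      by rewrite a4 eqxx; exact: valE.
    by apply: keep => //; [rewrite lu|apply: J2].
- by move=> v; rewrite subn0 ltnNge lev_le.
Qed.

Lemma columns_spec s : rg s 0 = n -> madj s -> (forall v : 'I_n, ar s 22 v = lev v) ->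
  let s' := run columnsP s in
  cost columnsP s <= 200 * n ^ 2 /\ exists M : pred 'I_n,
  (forall v, M v = isA v || [exists w, [&& lev w == (lev v).+1, M w & ~~ G v w]]) /\
  forall v : 'I_n, ar s' 2 v = scol lev M v.
Proof.
move=> rn mj hL.
have [c1 h1] := @nnx_table lev 25 s isT rn mj hL; set q1 := run (tabcntP 25 _ _) s in h1.
have rn1 : rg q1 0 = n by rewrite rg_run.
have m1 : madj q1 by move=> u v; rewrite ar_run //; apply: mj.
have l1 (v : 'I_n) : ar q1 22 v = lev v by rewrite ar_run.
have [c2 h2] := @npv_table lev 26 q1 isT rn1 m1 l1; set q2 := run (tabcntP 26 _ _) q1 in h2.
have rn2 : rg q2 0 = n by rewrite rg_run.
have m2 : madj q2 by move=> u v; rewrite ar_run //; apply: m1.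
have l2 (v : 'I_n) : ar q2 22 v = lev v by rewrite ar_run.
have x2 (v : 'I_n) : ar q2 25 v = nnx G lev v by rewrite ar_run.
have [c3 h3] : cost (tabcntP 29 nunE (ER 6)) q2 <= 3 + n * (5 * n + 8) /\
    forall v : 'I_n, ar (run (tabcntP 29 nunE (ER 6)) q2) 29 v = nun v.
  apply: (@tabcnt_rule n inp 29 _ (ER 6) id) => // v w s' f r2 r8.
  by rewrite /= r2 r8 !(fr_ar f) // (fr_rg f (r := 0)) // rn2 m2 !l2 !bE.
set q3 := run (tabcntP 29 _ _) q2 in h3.
have rn3 : rg q3 0 = n by rewrite rg_run.
have m3 : madj q3 by move=> u v; rewrite ar_run //; apply: m2.
have l3 (v : 'I_n) : ar q3 22 v = lev v by rewrite ar_run.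
have x3 (v : 'I_n) : ar q3 25 v = nnx G lev v by rewrite ar_run.
have p3 (v : 'I_n) : ar q3 26 v = npv G lev v by rewrite ar_run.
have [c4 h4] : cost (tabcntP 30 betterE (ER 6)) q3 <= 3 + n * (5 * n + 8) /\
    forall v : 'I_n, ar (run (tabcntP 30 betterE (ER 6)) q3) 30 v =
      #|[set u | [&& lev u == lev v, 0 < nun u & zprio u < zprio v]]|.
  apply: (@tabcnt_rule n inp 30 _ (ER 6) id) => // v w s' f r2 r8.
  rewrite /= r2 r8 !(fr_ar f) // (fr_rg f (r := 0)) // rn3 !l3 !h3 !x3 !p3 !addn1 !bE.
  by [].
set q4 := run (tabcntP 30 _ _) q3 in h4.
have rn4 : rg q4 0 = n by rewrite rg_run.
have m4 : madj q4 by move=> u v; rewrite ar_run //; apply: m3.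
have l4 (v : 'I_n) : ar q4 22 v = lev v by rewrite ar_run.
have u4 (v : 'I_n) : ar q4 29 v = nun v by rewrite ar_run.
have [c5 h5] : cost (tabcntP 31 isAE posE) q4 <= 3 + n * (5 * n + 8) /\
    forall v : 'I_n, ar (run (tabcntP 31 isAE posE) q4) 31 v =
      (fun c => nat_of_bool (0 < c)) #|[set z | [&& lev z == lev v, isz z, z != v & ~~ G v z]]|.
  apply: (@tabcnt_rule n inp 31 _ posE (fun c => nat_of_bool (0 < c))) => // v w s' f r2 r8.
  rewrite /= r2 r8 !(fr_ar f) // (fr_rg f (r := 0)) // rn4 m4 !l4 !u4 !h4 !bE.
  by rewrite /isz -!andbA.
set q5 := run (tabcntP 31 _ _) q4 in h5.
have rn5 : rg q5 0 = n by rewrite rg_run.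
have m5 : madj q5 by move=> u v; rewrite ar_run //; apply: m4.
have l5 (v : 'I_n) : ar q5 22 v = lev v by rewrite ar_run.
have a5 (v : 'I_n) : ar q5 31 v = isA v :> nat.
  rewrite h5; congr nat_of_bool; apply/card_gt0P/existsP => -[z]; rewrite ?inE => h; exists z.
    exact: h.
  by rewrite inE.
have [c6 h6] := mark_spec rn5 m5 l5 a5; set q6 := run markP q5 in h6.
have [c7 h7] : cost (tabP 2 PSkip (EB OpSub (eLev 2) (EA 32 (ER 2)))) q6 <= 3 + n * 4 /\
    forall v : 'I_n, ar (run (tabP 2 PSkip (EB OpSub (eLev 2) (EA 32 (ER 2)))) q6) 2 v =
      lev v - ar q6 32 v.
  apply: tab_copy; first by rewrite rg_run.
  by move=> v s' f r2; rewrite /= r2 !(fr_ar f) // ar_run // l5.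
have rE : run columnsP s = run (tabP 2 PSkip (EB OpSub (eLev 2) (EA 32 (ER 2)))) q6.
  by rewrite /columnsP 7!run_seqs run_skip.
split.
  rewrite /columnsP 6!cost_seqs -/q1 -/q2 -/q3 -/q4 -/q5 -/q6.
  rewrite -[seqs [:: tabP _ _ _]]/(tabP 2 PSkip (EB OpSub (eLev 2) (EA 32 (ER 2)))).
  move: c1 c2 c3 c4 c5 c6 c7; move: (cost _ s) (cost _ q1) (cost _ q2) (cost _ q3) (cost _ q4).
  by have hn := leq_pmulr n n_gt0; move: (cost _ q5) (cost _ q6) => *; rewrite -mulnn; nia.
exists (fun v : 'I_n => ar q6 32 v != 0); split=> v.
  by rewrite h6 eqb0 negbK.
by rewrite rE h7 /scol; have := h6 v; case: (_ || _) => ->.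
Qed.

End Shifting.

End Solve.

Definition rprioE q := EB OpAdd (EB OpMul (EB OpAdd (EB OpMul (EB OpSub (ER 0) (EA 33 (ER q)))
  (eS (ER 0))) (EA 34 (ER q))) (eS (ER 0))) (EB OpSub (ER 0) (ER q)).
Definition predE := eAnd (eEq (eCol 8) (eCol 2)) (eLt (rprioE 2) (rprioE 8)).
Definition nprevE := eAnd (eEq (eS (eCol 8)) (eCol 2)) (eNot (eAdj 2 8)).
Definition sameE := eEq (eRow 8) (eRow 2).
(** Register 7 is the length of the queue. A stamp names the source of the current search, so
    nothing is reset between searches; the target [n] stands for a missing arrow. *)
Definition pushP k : prog :=
  PSeq (PSet 10 (EA k (ER 8)))
    (PIf (eAnd (eLt (ER 10) (ER 0)) (eNot (eEq (EA 39 (ER 10)) (eS (ER 2)))))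
      (seqs [:: PSto 39 (ER 10) (eS (ER 2)); PSto 38 (ER 7) (ER 10); PSet 7 (eS (ER 7))]) PSkip).
(** Round [j] expands the entry [j] of the queue, if it exists. At most [n] entries occur and each
    has three arrows, so one search is linear and all searches together are quadratic. *)
Definition visitP : prog := PIf (eLt (ER 4) (ER 7))
  (seqs [:: PSet 8 (EA 38 (ER 4)); pushP 35; pushP 36; pushP 37]) PSkip.
Definition reachP : prog := PFor 2 3 eN (seqs [:: PSto 38 (EC 0) (ER 2);
  PSto 39 (ER 2) (eS (ER 2)); PSet 7 (EC 1); PFor 4 5 eN visitP; PSto 1 (ER 2) (ER 7)]).
Definition rowsP : prog := seqs [:: tabcntP 33 (nextE eCol) (ER 6);
  tabcntP 34 (prevE eCol) (ER 6); tabargP 35 predE rprioE; tabargP 36 (nextE eCol) rprioE;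
  tabargP 37 nprevE rprioE; reachP; tabcntP 4 (eAnd (nextE eCol) sameE) posE;
  tabcntP 3 (eAnd (prevE eCol) sameE) posE; PSet 1 (EC 0);
  maxP 1 eN (ER 4) (EC 1) (eCol 8)].
Definition solveP : prog :=
  seqs [:: PSet 0 (EI (EC 0)); offsetP; layersP; columnsP; rowsP; coreP].

Section Reach.
Variables (n : nat) (inp : seq nat).
Local Notation run := (run inp).
Local Notation cost := (cost inp).
Local Notation ev := (ev inp).

Definition qinv (v : nat) (s : st) (l : seq 'I_n) : Prop :=
  [/\ uniq l, rg s 7 = size l, (forall j, j < size l -> ar s 38 j = nth 0 (map val l) j),
      (forall h : 'I_n, (ar s 39 h == v.+1) = (h \in l)) & forall h, ar s 39 h <= v.+1].

Lemma push_spec k v s l (g : 'I_n) : k \notin [:: 38; 39] ->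
  rg s 0 = n -> rg s 2 = v -> rg s 8 = g -> qinv v s l ->
  cost (pushP k) s <= 6 /\ exists r, [/\ qinv v (run (pushP k) s) (l ++ r),
    (forall h, h \in r -> ar s k g = h) & forall h : 'I_n, ar s k g = h -> h \in l ++ r].
Proof.
move=> hk rn r2 r8 [ul r7 q38 q39 m39]; rewrite /pushP cost_seq run_seq cost_set run_set.
rewrite -[ev s (EA k (ER 8))]/(ar s k (rg s 8)) r8; set h := ar s k g; set s1 := setr 10 h s.
split; first by rewrite cost_if; case: ifP => _; rewrite ?cost_skip // 2!cost_seqs !costE.
rewrite run_if; have -> : (ev s1 (eAnd (eLt (ER 10) (ER 0)) (eNot (eEq (EA 39 (ER 10))
    (eS (ER 2))))) == 0) = ~~ ((h < n) && (ar s 39 h != v.+1)).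
  by rewrite /= rn r2 addn1 !bE.
case: (boolP (_ && _)) => [/andP[hn nm]|] /=.
  pose w := Ordinal hn; exists [:: w].
  have wl : w \notin l by rewrite -q39.
  rewrite !run_seqs run_skip !runE /= r2 r7; split=> [|x|x ex].
  - split=> [|||x|x] /=.
    + by rewrite cat_uniq ul /= orbF wl.
    + by rewrite size_cat.
    + move=> j; rewrite size_cat map_cat nth_cat size_map /= => jl; rewrite updrE.
      case: ltnP => jl'; first by rewrite ltn_eqF // q38.
      have -> : j = size l by move: jl jl'; lia.
      by rewrite eqxx subnn.
    + rewrite updrE addn1 mem_cat inE -[(x : nat) == h]/(x == w) -q39.
      by case: (x == w); rewrite ?eqxx ?orbT ?orbF.
    + by rewrite updrE addn1; case: eqP.
  - by rewrite inE => /eqP->.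
  - have -> : x = w by apply: val_inj; rewrite /= -ex.
    by rewrite mem_cat inE eqxx orbT.
rewrite negb_and negbK -leqNgt run_skip => hc; exists [::]; rewrite cats0; split=> // x e.
by case/orP: hc => [|]; rewrite e ?q39 // leqNgt ltn_ord.
Qed.

Section From.
Variables (s0 : st).
Definition step_rel : rel 'I_n := fun u w =>
  [|| ar s0 35 u == w :> nat, ar s0 36 u == w :> nat | ar s0 37 u == w :> nat].
Local Notation e := step_rel.

Lemma reach_spec : rg s0 0 = n -> (forall i, ar s0 39 i = 0) ->
  cost reachP s0 <= 3 + n * (40 * n + 10) /\
  forall v : 'I_n, ar (run reachP s0) 1 v = #|connect e v|.
Proof.
move=> rn z39.
pose I i s1 := (forall h, ar s1 39 h <= i) /\ forall v : 'I_n, v < i -> ar s1 1 v = #|connect e v|.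
pose body := seqs [:: PSto 38 (EC 0) (ER 2);
  PSto 39 (ER 2) (eS (ER 2)); PSet 7 (EC 1); PFor 4 5 eN visitP; PSto 1 (ER 2) (ER 7)].
have := @for_rule_const inp 2 3 eN body s0 I (40 * n + 8).
have -> : ev s0 eN = n by [].
case=> //; last first.
- move=> h1 [_ h2]; split; last by move=> v; apply: h2.
  by apply: leq_trans h1 _; rewrite -addnA.
- move=> i s1 iN f1 r2 [I1 I2]; pose v := Ordinal iN.
  pose s2 := setr 7 1 (seta 39 i i.+1 (seta 38 0 i s1)).
  have s2E : run (PSet 7 (EC 1)) (run (PSto 39 (ER 2) (eS (ER 2))) (run (PSto 38 (EC 0) (ER 2)) s1)) = s2.
    by rewrite !runE /= r2 addn1.
  have rn1 : rg s1 0 = n by rewrite (fr_rg f1).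
  have t1 k : k \in [:: 35; 36; 37] -> ar s1 k = ar s0 k.
    by rewrite !inE => /or3P[]/eqP->; rewrite (fr_ar f1).
  pose K j s3 := exists l : seq 'I_n, [/\ qinv i s3 l, v \in l, (forall h, h \in l -> connect e v h) &
    forall m, m < j -> m < size l -> forall h, e (nth v l m) h -> h \in l].
  have := @for_rule_const inp 4 5 eN visitP s2 K 30.
  have -> : ev s2 eN = n by [].
  case=> //; last first.
  + move=> c2 [l [q vl cl hl]]; set s3 := run (PFor 4 5 eN visitP) s2 in q *.
    have f3 : fr [:: 4; 5; 7; 8; 10] [:: 38; 39] s2 s3 by apply: fr_runb.
    have [ul r7 _ _ m39] := q.
    have sl : size l <= n by rewrite -(card_uniqP ul) -[leqRHS]card_ord max_card.
    have gen p u : u \in l -> path e u p -> seq.last u p \in l.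
      elim: p u => //= x p IH u ul' /andP[eux hp]; apply: IH => //.
      have ui : index u l < size l by rewrite index_mem.
      by apply: (hl _ (leq_trans ui sl) ui); rewrite nth_index.
    have conn_l h : connect e v h -> h \in l.
      case/connectP=> p hp ->; exact: gen.
    have cE : #|connect e v| = size l.
      rewrite -(card_uniqP ul); apply: eq_card => h; rewrite !inE.
      by apply/idP/idP => [/conn_l|/cl].
    have rE : run body s1 = seta 1 i (size l) s3.
      rewrite /body 5!run_seqs run_skip s2E -/s3 run_sto; congr (seta 1 _ _ _); last exact: r7.
      by rewrite /= (fr_rg f3).
    have cE' : cost body s1 = 1 + (1 + (1 + (cost (PFor 4 5 eN visitP) s2 + 1))).
      by rewrite /body 4!cost_seqs s2E !costE.
    rewrite rE cE'; split; first by move: c2; rewrite mulnDr; lia.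
    split=> [h|u ui]; first exact: m39.
    rewrite -[ar (setr _ _ _) 1]/(ar (seta 1 i (size l) s3) 1) ar_seta.
    rewrite -[(u : nat) == i]/(u == v); have [->|uv] := eqVneq u v; first by rewrite cE.
    rewrite (fr_ar f3) // -[ar s2 1]/(ar s1 1); apply: I2.
    move: ui; rewrite ltnS leq_eqVlt => /orP[/eqP e'|//].
    by case/eqP: uv; apply: val_inj.
  + move=> j s3 jN f3 r4 [l [q vl cl hl]].
    have {}f3 : fr [:: 4; 5; 7; 8; 10] [:: 38; 39] s2 s3 by apply: fr_sub f3 _ _.
    have rn3 : rg s3 0 = n by rewrite (fr_rg f3).
    have r23 : rg s3 2 = i by rewrite (fr_rg f3).
    have t3 k s4 : k \in [:: 35; 36; 37] -> fr [:: 4; 5; 7; 8; 10] [:: 38; 39] s2 s4 ->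
        ar s4 k = ar s0 k.
      move=> hk f4; rewrite -t1 // (fr_ar f4); last by move: hk; rewrite !inE => /or3P[]/eqP->.
      by move: hk; rewrite !inE => /or3P[]/eqP->.
    have [_ r7 q38 _ _] := q.
    rewrite /visitP cost_if run_if -[ev s3 _]/(nat_of_bool (rg s3 4 < rg s3 7)) r4 r7 eqb0.
    case: (ltnP j (size l)) => jl /=; last first.
      rewrite cost_skip run_skip; split=> //; exists l; split=> // m mj ml; apply: hl => //.
      exact: leq_trans ml jl.
    pose g := nth v l j.
    have gl : g \in l by rewrite mem_nth.
    rewrite 3!cost_seqs 4!run_seqs run_skip cost_set run_set.
    rewrite -[seqs [:: pushP 37]]/(pushP 37).
    have -> : ev s3 (EA 38 (ER 4)) = g by rewrite /= r4 q38 // (nth_map v).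
    set p0 := setr 8 g s3.
    have fp0 : fr [:: 4; 5; 7; 8; 10] [:: 38; 39] s2 p0 by apply: fr_trans f3 _; apply: fr_setr.
    have q0 : qinv i p0 l by [].
    have [c1 [l1 [q1 s1' e1]]] := @push_spec 35 i p0 l g isT rn3 r23 erefl q0.
    set p1 := run (pushP 35) p0 in q1 *.
    have fp1 : fr [:: 4; 5; 7; 8; 10] [:: 38; 39] s2 p1.
      by apply: fr_trans fp0 _; apply: fr_runb.
    have rg1 : [/\ rg p1 0 = n, rg p1 2 = i & rg p1 8 = g] by rewrite !rg_run.
    have [rg10 rg12 rg18] := rg1.
    have [c2 [l2 [q2 s2' e2]]] := @push_spec 36 i p1 _ g isT rg10 rg12 rg18 q1.
    set p2 := run (pushP 36) p1 in q2 *.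
    have fp2 : fr [:: 4; 5; 7; 8; 10] [:: 38; 39] s2 p2.
      by apply: fr_trans fp1 _; apply: fr_runb.
    have rg2 : [/\ rg p2 0 = n, rg p2 2 = i & rg p2 8 = g] by rewrite !(rg_run _ p1).
    have [rg20 rg22 rg28] := rg2.
    have [c3 [l3 [q3 s3' e3]]] := @push_spec 37 i p2 _ g isT rg20 rg22 rg28 q2.
    set p3 := run (pushP 37) p2 in q3 *.
    rewrite !(t3 35) // in s1' e1; rewrite !(t3 36) // in s2' e2; rewrite !(t3 37) // in s3' e3.
    split; first by move: (cost _ p0) (cost _ p1) (cost _ p2) c1 c2 c3 => x y z; lia.
    rewrite -!catA in q3 e3; rewrite -catA in e2.
    exists (l ++ l1 ++ l2 ++ l3); split=> //.
    * by rewrite mem_cat vl.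
    * have cg : connect e v g by apply: cl.
      move=> h; rewrite !mem_cat => /or4P[/cl//|/s1' h1|/s2' h1|/s3' h1];
        apply: connect_trans cg (connect1 _); rewrite /step_rel h1 eqxx ?orbT //.
    * move=> m mj ml h; rewrite nth_cat; have mjl : m < size l by apply: leq_trans mj jl.
      rewrite mjl; move: mj; rewrite ltnS leq_eqVlt => /orP[/eqP->|mj eh]; last first.
        by rewrite mem_cat (hl m).
      rewrite -/g => /or3P[]/eqP eh.
      - by have := e1 h eh; rewrite !mem_cat => /orP[->//|->]; rewrite orbT.
      - by have := e2 h eh; rewrite !mem_cat => /or3P[->//|->|->]; rewrite ?orbT.
      - exact: e3.
  + exists [:: v]; split=> //=.
    * split=> //= [j|h|h]; first by case: j.
        rewrite updrE inE -[(h : nat) == i]/(h == v).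
        case: (eqVneq h v) => _; first by rewrite eqxx.
        by apply/eqP => e'; have := I1 h; rewrite e' ltnn.
      by rewrite updrE; case: eqP => // _; apply: leq_trans (I1 h) _.
    * by rewrite inE.
    * by move=> h; rewrite inE => /eqP->; apply: connect0.
- by split=> // h; rewrite /= z39.
Qed.

End From.
End Reach.

(** * Correctness of the program that is given only the graph *)

Section Main.
Variables (n : nat) (G : sgraph 'I_n) (a : 'I_n -> seq 'I_n) (inp : seq nat).
Hypothesis n_gt0 : 0 < n.
Hypothesis aP : adjacency_lists G a.
Local Notation run := (run inp).
Local Notation cost := (cost inp).
Local Notation ev := (ev inp).
Local Notation madj := (madj G).
Local Notation vid := (@nat_of_ord n).

Section WithColumns.
Variable col : 'I_n -> nat.
Local Notation rprio := (rprio G col vid n).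

Lemma rows_spec s : rg s 0 = n -> madj s -> (forall v : 'I_n, ar s 2 v = col v) ->
  (forall i, ar s 39 i = 0) ->
  let s' := run rowsP s in
  cost rowsP s <= 300 * n ^ 2 /\ exists e : rel 'I_n,
  [/\ (forall v w, e v w -> [\/ col w = col v /\ rprio v < rprio w,
        col w = (col v).+1 /\ G v w | col v = (col w).+1 /\ ~~ G w v]),
      (forall v u, col u = col v -> rprio v < rprio u ->
        exists p, [/\ e v p, col p = col v, rprio v < rprio p & rprio p <= rprio u]),
      (forall u w, col w = (col u).+1 -> G u w ->
        exists w', [/\ e u w', col w' = col w & rprio w' <= rprio w]),
      (forall u w, col w = (col u).+1 -> ~~ G u w ->
        exists u', [/\ e w u', col u' = col u & rprio u' <= rprio u]) &
      rg s' 1 = \max_v col v /\ forall v : 'I_n, [/\ ar s' 1 v = rrow e v, ar s' 2 v = col v,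
        ar s' 3 v = rs1 G col e v :> nat & ar s' 4 v = rs2 G col e v :> nat]].
Proof.
move=> rn mj hC z39.
have [c1 h1] : cost (tabcntP 33 (nextE eCol) (ER 6)) s <= 3 + n * (5 * n + 8) /\
    forall v : 'I_n, ar (run (tabcntP 33 (nextE eCol) (ER 6)) s) 33 v = #|nextc G col v|.
  apply: (@tabcnt_rule n inp 33 _ (ER 6) id) => // v w s' f r2 r8.
  by rewrite /= r2 r8 !(fr_ar f) // (fr_rg f (r := 0)) // rn mj !hC addn1 !bE.
set q1 := run (tabcntP 33 _ _) s in h1.
have rn1 : rg q1 0 = n by rewrite rg_run.
have m1 : madj q1 by move=> u v; rewrite ar_run //; apply: mj.
have l1 (v : 'I_n) : ar q1 2 v = col v by rewrite ar_run.
have [c2 h2] : cost (tabcntP 34 (prevE eCol) (ER 6)) q1 <= 3 + n * (5 * n + 8) /\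
    forall v : 'I_n, ar (run (tabcntP 34 (prevE eCol) (ER 6)) q1) 34 v = #|prevc G col v|.
  apply: (@tabcnt_rule n inp 34 _ (ER 6) id) => // v w s' f r2 r8.
  by rewrite /= r2 r8 !(fr_ar f) // (fr_rg f (r := 0)) // rn1 m1 !l1 addn1 !bE.
set q2 := run (tabcntP 34 _ _) q1 in h2.
pose ready q := [/\ rg q 0 = n, madj q, forall v : 'I_n, ar q 2 v = col v,
  forall v : 'I_n, ar q 33 v = #|nextc G col v| & forall v : 'I_n, ar q 34 v = #|prevc G col v|].
have ready_fr Rs Ks q q' : fr Rs Ks q q' -> 0 \notin Rs ->
    ~~ has (mem [:: 20; 2; 33; 34]) Ks -> ready q -> ready q'.
  move=> f h0 hk [d1 d2 d3 d4 d5].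
  have ka k : k \in [:: 20; 2; 33; 34] -> ar q' k = ar q k.
    by move=> hk'; apply: (fr_ar f); apply: contra hk => h; apply/hasP; exists k.
  split; first by rewrite (fr_rg f).
  - by move=> u v; rewrite ka //; apply: d2.
  - by move=> v; rewrite ka.
  - by move=> v; rewrite ka.
  - by move=> v; rewrite ka.
have ready_run p q : 0 \notin rmods p -> ~~ has (mem [:: 20; 2; 33; 34]) (amods p) ->
    ready q -> ready (run p q).
  by move=> h0 hk; apply: ready_fr h0 hk; apply: fr_run.
have y2 : ready q2 by split=> [|u v|v|v|v] //; rewrite ?rg_run // ar_run //; apply: m1.
have rpE q q' p (u : 'I_n) : ready q -> ready q' -> rg q' p = u -> ev q' (rprioE p) = rprio u.
  by move=> _ [d1 _ _ d4 d5] rp; rewrite /= rp d1 d4 d5 !addn1.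
have tabl k c P : k \in [:: 35; 36; 37] -> forall q, ready q ->
    (forall (v w : 'I_n) q', ready q' -> rg q' 2 = v -> rg q' 8 = w -> (ev q' c != 0) = P v w) ->
    cost (tabargP k c rprioE) q <= 3 + n * (5 * n + 8) /\
    forall v : 'I_n, (ar (run (tabargP k c rprioE) q) k v = n /\ forall w, ~~ P v w) \/
      exists w : 'I_n, [/\ ar (run (tabargP k c rprioE) q) k v = w, P v w &
        forall w', P v w' -> rprio w <= rprio w'].
  move=> hk q yq hc; have kk : ~~ has (mem [:: 20; 2; 33; 34]) [:: k].
    by move: hk; rewrite !inE => /or3P[]/eqP->.
  apply: tabarg_rule; first by case: yq.
    by move=> v w s' f r2 r8; apply: hc => //; apply: ready_fr f _ _ yq.
  move=> w p s' f rp _; apply: (rpE q) => //; exact: ready_fr f _ _ yq.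
pose P1 v w := (col w == col v) && (rprio v < rprio w).
pose P2 v w := G v w && (col w == (col v).+1).
pose P3 v w := ((col w).+1 == col v) && ~~ G v w.
have [c3 h3] : cost (tabargP 35 predE rprioE) q2 <= 3 + n * (5 * n + 8) /\
    forall v : 'I_n, (ar (run (tabargP 35 predE rprioE) q2) 35 v = n /\ forall w, ~~ P1 v w) \/
      exists w : 'I_n, [/\ ar (run (tabargP 35 predE rprioE) q2) 35 v = w, P1 v w &
        forall w', P1 v w' -> rprio w <= rprio w'].
  apply: tabl => // v w q' yq r2 r8.
  rewrite -[ev q' predE]/((ar q' 2 (rg q' 8) == ar q' 2 (rg q' 2)) *
    (ev q' (rprioE 2) < ev q' (rprioE 8))).
  rewrite (rpE q' q' 2 v) // (rpE q' q' 8 w) // r2 r8; case: yq => _ _ d3 _ _.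
  by rewrite !d3 !bE.
set q3 := run (tabargP 35 _ _) q2 in h3.
have y3 : ready q3 by apply: ready_run y2.
have [c4 h4] : cost (tabargP 36 (nextE eCol) rprioE) q3 <= 3 + n * (5 * n + 8) /\
    forall v : 'I_n, (ar (run (tabargP 36 (nextE eCol) rprioE) q3) 36 v = n /\ forall w, ~~ P2 v w) \/
      exists w : 'I_n, [/\ ar (run (tabargP 36 (nextE eCol) rprioE) q3) 36 v = w, P2 v w &
        forall w', P2 v w' -> rprio w <= rprio w'].
  apply: tabl => // v w q' [d1 d2 d3 _ _] r2 r8.
  by rewrite /= r2 r8 d1 d2 !d3 addn1 !bE.
set q4 := run (tabargP 36 _ _) q3 in h4.
have y4 : ready q4 by apply: ready_run y3.
have [c5 h5] : cost (tabargP 37 nprevE rprioE) q4 <= 3 + n * (5 * n + 8) /\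
    forall v : 'I_n, (ar (run (tabargP 37 nprevE rprioE) q4) 37 v = n /\ forall w, ~~ P3 v w) \/
      exists w : 'I_n, [/\ ar (run (tabargP 37 nprevE rprioE) q4) 37 v = w, P3 v w &
        forall w', P3 v w' -> rprio w <= rprio w'].
  apply: tabl => // v w q' [d1 d2 d3 _ _] r2 r8.
  by rewrite /= r2 r8 d1 d2 !d3 addn1 !bE.
set q5 := run (tabargP 37 _ _) q4 in h5.
have y5 : ready q5 by apply: ready_run y4.
have e35 : ar q5 35 = ar q3 35 by rewrite ar_run // ar_run.
have e36 : ar q5 36 = ar q4 36 by rewrite ar_run.
rewrite -e35 in h3; rewrite -e36 in h4.
have z5 i : ar q5 39 i = 0 by rewrite !ar_run // z39.
have [rn5 _ _ _ _] := y5.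
have [c6 h6] := @reach_spec n inp q5 rn5 z5; set q6 := run reachP q5 in h6.
pose e := @step_rel n q5.
have y6 : ready q6 by apply: ready_run y5.
have [c7 h7] : cost (tabcntP 4 (eAnd (nextE eCol) sameE) posE) q6 <= 3 + n * (5 * n + 8) /\
    forall v : 'I_n, ar (run (tabcntP 4 (eAnd (nextE eCol) sameE) posE) q6) 4 v =
    (fun c => nat_of_bool (0 < c)) #|[set w | [&& G v w, col w == (col v).+1 & rrow e w == rrow e v]]|.
  have [rn6 m6 l6 _ _] := y6.
  apply: (@tabcnt_rule n inp 4 _ posE (fun c => nat_of_bool (0 < c))) => // v w s' f r2 r8.
  rewrite /= r2 r8 !(fr_ar f) // (fr_rg f (r := 0)) // rn6 m6 !l6 !h6 addn1 !bE.
  by rewrite -andbA.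
set q7 := run (tabcntP 4 _ _) q6 in h7.
have y7 : ready q7 by apply: ready_run y6.
have r7 (v : 'I_n) : ar q7 1 v = rrow e v by rewrite ar_run // h6.
have [c8 h8] : cost (tabcntP 3 (eAnd (prevE eCol) sameE) posE) q7 <= 3 + n * (5 * n + 8) /\
    forall v : 'I_n, ar (run (tabcntP 3 (eAnd (prevE eCol) sameE) posE) q7) 3 v =
    (fun c => nat_of_bool (0 < c)) #|[set w | [&& G v w, (col w).+1 == col v & rrow e w == rrow e v]]|.
  have [rn7 m7 l7 _ _] := y7.
  apply: (@tabcnt_rule n inp 3 _ posE (fun c => nat_of_bool (0 < c))) => // v w s' f r2 r8.
  rewrite /= r2 r8 !(fr_ar f) // (fr_rg f (r := 0)) // rn7 m7 !l7 !r7 addn1 !bE.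
  by rewrite -andbA.
set q8 := run (tabcntP 3 _ _) q7 in h8.
have y8 : ready q8 by apply: ready_run y7.
pose q9 := setr 1 0 q8; have y9 : ready q9 by exact: y8.
have [rn9 _ l9 _ _] := y9.
have := @max_rule inp 1 eN (ER 4) (EC 1) (eCol 8) q9 (iota 0 n) xpredT
  (fun u => if insub u is Some w then col w else 0).
case=> //.
- by rewrite size_iota.
- by move=> j s3 jN _ /= ->; rewrite nth_iota // -(size_iota 0 n).
- move=> j s3 jN f3; rewrite size_iota in jN; rewrite nth_iota // add0n => r8; split=> //.
  by rewrite (insubT (fun i => i < n) jN) /= r8 (fr_ar f3) // -[j]/(nat_of_ord (Ordinal jN)) l9.
rewrite size_iota => c9 h9; set q10 := run (maxP _ _ _ _ _) q9 in h9.
have rE : run rowsP s = q10 by rewrite /rowsP 10!run_seqs run_skip.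
split.
  rewrite /rowsP 9!cost_seqs -/q1 -/q2 -/q3 -/q4 -/q5 -/q6 -/q7 -/q8 -[run (PSet 1 _) q8]/q9 cost_set.
  rewrite -[seqs [:: maxP _ _ _ _ _]]/(maxP 1 eN (ER 4) (EC 1) (eCol 8)).
  move: c1 c2 c3 c4 c5 c6 c7 c8 c9; move: (cost _ s) (cost _ q1) (cost _ q2) (cost _ q3).
  move: (cost _ q4) (cost _ q5) (cost _ q6) (cost _ q7) (cost _ q9) => *.
  by have hn := leq_pmulr n n_gt0; rewrite -mulnn; nia.
have lt_ne (w : 'I_n) x : x = n -> x = w :> nat -> False by move=> -> e'; have := ltn_ord w; rewrite -e' ltnn.
exists e; split.
- move=> v w /or3P[]/eqP ew.
  + case: (h3 v) => [[eq _]|[w' [eq /andP[/eqP p1 p2] _]]]; first by case: (lt_ne w _ eq ew).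
    by constructor 1; have <- : w' = w by apply: val_inj; rewrite /= -eq.
  + case: (h4 v) => [[eq _]|[w' [eq /andP[p1 /eqP p2] _]]]; first by case: (lt_ne w _ eq ew).
    by constructor 2; have <- : w' = w by apply: val_inj; rewrite /= -eq.
  + case: (h5 v) => [[eq _]|[w' [eq /andP[/eqP p1 p2] _]]]; first by case: (lt_ne w _ eq ew).
    by constructor 3; have <- : w' = w by [apply: val_inj; rewrite /= -eq]; rewrite adj_sym.
- move=> v u cu lt; case: (h3 v) => [[_ no]|[w [eq /andP[/eqP p1 p2] mn]]].
    by have := no u; rewrite /P1 cu eqxx lt.
  exists w; split=> //; first by rewrite /e /step_rel eq eqxx.
  by apply: mn; rewrite /P1 cu eqxx.
- move=> u w cw g; case: (h4 u) => [[_ no]|[w' [eq /andP[p1 /eqP p2] mn]]].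
    by have := no w; rewrite /P2 g cw eqxx.
  exists w'; split; [by rewrite /e /step_rel eq eqxx orbT|by rewrite p2 cw|].
  by apply: mn; rewrite /P2 g cw eqxx.
- move=> u w cw ng; case: (h5 w) => [[_ no]|[w' [eq /andP[/eqP p1 p2] mn]]].
    by have := no u; rewrite /P3 adj_sym ng cw eqxx.
  exists w'; split; [by rewrite /e /step_rel eq eqxx !orbT|by apply: succn_inj; rewrite p1|].
  by apply: mn; rewrite /P3 adj_sym ng cw eqxx.
- rewrite rE h9 max0n; split.
    have -> : iota 0 n = index_iota 0 n by rewrite /index_iota subn0.
    by rewrite big_mkord; apply: eq_bigr => v _; rewrite valK.
  have cardE (P : pred 'I_n) : (0 < #|[set w | P w]|) = [exists w, P w].
    by apply/card_gt0P/existsP => -[w]; rewrite ?inE => h; exists w; rewrite ?inE.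
  have q10E k : k \in [:: 1; 2; 3; 4] -> ar q10 k = ar q8 k by move=> _; rewrite ar_run.
  move=> v; rewrite !q10E //; split.
  + by rewrite ar_run.
  + by case: y8.
  + by rewrite h8 cardE.
  + by rewrite ar_run // h7 cardE.
Qed.

End WithColumns.

Lemma solve_spec (Rt : realType) : inp = encode_graph a -> mixed_unit_interval Rt G ->
  exists (B : ububble 'I_n) (t : cwterm 'I_n),
  [/\ ub_model B G, is_kexpression (minn (2 * alpha G + 3) (group_number B G + 2)) t G,
      ou (run solveP st0) = encode_term t & cost solveP st0 <= 2000 * n ^ 2].
Proof.
move=> inpE mix; have T0 : 0 < #|'I_n| by rewrite card_ord.
have [U [U0 [R0 rR0]]] := nat_rep T0 mix.
pose s1 := setr 0 n st0.
have os : let s' := run offsetP s1 in [/\ cost offsetP s1 <= 4 + n * 4, adj_input a inp s' &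
    rg s' 6 = size (encode_graph a)].
  by have := @offset_spec n a [::] s1 erefl; rewrite cats0 -inpE.
have [co ai _] := os; set s2 := run offsetP s1 in ai.
have rn2 : rg s2 0 = n by rewrite rg_run.
have z2 k i : 20 <= k -> ar s2 k i = 0 by move=> hk; rewrite ar_run // !inE; case: k hk.
have [cl m3 [key [lev [bfs l3 st]]]] := layers_spec n_gt0 aP rn2 ai z2.
set s3 := run layersP s2 in m3 l3.
have rn3 : rg s3 0 = n by rewrite rg_run.
have [cc [M [ME c4]]] := @columns_spec n G inp n_gt0 key lev bfs s3 rn3 m3 l3; set s4 := run columnsP s3 in c4.
have rn4 : rg s4 0 = n by rewrite rg_run.
have m4 : madj s4 by move=> u v; rewrite ar_run //; apply: m3.
have z4 i : ar s4 39 i = 0 by rewrite !ar_run // z2.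
pose col := scol lev M.
have [cr [e [e1 e2 e3 e4 [rk hr]]]] := rows_spec rn4 m4 c4 z4; set s5 := run rowsP s4 in rk hr.
have [R1 [rR1 sR1]] := st U R0 U0 rR0.
have nT : n = #|'I_n| by rewrite card_ord.
(* From here on the representation agrees with the vertices chosen by the program, although the
   program never sees it. *)
have [R [rR sR gz]] := swap_rep U0 bfs nT (@ltn_ord n) (@ord_inj n) rR1 sR1.
have adjG : bub_adj G (rrow e) col (rs1 G col e) (rs2 G col e).
  apply: (rows_bub_adj U0 rR nT (@ltn_ord n) (@ord_inj n)) e1 e2 e3 e4.
  - by move=> u v; apply: (scol_clique U0 bfs nT ME rR sR gz).
  - by move=> u v; apply: (scol_adj U0 bfs nT ME rR sR gz).
  - by move=> u v; apply: (scol_nonadj U0 bfs nT ME rR sR gz).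
pose k := \max_v col v.
have col_rng v : 0 < col v <= k.
  by rewrite (scol_pos U0 bfs nT ME rR sR gz) /=; apply: leq_bigmax.
have hcol j : 0 < j <= k -> exists v, col v = j.
  move=> hj; have [v hv] : exists v, k = col v.
    by have [v hv] := eq_bigmax col T0; exists v.
  by apply: (scol_cont U0 bfs nT (@ltn_ord n) (@ord_inj n) ME rR sR gz (v := v)); move: hj; rewrite hv.
have k_le : k <= n by rewrite -[leqRHS]card_ord; apply: (@surj_leq_card _ col).
have row_le v : rrow e v <= n by rewrite -[leqRHS]card_ord; apply: max_card.
(* The computed columns and rows become coordinates with unit [n + 1], which exceeds every row
   number. The model cut from them may have other columns, but it has the same left-endpoint order,
   and this is what the label bound of [core_spec] needs. *)
pose x v := col v * n.+1 + rrow e v.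
have xP u v : u != v -> G u v = touch n.+1 x (rs1 G col e) (rs2 G col e) u v &&
    touch n.+1 x (rs1 G col e) (rs2 G col e) v u.
  move=> uv; rewrite adjG uv /=.
  have base w w' : col w = col w' -> x w < x w' + n.+1.
    by move=> ew; rewrite /x ew; have := row_le w; lia.
  have nxt w w' : (col w).+1 = col w' -> [/\ x w < x w' + n.+1,
      (x w' < x w + n.+1) = (rrow e w' < rrow e w) & (x w' == x w + n.+1) = (rrow e w == rrow e w')].
    move=> ew; have -> : x w' = col w * n.+1 + n.+1 + rrow e w' by rewrite /x -ew mulSn; lia.
    by rewrite /x; have := row_le w; have := row_le w'; split; lia.
  have farr w w' : (col w).+1 < col w' -> touch n.+1 x (rs1 G col e) (rs2 G col e) w' w = false.
    move=> ew; have : (col w).+2 * n.+1 <= col w' * n.+1 by rewrite leq_mul2r ew orbT.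
    have := row_le w; rewrite !mulSn /touch /x => h1 h2.
    move: (col w * n.+1) (col w' * n.+1) (rrow e w) (rrow e w') h1 h2 => p q r r' h1 h2.
    have l1 : p + r + n.+1 < q + r' by clear -h1 h2; lia.
    by rewrite ltnNge (ltnW l1) /= gtn_eqF.
  rewrite /bub_arc; have [lt|gt|eq] := ltngtP (col u) (col v); last first.
  - by rewrite /touch !base.
  - have [e'|ne] := eqVneq (col v).+1 (col u).
      have [n1 n2 n3] := nxt _ _ e'; rewrite /touch n1 n2 n3.
      have -> : ((col u).+1 == col v) = false by lia.
      by rewrite /= andbT [rs2 _ _ _ _ && _]andbC.
    rewrite [touch _ _ _ _ u v]farr; last by lia.
    by have -> : ((col u).+1 == col v) = false by lia.
  - have [e'|ne] := eqVneq (col u).+1 (col v).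
      have [n1 n2 n3] := nxt _ _ e'; rewrite /touch n1 n2 n3 /=.
      have -> : ((col v).+1 == col u) = false by lia.
      by rewrite orbF [rs2 _ _ _ _ && _]andbC.
    rewrite [touch _ _ _ _ v u]farr; last by lia.
    by rewrite andbF; have -> : ((col v).+1 == col u) = false by lia.
have n1 : 0 < n.+1 by [].
have [v0 v0P] := x_min_ex x T0.
pose B := bmodel x (rs1 G col e) (rs2 G col e) n1 T0 v0.
have modelB : ub_model B G := bmodelP n1 T0 xP v0P.
have idx_inj : injective vid by apply: ord_inj.
have [sq [u1 u2 u3 u4]] := strict_order_enum
  (left_lt_irr vid (rrow e) col (rs1 G col e)) (@left_lt_trans _ _ _ _ _)
  (fun x y => @left_lt_total _ _ (rrow e) col (rs1 G col e) idx_inj x y).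
have [sr [w1 w2 w3 w4]] := row_lt_order (rrow e) u2.
have u4B y z : (index y sq < index z sq) = left_lt vid (row B) (Defs.col B) (sgn1 B) y z.
  rewrite u4 bmodel_order /left_lt /x ltnn eqxx /=.
  have r1 := row_le y; have r2 := row_le z.
  have [lt|gt|eq] := ltngtP (col y) (col z).
  - have : (col y).+1 * n.+1 <= col z * n.+1 by rewrite leq_mul2r lt orbT.
    by rewrite mulSn; case: ltnP => //; lia.
  - have : (col z).+1 * n.+1 <= col y * n.+1 by rewrite leq_mul2r gt orbT.
    by rewrite mulSn; case: ltngtP => //; lia.
  - by rewrite eq ltn_add2l eqn_add2l.
have m5 : model_in a (rrow e) col (rs1 G col e) (rs2 G col e) k inp s5.
  split; [by rewrite rg_run|exact: rk| |by move=> v; apply: hr].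
  have ai3 : adj_input a inp s3 by move=> v; rewrite ar_run //; apply: ai.
  have ai4 : adj_input a inp s4 by move=> v; rewrite ar_run //; apply: ai3.
  by move=> v; rewrite ar_run //; apply: ai4.
have [||t [t1 t2 t3 t4]] := core_spec n_gt0 aP adjG col_rng k_le row_le
  u1 u2 u3 u4 (live_group_number modelB u2 u4B) w1 w2 w3 w4 m5.
- by rewrite !ou_run.
- by move=> g; rewrite !ar_run.
exists B, t; split=> //.
- split=> //; apply: leq_trans t2 _; rewrite leq_min !geq_min leq_add2r.
  by rewrite (bub_adj_alpha adjG hcol) leqnn orbT.
- have i0 : run (PSet 0 (EI (EC 0))) st0 = s1 by rewrite run_set /= inpE.
  by rewrite /solveP 6!run_seqs run_skip i0.
- have i0 : run (PSet 0 (EI (EC 0))) st0 = s1 by rewrite run_set /= inpE.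
  rewrite /solveP 5!cost_seqs i0 cost_set -/s2 -/s3 -/s4 -/s5 -[seqs [:: coreP]]/coreP.
  have : \sum_v size (a v) <= n * n.
    rewrite -[X in X * _]card_ord -sum_nat_const; apply: leq_sum => v _; exact: size_adj aP v.
  move: co cl cc cr t4; rewrite -mulnn; move: (cost _ s1) (cost _ s2) (cost _ s3) (cost _ s4) (cost _ s5).
  by move: (\sum_v _) (leq_pmulr n n_gt0) => X hn; lia.
Qed.

End Main.

Lemma solve_okp : okp solveP. Proof. by vm_compute. Qed.

Theorem theorem29 (R : realType) :
  (forall (T : finType) (G : sgraph T) (B : ububble T),
     mixed_unit_interval R G -> ub_model B G ->
     cwd G <= minn (2 * alpha G + 3) (group_number B G + 2) /\
     minn (2 * alpha G + 3) (group_number B G + 2) <= omega G + 1) /\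
  (exists (P : cmd) (c : nat),
     forall (n : nat) (G : sgraph 'I_n) (B : ububble 'I_n)
            (a : 'I_n -> seq 'I_n),
     mixed_unit_interval R G -> ub_model B G -> adjacency_lists G a ->
     exists t : cwterm 'I_n,
       is_kexpression (minn (2 * alpha G + 3) (group_number B G + 2)) t G /\
       outputs_within (word_bound c n) P (encode_graph a ++ encode_ububble B)
         (encode_term t) (c * (n + #|edges G|))) /\
  (exists (P : cmd) (c : nat),
     forall (n : nat) (G : sgraph 'I_n) (a : 'I_n -> seq 'I_n),
     0 < n -> mixed_unit_interval R G -> adjacency_lists G a ->
     exists (B : ububble 'I_n) (t : cwterm 'I_n),
       ub_model B G /\
       is_kexpression (minn (2 * alpha G + 3) (group_number B G + 2)) t G /\
       outputs_within (word_bound c n) P (encode_graph a)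
         (encode_term t) (c * n ^ 2)).
Proof.
split; [|split].
- move=> T G B _ modelB; split; first exact: cwd_bubble.
  by rewrite geq_min (group_number_omega modelB) orbT.
- have [c hc] := outputs_of_cost 700 model_okp.
  exists (comp modelP), c => n G B a _ modelB aP.
  have [t [tk to tc]] := model_spec modelB aP; exists t; split=> //.
  apply: hc => //; [exact: (bubble_n_gt0 B)|by move=> i; apply: (model_input_le modelB aP)|].
  by have := card_edges_le G; rewrite -!mulnn; nia.
- have [c hc] := outputs_of_cost 2000 solve_okp.
  exists (comp solveP), c => n G a n_gt0 mix aP.
  have [B [t [modelB tk to tc]]] := solve_spec n_gt0 aP erefl mix.
  exists B, t; split=> //; split=> //; apply: hc => // [i|]; last first.
    by rewrite leq_exp2r.
  have [iN|iN] := ltnP i (size (encode_graph a)); last by rewrite nth_default.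
  exact: (all_nthP 0 (encode_graph_le aP)).
Qed.
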